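(* Let $G$ be a connected, simply connected, semisimple, complex linear Lie group of rank $r$, with Lie algebra $\mathfrak g$ and invariant form $\mathcal B$ as in the context, and let $\sigma_1,\dots,\sigma_r$ be the characters of a system of fundamental representations of $G$. Let $\nu$ be the form on $\mathcal R^{reg}(S^1,G)$ defined (up to sign) in the context. Then $$\nu=\pm C\, d\sigma_1\wedge\cdots\wedge d\sigma_r$$ for some constant $C\in\mathbb C^*$ depending only on $G$ and $\mathcal B$. In addition, for $G=\mathrm{SL}_N(\mathbb C)$ and $\mathcal B(X,Y)=-\operatorname{tr}(XY)$ for $X,Y\in\mathfrak{sl}_N(\mathbb C)$, $$C=\pm(-1)^{(N-1)(N-2)/4}\sqrt N ,$$ where $(-1)^{(N-1)(N-2)/4}$ means $(\sqrt{-1})^{(N-1)(N-2)/2}$.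
   Context: $G$ has dimension $d$, rank $r$ and compact real form $G_{\mathbb R}$ with Lie algebra $\mathfrak g_{\mathbb R}$. $\mathcal B\colon\mathfrak g\times\mathfrak g\to\mathbb C$ is a fixed nondegenerate symmetric bilinear $G$-invariant form whose restriction to $\mathfrak g_{\mathbb R}$ is positive definite. An element $g\in G$ is regular if its centralizer has minimal dimension (namely $r$) among centralizers of elements of $G$. A representation $\rho\colon\pi_1(S^1)\cong\mathbb Z\to G$ is regular if the image $g$ of the generator is regular; $\mathcal R^{reg}(S^1,G)\cong G^{reg}/G$ is the set of conjugacy classes of regular representations. By Steinberg's theorem $(\sigma_1,\dots,\sigma_r)$ induces an isomorphism $G^{reg}/G\cong\mathbb C^r$. For $G=\mathrm{SL}_N(\mathbb C)$, $r=N-1$ and $\sigma_i(A)$ is the $i$-th elementary symmetric function of the eigenvalues of $A$. Cohomology: orient $S^1$ and use the cell structure with one $0$-cell and one (positively oriented) $1$-cell. Then $C^0=C^1=\mathfrak g$, $\delta(X)=\operatorname{Ad}_g X-X$, $H^0(S^1;\operatorname{Ad}\rho)=\ker\delta$, $H^1(S^1;\operatorname{Ad}\rho)=\mathfrak g/\operatorname{Im}\delta$, both of dimension $r$. $H^1(S^1;\operatorname{Ad}\rho)$ is identified with $T_{[\rho]}\mathcal R^{reg}(S^1,G)$ by sending the class of $X\in\mathfrak g$ to the tangent vector of $t\mapsto[\exp(tX)g]$. The pairing $\langle\cdot,\cdot\rangle\colon H^1\times H^0\to\mathbb C$ is induced by $(X,Y)\mapsto\mathcal B(X,Y)$; for bases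 $\mathbf v=\{v_i\}$ of $H^1$ and $\mathbf u=\{u_j\}$ of $H^0$, $\langle\wedge\mathbf v,\wedge\mathbf u\rangle=\det(\langle v_i,u_j\rangle)$, where $\wedge\mathbf v=v_1\wedge\cdots\wedge v_r$. Sign-refined (Turaev) torsion: let $[\mathbf a:\mathbf b]$ be the determinant of the matrix expressing the basis $\mathbf a$ in terms of the basis $\mathbf b$. Let $\mathbf c^0=\mathbf c^1$ be a basis of $\mathfrak g$, $\mathbf b^1$ a basis of $\operatorname{Im}\delta\subset C^1$, $\widetilde{\mathbf b^1}\subset C^0$ a lift of $\mathbf b^1$ by $\delta$, and $\widetilde{\mathbf u}\subset C^0$, $\widetilde{\mathbf v}\subset C^1$ representatives of $\mathbf u,\mathbf v$. Put $\operatorname{tor}=[\widetilde{\mathbf v}\sqcup\mathbf b^1:\mathbf c^1]/[\widetilde{\mathbf b^1}\sqcup\widetilde{\mathbf u}:\mathbf c^0]$ and $\operatorname{Tor}=(-1)^{M}\operatorname{tor}$, where $M=\alpha_0\beta_0+\alpha_1\beta_1$, $\alpha_i=\sum_{l\le i}\dim C^l$, $\beta_i=\sum_{l\le i}\dim H^l$. Make the same construction for trivial real coefficients, with bases $h^i$ of $H^i(S^1;\mathbb R)$ such that $(h^0,h^1)$ gives the orientation $\mathfrak o$ of $H^0(S^1;\mathbb R)\oplus H^1(S^1;\mathbb R)$ determined by the orientation of $S^1$, to get $\operatorname{Tor}(S^1,1,h^0,h^1)$. Then $\operatorname{TOR}(S^1,\operatorname{Ad}\rho,\mathfrak o,\mathbf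 u,\mathbf v)=\operatorname{Tor}\cdot\operatorname{sgn}(\operatorname{Tor}(S^1,1,h^0,h^1))^{d}$. The form $\nu\colon\bigwedge^r H^1(S^1;\operatorname{Ad}\rho)\to\mathbb C$ is defined up to sign by $$\nu(\wedge\mathbf v)=\pm\sqrt{\operatorname{TOR}(S^1,\operatorname{Ad}\rho,\mathfrak o,\mathbf u,\mathbf v)\,\langle\wedge\mathbf v,\wedge\mathbf u\rangle},$$ which does not depend on the basis $\mathbf u$ of $H^0(S^1;\operatorname{Ad}\rho)$. *)

(* Defs.v *)
(* The complex numbers are R[i] for an arbitrary R : realType. *)
From HB Require Import structures.
From mathcomp Require Import all_boot all_order all_algebra.
From mathcomp Require Import complex.
From mathcomp Require Import all_classical all_reals all_analysis.

Set Implicit Arguments.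
Unset Strict Implicit.
Unset Printing Implicit Defensive.

Import Order.TTheory GRing.Theory Num.Theory.
Import numFieldNormedType.Exports.
Local Open Scope classical_set_scope.
Local Open Scope complex_scope.
Local Open Scope ring_scope.

(* R[i] as a normed (hence topological) vector space over itself. *)
HB.instance Definition _ (R : rcfType) := NormedModule.copy R[i] R[i]^o.

Section Torsion.
Variables (F : fieldType) (V : vectType F).
Implicit Types (W : {vspace V}) (A : 'End(V)) (a b c u v : seq V).

(* The coefficient module is the subspace W, the generator of pi_1(S^1) acts
   by A, and C^0 = C^1 = W for the cell structure with one cell in each of the
   dimensions 0 and 1. *)
Definition coboundary A : 'End(V) := A - \1%VF.
Definition H0 W A : {vspace V} := (W :&: lker (coboundary A))%VS.
Definition B1 W A : {vspace V} := (coboundary A @: W)%VS.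
Definition dimH0 W A : nat := \dim (H0 W A).
Definition dimH1 W A : nat := (\dim W - \dim (B1 W A))%N.

(* v is a list of representatives in W of a basis of H^1 = W / B1. *)
Definition basisH1 W A v : Prop :=
  [/\ free v, (<<v>> :&: B1 W A = 0)%VS & (<<v>> + B1 W A = W)%VS].

(* [a : b], the determinant of the coordinates of a in the basis b. *)
Definition base_change a b : F :=
  \det (\matrix_(i < size b, j < size b) coord (in_tuple b) j a`_i).

Definition torsion_sign_exponent W A : nat :=
  let alpha0 := \dim W in
  let alpha1 := (\dim W + \dim W)%N in
  let beta0 := dimH0 W A in
  let beta1 := (dimH0 W A + dimH1 W A)%N in
  (alpha0 * beta0 + alpha1 * beta1)%N.

(* T is the sign-refined torsion computed from some choice of a basis c of
   C^0 = C^1, a basis b of B1 and a lift b' of b. *)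
Definition is_Tor W A u v (T : F) : Prop :=
  exists c b b' : seq V,
    [/\ basis_of W c, basis_of (B1 W A) b,
        {subset b' <= W} /\ map (coboundary A) b' = b
      & T = (-1) ^+ torsion_sign_exponent W A *
            (base_change (v ++ b) c / base_change (b' ++ u) c)].

End Torsion.

Section RealCoefficients.
Variable R : realType.

(* The orientation of S^1 orients H^0(S^1; R) (+) H^1(S^1; R) = R (+) R by the
   basis made of the class 1 of H^0 and of the class of H^1 with value 1 on the
   positively oriented 1-cell. *)
Definition positively_oriented (h0 h1 : R) : Prop := 0 < h0 * h1.

Definition is_real_Tor (T : R) : Prop :=
  exists h0 h1 : R, positively_oriented h0 h1 /\
    is_Tor (fullv : {vspace R^o}) \1%VF [:: (h0 : R^o)] [:: (h1 : R^o)] T.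

End RealCoefficients.

Section LieGroups.
Variable R : realType.
Local Notation C := (R[i]).

Definition expm n (X : 'M[C]_n.+1) : 'M[C]_n.+1 :=
  lim (series (fun k => (k`!%:R)^-1 *: X ^+ k) @ \oo).

Section OneGroup.
Variable n : nat.
Local Notation M := 'M[C]_n.+1.
Implicit Types (G K : set M) (g h U W : {vspace M}) (x y X Y : M).

Definition is_subgroup G : Prop :=
  [/\ G 1, forall x y, G x -> G y -> G (x * y)
    & forall x, G x -> x \is a GRing.unit /\ G x^-1].

Definition lie_set G : set M :=
  [set X | forall t : R, G (expm (t%:C *: X))].

(* As g is a complex subspace, this also says that G is a complex group. *)
Definition lie_algebra G g : Prop := forall X, X \in g <-> lie_set G X.

Definition simply_connected G : Prop :=
  forall gamma : R -> M,
    {within `[0, 1], continuous gamma} ->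
    (forall s, s \in `[0, 1] -> G (gamma s)) -> gamma 0 = gamma 1 ->
    exists H : R * R -> M,
      [/\ {within `[0, 1] `*` `[0, 1], continuous H},
          forall s t, s \in `[0, 1] -> t \in `[0, 1] -> G (H (s, t)),
          forall s, s \in `[0, 1] -> H (s, 0) = gamma s,
          forall s, s \in `[0, 1] -> H (s, 1) = gamma 0
        & forall t, t \in `[0, 1] -> H (0, t) = gamma 0 /\ H (1, t) = gamma 0].

Definition lie_bracket X Y : M := X * Y - Y * X.

(* The span of all brackets of an element of U with an element of W. *)
Definition lie_bracketv U W : {vspace M} :=
  <<[seq lie_bracket X Y | X <- vbasis U, Y <- vbasis W]>>%VS.

Definition lie_solvable U : Prop :=
  exists k, iter k (fun W => lie_bracketv W W) U = 0%VS.

Definition lie_nilpotent U : Prop :=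
  exists k, iter k (fun W => lie_bracketv U W) U = 0%VS.

Definition lie_semisimple g : Prop :=
  forall U, (U <= g)%VS -> (lie_bracketv g U <= U)%VS -> lie_solvable U ->
    U = 0%VS.

(* A connected, simply connected, semisimple, complex Lie group G, closed in
   GL_{n+1}(C), with Lie algebra g. *)
Definition ssc_linear_group G g : Prop :=
  [/\ is_subgroup G, closure G `&` [set x | x \is a GRing.unit] `<=` G,
      lie_algebra G g,
      connected G /\ simply_connected G
    & lie_semisimple g].

Definition cartan g h : Prop :=
  [/\ (h <= g)%VS, lie_nilpotent h
    & forall X, X \in g -> (forall H, H \in h -> lie_bracket X H \in h) ->
      X \in h].

Definition is_rank g (r : nat) : Prop :=
  exists2 h, cartan g h & \dim h = r.

Definition compact_real_form G g K : Prop :=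
  [/\ K `<=` G, is_subgroup K, compact K,
      forall X, X \in g <->
        exists X1 X2, [/\ lie_set K X1, lie_set K X2 & X = X1 + 'i *: X2]
    & forall X, lie_set K X -> lie_set K ('i *: X) -> X = 0].

(* Only the restriction of B to g x g matters. *)
Definition invariant_form G g (B : M -> M -> C) : Prop :=
  [/\ forall a X Y Z, X \in g -> Y \in g -> Z \in g ->
        B (a *: X + Y) Z = a * B X Z + B Y Z,
      forall X Y, X \in g -> Y \in g -> B X Y = B Y X,
      forall X, X \in g -> (forall Y, Y \in g -> B X Y = 0) -> X = 0,
      forall x X Y, G x -> X \in g -> Y \in g ->
        B (x * X * x^-1) (x * Y * x^-1) = B X Y
    & exists2 K, compact_real_form G g K &
        forall X, lie_set K X -> X != 0 -> 0 < B X X].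

Definition centralizer G x : set M := G `&` [set y | y * x = x * y].

Definition regular G x : Prop :=
  G x /\ exists2 z, lie_algebra (centralizer G x) z &
    forall y z', G y -> lie_algebra (centralizer G y) z' ->
      (\dim z <= \dim z')%N.

Section FundamentalRepresentations.
Variables (g h : {vspace M}).
Local Notation dual := 'Hom(subvs_of h, C^o).
Implicit Types (alpha beta : dual) (H : subvs_of h).

Definition root_vector alpha X : Prop :=
  X \in g /\ forall H, lie_bracket (vsval H) X = (alpha H : C) *: X.

Definition is_root alpha : Prop :=
  alpha != 0 /\ exists2 X, X != 0 & root_vector alpha X.

Definition simple_system r (a : r.-tuple dual) : Prop :=
  [/\ basis_of fullv a, forall i, is_root (tnth a i)
    & forall beta, is_root beta -> exists k : 'I_r -> nat,
        beta = \sum_i tnth a i *+ k i \/ beta = - \sum_i tnth a i *+ k i].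

Definition is_coroot alpha H : Prop :=
  alpha H = 2%:R /\ exists X Y,
    [/\ root_vector alpha X, root_vector (- alpha) Y
      & vsval H = lie_bracket X Y].

Variable G : set M.

(* Complex differentiability of a continuous morphism at the identity along
   the one-parameter subgroups makes it holomorphic on G. *)
Definition holomorphic_rep m (rho : M -> 'M[C]_m.+1) : Prop :=
  [/\ rho 1 = 1, forall x y, G x -> G y -> rho (x * y) = rho x * rho y,
      {within G, continuous rho}
    & forall X, X \in g ->
        derivable (fun t : C => rho (expm (t *: X))) (0 : C) (1 : C)].

Definition diff_rep m (rho : M -> 'M[C]_m.+1) X : 'M[C]_m.+1 :=
  derive1 (fun t : C => rho (expm (t *: X))) 0.

Definition irreducible_rep m (rho : M -> 'M[C]_m.+1) : Prop :=
  forall U : {vspace 'cV[C]_m.+1},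
    (forall x w, G x -> w \in U -> rho x *m w \in U) ->
    U = 0%VS \/ U = fullv.

(* w is a highest weight vector of rho, of weight equal to the i-th fundamental
   weight, which takes the value 1 on the i-th simple coroot and 0 on the
   other ones. *)
Definition fundamental_highest_weight r (a : r.-tuple dual) (i : 'I_r)
    m (rho : M -> 'M[C]_m.+1) (w : 'cV[C]_m.+1) : Prop :=
  [/\ w != 0,
      forall j X, root_vector (tnth a j) X -> diff_rep rho X *m w = 0
    & forall j H, is_coroot (tnth a j) H ->
        diff_rep rho (vsval H) *m w = (i == j)%:R *: w].

End FundamentalRepresentations.

Definition fundamental_characters G g r (sigma : 'I_r -> M -> C) : Prop :=
  exists2 h, cartan g h &
  exists2 a : r.-tuple 'Hom(subvs_of h, C^o), simple_system g a &
  forall i, exists m (rho : M -> 'M[C]_m.+1),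
    [/\ holomorphic_rep g G rho, irreducible_rep G rho,
        exists w, fundamental_highest_weight g a i rho w
      & forall x, G x -> sigma i x = \tr (rho x)].

Definition Ad x : 'End(M) := linfun (fun X : M => x * X * x^-1).

Definition is_TOR g x (u v : seq M) (T : C) : Prop :=
  exists (T1 : C) (T0 : R), [/\ is_Tor g (Ad x) u v T1, is_real_Tor T0
    & T = T1 * (Num.sg T0)%:C ^+ \dim g].

Definition pairing (B : M -> M -> C) r (v u : r.-tuple M) : C :=
  \det (\matrix_(i < r, j < r) B (tnth v i) (tnth u j)).

Definition update r (v : r.-tuple M) (i : 'I_r) X : r.-tuple M :=
  [tuple if j == i then X else tnth v j | j < r].

(* An r-form on H^1 = g / B1, as an alternating multilinear function of r
   elements of g which vanishes as soon as one of them is in B1. *)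
Definition formH1 g x r (w : r.-tuple M -> C) : Prop :=
  [/\ forall (v : r.-tuple M) i a X Y, {subset v <= g} -> X \in g -> Y \in g ->
        w (update v i (a *: X + Y)) = a * w (update v i X) + w (update v i Y),
      forall (v : r.-tuple M) i j, {subset v <= g} -> i != j ->
        tnth v i = tnth v j -> w v = 0
    & forall (v : r.-tuple M) i X, {subset v <= g} -> X \in B1 g (Ad x) ->
        w (update v i X) = 0].

Definition is_nu g (B : M -> M -> C) x r (w : r.-tuple M -> C) : Prop :=
  formH1 g x w /\
  forall (v u : r.-tuple M) T,
    basisH1 g (Ad x) v -> basis_of (H0 g (Ad x)) u -> is_TOR g x u v T ->
    w v = sqrtC (T * pairing B v u) \/ w v = - sqrtC (T * pairing B v u).

(* The value of d f at the class of X in H^1, i.e. at the tangent vector of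
   t |-> [exp (t X) x]. *)
Definition dchar (f : M -> C) x X : C :=
  derive1 (fun t : C => f (expm (t *: X) * x)) 0.

Definition wedge_dchar r (sigma : 'I_r -> M -> C) x (v : r.-tuple M) : C :=
  \det (\matrix_(i < r, j < r) dchar (sigma i) x (tnth v j)).

(* nu = +- c dsigma_1 /\ ... /\ dsigma_r at every regular [x]. *)
Definition nu_constant G g B r (sigma : 'I_r -> M -> C) (c : C) : Prop :=
  forall x, regular G x -> forall w : r.-tuple M -> C,
    is_nu g B x w <->
    (forall v : r.-tuple M, {subset v <= g} ->
       w v = c * wedge_dchar sigma x v) \/
    (forall v : r.-tuple M, {subset v <= g} ->
       w v = - c * wedge_dchar sigma x v).

End OneGroup.

Definition SL n : set 'M[C]_n.+1 := [set x | \det x = 1].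

Definition sl n : {vspace 'M[C]_n.+1} :=
  lker (linfun (mxtrace : 'M[C]_n.+1 -> C^o)).

Definition sl_form n (X Y : 'M[C]_n.+1) : C := - \tr (X * Y).

Definition eigenvalues n (x : 'M[C]_n.+1) : seq C :=
  sval (closed_field_poly_normal (char_poly x)).

Definition elem_sym (k : nat) (s : seq C) : C :=
  \sum_(I : {set 'I_(size s)} | #|I| == k) \prod_(j in I) s`_j.

Definition sl_sigma n (i : 'I_n) (x : 'M[C]_n.+1) : C :=
  elem_sym i.+1 (eigenvalues x).

End LieGroups.

Arguments SL R n : clear implicits.
Arguments sl R n : clear implicits.
Arguments sl_form R n : clear implicits.
Arguments sl_sigma R n : clear implicits.

(* Main.v *)
Require Import Defs.
From HB Require Import structures.
From mathcomp Require Import all_boot all_order all_algebra.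
From mathcomp Require Import complex.
From mathcomp Require Import all_classical all_reals all_analysis.
From mathcomp Require Import perm.
From mathcomp Require Import ring lra zify.
Set Implicit Arguments.
Unset Strict Implicit.
Unset Printing Implicit Defensive.
Import Order.TTheory GRing.Theory Num.Theory.
Import numFieldNormedType.Exports.
Local Open Scope ring_scope.

(* Up to sign, the torsion times the pairing at a regular x is
     N(x, v) = det (Ad x - 1 + sum_k B(v_k, .) v_k),
   which, unlike the torsion, makes sense at every x of G. So we want
   N(x, v) = q * (dsigma_1 /\ ... /\ dsigma_r)(v)^2 with q constant. Both sides
   are regular class functions of (x, v), hence it suffices to compare them at
   x = exp H for H in a Cartan subalgebra: the conjugates of the regular ones are
   dense enough for an identity principle, because h + (Ad z - 1) g = g. There
   N is det B(co_i, co_j) times the product over all roots of exp (alpha H) - 1,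
   which is +- the square of the Weyl denominator, and the Jacobian of the
   sigma_i is the Weyl denominator itself: it is antisymmetric under the Weyl
   group with the same leading exponent rho. Therefore
     q = (-1)^(number of positive roots) * det B(co_i, co_j),
   co_i being the simple coroots. Two choices of the Cartan subalgebra and of
   the simple roots give values of q whose quotients are squares of integers in
   both directions, so that q depends on G and B only. For SL_N the elementary
   symmetric functions have the fundamental weights as leading exponents, and
   det B(co_i, co_j) = (-1)^(N-1) N by the determinant of the Cartan matrix. *)

(** * Matrices over an algebraically closed field *)

(** Since C is only asked to be a square root of q, the sign of q itself must come out exactly. The
    torsion exponent, the real torsion and the reordering of bases contribute (-1)^(d + 5 d r + r (d
    - r)), which is 1 because d - r, the number of roots, is even. The structure theory of g rests
    on the trace form of the given matrices, which is nondegenerate on g thanks to the compact real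
    form: a matrix whose one-parameter group is bounded has imaginary eigenvalues and no Jordan
    block, so tr (Y^2) < 0 unless Y = 0. The weights of these matrices are integers on coroots, so
    that the trace form is positive on real combinations of coroots; this positivity drives the
    arguments on roots and exponents. Regular functions are coefficients of finite-dimensional
    actions of exp g, and the identity principle propagates zeros through products of exponentials,
    dense in G by connectedness. For SL_N there are N (N - 1) / 2 positive roots; together with the
    sign (-1)^(N - 1) of the Gram determinant they give the exponent (N - 1) (N - 2) / 2 modulo 2,
    whence the power of the square root of -1 in C. *)

Section MatrixAlgebra.
Variable F : numClosedFieldType.

Lemma cotrig N (As : seq 'M[F]_N) : {in As &, forall A B, A *m B = B *m A} ->
  exists2 P, P \in unitmx & forall A, A \in As -> is_trig_mx (P *m A *m invmx P).
Proof.
move=> H; have [P Pu /allP HP] := cotrigonalization H.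
have Punit := unitarymx_unit Pu.
by exists P => // A /HP; rewrite /= /similar_to conjumx.
Qed.

Lemma trig_mul N (A B : 'M[F]_N) : is_trig_mx A -> is_trig_mx B -> is_trig_mx (A *m B).
Proof.
move=> /is_trig_mxP tA /is_trig_mxP tB; apply/is_trig_mxP => i j ij.
rewrite mxE big1 // => k _; have [ik|ki] := ltnP i k; first by rewrite tA ?mul0r.
by rewrite tB ?mulr0 // (leq_ltn_trans ki).
Qed.

Lemma trig_mul_diag N (A B : 'M[F]_N) i : is_trig_mx A -> is_trig_mx B ->
  (A *m B) i i = A i i * B i i.
Proof.
move=> /is_trig_mxP tA /is_trig_mxP tB.
rewrite mxE (bigD1 i) //= big1 ?addr0 // => k ki.
have [ik|ki'] := ltnP i k; first by rewrite tA ?mul0r.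
by rewrite tB ?mulr0 // ltn_neqAle ki.
Qed.

Lemma trigX N (A : 'M[F]_N) k : is_trig_mx A ->
  is_trig_mx (A ^+ k) /\ forall i, (A ^+ k) i i = A i i ^+ k.
Proof.
move=> tA; elim: k => [|k [IH1 IH2]].
  by rewrite expr0; split=> [|i]; rewrite ?mxE ?eqxx ?expr0 //; exact: scalar_mx_is_trig.
rewrite exprS; split; first exact: trig_mul.
by move=> i; rewrite [_ * _]/(_ *m _) trig_mul_diag // IH2 exprS.
Qed.

Lemma mxXS N (A : 'M[F]_N) k : A ^+ k.+1 = A *m A ^+ k.
Proof. by rewrite exprS. Qed.

Lemma mxXSr N (A : 'M[F]_N) k : A ^+ k.+1 = A ^+ k *m A.
Proof. by rewrite exprSr. Qed.

Lemma conjX N (P A : 'M[F]_N) k : P \in unitmx ->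
  P *m (A ^+ k) *m invmx P = (P *m A *m invmx P) ^+ k.
Proof.
move=> Pu; elim: k => [|k IH]; first by rewrite !expr0 mulmx1 mulmxV.
rewrite !mxXS -IH !mulmxA -(mulmxA (P *m A) (invmx P) P) mulVmx //.
by rewrite mulmx1.
Qed.

Lemma tr_conj N (P A : 'M[F]_N) : P \in unitmx -> \tr (P *m A *m invmx P) = \tr A.
Proof. by move=> Pu; rewrite mxtrace_mulC mulmxA mulVmx // mul1mx. Qed.

Lemma trig1 N (A : 'M[F]_N) :
  exists2 P, P \in unitmx & is_trig_mx (P *m A *m invmx P).
Proof.
have [|P Pu HP] := @cotrig N [:: A].
  by move=> x y; rewrite !inE => /eqP-> /eqP->.
by exists P => //; apply: HP; rewrite inE.
Qed.

Lemma nil_tr0 N (A : 'M[F]_N) k : A ^+ k = 0 -> \tr A = 0.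
Proof.
move=> Ak; have [P Pu tP] := trig1 A; rewrite -(tr_conj A Pu).
rewrite /mxtrace big1 // => i _; set B := _ *m _ in tP *.
have [_ /(_ i)] := trigX k tP; rewrite -conjX // Ak mulmx0 mul0mx mxE.
by move/esym/eqP; rewrite expf_eq0 => /andP[_ /eqP].
Qed.

(** By linearity the hypothesis says that X p sums to 0 over the [l i] for every polynomial p. A p
    that vanishes at all values other than [l i0] leaves a positive multiple of [l i0 * p(l i0)],
    and the characteristic is 0. *)
Lemma sum_pow0 (I : finType) (l : I -> F) :
  (forall k, \sum_i l i ^+ k.+1 = 0) -> forall i, l i = 0.
Proof.
move=> H i0; apply/eqP/negP => li0.
have Hp (p : {poly F}) : \sum_i ('X * p).[l i] = 0.
  transitivity (\sum_i \sum_(k < size p) p`_k * l i ^+ k.+1).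
    apply: eq_bigr => i _; rewrite hornerM hornerX horner_coef mulr_sumr.
    by apply: eq_bigr => k _; rewrite mulrCA exprS.
  by rewrite exchange_big big1 // => k _; rewrite -mulr_sumr H mulr0.
pose p := \prod_(x <- [seq l i | i <- enum I & l i != l i0]) ('X - x%:P).
have := Hp p; rewrite (bigID (fun i => l i == l i0)) /=.
rewrite [X in _ + X]big1 ?addr0; last first.
  move=> i ii0; rewrite hornerM; suff -> : p.[l i] = 0 by rewrite mulr0.
  apply/eqP; rewrite -[_ == 0]/(root p (l i)) root_prod_XsubC.
  by apply: map_f; rewrite mem_filter ii0 mem_enum.
rewrite (eq_bigr (fun=> ('X * p).[l i0])); last by move=> i /eqP->.
rewrite sumr_const -mulr_natr => /eqP; rewrite mulf_eq0 hornerM hornerX mulf_eq0.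
rewrite (negPf (introN idP li0)) /= => /orP[|].
  rewrite -[_ == 0]/(root p (l i0)) root_prod_XsubC.
  case/seq.mapP => i; rewrite mem_filter => /andP[/negP h _] /esym/eqP /h [].
rewrite pnatr_eq0 -leqn0 leqNgt => /negP; apply; apply/card_gt0P; exists i0.
by rewrite unfold_in; apply/eqP.
Qed.

Lemma char_poly_conj N (P A : 'M[F]_N) : P \in unitmx ->
  char_poly (P *m A *m invmx P) = char_poly A.
Proof.
move=> Pu; rewrite /char_poly /char_poly_mx !map_mxM /= map_invmx.
set P' := map_mx _ P; have P'u : P' \in unitmx by rewrite map_unitmx.
have -> : 'X%:M - P' *m map_mx polyC A *m invmx P' =
   P' *m ('X%:M - map_mx polyC A) *m invmx P'.
  by rewrite mulmxBr mulmxBl scalar_mxC -(mulmxA _ P') mulmxV // mulmx1.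
rewrite !det_mulmx mulrAC -det_mulmx mulmxV // det1 mul1r //.
Qed.

Lemma char_poly_strict N (B : 'M[F]_N) : is_trig_mx B -> (forall i, B i i = 0) ->
  char_poly B = 'X ^+ N.
Proof.
move=> tB Bi; rewrite /char_poly det_trig; last first.
  apply/is_trig_mxP => i j ij; rewrite !mxE -val_eqE ltn_eqF //= mulr0n.
  by rewrite (is_trig_mxP tB) // subr0.
rewrite (eq_bigr (fun=> 'X)) ?prodr_const ?card_ord // => i _.
by rewrite !mxE eqxx mulr1n Bi subr0.
Qed.

(** The traces are the power sums of the eigenvalues, which therefore all vanish; the characteristic
    polynomial is X^N and Cayley-Hamilton concludes. *)
Lemma trace_pow_nil N (A : 'M[F]_N) : (forall k, \tr (A ^+ k.+1) = 0) -> A ^+ N = 0.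
Proof.
move=> H; have [P Pu tP] := trig1 A; set B := _ *m _ in tP.
have Bi : forall i, B i i = 0.
  apply: sum_pow0 => k; rewrite -[RHS](H k) -(tr_conj (A ^+ k.+1) Pu) conjX //.
  by apply: eq_bigr => i _; rewrite (trigX _ tP).2.
have cA : char_poly A = 'X ^+ N.
  by rewrite -(char_poly_conj A Pu); exact: char_poly_strict tP Bi.
case: N A H P Pu B tP Bi cA => [|N] A H P Pu B tP Bi cA.
  by apply/matrixP => -[].

by have := Cayley_Hamilton A; rewrite cA rmorphXn /= horner_mx_X.
Qed.

Lemma comm_mul_nil N (A B : 'M[F]_N) k : A ^+ k = 0 -> A *m B = B *m A ->
  \tr (A *m B) = 0.
Proof.
move=> Ak AB; apply: (@nil_tr0 _ _ k).
rewrite [A *m B]/(A * B) exprMn_comm; last exact: AB.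
by rewrite Ak mul0r.
Qed.

(* If z = sum of brackets [X, Y] and all these X commute with z, then z is
   nilpotent: tr (z^k [X, Y]) = 0. *)
Lemma comm_bracket_tr N (Z X Y : 'M[F]_N) k : X *m Z = Z *m X ->
  \tr (Z ^+ k *m (X *m Y - Y *m X)) = 0.
Proof.
move=> XZ; have XZk : X *m Z ^+ k = Z ^+ k *m X by apply: commrX.
rewrite mulmxBr linearB /= !mulmxA -XZk.
by rewrite -(mulmxA X) (mxtrace_mulC X) subrr.
Qed.

(** The trace of c B^(k+1) is that of B^k [A, B], which is 0 by cyclicity. *)
Lemma bracket_eigen_nil N (A B : 'M[F]_N) c : c != 0 ->
  A *m B - B *m A = c *: B -> B ^+ N = 0.
Proof.
move=> c0 AB; apply: trace_pow_nil => k; apply: (mulfI c0); rewrite mulr0.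
rewrite -linearZ /= mxXSr scalemxAr -AB mulmxBr linearB /= !mulmxA -mxXSr.
by rewrite -(mulmxA (B ^+ k)) mxtrace_mulC -mulmxA -mxXS mxtrace_mulC subrr.
Qed.

(** Chinese remainder theorem for the pairwise coprime (X - m)^k. With rs the eigenvalues of H and k
    large, s evaluated at H is the semisimple part of H. *)
Lemma crt_poly (rs : seq F) k : uniq rs ->
  exists s : {poly F}, forall m, m \in rs -> ('X - m%:P) ^+ k %| s - m%:P.
Proof.
move=> urs.
have cop m : m \in rs -> coprimep (('X - m%:P) ^+ k)
    (\prod_(x <- rem m rs) ('X - x%:P) ^+ k).
  move=> mrs; apply: coprimep_expl; rewrite big_seq.
  elim/big_ind: _ => [|x y cx cy|x]; first exact: coprimep1.
    by rewrite coprimepMr cx.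
  rewrite (mem_rem_uniq _ urs) inE => /andP[xm _].
  apply: coprimep_expr; rewrite coprimep_sym coprimep_XsubC rootE hornerXsubC.
  by rewrite subr_eq0 eq_sym.
have /choice[u Hu] m : exists u : {poly F}, m \in rs ->
   ('X - m%:P) ^+ k %| u * \prod_(x <- rem m rs) ('X - x%:P) ^+ k - 1.
  have [mrs|] := boolP (m \in rs); last by exists 0.
  have := cop m mrs => /Bezout_eq1_coprimepP [[a b] /= ab].
  exists b => _.
  have -> : b * \prod_(x <- rem m rs) ('X - x%:P) ^+ k - 1 = - a * ('X - m%:P) ^+ k.
    by rewrite -[X in _ - X]ab opprD addrCA subrr addr0 mulNr.
  by rewrite dvdp_mull.
exists (\sum_(x <- rs) x%:P * (u x * \prod_(y <- rem x rs) ('X - y%:P) ^+ k)).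
move=> m mrs; rewrite (big_rem m mrs) /= addrAC.
apply: dvdp_add.
  have -> : m%:P * (u m * \prod_(y <- rem m rs) ('X - y%:P) ^+ k) - m%:P =
    m%:P * (u m * \prod_(y <- rem m rs) ('X - y%:P) ^+ k - 1).
    by rewrite mulrBr mulr1.
  by rewrite dvdp_mull // Hu.
rewrite big_seq; elim/big_ind: _ => [|x y|x xr]; [exact: dvdp0|exact: dvdp_add|].
apply/dvdp_mull/dvdp_mull; rewrite (big_rem m) ?dvdp_mulr //=.
move: xr; rewrite (mem_rem_uniq _ urs) inE => /andP[xm xrs].
by rewrite (mem_rem_uniq _ urs) inE eq_sym xm.
Qed.

(* Here S is the semisimple part of H, a polynomial in H. *)
Lemma jordan N (H : 'M[F]_N) : exists S : 'M[F]_N, [/\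
   forall K, H *m K = K *m H -> S *m K = K *m S,
   (H - S) ^+ N = 0
 & exists P d, P \in unitmx /\ P *m S *m invmx P = diag_mx d].
Proof.
case: N H => [|n] H.
  exists H; split=> //; first by rewrite subrr expr0; apply/matrixP => -[].
  by exists 1%:M, 0; rewrite unitmx1; split=> //; apply/matrixP => -[].
pose r := sval (closed_field_poly_normal (char_poly H)).
have rE : char_poly H = \prod_(x <- r) ('X - x%:P).
  rewrite /r; case: closed_field_poly_normal => s /= ->.
  by rewrite (monicP (char_poly_monic H)) scale1r.
have szr : size r = n.+1.
  by have := size_char_poly H; rewrite rE size_prod_XsubC => -[].
pose rs := undup r; have urs : uniq rs by exact: undup_uniq.
have [s Hs] := crt_poly n.+1 urs.
have cdvd : char_poly H %| \prod_(x <- rs) ('X - x%:P) ^+ n.+1.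
  rewrite rE -(prodr_undup_exp_count r predT (fun x => 'X - x%:P)) -/rs.
  move: (rs) => l; elim: l => [|x l IH]; first by rewrite !big_nil.
  rewrite !big_cons; apply: dvdp_mul => //; apply: dvdp_exp2l.
  by rewrite -szr; exact: (count_size (pred1 x) r).
pose S := horner_mx H s.
have hd p : char_poly H %| p -> horner_mx H p = 0.
  by move=> /dvdpP[q ->]; rewrite rmorphM /= Cayley_Hamilton mulr0.
exists S; split.
- move=> K HK; exact/esym/(@comm_mx_horner _ _ K H s)/esym.
- have -> : H - S = horner_mx H ('X - s) by rewrite rmorphB /= horner_mx_X.
  rewrite -rmorphXn /=; apply: hd; apply: dvdp_trans cdvd _.
  have : \prod_(x <- rs) ('X - x%:P) %| 'X - s.
    apply: uniq_roots_dvdp; last by rewrite uniq_rootsE.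
    apply/allP => x xrs; rewrite rootE hornerD hornerN hornerX.
    have : 'X - x%:P %| s - x%:P.
      by apply: dvdp_trans (Hs x xrs); rewrite exprS dvdp_mulr.
    by rewrite dvdp_XsubCl rootE hornerD hornerN hornerC subr_eq0 => /eqP->; rewrite subrr.
  by move/(dvdp_exp2r n.+1); rewrite -prodrXl.
- have : diagonalizable S.
    apply/diagonalizableP; exists rs => //.
    apply: mxminpoly_min; rewrite -[horner_mx S _]/(horner_mx (horner_mx H s) _).
    have -> : horner_mx (horner_mx H s) (\prod_(x <- rs) ('X - x%:P)) =
      horner_mx H (\prod_(x <- rs) (s - x%:P)).
      rewrite !rmorph_prod /=; apply: eq_bigr => x _.
      by rewrite !rmorphB /= horner_mx_X !horner_mx_C.
    apply: hd; apply: dvdp_trans cdvd _.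
    rewrite big_seq [X in _ %| X]big_seq.
    by elim/big_ind2: _ => [//|a b c d|x xrs]; [exact: dvdp_mul|exact: Hs].
  move=> [P Pu]; rewrite /similar_to conjumx // => /is_diag_mxP dP.
  exists P, (\row_i (P *m S *m invmx P) i i); split=> //.
  apply/matrixP => i j; rewrite [RHS]mxE [X in X *+ _]mxE.
  by have [->|ij] := eqVneq i j; rewrite ?mulr1n // mulr0n dP.
Qed.

(* ad S is diagonalizable when S is, so it has no generalized eigenvectors. *)
Lemma ad_diag_eigen N (S Y : 'M[F]_N) c k :
  (exists P d, P \in unitmx /\ P *m S *m invmx P = diag_mx d) ->
  iter k (fun X => S *m X - X *m S - c *: X) Y = 0 -> S *m Y - Y *m S = c *: Y.
Proof.
move=> [P [d [Pu PS]]].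
pose f X := S *m X - X *m S - c *: X.
pose Q X : 'M[F]_N := P *m X *m invmx P.
have Qinj X : Q X = 0 -> X = 0.
  move=> /(congr1 (fun Z => invmx P *m Z *m P)).
  rewrite /Q mulmx0 mul0mx -!mulmxA mulVmx // mulmx1 mulmxA mulVmx // mul1mx //.
have QM X X' : Q (X *m X') = Q X *m Q X'.
  by rewrite /Q !mulmxA -(mulmxA (P *m X) (invmx P) P) mulVmx // mulmx1.
have QB X X' : Q (X - X') = Q X - Q X' by rewrite /Q mulmxBr mulmxBl.
have QZ a X : Q (a *: X) = a *: Q X by rewrite /Q -scalemxAr -scalemxAl.
have Qf X i j : Q (f X) i j = (d 0 i - d 0 j - c) * Q X i j.
  rewrite /f !QB !QM QZ [Q S]PS mul_diag_mx mul_mx_diag !mxE; ring.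
have Qiter X i j : Q (iter k f X) i j = (d 0 i - d 0 j - c) ^+ k * Q X i j.
  by elim: k => [|m IH]; rewrite ?expr0 ?mul1r //= Qf IH exprS mulrA.
move=> Yk; apply/eqP; rewrite -subr_eq0; apply/eqP/Qinj.
apply/matrixP => i j; rewrite [Q _ i j]Qf [RHS]mxE.
have := Qiter Y i j; rewrite Yk [Q 0]/Q mulmx0 mul0mx [LHS]mxE => /esym/eqP.
by rewrite mulf_eq0 expf_eq0 => /orP[/andP[_ /eqP->]|/eqP->]; rewrite ?mul0r ?mulr0.
Qed.

End MatrixAlgebra.

(** * Subspaces, Fitting decomposition and representation of functionals *)

Section VectorLemmas.
Variables (F : fieldType) (V : vectType F).
Implicit Types (U W : {vspace V}) (f : 'End(V)).

Definition lfun_iter f k : 'End(V) := iter k (fun e => (f \o e)%VF) \1%VF.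

Lemma lfun_iterE f k v : lfun_iter f k v = iter k f v.
Proof. by elim: k => [|k IH] /=; rewrite ?id_lfunE // comp_lfunE -IH. Qed.

Lemma iterlB f k u v : iter k f (u - v) = iter k f u - iter k f v.
Proof. by elim: k => //= k ->; rewrite linearB. Qed.

Lemma iterlD f k u v : iter k f (u + v) = iter k f u + iter k f v.
Proof. by elim: k => //= k ->; rewrite linearD. Qed.

Lemma iterl0 f k : iter k f 0 = 0.
Proof. by elim: k => //= k ->; rewrite linear0. Qed.

Lemma iter_stable f U k v : (f @: U <= U)%VS -> v \in U -> iter k f v \in U.
Proof.
by move=> fU vU; elim: k => //= k IH; apply: (subvP fU); exact: memv_img.
Qed.

(** Fitting decomposition. The images of U under the powers of f decrease, hence stabilise at some
    k; f is bijective on that image U1, so subtracting from u the element of U1 with the same k-th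
    iterate lands in the generalized kernel U0. *)
Lemma fitting f U : (f @: U <= U)%VS -> exists U0 U1,
  [/\ (U <= U0 + U1)%VS, (U1 <= U)%VS, (f @: U1)%VS = U1,
      forall v, v \in U0 <-> v \in U /\ exists n, iter n f v = 0
    & forall v, v \in U1 -> f v = 0 -> v = 0].
Proof.
move=> fU; pose W k := (lfun_iter f k @: U)%VS.
have WP k v : v \in W k <-> exists2 u, u \in U & v = iter k f u.
  split=> [/memv_imgP[u uU ->]|[u uU ->]]; first by exists u; rewrite ?lfun_iterE.
  by rewrite -lfun_iterE; exact: memv_img.
have fW k : (f @: W k)%VS = W k.+1 by rewrite /W /= limg_comp.
have WS k : (W k.+1 <= W k)%VS.
  apply/subvP => v /WP[u uU ->]; apply/WP; exists (f u); last by rewrite iterSr.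
  by apply: (subvP fU); exact: memv_img.
have [k dk] : exists k, \dim (W k.+1) = \dim (W k).
  apply: contrapT => /forallNP H.
  have L k : (\dim (W k) + k <= \dim (W 0%N))%N.
    elim: k => [|k IH]; first by rewrite addn0.
    apply: leq_trans IH; rewrite addnS ltn_add2r ltn_neqAle dimvS // andbT.
    exact/eqP/H.
  by have := L (\dim (W 0%N)).+1; rewrite addnS ltnNge leq_addl.
have Wk : W k.+1 = W k by apply/eqP; rewrite eqEdim WS dk leqnn.
have Wkn n v : v \in W k -> exists2 u, u \in W k & v = iter n f u.
  elim: n v => [|n IH] v vk; first by exists v.
  have [u uk ->] := IH v vk; move: uk; rewrite -{1}Wk -fW => /memv_imgP[u' u'k ->].
  by exists u' => //; rewrite iterSr.
have inj v : v \in W k -> f v = 0 -> v = 0.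
  move=> vk fv; have := limg_ker_dim f (W k); rewrite fW dk.
  move/(canRL (addnK _)); rewrite subnn => /eqP; rewrite dimv_eq0 => /eqP K0.
  apply/eqP; rewrite -memv0 -K0 memv_cap vk memv_ker fv eqxx //.
have injn n v : v \in W k -> iter n f v = 0 -> v = 0.
  elim: n v => [//|n IH] v vk; rewrite iterSr => /IH fv; apply: inj => //.
  by apply: fv; rewrite -Wk -fW memv_img.
have sub u : u \in U -> exists2 z, z \in W k & iter k f (u - z) = 0.
  move=> uU; have [|z zk E] := Wkn k (iter k f u); first by apply/WP; exists u.
  by exists z => //; rewrite iterlB E subrr.
have WkU : (W k <= U)%VS.
  by apply/subvP => v /WP[u uU ->]; exact: iter_stable.
exists (U :&: lker (lfun_iter f k))%VS, (W k); split => //.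
- apply/subvP => u uU; have [z zk E] := sub u uU.
  rewrite -(subrK z u) memv_add // memv_cap memv_ker lfun_iterE E eqxx andbT.
  by rewrite memvB // (subvP WkU).
- by rewrite fW.
move=> v; rewrite memv_cap memv_ker lfun_iterE; split=> [/andP[-> /eqP]|].
  by split=> //; exists k.
move=> [vU [n vn]]; rewrite vU /=; have [z zk E] := sub v vU.
have z0 : z = 0.
  apply: (injn (k + n)%N) => //; rewrite -(subKr v z) iterlB.
  by rewrite iterD vn addnC iterD E !iterl0 subrr.
by move: E; rewrite z0 subr0 => ->.
Qed.

(** Every term of the binomial expansion of (f1 - f2)^(a + b) contains f1^a or f2^b; the induction
    on a + b avoids writing the expansion. *)
Lemma iter_sub_nil f1 f2 a b v : (forall u, f1 (f2 u) = f2 (f1 u)) ->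
  iter a f1 v = 0 -> iter b f2 v = 0 -> iter (a + b) (f1 - f2) v = 0.
Proof.
move=> C; have iC n u : iter n f1 (f2 u) = f2 (iter n f1 u).
  by elim: n => //= n ->; rewrite C.
have iC' n u : iter n f2 (f1 u) = f1 (iter n f2 u).
  by elim: n => //= n ->; rewrite C.
have [n] := ubnP (a + b)%N; elim: n a b v => // n IH [|a] [|b] v nab H1 H2.
- by rewrite /= in H1 *.
- by rewrite /= in H1; rewrite H1 iterl0.
- by rewrite /= in H2; rewrite H2 iterl0.
rewrite addSn iterSr add_lfunE opp_lfunE iterlB IH; first last.
- by rewrite iC' H2 linear0.
- by rewrite -iterSr.
- by rewrite -ltnS -addSn.
rewrite addnS -addSn (IH a.+1 b) ?subrr //; first by rewrite addnS in nab.
- by rewrite iC H1 linear0.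
- by rewrite -iterSr.
Qed.

(** The span of an arbitrary predicate: a subspace containing P which is not the least one can be
    intersected with another one, and its dimension drops, so k counts the cuts made so far. *)
Lemma pred_span (P : V -> Prop) : exists U : {vspace V}, (forall v, P v -> v \in U) /\
  forall W : {vspace V}, (forall v, P v -> v \in W) -> (U <= W)%VS.
Proof.
suff K k : (exists U : {vspace V}, (forall v, P v -> v \in U) /\
    forall W : {vspace V}, (forall v, P v -> v \in W) -> (U <= W)%VS) \/
    exists U : {vspace V}, (forall v, P v -> v \in U) /\ (\dim U + k <= \dim {: V})%N.
  have [//|[U [_]]] := K (\dim {: V}).+1.
  by rewrite addnS ltnNge leq_addl.
elim: k => [|k [IH|[U [PU dU]]]]; first by right; exists fullv; rewrite addn0; split=> // v; rewrite memvf.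
  by left.
have [HW|/existsNP[W /not_implyP[PW /negP UW]]] := pselect
    (forall W : {vspace V}, (forall v, P v -> v \in W) -> (U <= W)%VS); first by left; exists U.
right; exists (U :&: W)%VS; split=> [v Pv|]; first by rewrite memv_cap PU ?PW.
apply: leq_trans dU; rewrite addnS ltn_add2r ltn_neqAle dimvS ?capvSl // andbT.
apply: contra UW => /eqP E; have /eqP <- : (U :&: W == U)%VS.
  by rewrite eqEdim capvSl E leqnn.
exact: capvSr.
Qed.

(** Completes the free family [e0] to a basis of U by vectors of P: as long as the family does not
    span U, the spanning hypothesis yields a vector of P outside its span. *)
Lemma basis_pred (U : {vspace V}) (P : V -> Prop) (e0 : seq V) :
  free e0 -> (forall v, v \in e0 -> v \in U /\ P v) ->
  (forall W, (forall v, v \in U -> P v -> v \in W) -> (U <= W)%VS) ->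
  exists e : seq V, basis_of U (e ++ e0) /\ forall v, v \in e -> P v.
Proof.
move=> f0 P0 H.
suff K k : (exists e : seq V, basis_of U (e ++ e0) /\ forall v, v \in e -> P v) \/
    exists e : seq V, [/\ free (e ++ e0), size e = k & forall v, v \in e -> v \in U /\ P v].
  have [//|[e [fe se He]]] := K (\dim U).+1.
  have : (<<e ++ e0>> <= U)%VS.
    by apply/span_subvP => v; rewrite mem_cat => /orP[/He[]|/P0[]].
  move/dimvS => L; move: fe; rewrite /free => /eqP E; move: L; rewrite E size_cat se.
  by rewrite ltnNge leq_addr.
elim: k => [|k [IH|[e [fe se He]]]]; first by right; exists [::].
  by left.
have [eU|eU] := eqVneq <<e ++ e0>>%VS U.
  by left; exists e; rewrite /basis_of fe eU eqxx; split=> // v /He[].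
right; have [|/existsNP[v /not_implyP[vU /not_implyP[Pv /negP vW]]]] :=
    pselect (forall v, v \in U -> P v -> v \in <<e ++ e0>>%VS).
  move/H => Ue; case/negP: eU; apply/eqP/subv_anti; rewrite Ue andbT.
  by apply/span_subvP => v; rewrite mem_cat => /orP[/He[]|/P0[]].
exists (v :: e); rewrite free_cons vW fe /= se; split => // u.
by rewrite inE => /orP[/eqP->|/He].
Qed.

Lemma linfun_of (W : vectType F) (f : V -> W) :
  (forall a x y, f (a *: x + y) = a *: f x + f y) ->
  exists phi : 'Hom(V, W), forall x, phi x = f x.
Proof.
move=> lf; pose fL : {linear V -> W} := HB.pack f (GRing.isLinear.Build _ _ _ _ f lf).
by exists (linfun fL) => x; rewrite lfunE.
Qed.

Lemma span_basis_ind (U : {vspace V}) (e : seq V) (W : {vspace V}) : basis_of U e ->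
  (forall v, v \in e -> v \in W) -> (U <= W)%VS.
Proof. by move=> /span_basis <- H; exact/span_subvP. Qed.

(** The form is bilinear on U only, so one works with its Gram matrix in a basis of U; nondegeneracy
    makes it row free, hence invertible, and the vector is found by solving a linear system. *)
Lemma form_represent (U : {vspace V}) (b : V -> V -> F) (phi : V -> F) :
  (forall a X Y Z, X \in U -> Y \in U -> Z \in U -> b (a *: X + Y) Z = a * b X Z + b Y Z) ->
  (forall a X Y Z, X \in U -> Y \in U -> Z \in U -> b Z (a *: X + Y) = a * b Z X + b Z Y) ->
  (forall X, X \in U -> (forall Y, Y \in U -> b X Y = 0) -> X = 0) ->
  (forall a X Y, X \in U -> Y \in U -> phi (a *: X + Y) = a * phi X + phi Y) ->
  exists2 X, X \in U & forall Y, Y \in U -> b X Y = phi Y.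
Proof.
move=> bl br nd pl; pose e := vbasis U; pose d := \dim U.
have eU i : e`_i \in U.
  have [id|di] := ltnP i (size e); last by rewrite nth_default ?mem0v.
  by rewrite vbasis_mem ?mem_nth.
have sumU (I : finType) (c : I -> F) (x : I -> V) : (forall i, x i \in U) ->
   \sum_i c i *: x i \in U by move=> xU; apply: memv_suml => i _; rewrite memvZ.
have lsum (psi : V -> F) (I : finType) (c : I -> F) (x : I -> V) :
    (forall a X Y, X \in U -> Y \in U -> psi (a *: X + Y) = a * psi X + psi Y) ->
   (forall i, x i \in U) -> psi (\sum_i c i *: x i) = \sum_i c i * psi (x i).
  move=> pl' xU; have p0 : psi 0 = 0.
    have := pl' 1 0 0 (mem0v _) (mem0v _); rewrite scaler0 addr0 mul1r.
    by move/eqP; rewrite -subr_eq0 opprD addrA subrr sub0r oppr_eq0 => /eqP.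
  suff : \sum_i c i *: x i \in U /\ psi (\sum_i c i *: x i) = \sum_i c i * psi (x i) by case.
  elim/big_ind2: _ => [|y1 y2 z1 z2 [? E1] [? E2]|i _]; first by rewrite mem0v.
    by split; [rewrite memvD|rewrite -[y2]scale1r pl' // mul1r E1 E2].
  by split; [rewrite memvZ|rewrite -[_ *: _]addr0 pl' ?mem0v // p0 addr0].
pose A := \matrix_(i < d, j < d) b e`_i e`_j.
have sumb (x : 'I_d -> F) j : b (\sum_i x i *: e`_i) e`_j = \sum_i x i * b e`_i e`_j.
  by apply: (lsum (fun X => b X e`_j)) => // *; exact: bl.
have Au : row_free A.
  apply/inj_row_free => v vA; pose X := \sum_i v 0 i *: e`_i.
  have X0 : X = 0.
    apply: nd => [|Y YU]; first exact: sumU.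
    rewrite (coord_vbasis YU) (lsum (fun Z => b X Z)); first last.
    - by move=> i.
    - by move=> a Y1 Y2 ? ?; apply: br => //; exact: sumU.
    rewrite big1 // => j _; rewrite sumb.
    by have := congr1 (fun M : 'rV_d => M 0 j) vA; rewrite !mxE => E; rewrite [X in _ * X](_ : _ = 0) ?mulr0 // -[RHS]E; apply: eq_bigr => i _; rewrite mxE.
  apply/rowP => i; rewrite mxE.
  by have /freeP H := basis_free (vbasisP U); exact: (H (v 0) X0).
have Ainv : A \in unitmx by rewrite -row_free_unit.
pose x := (\row_j phi e`_j) *m invmx A.
exists (\sum_i x 0 i *: e`_i) => [|Y YU]; first exact: sumU.
rewrite (coord_vbasis YU) (lsum (fun Z => b _ Z)); first last.
- by move=> i.
- by move=> a Y1 Y2 ? ?; apply: br => //; exact: sumU.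
rewrite (lsum phi) //; apply: eq_bigr => j _; congr (_ * _); rewrite sumb.
have E : x *m A = \row_j phi e`_j by rewrite mulmxKV.
transitivity ((x *m A) 0 j); last by rewrite E mxE.
by rewrite [RHS]mxE; apply: eq_bigr => i _; rewrite [A i j]mxE.
Qed.

End VectorLemmas.

Lemma eigen_exists (F : closedFieldType) (V : vectType F) (f : 'End(V)) (U : {vspace V}) :
  (f @: U <= U)%VS -> U != 0%VS -> exists c v, [/\ v \in U, v != 0 & f v = c *: v].
Proof.
move=> fU U0; pose e := vbasis U; pose d := \dim U.
have eU i : e`_i \in U.
  have [id|di] := ltnP i (size e); last by rewrite nth_default ?mem0v.
  by rewrite vbasis_mem ?mem_nth.
pose A := \matrix_(i < d, j < d) coord e j (f e`_i).
have d0 : (0 < d)%N by rewrite lt0n dimv_eq0.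
have [c] : exists c, root (char_poly A) c.
  apply/closed_rootP; by rewrite size_char_poly; case: (d) d0.
rewrite -eigenvalue_root_char => /eigenvalueP[v vA v0].
exists c, (\sum_i v 0 i *: e`_i); split.
- by apply: memv_suml => i _; rewrite memvZ.
- apply: contra v0 => /eqP E; apply/eqP/rowP => i; rewrite mxE.
  by have /freeP := basis_free (vbasisP U); apply; exact: E.
rewrite linear_sum /= scaler_sumr.
transitivity (\sum_(i < d) \sum_(j < d) (v 0 i * A i j) *: e`_j).
  apply: eq_bigr => i _; rewrite linearZ /= [f _](coord_vbasis (subvP fU _ (memv_img f (eU i)))).
  by rewrite scaler_sumr; apply: eq_bigr => j _; rewrite scalerA mxE.
rewrite exchange_big; apply: eq_bigr => j _ /=; rewrite -scaler_suml scalerA.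
by congr (_ *: _); have := congr1 (fun M : 'rV_d => M 0 j) vA; rewrite !mxE.
Qed.

(** * Cartan subalgebras and roots *)

Section Bracket.
Variables (F : fieldType) (N : nat).
Implicit Types (X Y Z H : 'M[F]_N) (U W : {vspace 'M[F]_N}).

(** Mirrors [lie_bracket], and [brv] mirrors [lie_bracketv], in terms of [*m] and for matrices of
    any size; at size n.+1 they are convertible. *)
Definition br X Y : 'M[F]_N := X *m Y - Y *m X.

Definition ad X : 'End('M[F]_N) := (linfun (mulmx X) - linfun (mulmxr X))%R.

Lemma adE X Y : ad X Y = br X Y.
Proof. by rewrite /ad add_lfunE opp_lfunE !lfunE. Qed.

Lemma brDr X Y Z : br X (Y + Z) = br X Y + br X Z.
Proof. by rewrite -!adE linearD. Qed.

Lemma brZr a X Y : br X (a *: Y) = a *: br X Y.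
Proof. by rewrite -!adE linearZ. Qed.

Lemma brC X Y : br X Y = - br Y X.
Proof. by rewrite /br opprB. Qed.

Lemma brDl X Y Z : br (X + Y) Z = br X Z + br Y Z.
Proof. by rewrite brC brDr opprD -!brC. Qed.

Lemma brZl a X Y : br (a *: X) Y = a *: br X Y.
Proof. by rewrite brC brZr -scalerN -brC. Qed.

Lemma br0r X : br X 0 = 0. Proof. by rewrite -adE linear0. Qed.
Lemma br0l X : br 0 X = 0. Proof. by rewrite brC br0r oppr0. Qed.
Lemma brNr X Y : br X (- Y) = - br X Y. Proof. by rewrite -!adE linearN. Qed.
Lemma brNl X Y : br (- X) Y = - br X Y. Proof. by rewrite brC brNr -brC. Qed.
Lemma brBr X Y Z : br X (Y - Z) = br X Y - br X Z.
Proof. by rewrite brDr brNr. Qed.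
Lemma brBl X Y Z : br (X - Y) Z = br X Z - br Y Z.
Proof. by rewrite brDl brNl. Qed.
Lemma brXX X : br X X = 0. Proof. exact: subrr. Qed.

Lemma br_sumr (I : Type) (r : seq I) (P : pred I) (f : I -> 'M[F]_N) X :
  br X (\sum_(i <- r | P i) f i) = \sum_(i <- r | P i) br X (f i).
Proof. by rewrite -adE linear_sum; apply: eq_bigr => i _; exact: adE. Qed.

Lemma br_suml (I : Type) (r : seq I) (P : pred I) (f : I -> 'M[F]_N) X :
  br (\sum_(i <- r | P i) f i) X = \sum_(i <- r | P i) br (f i) X.
Proof. by rewrite brC br_sumr -sumrN; apply: eq_bigr => i _; rewrite -brC. Qed.

Lemma jacobi X Y Z : br X (br Y Z) = br (br X Y) Z + br Y (br X Z).
Proof.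
rewrite /br !mulmxBl !mulmxBr !mulmxA.
move: (X *m Y *m Z) (X *m Z *m Y) (Y *m Z *m X) (Z *m Y *m X) (Y *m X *m Z) (Z *m X *m Y).
by move=> a b c d e f; apply/matrixP => i j; rewrite !mxE; ring.
Qed.

Lemma tr_brA X Y Z : \tr (br X Y *m Z) = \tr (X *m br Y Z).
Proof.
rewrite /br mulmxBl mulmxBr !(raddfB (@mxtrace F N)) /= !mulmxA.
by rewrite -(mulmxA Y) (mxtrace_mulC Y).
Qed.

(** Leibniz rule for the derivation [ad H]: its generalized kernel is closed under brackets. *)
Lemma ad_nilp_leibniz H K Y a b : iter a (ad H) K = 0 -> iter b (ad H) Y = 0 ->
  iter (a + b) (ad H) (br K Y) = 0.
Proof.

have [n] := ubnP (a + b)%N; elim: n a b K Y => // n IH [|a] [|b] K Y nab H1 H2.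
- by rewrite /= in H1; rewrite H1 br0l iterl0.
- by rewrite /= in H1; rewrite H1 br0l iterl0.
- by rewrite /= in H2; rewrite H2 br0r iterl0.
rewrite addSn iterSr adE jacobi iterlD IH; first last.
- exact: H2.
- by rewrite -adE -iterSr.
- by rewrite -ltnS -addSn.
rewrite add0r addnS -addSn (IH a.+1 b) //; first by rewrite addnS in nab.
by rewrite -adE -iterSr.
Qed.

(** [ad X] is the difference of the commuting left and right multiplications by X, both
    nilpotent. *)
Lemma ad_nil X k Y : X ^+ k = 0 -> iter (k + k) (ad X) Y = 0.
Proof.
move=> Xk; rewrite /ad; apply: iter_sub_nil => [u||].
- by rewrite !lfunE /= mulmxA.
- suff E n : iter n (linfun (mulmx X)) Y = X ^+ n *m Y by rewrite E Xk mul0mx.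
  by elim: n => [|n IH] /=; rewrite ?expr0 ?mul1mx // IH lfunE /= mulmxA exprS.
- suff E n : iter n (linfun (mulmxr X)) Y = Y *m X ^+ n by rewrite E Xk mulmx0.
  by elim: n => [|n IH] /=; rewrite ?expr0 ?mulmx1 // IH lfunE /= -mulmxA exprSr.
Qed.

Definition brv U W : {vspace 'M[F]_N} :=
  <<[seq br X Y | X <- vbasis U, Y <- vbasis W]>>%VS.

Lemma memv_brv U W X Y : X \in U -> Y \in W -> br X Y \in brv U W.
Proof.
move=> /coord_vbasis-> /coord_vbasis->; rewrite br_suml; apply: memv_suml => i _.
rewrite br_sumr; apply: memv_suml => j _; rewrite brZl brZr !memvZ //.
by apply: memv_span; apply: allpairs_f; rewrite mem_nth ?size_tuple.
Qed.

Lemma brv_sub U W (S : {vspace 'M[F]_N}) : (forall X Y, X \in U -> Y \in W -> br X Y \in S) ->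
  (brv U W <= S)%VS.
Proof.
move=> H; apply/span_subvP => Z /seq.allpairsP[[X Y] /= [Xu Yw ->]].
by apply: H; exact: vbasis_mem.
Qed.

End Bracket.

Section Cartan.
Variables (F : numClosedFieldType) (N : nat) (g h : {vspace 'M[F]_N}).
Hypothesis g_br : forall X Y, X \in g -> Y \in g -> br X Y \in g.
Hypothesis g_nondeg :
  forall X, X \in g -> (forall Y, Y \in g -> \tr (X *m Y) = 0) -> X = 0.
Hypothesis h_g : (h <= g)%VS.
Hypothesis h_nil : exists k, iter k (brv h) h = 0%VS.
Hypothesis h_self : forall X, X \in g -> (forall H, H \in h -> br X H \in h) -> X \in h.
Implicit Types (X Y Z H K : 'M[F]_N) (U W : {vspace 'M[F]_N}).

Let hg X : X \in h -> X \in g. Proof. exact: (subvP h_g). Qed.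
Let c j := iter j (brv h) h.

Let c_br j H X : H \in h -> X \in c j -> br H X \in c j.+1.
Proof. exact: memv_brv. Qed.

Let c_g j : (c j <= g)%VS.
Proof.
elim: j => [|j IH]; first exact: h_g.
by apply: brv_sub => X Y /hg Xg /(subvP IH); exact: g_br.
Qed.

Let cS0 k : c k = 0%VS -> c k.+1 = 0%VS.
Proof.
move=> ck; apply/eqP; rewrite -subv0; apply: brv_sub => X Y _ Yc.
have : Y \in c k by []. 
by rewrite ck !memv0 => /eqP->; rewrite br0r.
Qed.

(* A nilpotent self-normalizing subspace is a subalgebra: the last nonzero
   term of its lower central series lies in it, then the previous one, ... *)
Let c1_h : (c 1 <= h)%VS.
Proof.
have [k ck] := h_nil; suff: (c 1 <= h)%VS by [].
suff H j : (j <= k)%N -> (c (k - j).+1 <= h)%VS.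
  by have := H k (leqnn k); rewrite subnn.
elim: j => [_|j IH jk].
  by rewrite subn0 (cS0 ck) sub0v.
apply/subvP => X Xc; apply: h_self => [|H Hh]; first exact: (subvP (c_g _) _ Xc).
rewrite brC memvN; apply: (subvP (IH (ltnW jk))).
by rewrite -(subnSK jk); exact: c_br.
Qed.

Lemma cartan_br H K : H \in h -> K \in h -> br H K \in h.
Proof. by move=> Hh Kh; apply: (subvP c1_h); exact: (@c_br 0). Qed.

Let c_dec j : (c j.+1 <= c j)%VS.
Proof.
elim: j => [|j IH]; first exact: c1_h.
by apply: brv_sub => X Y Xh /(subvP IH); exact: c_br.
Qed.

Let c_h j : (c j <= h)%VS.
Proof. by elim: j => [|j IH]; [exact: subvv|exact: subv_trans (c_dec j) IH]. Qed.

Let ad_h_nil H : H \in h -> exists k, forall K, K \in h -> iter k (ad H) K = 0.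
Proof.
move=> Hh; have [k ck] := h_nil; exists k => K Kh.
have : iter k (ad H) K \in c k.
  by elim: (k) => [//|j IH] /=; rewrite adE; exact: c_br.
by rewrite [c k]ck memv0 => /eqP.
Qed.

Let stable U := forall H X, H \in h -> X \in U -> br H X \in U.

(* Fitting: an invariant functional which vanishes on the range of ad H is
   determined by its restriction to the generalized kernel of ad H. *)
Let fitting_list (phi : 'M[F]_N -> F) (l : seq 'M[F]_N) :
  {morph phi : X Y / X + Y} ->
  (forall H X, H \in h -> X \in g -> phi (br H X) = 0) ->
  (exists2 X, X \in g & phi X != 0) ->
  (forall H, H \in l -> H \in h) ->
  exists V, [/\ (h <= V)%VS, (V <= g)%VS, stable V, exists2 X, X \in V & phi X != 0 &
     forall H, H \in l -> forall X, X \in V -> exists n, iter n (ad H) X = 0].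
Proof.
move=> phiD phi0 phin0; elim: l => [_|H l IH Hl].
  by exists g; split=> // H X /hg; exact: g_br.
have [K Kl|V [hV Vg sV [X XV pX] nV]] := IH; first by apply: Hl; rewrite inE Kl orbT.
have Hh : H \in h by apply: Hl; rewrite inE eqxx.
have sH : (ad H @: V <= V)%VS.
  by apply/subvP => Y /memv_imgP[Z ZV ->]; rewrite adE; exact: sV.
have [V0 [V1 [VV V1V fV1 V0P inj]]] := fitting sH.
exists V0; split.
- apply/subvP => K Kh; apply/V0P; split; first exact: (subvP hV).
  by have [k Hk] := ad_h_nil Hh; exists k; exact: Hk.
- by apply/subvP => Y /V0P[/(subvP Vg)].
- move=> K Y Kh /V0P[YV [n nY]]; apply/V0P; split; first exact: sV.
  have [k Hk] := ad_h_nil Hh; exists (k + n)%N.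
  by apply: ad_nilp_leibniz; rewrite ?Hk.
- have /memv_addP[Y YV0 [Z ZV1 E]] := subvP VV _ XV.
  exists Y => //; move: pX; rewrite E phiD.
  move: ZV1; rewrite -fV1 => /memv_imgP[Z' Z'V ->]; rewrite adE phi0 ?addr0 //.
  exact/(subvP Vg)/(subvP V1V).
- move=> K; rewrite inE => /orP[/eqP->|Kl] Y /V0P[YV nY //].
  exact: nV Kl _ YV.
Qed.

(** Engel's theorem for h acting on V / h. Going down in j climbs the lower central series, and
    within each term one runs through a basis: by Jacobi, bracketing with the next element K
    preserves the set of vectors already sent into h, and the last iterate of [ad K] outside h is
    sent into h by K as well. *)
Let engel V : (h <= V)%VS -> stable V ->
  (forall j H, H \in vbasis (c j) -> forall X, X \in V -> exists n, iter n (ad H) X = 0) ->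
  (exists2 X, X \in V & X \notin h) ->
  exists X, [/\ X \in V, X \notin h & forall H, H \in h -> br H X \in h].
Proof.
move=> hV sV nV [X0 X0V X0h]; have [k ck] := h_nil.
suff H j : (j <= k)%N -> exists X, [/\ X \in V, X \notin h &
   forall K, K \in c (k - j) -> br K X \in h].
  by have := H k (leqnn k); rewrite subnn.
elim: j => [_|j IH jk].
  exists X0; split=> // K; rewrite subn0 [c k]ck memv0 => /eqP->.
  by rewrite br0l mem0v.
have [X [XV Xh HX]] := IH (ltnW jk).
suff G (l : seq 'M[F]_N) : (forall K, K \in l -> K \in vbasis (c (k - j.+1))) ->
    exists Y, [/\ Y \in V, Y \notin h,
    forall K, K \in c (k - j) -> br K Y \in h &
    forall K, K \in l -> br K Y \in h].
  have [//|Y [YV Yh HY HY']] := G (vbasis (c (k - j.+1))).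
  exists Y; split=> // K /coord_vbasis->; rewrite br_suml; apply: memv_suml => i _.
  by rewrite brZl memvZ // HY' // mem_nth ?size_tuple.
elim: l => [_|K l IHl Kl]; first by exists X; split=> // K.
have [K' ?|Y [YV Yh HY HY']] := IHl; first by apply: Kl; rewrite inE orbC; apply/orP; left.
have Kb : K \in vbasis (c (k - j.+1)) by apply: Kl; rewrite inE eqxx.
have Kc := vbasis_mem Kb; have Kh := subvP (c_h _) _ Kc.
have step Z : [/\ Z \in V, forall K', K' \in c (k - j) -> br K' Z \in h &
    forall K', K' \in l -> br K' Z \in h] ->
  [/\ br K Z \in V, forall K', K' \in c (k - j) -> br K' (br K Z) \in h &
    forall K', K' \in l -> br K' (br K Z) \in h].
  move=> [ZV H1 H2]; split; first exact: sV.
    move=> K' K'c; rewrite jacobi memvD //; last by apply: cartan_br => //; exact: H1.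
    apply: H1; rewrite brC memvN; apply: (subvP (c_dec _)); apply: c_br => //.
  move=> K' K'l; have K'c : K' \in c (k - j.+1).
    by apply: vbasis_mem; apply: Kl; rewrite inE orbC; apply/orP; left.
  rewrite jacobi memvD //; last by apply: cartan_br => //; exact: H2.
  apply: H1; rewrite -subnSK //; apply: c_br => //.
  exact: (subvP (c_h _)) K'c.
have [n nY] := nV _ _ Kb _ YV.
(* The last iterate of [ad K] on Y that is outside h: Y is outside and some iterate is 0. *)
have [n0 [n1 n2]] : exists n, iter n (ad K) Y \notin h /\ br K (iter n (ad K) Y) \in h.
  elim: n nY => [Y0|n IHn]; first by move: Yh; rewrite [Y]Y0 mem0v.
  have [inh|nin] := boolP (iter n (ad K) Y \in h); last first.
    by rewrite /= adE => E; exists n; rewrite E mem0v.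
  clear IHn => _; elim: n inh => [inh|n IHn]; first by rewrite inh in Yh.
  have [inh|nin] := boolP (iter n (ad K) Y \in h); first by move=> _; exact: IHn.
  by rewrite /= adE => E; exists n.
have [I1 I2 I3] : [/\ iter n0 (ad K) Y \in V,
    forall K', K' \in c (k - j) -> br K' (iter n0 (ad K) Y) \in h &
    forall K', K' \in l -> br K' (iter n0 (ad K) Y) \in h].
  by elim: (n0) => [|m IHm] /=; [split|rewrite adE; exact: step].
exists (iter n0 (ad K) Y); split=> // K'; rewrite inE => /orP[/eqP->//|]; exact: I3.
Qed.

(** Otherwise X -> tr (Z X) is an h-invariant functional on g which vanishes on h but not on g. By
    Fitting it is nonzero on some stable V containing h on which the basis elements act nilpotently;
    V is then larger than h, and Engel produces an element outside h which normalizes h. *)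
Lemma cartan_central_zero Z : Z \in h -> (forall H, H \in h -> br H Z = 0) ->
  (forall H, H \in h -> \tr (Z *m H) = 0) -> Z = 0.
Proof.
move=> Zh Zc Zt; apply: g_nondeg; first exact: hg.
apply: contrapT => /existsNP[Y /not_implyP[Yg /eqP nY]].
have [k ck] := h_nil.
pose l := flatten [seq vbasis (c j) : seq _ | j <- iota 0 k].
have inl j K : K \in vbasis (c j) -> (j < k)%N -> K \in l.
  move=> Kj jk; apply/flatten_mapP; exists j => //; first by rewrite mem_iota.
have [|||K /flatten_mapP[j _ /vbasis_mem/(subvP (c_h j))] //|V [hV Vg sV [X XV nX] nV]] :=
    @fitting_list (fun X => \tr (Z *m X)) l.
- by move=> X X'; rewrite mulmxDr linearD.
- by move=> H X Hh Xg; rewrite -tr_brA brC Zc // oppr0 mul0mx linear0.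
- by exists Y.
have [||X' [X'V X'h HX']] := engel hV sV.
- move=> j H Hj X1 X1V; have [jk|kj] := ltnP j k.
    by apply: nV => //; exact: inl Hj jk.
  exists 1; have : H \in c j := vbasis_mem Hj.
  suff -> : c j = 0%VS by rewrite memv0 => /eqP->; rewrite /= adE br0l.
  rewrite -(subnK kj) /c iterD ck; elim: (j - k)%N => [//|m IH].
  rewrite iterS IH; apply/eqP; rewrite -subv0; apply: brv_sub => X2 Y2 _.
  by rewrite !memv0 => /eqP->; rewrite br0r.
- by exists X => //; apply: contra nX => Xh; rewrite Zt.
move/negP: X'h; apply; apply: h_self; first exact: (subvP Vg).
by move=> H Hh; rewrite brC memvN; exact: HX'.
Qed.

(** Take Z in the last term of the lower central series, supposed to be of positive index. It
    commutes with h and is a sum of brackets of elements of h, hence is nilpotent; so it is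
    trace-orthogonal to h and [cartan_central_zero] kills it. *)
Lemma cartan_abelian H K : H \in h -> K \in h -> br H K = 0.
Proof.
move=> Hh Kh; apply/eqP; rewrite -memv0; suff <- : c 1 = 0%VS by exact: (@c_br 0).
have [k ck] := h_nil.
have {k ck} : exists k, c k.+1 = 0%VS.
  by exists k; exact: cS0.
case; elim=> [//|k IH ck]; apply: IH; apply/eqP; rewrite -subv0.
apply/subvP => Z Zc; rewrite memv0; apply/eqP.
have Zh := subvP (c_h _) _ Zc.
have Zcen X : X \in h -> br X Z = 0.
  by move=> Xh; apply/eqP; rewrite -memv0 -ck; exact: c_br.
have comm X : X \in h -> X *m Z = Z *m X.
  by move=> Xh; apply/eqP; rewrite -subr_eq0; apply/eqP; exact: Zcen.
have Zn : Z ^+ N = 0.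
  apply: trace_pow_nil => m; rewrite mxXSr.
  suff H1 X : X \in c k.+1 -> \tr (Z ^+ m *m X) = 0 by exact: H1.
  pose f := (linfun (mxtrace : 'M[F]_N -> F^o) \o linfun (mulmx (Z ^+ m)))%VF.
  have fE Y : f Y = \tr (Z ^+ m *m Y) by rewrite comp_lfunE !lfunE.
  suff : (c k.+1 <= lker f)%VS.
    by move/subvP => s /s; rewrite memv_ker fE => /eqP.
  apply: brv_sub => X1 X2 X1h _; rewrite memv_ker fE; apply/eqP.
  by apply: comm_bracket_tr; exact: comm.
apply: cartan_central_zero => // X Xh; apply: comm_mul_nil Zn _.
by rewrite comm.
Qed.

Lemma cartan_comm H K : H \in h -> K \in h -> H *m K = K *m H.
Proof. by move=> Hh Kh; apply/eqP; rewrite -subr_eq0; apply/eqP/cartan_abelian. Qed.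

(** The generalized eigenspaces span: [fitting] splits off the one of some eigenvalue, and the
    complement, stable under f, has smaller dimension. *)
Let gen_span (f : 'End('M[F]_N)) U W : (f @: U <= U)%VS ->
  (forall X c n, X \in U -> iter n (f - c *: \1%VF) X = 0 -> X \in W) -> (U <= W)%VS.
Proof.
have [n] := ubnP (\dim U); elim: n U => // n IH U dU fU HW.
have [->|U0] := eqVneq U 0%VS; first exact: sub0v.
have [a [X [XU X0 fX]]] := eigen_exists fU U0.
have faE Y : (f - a *: \1%VF) Y = f Y - a *: Y.
  by rewrite add_lfunE opp_lfunE scale_lfunE id_lfunE.
have faU : ((f - a *: \1%VF) @: U <= U)%VS.
  apply/subvP => Y /memv_imgP[Z ZU ->]; rewrite faE memvB ?memvZ //.
  by apply: (subvP fU); exact: memv_img.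
have [V0 [V1 [VV V1V fV1 V0P inj]]] := fitting faU.
apply: subv_trans VV _; rewrite subv_add; apply/andP; split.
  by apply/subvP => Y /V0P[YU [m E]]; exact: HW E.
apply: IH.
- have dU' : (\dim U <= n)%N by [].
  apply: leq_trans dU'; rewrite ltn_neqAle dimvS // andbT; apply/negP => /eqP E.
  have /eqP EV : V1 == U by rewrite eqEdim V1V E leqnn.
  by case/eqP: X0; apply: inj; rewrite ?EV // faE fX subrr.
- apply/subvP => Y /memv_imgP[Z ZV1 ->].
  have : (f - a *: \1%VF) Z \in V1 by rewrite -fV1; exact: memv_img.
  by rewrite faE => E; rewrite -(subrK (a *: Z) (f Z)) memvD ?memvZ.
- by move=> Y b m /(subvP V1V); exact: HW.
Qed.

(* ad S is the semisimple part of ad H on g; as S - (element of g) commutes with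
   g, the nilpotent part of H, corrected, is central and trace-orthogonal to h. *)
Lemma cartan_gen_eigen H X a n : H \in h -> X \in g ->
  iter n (ad H - a *: \1%VF) X = 0 -> br H X = a *: X.
Proof.
move=> Hh; have [S [Scomm Snil Sdiag]] := jordan H.
have HS : H *m S = S *m H by rewrite Scomm.
have adcE T b Y : (ad T - b *: \1%VF) Y = br T Y - b *: Y.
  by rewrite add_lfunE opp_lfunE scale_lfunE id_lfunE adE.
have S_eig Y b m : iter m (ad H - b *: \1%VF) Y = 0 -> br S Y = b *: Y.
  move=> E; apply: (@ad_diag_eigen _ _ S Y b (m + (N + N))) => //.
  have E2 : ad S - b *: \1%VF = (ad H - b *: \1%VF) - ad (H - S).
    apply/lfunP => Z; rewrite adcE [RHS]add_lfunE adcE opp_lfunE adE brBl.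
    by rewrite opprB [RHS]addrC addrA subrK.
  have := @iter_sub_nil _ _ (ad H - b *: \1%VF) (ad (H - S)) m (N + N) Y.
  rewrite -E2 => <- //; last exact: ad_nil.
    by elim: (m + (N + N))%N => //= k <-; rewrite adcE.
  move=> Z; rewrite adcE !adE adcE (brBr (H - S) (br H Z)) (brZr b (H - S) Z).
  congr (_ - _); rewrite jacobi [X in br X _](_ : _ = 0) ?br0l ?add0r //.
  by rewrite brBr brXX /br HS subrr subrr.
have gs Y : Y \in g -> br S Y \in g.
  pose W := (g :&: (ad S @^-1: g))%VS.
  suff /subvP gW : (g <= W)%VS.
    by move=> /gW; rewrite memv_cap -memv_preim adE => /andP[].
  apply: (@gen_span (ad H)).
    apply/subvP => Z /memv_imgP[Z' Z'g ->]; rewrite adE; apply: g_br => //; exact: hg.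
  move=> Z b m Zg E; rewrite memv_cap Zg -memv_preim adE (S_eig _ _ _ E).
  by rewrite memvZ.
have [T Tg TP] : exists2 T, T \in g & forall Y, Y \in g -> \tr (T *m Y) = \tr (S *m Y).
  apply: form_represent => //.
  - by move=> b Y Z Z' _ _ _; rewrite mulmxDl -scalemxAl linearP.
  - by move=> b Y Z Z' _ _ _; rewrite mulmxDr -scalemxAr linearP.
  - by move=> b Y Z _ _; rewrite mulmxDr -scalemxAr linearP.
have TS Y : Y \in g -> br T Y = br S Y.
  move=> Yg; apply/eqP; rewrite -subr_eq0; apply/eqP; apply: g_nondeg.
    by rewrite memvB ?gs ?g_br.
  move=> Y' Y'g; rewrite mulmxBl linearB /= !tr_brA TP ?subrr //; exact: g_br.
have HT : H - T = 0.
  have Zc K : K \in h -> br K (H - T) = 0.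
    move=> Kh; rewrite brBr cartan_abelian // sub0r -brC (TS _ (hg Kh)) /br Scomm ?subrr //.
    exact: cartan_comm.
  have Zh : H - T \in h.
    apply: h_self; first by apply: memvB => //; exact: hg.
    by move=> K Kh; rewrite brC Zc // oppr0 mem0v.
  apply: cartan_central_zero => // K Kh.
  rewrite mulmxBl linearB /= (TP _ (hg Kh)) -linearB /= -mulmxBl.
  apply: comm_mul_nil Snil _; rewrite mulmxBl mulmxBr -(cartan_comm Kh Hh).
  by rewrite Scomm // cartan_comm.
move=> Xg E; move/eqP: HT; rewrite subr_eq0 => /eqP->.
by rewrite TS //; exact: S_eig E.
Qed.

(** Simultaneous diagonalization, one element of a basis of h at a time: the joint eigenspace of the
    previous ones is stable under the next [ad H], is spanned by its generalized eigenvectors, and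
    these are eigenvectors by [cartan_gen_eigen]. *)
Lemma cartan_weight_basis : exists e : seq 'M[F]_N, basis_of g e /\
  forall X, X \in e -> forall H, H \in vbasis h -> exists a, br H X = a *: X.
Proof.
suff [e] : exists e : seq 'M[F]_N, basis_of g (e ++ [::]) /\
  forall X, X \in e -> forall H, H \in vbasis h -> exists a, br H X = a *: X.
  by rewrite cats0; exists e.
apply: basis_pred => [||W HW]; [exact: nil_free|by []|].
have : forall H, H \in (vbasis h : seq _) -> H \in vbasis h by [].
suff K (l : seq 'M[F]_N) : (forall H, H \in l -> H \in h) -> forall W, (forall X, X \in g ->
   (forall H, H \in l -> exists a, br H X = a *: X) -> X \in W) -> (g <= W)%VS.
  by move=> _; apply: (K (vbasis h)) => // H /vbasis_mem.
elim: l => [_ W0 HW0|H l IH Hl W0 HW0].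
  by apply/subvP => X Xg; apply: HW0.
have Hh : H \in h by apply: Hl; rewrite inE eqxx.
have lh H' : H' \in l -> H' \in h by move=> ?; apply: Hl; rewrite inE orbC; apply/orP; left.
apply: IH => // X Xg HX.
have /choice[a Ha] : forall H', exists a, H' \in l -> br H' X = a *: X.
  move=> H'; have [/HX[a aP]|] := boolP (H' \in l); first by exists a.
  by exists 0.
have [U UP] : exists U : {vspace 'M[F]_N}, forall Y, Y \in U <->
    (Y \in g /\ forall H', H' \in l -> br H' Y = a H' *: Y).
  elim: (l) => [|H1 l1 [U UP]]; first by exists g => Y; split=> [|[]].
  exists (U :&: lker (ad H1 - a H1 *: \1%VF))%VS => Y; rewrite memv_cap memv_ker.
  rewrite add_lfunE opp_lfunE scale_lfunE id_lfunE adE subr_eq0; split.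
    move=> /andP[/UP[Yg HY] /eqP E]; split=> // H'; rewrite inE => /orP[/eqP->//|].
    exact: HY.
  move=> [Yg HY]; rewrite HY ?inE ?eqxx // andbT; apply/UP; split=> // H' H'l.
  by apply: HY; rewrite inE H'l orbT.
suff /subvP UW : (U <= W0)%VS by apply: UW; apply/UP.
apply: (@gen_span (ad H)).
  apply/subvP => Z /memv_imgP[Y /UP[Yg HY] ->]; rewrite adE; apply/UP.
  split=> [|H' H'l]; first by apply: g_br => //; exact: hg.
  rewrite jacobi (HY H' H'l) (brZr (a H') H Y) (cartan_abelian (lh _ H'l) Hh) br0l add0r //.
move=> Y b m /UP[Yg HY] /(cartan_gen_eigen Hh Yg) E; apply: HW0 => // H'.
rewrite inE => /orP[/eqP->|/HY ?]; first by exists b.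
by exists (a H').
Qed.

End Cartan.

(** * Representations of sl_2 *)

Section Sl2.
Variables (F : numClosedFieldType) (V : lmodType F).
Variables E D H : {linear V -> V}.
Hypothesis HED : forall u, E (D u) = D (E u) + H u.
Hypothesis HHE : forall u, H (E u) = E (H u) + 2%:R *: E u.
Hypothesis HHD : forall u, H (D u) = D (H u) - 2%:R *: D u.

Lemma sl2_lower v (l : F) n : H v = l *: v ->
  H (iter n D v) = (l - (2 * n)%:R) *: iter n D v.
Proof.
move=> Hv; elim: n => [|n IH] /=; first by rewrite muln0 subr0.
rewrite HHD IH linearZ /= -scalerBl -addrA -opprD -natrD.
by congr ((_ - _%:R) *: _); rewrite mulnS addnC.
Qed.

Lemma sl2_raise_lower v (l : F) n : E v = 0 -> H v = l *: v ->
  E (iter n.+1 D v) = (n.+1%:R * (l - n%:R)) *: iter n D v.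
Proof.
move=> Ev Hv; elim: n => [|n IH].
  by rewrite /= HED Ev linear0 add0r subr0 mul1r.
rewrite [iter n.+2 D v]iterS HED IH (sl2_lower n.+1 Hv) linearZ -iterS -scalerDl; congr (_ *: _).
ring.
Qed.

(** If D^(k+1) v is the first vanishing iterate, raising it gives (k + 1) (l - k) D^k v = 0, whence
    l = k. *)
Lemma sl2_highest_nat v (l : F) k : v != 0 -> E v = 0 -> H v = l *: v ->
  iter k D v = 0 -> exists n : nat, l = n%:R.
Proof.
move=> v0 Ev Hv; elim: k => [/eqP|k IH Dk]; first by rewrite (negPf v0).
have [/IH//|nz] := eqVneq (iter k D v) 0.
have := sl2_raise_lower k Ev Hv; rewrite Dk linear0 => /esym/eqP.
rewrite scaler_eq0 (negPf nz) orbF mulf_eq0 pnatr_eq0 /= subr_eq0 => /eqP ->.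
by exists k.
Qed.

Lemma sl2_string v (n k : nat) : v != 0 -> E v = 0 -> H v = n%:R *: v -> (k <= n)%N ->
  iter k D v != 0.
Proof.
move=> v0 Ev Hv; elim: k => // k IH kn; apply/eqP => Dk.
have := sl2_raise_lower k Ev Hv; rewrite Dk linear0 => /esym/eqP.
rewrite scaler_eq0 (negPf (IH (ltnW kn))) orbF mulf_eq0 pnatr_eq0 /= subr_eq0 eqr_nat.
by rewrite gtn_eqF.
Qed.

Lemma sl2_top v (mu : F) k : v != 0 -> H v = mu *: v -> iter k E v = 0 ->
  exists m, [/\ iter m E v != 0, E (iter m E v) = 0 &
    H (iter m E v) = (mu + (2 * m)%:R) *: iter m E v].
Proof.
move=> v0 Hv.
have HE m : H (iter m E v) = (mu + (2 * m)%:R) *: iter m E v.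
  elim: m => [|m IH] /=; first by rewrite muln0 addr0.
  rewrite HHE IH linearZ /= -scalerDl -addrA -natrD.
  by congr ((_ + _%:R) *: _); rewrite mulnS addnC.
elim: k => [/eqP|k IH Ek]; first by rewrite (negPf v0).
have [/IH//|nz] := eqVneq (iter k E v) 0.
by exists k.
Qed.

Lemma sl2_integral v (mu : F) : v != 0 -> H v = mu *: v ->
  (forall u, exists n, iter n E u = 0) -> (forall u, exists n, iter n D u = 0) ->
  exists z : int, mu = z%:~R.
Proof.
move=> v0 Hv En Dn; have [k Ek] := En v.
have [m [nz Em Hm]] := sl2_top v0 Hv Ek.
have [k' Dk'] := Dn (iter m E v).
have [n E1] := sl2_highest_nat nz Em Hm Dk'.
exists (n%:Z - (2 * m)%:Z); rewrite rmorphB /= -!pmulrn -E1; ring.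
Qed.

End Sl2.

Section MatrixSl2.
Variables (F : numClosedFieldType) (N : nat).
Implicit Types (E D H : 'M[F]_N).

Lemma matrix_sl2_nil E H (c : F) : c != 0 -> br H E = c *: E -> E ^+ N = 0.
Proof. by move=> c0 HE; apply: (@bracket_eigen_nil _ _ H E c). Qed.

Lemma matrix_sl2_integral E D H (a : F) : br E D = H -> br H E = 2%:R *: E ->
  br H D = - 2%:R *: D -> root (char_poly H) a -> exists z : int, a = z%:~R.
Proof.
move=> ED HE HD; rewrite -eigenvalue_root_char => /eigenvalueP[v vH v0].
have two0 : (2%:R : F) != 0 by rewrite pnatr_eq0.
have EN := matrix_sl2_nil two0 HE.
have DN : D ^+ N = 0 by apply: matrix_sl2_nil HD; rewrite oppr_eq0.
have iterE X u n : iter n (mulmxr X) u = u *m X ^+ n :> 'rV[F]_N.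
  by elim: n => [|n IH] /=; rewrite ?expr0 ?mulmx1 // IH /= -mulmxA exprSr.
(* Row vectors are acted on from the right, which reverses products: D raises and E lowers. *)
apply: (@sl2_integral _ _ (mulmxr D) (mulmxr E) (mulmxr H) _ _ _ v a v0 vH) => u /=.
- by rewrite -!mulmxA -mulmxDr -ED /br addrC subrK.
- rewrite -!mulmxA scalemxAr -mulmxDr; congr (_ *m _).
  by move/eqP: HD; rewrite /br scaleNr subr_eq addrC -subr_eq opprK => /eqP <-.
- rewrite -!mulmxA scalemxAr -mulmxBr; congr (_ *m _).
  by move/eqP: HE; rewrite /br subr_eq addrC => /eqP ->; rewrite addrK.
- by exists N; rewrite iterE DN mulmx0.
- by exists N; rewrite iterE EN mulmx0.
Qed.

Lemma char_poly_trig_root (A P : 'M[F]_N) i : P \in unitmx ->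
  is_trig_mx (P *m A *m invmx P) -> root (char_poly A) ((P *m A *m invmx P) i i).
Proof.
move=> Pu; rewrite -(char_poly_conj A Pu); move: (P *m A *m invmx P) => B tB.
rewrite /char_poly det_trig; last first.
  apply/is_trig_mxP => k j kj; rewrite !mxE -val_eqE ltn_eqF //= mulr0n.
  by rewrite (is_trig_mxP tB) // subr0.
rewrite (bigD1 i) //= rootM; apply/orP; left.
by rewrite !mxE eqxx mulr1n root_XsubC.
Qed.

End MatrixSl2.

(** The trace form of the given matrices takes the place of the Killing form; [cp_nondeg] is its
    nondegeneracy. *)
Record cartan_pair (F : numClosedFieldType) N (g h : {vspace 'M[F]_N}) : Prop := CartanPair {
  cp_br : forall X Y, X \in g -> Y \in g -> br X Y \in g;
  cp_nondeg : forall X, X \in g -> (forall Y, Y \in g -> \tr (X *m Y) = 0) -> X = 0;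
  cp_sub : (h <= g)%VS;
  cp_nil : exists k, iter k (brv h) h = 0%VS;
  cp_self : forall X, X \in g -> (forall H, H \in h -> br X H \in h) -> X \in h }.

(** * Roots, coroots and root strings *)

Section Roots.
Variables (F : numClosedFieldType) (N : nat) (g h : {vspace 'M[F]_N}).
Hypothesis cp : cartan_pair g h.
Let g_br := cp_br cp.
Let g_nondeg := cp_nondeg cp.
Let h_g := cp_sub cp.
Let h_nil := cp_nil cp.
Let h_self := cp_self cp.
Local Notation dual := 'Hom(subvs_of h, F^o).
Implicit Types (X Y Z : 'M[F]_N) (H K T : subvs_of h) (alpha beta : dual).

Let hg X : X \in h -> X \in g. Proof. exact: (subvP h_g). Qed.
Let vh H : vsval H \in h. Proof. exact: subvsP. Qed.
Let vg H : vsval H \in g. Proof. exact: hg. Qed.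

Definition rootv alpha X : Prop :=
  X \in g /\ forall H, br (vsval H) X = (alpha H : F) *: X.

Definition isroot alpha : Prop := alpha != 0 /\ exists2 X, X != 0 & rootv alpha X.

Lemma rootv0 X : rootv 0 X -> X \in h.
Proof.
move=> [Xg HX]; apply: h_self => // H Hh; have := HX (vsproj h H).
by rewrite vsprojK // zero_lfunE scale0r brC => /eqP; rewrite oppr_eq0 => /eqP->; rewrite mem0v.
Qed.

Lemma rootv_h X : X \in h -> rootv 0 X.
Proof.
move=> Xh; split=> [|H]; first exact: hg.
by rewrite zero_lfunE scale0r (cartan_abelian g_br g_nondeg h_g h_nil h_self).
Qed.

Lemma rootvZ a alpha X : rootv alpha X -> rootv alpha (a *: X).
Proof.
by move=> [Xg HX]; split=> [|H]; [rewrite memvZ|rewrite brZr HX !scalerA mulrC].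
Qed.

Lemma rootvD alpha X Y : rootv alpha X -> rootv alpha Y -> rootv alpha (X + Y).
Proof.
move=> [Xg HX] [Yg HY]; split=> [|H]; first by rewrite memvD.
by rewrite brDr HX HY scalerDr.
Qed.

Lemma rootv_br alpha beta X Y : rootv alpha X -> rootv beta Y ->
  rootv (alpha + beta) (br X Y).
Proof.
move=> [Xg HX] [Yg HY]; split=> [|H]; first exact: g_br.
by rewrite jacobi HX HY brZl brZr add_lfunE scalerDl.
Qed.

Lemma rootv_tr alpha beta X Y : rootv alpha X -> rootv beta Y ->
  alpha + beta != 0 -> \tr (X *m Y) = 0.
Proof.
move=> [Xg HX] [Yg HY] ab; apply/eqP; apply: contraNT ab => trn0.
apply/eqP/lfunP => H; rewrite zero_lfunE; apply/eqP.
rewrite -(mulIr_eq0 _ (mulIf trn0)) add_lfunE mulrDl.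
have -> : (beta H : F) * \tr (X *m Y) = \tr (X *m br (vsval H) Y).
  by rewrite HY -scalemxAr mxtraceZ.
by rewrite -tr_brA brC HX mulNmx linearN /= -scalemxAl mxtraceZ subrr.
Qed.

Lemma weight_vector X : X \in g -> X != 0 ->
  (forall Z, Z \in vbasis h -> exists a, br Z X = a *: X) -> exists alpha, rootv alpha X.
Proof.
move=> Xg X0 HX.
have /choice[a Ha] : forall Z, exists a, Z \in vbasis h -> br Z X = a *: X.
  move=> Z; have [/HX[a aP]|_] := boolP (Z \in vbasis h); first by exists a.
  by exists 0.
pose f H : F^o := \sum_i coord (vbasis h) i (vsval H) * a (vbasis h)`_i.
have [|phi phiE] := @linfun_of _ _ _ f.
  move=> b H K; rewrite /f scaler_sumr -big_split; apply: eq_bigr => i _ /=.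
  by rewrite linearP /= mulrDl -mulrA.
exists phi; split=> // H; rewrite phiE /f scaler_suml.
rewrite {1}(coord_vbasis (vh H)) br_suml; apply: eq_bigr => i _.
by rewrite brZl Ha ?scalerA // mem_nth ?size_tuple.
Qed.

Lemma weight_basis : exists e : seq 'M[F]_N, basis_of g e /\
  forall X, X \in e -> exists alpha, rootv alpha X.
Proof.
have [e [eg He]] := cartan_weight_basis g_br g_nondeg h_g h_nil h_self.
exists e; split=> // X Xe; apply: weight_vector => //.
- by rewrite (basis_mem eg).
- exact: (free_not0 (basis_free eg)).
- exact: He.
Qed.

Lemma weight_span (W : {vspace 'M[F]_N}) :
  (forall alpha X, rootv alpha X -> X \in W) -> (g <= W)%VS.
Proof.
have [e [eg He]] := weight_basis => HW.
by apply: (span_basis_ind eg) => X /He[alpha]; exact: HW.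
Qed.

Let h_nondeg Z : Z \in h -> (forall X, X \in h -> \tr (Z *m X) = 0) -> Z = 0.
Proof.
move=> Zh; apply: (cartan_central_zero g_br g_nondeg h_g h_nil h_self) => // H Hh.
exact: (cartan_abelian g_br g_nondeg h_g h_nil h_self).
Qed.

Lemma tr_dual_exists alpha : exists T, forall H, \tr (vsval T *m vsval H) = alpha H.
Proof.
have [||||T Th HT] := @form_represent _ _ h (fun X Y => \tr (X *m Y))
  (fun X => alpha (vsproj h X)).
- by move=> b Y Z Z' _ _ _; rewrite mulmxDl -scalemxAl linearP.
- by move=> b Y Z Z' _ _ _; rewrite mulmxDr -scalemxAr linearP.
- exact: h_nondeg.
- by move=> b Y Z _ _; rewrite !linearP.
by exists (vsproj h T) => H; rewrite vsprojK // HT // vsvalK.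
Qed.

(** The element of h that represents alpha for the trace form, usually written t_alpha. *)
Definition tr_dual alpha : subvs_of h := projT1 (cid (tr_dual_exists alpha)).

Lemma tr_dualE alpha H : \tr (vsval (tr_dual alpha) *m vsval H) = alpha H.
Proof. exact: (projT2 (cid (tr_dual_exists alpha))). Qed.

(** Both sides lie in h, where the trace form is nondegenerate, and by invariance of the form they
    have the same trace against every H. *)
Lemma rootv_opp_br alpha X Y : rootv alpha X -> rootv (- alpha) Y ->
  br X Y = \tr (X *m Y) *: vsval (tr_dual alpha).
Proof.
move=> HX HY; have XYh : br X Y \in h.
  by apply: rootv0; rewrite -(subrr alpha); exact: rootv_br.
apply/eqP; rewrite -subr_eq0; apply/eqP/h_nondeg; first by rewrite memvB ?memvZ.
move=> K Kh; rewrite mulmxBl linearB /= -scalemxAl mxtraceZ.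
rewrite -{2}(vsprojK Kh) tr_dualE tr_brA brC.
have [_ /(_ (vsproj h K))] := HY; rewrite vsprojK // => ->.
rewrite opp_lfunE scaleNr opprK -scalemxAr mxtraceZ mulrC subrr //.
Qed.

(** The weight spaces of alpha and beta are trace-orthogonal unless alpha + beta = 0, so
    nondegeneracy against X can only be witnessed in the weight space of -alpha. *)
Lemma rootv_dual alpha X : rootv alpha X -> X != 0 ->
  exists2 Y, rootv (- alpha) Y & \tr (X *m Y) = 1.
Proof.
move=> HX X0; apply: contrapT => H; case/eqP: X0; apply: g_nondeg; first by case: HX.
pose f := (linfun (mxtrace : 'M[F]_N -> F^o) \o linfun (mulmx X))%VF.
have fE Y : f Y = \tr (X *m Y) by rewrite comp_lfunE !lfunE.
suff /subvP s : (g <= lker f)%VS by move=> Y /s; rewrite memv_ker fE => /eqP.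
apply: weight_span => beta Y HY; rewrite memv_ker fE; apply/negP => trn0.
have [ab|/(rootv_tr HX HY)/eqP//] := eqVneq (alpha + beta) 0.
have eb : beta = - alpha by apply/eqP; rewrite -addr_eq0 addrC ab.
apply: H; exists ((\tr (X *m Y))^-1 *: Y); first by rewrite -eb; exact: rootvZ.
by rewrite -scalemxAr mxtraceZ mulVf //; exact/negP.
Qed.

Lemma isrootN alpha : isroot alpha -> isroot (- alpha).
Proof.
move=> [a0 [X X0 HX]]; split; first by rewrite oppr_eq0.
have [Y HY XY] := rootv_dual HX X0; exists Y => //.
by apply/eqP => Y0; move/eqP: XY; rewrite Y0 mulmx0 mxtrace0 eq_sym oner_eq0.
Qed.

(** If alpha (t_alpha) = 0 then T = [X, Y] commutes with X, hence is nilpotent; commuting with h, it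
    is trace-orthogonal to h, that is, alpha = 0. *)
Lemma root_tr_dual alpha : isroot alpha -> alpha (tr_dual alpha) != 0 :> F.
Proof.
move=> [a0 [X X0 HX]]; apply/negP => /eqP aT; case/eqP: a0; apply/lfunP => H.
have [Y HY XY] := rootv_dual HX X0; rewrite zero_lfunE -tr_dualE.
set T := vsval (tr_dual alpha).
have TXY : br X Y = T by rewrite (rootv_opp_br HX HY) XY scale1r.
have TX : X *m T = T *m X.
  apply/esym/eqP; rewrite -subr_eq0 -[_ - _]/(br T X); have [_ ->] := HX.
  by rewrite aT scale0r.
have Tn : T ^+ N = 0.
  apply: trace_pow_nil => k; rewrite mxXSr -[X in _ *m X]TXY.
  exact: comm_bracket_tr.
apply: comm_mul_nil Tn _.
exact: (cartan_comm g_br g_nondeg h_g h_nil h_self (vh _) (vh _)).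
Qed.

Definition coroot alpha : subvs_of h :=
  (2%:R / (alpha (tr_dual alpha) : F)) *: tr_dual alpha.

Let dualZ alpha a H : (alpha (a *: H) : F) = a * (alpha H : F).
Proof. by rewrite linearZ. Qed.

Let dualN alpha H : (alpha (- H) : F) = - (alpha H : F).
Proof. by rewrite linearN. Qed.

Let dualMn alpha k H : ((alpha *+ k) H : F) = (alpha H : F) *+ k.
Proof. by elim: k => [|k IH]; rewrite ?mulr0n ?zero_lfunE // !mulrS add_lfunE IH. Qed.

Let vsZ a H : vsval (a *: H) = a *: vsval H. Proof. exact: linearZ. Qed.
Let vsN H : vsval (- H) = - vsval H. Proof. exact: linearN. Qed.

Let vs_inj H K : vsval H = vsval K -> H = K. Proof. exact: val_inj. Qed.

Lemma corootE alpha : isroot alpha -> alpha (coroot alpha) = 2%:R :> F.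
Proof.
move=> ra; rewrite /coroot dualZ -mulrA mulVf ?mulr1 //.
exact: root_tr_dual.
Qed.

Lemma coroot_unique alpha H X Y : alpha H = 2%:R :> F -> rootv alpha X ->
  rootv (- alpha) Y -> vsval H = br X Y -> H = coroot alpha.
Proof.
move=> aH HX HY HXY; have E : H = \tr (X *m Y) *: tr_dual alpha.
  by apply/vs_inj; rewrite vsZ HXY (rootv_opp_br HX HY).
have : \tr (X *m Y) * (alpha (tr_dual alpha) : F) = 2%:R.
  by rewrite -aH E dualZ.
rewrite {1}E /coroot => <-; have [z|nz] := eqVneq (alpha (tr_dual alpha) : F) 0; last by rewrite mulfK.
move: aH; rewrite E dualZ z mulr0 => /esym/eqP.
by rewrite pnatr_eq0.
Qed.

Lemma sl2_triple alpha X : isroot alpha -> rootv alpha X -> X != 0 ->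
  exists2 Y, rootv (- alpha) Y & br X Y = vsval (coroot alpha).
Proof.
move=> ra HX X0; have [Y HY XY] := rootv_dual HX X0.
exists ((2%:R / (alpha (tr_dual alpha) : F)) *: Y); first exact: rootvZ.
by rewrite brZr (rootv_opp_br HX HY) XY scale1r vsZ.
Qed.

Lemma coroot_br alpha X : isroot alpha -> rootv alpha X ->
  br (vsval (coroot alpha)) X = 2%:R *: X.
Proof. by move=> ra [_ ->]; rewrite corootE. Qed.

Lemma coroot_brN alpha X : isroot alpha -> rootv (- alpha) X ->
  br (vsval (coroot alpha)) X = - 2%:R *: X.
Proof. by move=> ra [_ ->]; rewrite opp_lfunE corootE. Qed.

Let two0 : (2%:R : F) != 0. Proof. by rewrite pnatr_eq0. Qed.

Lemma rootv_nil alpha X : isroot alpha -> rootv alpha X -> X ^+ N = 0.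
Proof. by move=> ra HX; apply: matrix_sl2_nil (coroot_br ra HX). Qed.

Lemma tr_dualN alpha : tr_dual (- alpha) = - tr_dual alpha.
Proof.
apply/vs_inj/eqP; rewrite -subr_eq0; apply/eqP/h_nondeg; first by rewrite memvB.
move=> H Hh; rewrite -(vsprojK Hh) vsN opprK mulmxDl linearD /= !tr_dualE.
by rewrite opp_lfunE addNr.
Qed.

Lemma corootN alpha : coroot (- alpha) = - coroot alpha.
Proof. by rewrite /coroot tr_dualN opp_lfunE dualN opprK scalerN. Qed.

Lemma ad_sl2 alpha X Y : isroot alpha -> rootv alpha X -> rootv (- alpha) Y ->
  br X Y = vsval (coroot alpha) ->
  [/\ forall u, ad X (ad Y u) = ad Y (ad X u) + ad (vsval (coroot alpha)) u,
      forall u, ad (vsval (coroot alpha)) (ad X u) =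
        ad X (ad (vsval (coroot alpha)) u) + 2%:R *: ad X u
    & forall u, ad (vsval (coroot alpha)) (ad Y u) =
        ad Y (ad (vsval (coroot alpha)) u) - 2%:R *: ad Y u].
Proof.
move=> ra HX HY XY; split=> u; rewrite !adE jacobi.
- by rewrite XY addrC.
- by rewrite coroot_br // brZl addrC.
- by rewrite coroot_brN // brZl scaleNr addrC.
Qed.

Lemma ad_rootv_nil alpha X u : isroot alpha -> rootv alpha X ->
  exists n, iter n (ad X) u = 0.
Proof. by move=> ra HX; exists (N + N)%N; apply: ad_nil; exact: rootv_nil HX. Qed.

Lemma rootv_iter alpha beta X Y n : rootv alpha X -> rootv beta Y ->
  rootv (beta + alpha *+ n) (iter n (ad X) Y).
Proof.
move=> HX HY; elim: n => [|n IH] /=; first by rewrite addr0.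
by rewrite adE mulrS addrCA; exact: rootv_br.
Qed.

(** Subtracting a multiple of X gives Z in the same root space with tr (Z Y) = 0, so [Y, Z] = 0. For
    the opposite triple, in which Y raises, Z would be a highest weight vector of weight -2, which
    is not a natural number. *)
Lemma root_one_dim alpha X X' : isroot alpha -> rootv alpha X -> X != 0 ->
  rootv alpha X' -> exists a, X' = a *: X.
Proof.
move=> ra HX X0 HX'; have [Y HY XY] := sl2_triple ra HX X0.
have Y1 : \tr (X *m Y) != 0.
  apply/eqP => t0; move: XY; rewrite (rootv_opp_br HX HY) t0 scale0r => /esym E.
  have : (alpha (coroot alpha) : F) = 0 by rewrite (_ : coroot alpha = 0) ?linear0 //; exact: val_inj.
  by rewrite corootE // => /eqP; rewrite (negPf two0).
pose a := \tr (X' *m Y) / \tr (X *m Y); exists a; apply/eqP; rewrite -subr_eq0.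
set Z := X' - a *: X; have HZ : rootv alpha Z.
  by rewrite /Z -scaleNr; apply: rootvD => //; exact: rootvZ.
apply/negP => /negP Z0.
have YZ : br Y Z = 0.
  rewrite brC (rootv_opp_br HZ HY) /Z mulmxBl linearB /= -scalemxAl mxtraceZ.
  by rewrite mulfVK // subrr scale0r oppr0.
have [H1 H2 H3] := ad_sl2 ra HX HY XY.
have [k Hk] := ad_rootv_nil Z ra HX.
have h1 u : ad Y (ad X u) = ad X (ad Y u) + (- ad (vsval (coroot alpha)))%R u.
  by rewrite opp_lfunE H1 addrK.
have h2 u : (- ad (vsval (coroot alpha)))%R (ad X u) =
    ad X ((- ad (vsval (coroot alpha)))%R u) - 2%:R *: ad X u.
  by rewrite !opp_lfunE H2 linearN opprD.
have YZ' : ad Y Z = 0 by rewrite adE.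
have HZ' : (- ad (vsval (coroot alpha)))%R Z = (- 2%:R) *: Z.
  by rewrite opp_lfunE adE coroot_br // scaleNr.
have [n] := sl2_highest_nat h1 h2 Z0 YZ' HZ' Hk.
move/eqP; rewrite -subr_eq0 -opprD oppr_eq0 -natrD pnatr_eq0 //.
Qed.

(** Raise a vector of weight k alpha to a highest weight vector W, of weight (k + j) alpha, and
    lower it back to weight alpha. The result is a multiple of X, so [ad X] kills it, whereas the
    coefficient in [sl2_raise_lower] is nonzero. *)
Lemma root_no_multiple alpha k : isroot alpha -> (1 < k)%N -> ~ isroot (alpha *+ k).
Proof.
move=> ra k1 [_ [Z Z0 HZ]]; have [_ [X X0 HX]] := ra.
have [Y HY XY] := sl2_triple ra HX X0.
have [H1 H2 H3] := ad_sl2 ra HX HY XY.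
have [m Hm] := ad_rootv_nil Z ra HX.
have HZ2 : ad (vsval (coroot alpha)) Z = (2 * k)%:R *: Z.
  by rewrite adE; have [_ ->] := HZ; rewrite dualMn corootE // natrM mulr_natr.
have [j [W0 EW HW]] := sl2_top H2 Z0 HZ2 Hm.
move: W0 EW HW; set W := iter j _ _ => W0 EW HW.
have HW' : ad (vsval (coroot alpha)) W = (2 * (k + j))%:R *: W by rewrite HW -natrD mulnDr.
have str := sl2_string H1 H3 W0 EW HW'.
have rW : rootv (alpha *+ (k + j)) W by rewrite mulrnDr; exact: rootv_iter.
have kj : ((k + j).-2.+2 = k + j)%N by case: (k) k1 => [|[]].
have rv : rootv alpha (iter (k + j).-2.+1 (ad Y) W).
  suff -> : alpha = alpha *+ (k + j) + (- alpha) *+ (k + j).-2.+1 by exact: rootv_iter.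
  by rewrite -{1}kj mulrS mulNrn addrK.
have [a Ha] := root_one_dim ra HX X0 rv.
have := sl2_raise_lower H1 H3 (k + j).-2 EW HW'; rewrite Ha linearZ /= adE brXX scaler0.
move/esym/eqP; rewrite scaler_eq0 (negPf (str _ _)) ?orbF; last first.
  by apply: leq_trans (leq_pred _) _; apply: leq_trans (leq_pred _) _; rewrite leq_pmull.
rewrite mulf_eq0 pnatr_eq0 /= subr_eq0 eqr_nat => /eqP E.
have : ((k + j).-2 <= k + j)%N by rewrite -{2}kj -addn2 leq_addr.
by rewrite -E; move: kj; lia.
Qed.

(** Simultaneous triangularization over a basis of h; the weights are the diagonal entries, hence
    linear in H. A triangular form suffices for traces and eigenvalues. *)
Lemma cartan_rep_weights m (D : subvs_of h -> 'M[F]_m) :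
  (forall a H K, D (a *: H + K) = a *: D H + D K) ->
  (forall H K, D H *m D K = D K *m D H) ->
  exists P (mu : 'I_m -> dual), P \in unitmx /\
    forall H, is_trig_mx (P *m D H *m invmx P) /\
      forall p, (P *m D H *m invmx P) p p = mu p H.
Proof.
move=> lD cD; have [phi phiE] := linfun_of lD.
pose b := vbasis h; pose hb i := vsproj h b`_i.
have HE H : H = \sum_i coord b i (vsval H) *: hb i.
  apply: vs_inj; rewrite linear_sum /= {1}(coord_vbasis (vh H)); apply: eq_bigr => i _.
  by rewrite /hb vsprojK // vbasis_mem // mem_nth ?size_tuple.
have [|P Pu tP] := @cotrig F m [seq D (hb i) | i : 'I_(\dim h)].
  by move=> A B /seq.mapP[i _ ->] /seq.mapP[j _ ->].
have Q : forall H, P *m D H *m invmx P =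
    \sum_i coord b i (vsval H) *: (P *m D (hb i) *m invmx P).
  move=> H; rewrite -phiE {1}(HE H) linear_sum mulmx_sumr mulmx_suml.
  by apply: eq_bigr => i _; rewrite linearZ /= -scalemxAr -scalemxAl phiE.
have tr H : is_trig_mx (P *m D H *m invmx P).
  apply/is_trig_mxP => i j ij; rewrite Q summxE big1 // => k _; rewrite mxE.
  have /is_trig_mxP -> // : is_trig_mx (P *m D (hb k) *m invmx P).
    by apply: tP; apply: map_f; rewrite mem_enum.
  by rewrite mulr0.
have /choice[mu Hmu] p : exists mu : dual, forall H, mu H = (P *m D H *m invmx P) p p :> F.
  apply: linfun_of => a H K; rewrite lD mulmxDr mulmxDl -scalemxAr -scalemxAl.
  by rewrite [LHS]mxE [X in X + _]mxE.
by exists P, mu; split=> // H; split=> [|p]; rewrite ?Hmu.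
Qed.

(** Writes the trace form on h as a sum over weights that take integer values on coroots. It is
    therefore positive semidefinite on real combinations of coroots, the source of all positivity
    below. *)
Lemma trace_weights : exists mu : 'I_N -> dual,
  (forall H K, \tr (vsval H *m vsval K) = \sum_p (mu p H : F) * (mu p K : F)) /\
  forall p alpha, isroot alpha -> exists z : int, mu p (coroot alpha) = z%:~R :> F.
Proof.
have [||P [mu [Pu HP]]] := @cartan_rep_weights N (fun H => vsval H).
- by move=> a H K; rewrite linearP.
- by move=> H K; exact: (cartan_comm g_br g_nondeg h_g h_nil h_self (vh _) (vh _)).
exists mu; split=> [H K|p alpha ra].
  rewrite -(tr_conj _ Pu); have -> : P *m (vsval H *m vsval K) *m invmx P =
    (P *m vsval H *m invmx P) *m (P *m vsval K *m invmx P).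
    by rewrite !mulmxA -(mulmxA (P *m vsval H) (invmx P) P) mulVmx // mulmx1.
  apply: eq_bigr => p _; rewrite trig_mul_diag; [|exact: (HP H).1|exact: (HP K).1].
  by rewrite (HP H).2 (HP K).2.
have [_ [X X0 HX]] := ra; have [Y HY XY] := sl2_triple ra HX X0.
rewrite -(HP _).2; apply: (matrix_sl2_integral XY).
- exact: coroot_br.
- exact: coroot_brN.
- by apply: char_poly_trig_root => //; exact: (HP _).1.
Qed.

(** The trace of the square of the coroot is 4 / alpha (t_alpha), and it is a sum of squares of
    integers. *)
Lemma root_norm_pos alpha : isroot alpha -> 0 < (alpha (tr_dual alpha) : F).
Proof.
move=> ra; have a0 := root_tr_dual ra; have [mu [tmu zmu]] := trace_weights.
set c := (alpha (tr_dual alpha) : F) in a0 *.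
have : \tr (vsval (coroot alpha) *m vsval (coroot alpha)) = 4%:R / c.
  rewrite /coroot -/c {1}vsZ -scalemxAl mxtraceZ tr_dualE dualZ -/c.
  by field.
rewrite tmu => E; have : 0 <= 4%:R / c.
  rewrite -E; apply: sumr_ge0 => p _; have [z ->] := zmu p alpha ra.
  by rewrite -rmorphM /= ler0z -expr2 sqr_ge0.
by rewrite pmulr_rge0 ?ltr0n // invr_ge0 lt_def a0.
Qed.

Lemma weight_coroot_int alpha beta : isroot alpha -> isroot beta ->
  exists z : int, beta (coroot alpha) = z%:~R :> F.
Proof.
move=> ra [_ [Z Z0 HZ]]; have [_ [X X0 HX]] := ra.
have [Y HY XY] := sl2_triple ra HX X0; have [H1 H2 H3] := ad_sl2 ra HX HY XY.
apply: (sl2_integral H1 H2 H3 Z0) => [|u|u]; last 2 first.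
- exact: ad_rootv_nil HX.
- by apply: ad_rootv_nil HY; exact: isrootN.
by rewrite -[LHS]/(ad (vsval (coroot alpha)) Z) adE; have [_ ->] := HZ.
Qed.

(* The alpha-string through beta contains the reflection of beta. *)
Lemma root_reflection alpha beta : isroot alpha -> isroot beta ->
  isroot (beta - (beta (coroot alpha) : F) *: alpha).
Proof.
move=> ra rb; have [z zE] := weight_coroot_int ra rb.
wlog [m mz] : alpha ra z zE / exists m : nat, z = m%:Z.
  move=> H; case: (intP z) zE => [|m|m] zE; first by apply: H zE _ => //; exists 0%N.
    by apply: H zE _ => //; exists m.+1.
  have /= := H (- alpha) (isrootN ra) m.+1%:Z; rewrite corootN dualN scaleNr scalerN opprK.
  by apply; [rewrite zE rmorphN opprK|exists m.+1].
move: zE; rewrite {}mz -pmulrn => mE.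
have [b0 [Z Z0 HZ]] := rb; have [_ [X X0 HX]] := ra.
have [Y HY XY] := sl2_triple ra HX X0; have [H1 H2 H3] := ad_sl2 ra HX HY XY.
have HZ2 : ad (vsval (coroot alpha)) Z = m%:R *: Z.
  by rewrite adE; have [_ ->] := HZ; rewrite mE.
have [k Hk] := ad_rootv_nil Z ra HX.
have [j [W0 EW HW]] := sl2_top H2 Z0 HZ2 Hk.
move: W0 EW HW (rootv_iter j HX HZ); set W := iter j _ _ => W0 EW HW rW.
rewrite -natrD in HW.
have := sl2_string H1 H3 W0 EW HW; move/(_ (m + j)%N); rewrite leq_add2l leq_pmull // => /(_ isT) nz.
have r1 := rootv_iter (m + j) HY rW.
have E : beta + alpha *+ j + (- alpha) *+ (m + j) = beta - (m%:R : F) *: alpha.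
  by rewrite mulNrn mulrnDr scaler_nat opprD [X in _ + X]addrC addrA addrK.
rewrite mE -E; split; last by exists (iter (m + j) (ad Y) W).
rewrite E; apply: contra b0 => /eqP b0.
have E3 : ((beta - (m%:R : F) *: alpha) (coroot alpha) : F) = m%:R - m%:R * 2%:R.
  by rewrite add_lfunE opp_lfunE scale_lfunE mE corootE.
have /eqP : (m%:R : F) = (m * 2)%:R.
  by apply/eqP; rewrite natrM -subr_eq0 -E3 b0 zero_lfunE.
rewrite eqr_nat => /eqP E2; have m0 : m = 0%N by lia.
by move/eqP: b0; rewrite m0 scale0r subr0.
Qed.

End Roots.

(** * Simple roots and highest weights *)

Section SimpleRoots.
Variables (F : numClosedFieldType) (N : nat) (g h : {vspace 'M[F]_N}).
Hypothesis cp : cartan_pair g h.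
Local Notation dual := 'Hom(subvs_of h, F^o).
Variables (r : nat) (a : r.-tuple dual).
Local Notation "''a_' i" := (tnth a i) (at level 8, i at level 2, format "''a_' i").
Local Notation isroot := (isroot g).
Local Notation rootv := (rootv g).
Implicit Types (X Y Z E : 'M[F]_N) (H K : subvs_of h) (alpha beta : dual).
Implicit Types (i j : 'I_r) (k : 'I_r -> nat).

Definition nat_comb k : dual := \sum_i 'a_i *+ k i.
Definition positive beta : Prop := exists k, beta = nat_comb k.

Hypothesis a_basis : basis_of fullv a.
Hypothesis a_root : forall i, isroot 'a_i.
Hypothesis a_pos : forall beta, isroot beta -> positive beta \/ positive (- beta).

Definition co i := coroot cp 'a_i.

Lemma simple_free (c : 'I_r -> F) : \sum_i c i *: 'a_i = 0 -> forall i, c i = 0.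
Proof.
have /freeP fr := basis_free a_basis => E; apply: fr; rewrite -[RHS]E.
by apply: eq_bigr => i _; rewrite (tnth_nth 0).
Qed.

Lemma simple_inj (c c' : 'I_r -> F) : \sum_i c i *: 'a_i = \sum_i c' i *: 'a_i ->
  forall i, c i = c' i.
Proof.
move=> E i; apply/eqP; rewrite -subr_eq0; apply/eqP; move: i; apply: simple_free.
rewrite -[RHS](subrr (\sum_i c' i *: 'a_i)) -{1}E -sumrB.
by apply: eq_bigr => i _; rewrite scalerBl.
Qed.

Lemma nat_combE k : nat_comb k = \sum_i (k i)%:R *: 'a_i.
Proof. by apply: eq_bigr => i _; rewrite scaler_nat. Qed.

Lemma nat_comb0 k : (forall i, k i = 0%N) -> nat_comb k = 0.
Proof. by move=> k0; rewrite /nat_comb big1 // => i _; rewrite k0. Qed.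

Lemma nat_combD k k' : nat_comb k + nat_comb k' = nat_comb (fun i => (k i + k' i)%N).
Proof. by rewrite -big_split; apply: eq_bigr => i _; rewrite mulrnDr. Qed.

Lemma nat_comb1 i : nat_comb (fun j => (j == i : nat)) = 'a_i.
Proof.
by rewrite /nat_comb (bigD1 i) //= eqxx big1 ?addr0 // => j /negPf->.
Qed.

Lemma nat_comb_inj k k' : nat_comb k = nat_comb k' -> forall i, k i = k' i.
Proof.
rewrite !nat_combE => /simple_inj E i; apply/eqP; have /eqP := E i.
by rewrite eqr_nat.
Qed.

Let norm i : F := 'a_i (tr_dual cp 'a_i).

Let norm_gt0 i : 0 < norm i. Proof. exact: root_norm_pos. Qed.

Let dualZ alpha c H : (alpha (c *: H) : F) = c * (alpha H : F).
Proof. by rewrite linearZ. Qed.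

Let dual_sum alpha (c : 'I_r -> F) (x : 'I_r -> subvs_of h) :
  (alpha (\sum_i c i *: x i) : F) = \sum_i c i * (alpha (x i) : F).
Proof. by rewrite linear_sum; apply: eq_bigr => i _; exact: dualZ. Qed.

Let tr_dual_co i : tr_dual cp 'a_i = (norm i / 2%:R) *: co i.
Proof.
rewrite /co /coroot scalerA -/(norm i) mulrA divfK ?pnatr_eq0 // mulfV ?scale1r //.
by rewrite gt_eqF.
Qed.

(** Let T represent lambda for the trace form. It is a nonnegative combination of simple coroots, so
    tr (T^2) = lambda (T) <= 0; but tr (T^2) is a sum of squares of the real numbers mu_p (T), so
    these vanish. *)
Lemma positivity (c : 'I_r -> F) (lambda : dual) : lambda = \sum_i c i *: 'a_i ->
  (forall i, 0 <= c i) -> (forall i, (lambda (co i) : F) <= 0) -> lambda = 0.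
Proof.
move=> lE c0 lco; pose T := \sum_i c i *: tr_dual cp 'a_i.
have trT H : \tr (vsval T *m vsval H) = lambda H.
  rewrite lE sum_lfunE linear_sum mulmx_suml linear_sum; apply: eq_bigr => i _.
  by rewrite scale_lfunE linearZ /= -scalemxAl mxtraceZ tr_dualE.
have TE : T = \sum_i (c i * (norm i / 2%:R)) *: co i.
  by apply: eq_bigr => i _; rewrite tr_dual_co scalerA.
have [mu [tmu zmu]] := trace_weights cp.
have n2 i : 0 <= norm i / 2%:R by rewrite divr_ge0 ?ltW ?ler0n.
have muT p : (mu p T : F) \is Num.real.
  rewrite TE dual_sum; apply: rpred_sum => i _.
  have [z ->] := zmu p _ (a_root i); rewrite rpredM ?realz // ger0_real //.
  by rewrite mulr_ge0.
have TT : \sum_p (mu p T : F) ^+ 2 <= 0.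
  have -> : \sum_p (mu p T : F) ^+ 2 = lambda T.
    by rewrite -trT tmu; apply: eq_bigr => p _; rewrite expr2.
  rewrite TE dual_sum; apply: sumr_le0 => i _.
  by rewrite mulr_ge0_le0 // mulr_ge0.
have sq p : 0 <= (mu p T : F) ^+ 2 by rewrite real_exprn_even_ge0.
have T0 p : (mu p T : F) = 0.
  have /eqP : \sum_p (mu p T : F) ^+ 2 = 0.
    by apply/le_anti; rewrite TT sumr_ge0.
  rewrite psumr_eq0 // => /allP /(_ p); rewrite mem_index_enum => /(_ isT) /=.
  by rewrite expf_eq0 => /eqP.
apply/lfunP => H; rewrite zero_lfunE -trT tmu big1 // => p _.
by rewrite T0 mul0r.
Qed.

Lemma pos_other i k : isroot (nat_comb k) -> nat_comb k != 'a_i ->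
  exists2 j, j != i & (0 < k j)%N.
Proof.
move=> rb bi; apply: contrapT => H.
have k0 j : j != i -> k j = 0%N.
  by move=> ji; apply/eqP; rewrite -leqn0 leqNgt; apply/negP => kj; apply: H; exists j.
have E : nat_comb k = 'a_i *+ k i.
  by rewrite /nat_comb (bigD1 i) //= big1 ?addr0 // => j /k0 ->.
case: (k i) E => [|[|n]] E.
- by have [] := rb; rewrite E mulr0n eqxx.
- by rewrite E mulr1n eqxx in bi.
- by have := @root_no_multiple _ _ _ _ cp _ n.+2 (a_root i) isT; rewrite -E.
Qed.

(** A positive root other than a_i involves some a_j with j != i. The shift leaves this positive
    coefficient unchanged, so the shifted root cannot be negative. *)
Lemma pos_shift i beta (c : F) : isroot beta -> positive beta -> beta != 'a_i ->
  isroot (beta - c *: 'a_i) -> positive (beta - c *: 'a_i).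
Proof.
move=> rb [k kE] bi rs; have [//|[k' k'E]] := a_pos rs.
have [j ji kj] : exists2 j, j != i & (0 < k j)%N by apply: pos_other; rewrite -kE.
have E : \sum_l ((k l)%:R - c * (l == i)%:R) *: 'a_l = \sum_l (- (k' l)%:R) *: 'a_l.
  transitivity (beta - c *: 'a_i).
    rewrite kE nat_combE -[X in c *: X]nat_comb1 nat_combE scaler_sumr -sumrB.
    by apply: eq_bigr => l _; rewrite scalerA scalerBl.
  rewrite -[LHS]opprK k'E nat_combE -sumrN.
  by apply: eq_bigr => l _; rewrite scaleNr.
have := simple_inj E j; rewrite (negPf ji) mulr0 subr0 => /eqP.
rewrite -addr_eq0 -natrD pnatr_eq0 addn_eq0 => /andP[/eqP kj0 _].
by rewrite kj0 in kj.
Qed.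

Lemma reflection_pos i beta : isroot beta -> positive beta -> beta != 'a_i ->
  positive (beta - (beta (co i) : F) *: 'a_i).
Proof. by move=> rb pb bi; apply: pos_shift => //; exact: root_reflection. Qed.

Let two0 : (2%:R : F) != 0. Proof. by rewrite pnatr_eq0. Qed.

Lemma neg_coroot i beta X : isroot beta -> rootv beta X -> X != 0 ->
  (forall E, rootv 'a_i E -> br E X = 0) -> 0 <= (beta (co i) : F).
Proof.
move=> rb HX X0 H0; have [_ [E E0 HE]] := a_root i.
have [Y HY EY] := sl2_triple cp (a_root i) HE E0.
have [H1 H2 H3] := ad_sl2 (a_root i) HE HY EY.
have EX : ad E X = 0 by rewrite adE H0.
have HcX : ad (vsval (coroot cp 'a_i)) X = (beta (co i) : F) *: X.
  by rewrite adE; have [_ ->] := HX.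
have [k Hk] := ad_rootv_nil cp X (isrootN cp (a_root i)) HY.
by have [n ->] := sl2_highest_nat H1 H3 X0 EX HcX Hk; rewrite ler0n.
Qed.

(** Let Z be a root vector for -beta. If every simple root vector E killed Z, sl_2 theory would give
    beta (co_i) <= 0 for all i, and [positivity] would make beta zero. So some [E, Z] is nonzero; a
    vector Y paired with it has weight beta - a_i, and [E, Y] spans the root space of beta. *)
Lemma pos_step beta X : isroot beta -> positive beta -> (forall i, beta != 'a_i) ->
  rootv beta X -> exists i Y E, [/\ isroot (beta - 'a_i), positive (beta - 'a_i),
    rootv (beta - 'a_i) Y, rootv 'a_i E & X = br E Y].
Proof.
move=> rb pb bi HX; have [b0 [Z Z0 HZ]] := isrootN cp rb.
have [[i [E [HE EZ]]]|] := pselect (exists i E, rootv 'a_i E /\ br E Z != 0); last first.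
  move=> H; case/eqP: (b0); rewrite -[RHS]oppr0; congr (- _); have [k kE] := pb.
  rewrite nat_combE in kE; apply: (positivity kE) => [i|i]; first exact: ler0n.
  rewrite -oppr_ge0 -opp_lfunE; apply: (neg_coroot _ HZ Z0); first exact: isrootN.
  by move=> E HE; apply/eqP/negP => /negP EZ; apply: H; exists i, E.
have HEZ : rootv (- (beta - 'a_i)) (br E Z) by rewrite opprB; exact: rootv_br.
have rs : isroot (beta - 'a_i).
  rewrite -[beta - _]opprK; apply: (isrootN cp); split; last by exists (br E Z).
  by rewrite oppr_eq0 subr_eq0 bi.
have ps : positive (beta - 'a_i).
  by move: rs; rewrite -[X in _ - X]scale1r; exact: pos_shift.
have [Y HY EZY] := rootv_dual cp HEZ EZ; rewrite opprK in HY.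
have EY0 : br E Y != 0.
  apply/eqP => EY; move/eqP: EZY; rewrite brC mulNmx linearN /= tr_brA EY mulmx0.
  by rewrite mxtrace0 oppr0 eq_sym oner_eq0.
have HEY : rootv beta (br E Y) by rewrite -(subrK 'a_i beta) addrC; exact: rootv_br.
have [c ->] := root_one_dim cp rb HEY EY0 HX.
by exists i, (c *: Y), E; split=> //; [exact: rootvZ|rewrite brZr].
Qed.

(** Positive root vectors are iterated brackets of simple ones; the induction is on the height,
    which [pos_step] lowers by one. *)
Lemma pos_ind (P : dual -> 'M[F]_N -> Prop) :
  (forall i E, rootv 'a_i E -> P 'a_i E) ->
  (forall i beta E Y, rootv 'a_i E -> rootv beta Y -> P 'a_i E -> P beta Y ->
     P ('a_i + beta) (br E Y)) ->
  forall beta X, isroot beta -> positive beta -> rootv beta X -> P beta X.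
Proof.
move=> P1 P2 beta X rb [k kE]; have [n] := ubnP (\sum_i k i)%N.
elim: n k beta X rb kE => // n IH k beta X rb kE kn HX.
have [[i bi]|nb] := pselect (exists i, beta = 'a_i); first by rewrite bi in HX *; exact: P1.
have [||i [Y [E [rs [k' k'E] HY HE ->]]]] := pos_step rb _ _ HX.
- by exists k.
- by move=> i; apply/eqP => bi; apply: nb; exists i.
rewrite -(subrK 'a_i beta) addrC; apply: P2 => //; first exact: P1.
apply: (IH k' _ Y rs k'E _ HY); rewrite -ltnS; apply: leq_trans kn; rewrite ltnS.
have E2 : nat_comb k = nat_comb (fun j => k' j + (j == i))%N.
  by rewrite -nat_combD -k'E nat_comb1 subrK.
have -> : (\sum_j k j = \sum_j k' j + \sum_j (j == i))%N.
  by rewrite -big_split; apply: eq_bigr => j _; exact: (nat_comb_inj E2).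
by rewrite [X in (_ < _ + X)%N](bigD1 i) //= eqxx; lia.
Qed.

Lemma co_free (c : 'I_r -> F) : \sum_i c i *: co i = 0 -> forall i, c i = 0.
Proof.
move=> E i; have n0 : 2%:R / norm i != 0 by rewrite mulf_neq0 ?invr_eq0 ?gt_eqF.
apply: (mulIf n0); rewrite mul0r; move: i {n0}.
apply: (@simple_free (fun i => c i * (2%:R / norm i))); apply/lfunP => H.
rewrite zero_lfunE; transitivity (\tr (vsval (\sum_i c i *: co i) *m vsval H)).
  rewrite sum_lfunE linear_sum mulmx_suml linear_sum; apply: eq_bigr => i _.
  by rewrite scale_lfunE !linearZ /= scalerA -scalemxAl mxtraceZ tr_dualE.
by rewrite E linear0 mul0mx mxtrace0.
Qed.

Lemma co_span H : exists c : 'I_r -> F, H = \sum_i c i *: co i.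
Proof.
pose cs := [tuple co i | i < r].
have csE i : cs`_i = co i by rewrite -tnth_nth tnth_mktuple.
have fr : free cs.
  apply/freeP => c E; apply: co_free; rewrite -[RHS]E.
  by apply: eq_bigr => i _; rewrite csE.
have : basis_of fullv cs.
  rewrite basisEfree fr subvf size_tuple /= dimvf.
  have <- := size_basis a_basis; rewrite dimvf.
  have -> : dim dual = (dim (subvs_of h) * 1)%N by [].
  by rewrite muln1.
move=> bc; have E := coord_basis bc (memvf H); exists (fun i => coord cs i H); rewrite {1}E.
by apply: eq_bigr => i _; rewrite csE.
Qed.

(** * Weights of an irreducible representation with a highest weight vector *)

Section HighestWeight.
Variables (m : nat) (D : 'M[F]_N -> 'M[F]_m) (i0 : 'I_r) (w : 'cV[F]_m).
Hypothesis D_lin : forall c X Y, X \in g -> Y \in g -> D (c *: X + Y) = c *: D X + D Y.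
Hypothesis D_br : forall X Y, X \in g -> Y \in g -> D (br X Y) = br (D X) (D Y).
Hypothesis w0 : w != 0.
Hypothesis w_kill : forall i E, rootv 'a_i E -> D E *m w = 0.
Hypothesis w_co : forall i, D (vsval (co i)) *m w = (i0 == i)%:R *: w.

Let vg H : vsval H \in g. Proof. exact: (subvP (cp_sub cp) _ (subvsP _)). Qed.

Let D0 : D 0 = 0.
Proof. by have := D_lin (- 1) (mem0v g) (mem0v g); rewrite scaler0 addr0 scaleN1r addNr. Qed.

Let DP c H K : D (vsval (c *: H + K)) = c *: D (vsval H) + D (vsval K).
Proof. by rewrite linearP; apply: D_lin; exact: vg. Qed.

Let D_sum (I : finType) (c : I -> F) (x : I -> 'M[F]_N) : (forall t, x t \in g) ->
  D (\sum_t c t *: x t) = \sum_t c t *: D (x t).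
Proof.
move=> xg; suff : \sum_t c t *: x t \in g /\ D (\sum_t c t *: x t) = \sum_t c t *: D (x t) by case.
elim/big_ind2: _ => [|y1 y2 z1 z2 [? E1] [? E2]|t _]; first by rewrite mem0v.
  by split; [rewrite memvD|rewrite -[y2]scale1r D_lin // scale1r E1 E2].
by split; [rewrite memvZ|rewrite -[_ *: _]addr0 D_lin ?mem0v // D0 addr0].
Qed.

Lemma highest_weight : exists omega : dual,
  (forall i, omega (co i) = (i0 == i)%:R :> F) /\
  forall H, D (vsval H) *m w = (omega H : F) *: w.
Proof.
have /choice[f Hf] H : exists c : F, D (vsval H) *m w = c *: w.
  have [c ->] := co_span H; elim/big_ind: _ => [|H1 H2 [c1 E1] [c2 E2]|i _].
  - by exists 0; rewrite linear0 D0 mul0mx scale0r.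
  - exists (c1 + c2); rewrite -[H1 + H2]/(H1 + H2 : subvs_of h) -[X in X + H2]scale1r DP.
    by rewrite scale1r mulmxDl E1 E2 scalerDl.
  exists (c i * (i0 == i)%:R); rewrite -[X in vsval X]addr0 DP linear0 D0 addr0.
  by rewrite -scalemxAl w_co scalerA.
have inj c c' : c *: w = c' *: w -> c = c'.
  move/eqP; rewrite -subr_eq0 -scalerBl scaler_eq0 (negPf w0) orbF subr_eq0.
  by move/eqP.
have [|omega HO] := @linfun_of _ _ _ (f : subvs_of h -> F^o).
  move=> c H K; apply: inj; rewrite -Hf DP mulmxDl -scalemxAl !Hf.
  by rewrite scalerDl scalerA.
exists omega; split=> [i|H]; last by rewrite HO Hf.
by apply: inj; rewrite HO -Hf w_co.
Qed.

Variable omega : dual.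
Hypothesis w_omega : forall H, D (vsval H) *m w = (omega H : F) *: w.

(** Monomials in lowering operators, in any order, applied to w; the index keeps track of the
    weight. *)
Inductive word : dual -> 'cV[F]_m -> Prop :=
| word0 : word omega w
| wordS gamma X mu u : isroot gamma -> positive gamma -> rootv (- gamma) X ->
    word mu u -> word (mu - gamma) (D X *m u).

Lemma pos_kill beta X : isroot beta -> positive beta -> rootv beta X -> D X *m w = 0.
Proof.
apply: (@pos_ind (fun b X => D X *m w = 0)) => [i E|i b E Y [Eg _] [Yg _] E1 E2]; first exact: w_kill.
by rewrite D_br // mulmxBl -!mulmxA E1 E2 !mulmx0 subrr.
Qed.

Lemma word_weight mu u : word mu u -> forall H, D (vsval H) *m u = (mu H : F) *: u.
Proof.
elim=> [H|gam X mu' u' _ _ HX _ IH H]; first exact: w_omega.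
have [Xg /(_ H) HX'] := HX.
have : D (br (vsval H) X) = - (gam H : F) *: D X.
  by rewrite HX' opp_lfunE -[_ *: X]addr0 D_lin ?mem0v // D0 addr0.
rewrite D_br // /br => /eqP; rewrite subr_eq => /eqP E.
rewrite mulmxA E mulmxDl -mulmxA IH -scalemxAl -scalemxAr -scalerDl.
by rewrite add_lfunE opp_lfunE addrC.
Qed.

Lemma word_form mu u : word mu u -> (u = w /\ mu = omega) \/
  exists2 k, (exists i, k i != 0%N) & mu = omega - nat_comb k.
Proof.
elim=> [|gam X mu' u' rg [k kE] HX _ IH]; [by left|right].
have k0 : exists i, k i != 0%N.
  apply: contrapT => H; case: rg => /eqP; case; rewrite kE; apply: nat_comb0 => i.
  by apply/eqP/negP => ki; apply: H; exists i; exact/negP.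
have [[_ ->]|[k' _ ->]] := IH; first by exists k; rewrite ?kE.
exists (fun i => (k' i + k i)%N); last by rewrite -nat_combD -kE opprD addrA.
by have [i ki] := k0; exists i; rewrite addn_eq0 negb_and ki orbT.
Qed.

(** W is the span of the words, and its minimality lets stability be tested on words, through
    preimages. Lowering operators send words to words and h acts by the weight; on D Y u, the
    operator D X is moved past D Y at the cost of D [X, Y], down to w, which positive root vectors
    kill. *)
Lemma word_stable (W : {vspace 'cV[F]_m}) : (forall mu u, word mu u -> u \in W) ->
  (forall W' : {vspace 'cV[F]_m}, (forall mu u, word mu u -> u \in W') -> (W <= W')%VS) ->
  forall X u, X \in g -> u \in W -> D X *m u \in W.
Proof.
move=> WP Wmin.
have neg gam X u : isroot gam -> positive gam -> rootv (- gam) X -> u \in W ->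
    D X *m u \in W.
  move=> rg pg HX uW; pose f := linfun (mulmx (D X) : 'cV[F]_m -> 'cV[F]_m).
  suff /subvP : (W <= f @^-1: W)%VS by move=> /(_ _ uW); rewrite -memv_preim lfunE.
  apply: Wmin => mu v wv; rewrite -memv_preim lfunE /=; apply: (WP (mu - gam)).
  exact: (wordS rg pg HX wv).
have red u : (forall alpha X, rootv alpha X -> D X *m u \in W) ->
    forall X, X \in g -> D X *m u \in W.
  move=> H X Xg; have [e [eg He]] := weight_basis cp.
  have es : \dim g = size e by rewrite (size_basis (X := in_tuple e)).
  have eg' (n : nat) : e`_n \in g.
    have [ie|ei] := ltnP n (size e); last by rewrite nth_default ?mem0v.
    by rewrite (basis_mem eg) // mem_nth.
  rewrite (coord_basis (X := in_tuple e) eg Xg) D_sum // mulmx_suml.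
  apply: memv_suml => i _; rewrite -scalemxAl memvZ //.
  have [|alpha Ha] := He e`_i; first by rewrite mem_nth.
  exact: H Ha.
have main mu u : word mu u -> forall X, X \in g -> D X *m u \in W.
  elim=> [|gam Y mu' u' rg pg HY wu' IH].
    apply: red => alpha X HX; have wW : w \in W by apply: (WP omega); exact: word0.
    have [->|X0] := eqVneq X 0; first by rewrite D0 mul0mx mem0v.
    have [a0|a0] := eqVneq alpha 0.
      have Xh : X \in h by apply: (rootv0 cp); rewrite -a0.
      by rewrite -(vsprojK Xh) w_omega memvZ.
    have ra : isroot alpha by split=> //; exists X.
    have [pa|na] := a_pos ra; first by rewrite (pos_kill ra pa HX) mem0v.
    by apply: (neg _ _ _ (isrootN cp ra)) => //; rewrite opprK.
  move=> X Xg; have [Yg _] := HY.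
  have -> : D X *m (D Y *m u') = D (br X Y) *m u' + D Y *m (D X *m u').
    by rewrite D_br // /br mulmxBl !mulmxA subrK.
  rewrite memvD ?IH //; first exact: (cp_br cp).
  by apply: neg HY _ => //; exact: IH.
move=> X u Xg uW; pose f := linfun (mulmx (D X) : 'cV[F]_m -> 'cV[F]_m).
suff /subvP s : (W <= f @^-1: W)%VS by have := s _ uW; rewrite -memv_preim lfunE.
by apply: Wmin => mu v wv; rewrite -memv_preim lfunE /=; exact: main wv _ _.
Qed.

(** By irreducibility the words span, so w is completed to a basis of words. The other ones differ
    from w, hence have strictly lower weights: omega occurs once, which makes the leading
    coefficient of the character equal to 1. *)
Lemma rep_weight_basis :
  (forall U : {vspace 'cV[F]_m}, (forall X u, X \in g -> u \in U -> D X *m u \in U) ->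
     U = 0%VS \/ U = fullv) ->
  exists es : seq 'cV[F]_m, basis_of fullv (es ++ [:: w]) /\
    forall u, u \in es -> exists k, (exists i, k i != 0%N) /\
      forall H, D (vsval H) *m u = ((omega - nat_comb k) H : F) *: u.
Proof.
move=> irr; pose P u := exists mu, word mu u.
have [U [PU Umin]] := pred_span P.
have wU : w \in U by apply: PU; exists omega; exact: word0.
have Ufull : U = fullv.
  case: (irr U) => //.
    apply: word_stable => [mu u wu|W' HW']; first by apply: PU; exists mu.
    by apply: Umin => v [mu]; exact: HW'.
  by move=> U0; move: wU; rewrite U0 memv0 (negPf w0).
have [||W HW|es [bes Pes]] := @basis_pred _ _ (fullv : {vspace 'cV[F]_m}) P [:: w].
- by rewrite seq1_free.
- by move=> v; rewrite inE => /eqP->; split; [exact: memvf|exists omega; exact: word0].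
- by rewrite -Ufull; apply: Umin => v Pv; apply: HW => //; exact: memvf.
exists es; split=> // u ues; have [mu wu] := Pes u ues.
have [[uw _]|[k k0 muE]] := word_form wu.
  have := free_uniq (basis_free bes); rewrite cat_uniq /= orbF => /and3P[_ + _].
  by rewrite -uw ues.
by exists k; split=> // H; rewrite -muE; exact: word_weight.
Qed.

End HighestWeight.
End SimpleRoots.

Lemma dualZ (F : fieldType) (V : vectType F) (alpha : 'Hom(V, F^o)) c (H : V) :
  (alpha (c *: H) : F) = c * (alpha H : F).
Proof. by rewrite linearZ. Qed.

Lemma dual_sumZ (F : fieldType) (V : vectType F) (alpha : 'Hom(V, F^o)) (I : finType)
  (c : I -> F) (x : I -> V) :
  (alpha (\sum_i c i *: x i) : F) = \sum_i c i * (alpha (x i) : F).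
Proof. by rewrite linear_sum; apply: eq_bigr => i _; exact: dualZ. Qed.

(** * Exponential sums and the Weyl denominator *)

(** The algebraic properties of the exponential; [el_eq1] makes distinct linear forms have distinct
    exponentials. *)
Record exp_like (F : fieldType) (ce : F -> F) : Prop := ExpLike {
  el0 : ce 0 = 1;
  elD : forall x y, ce (x + y) = ce x * ce y;
  el_eq1 : forall x, (forall t, ce (t * x) = 1) -> x = 0 }.

Section ExpSums.
Variables (F : numClosedFieldType) (ce : F -> F).
Hypothesis el : exp_like ce.
Let ce0 := el0 el.
Let ceD := elD el.

Lemma elN x : ce (- x) * ce x = 1.
Proof. by rewrite -ceD addNr ce0. Qed.

Lemma el_neq0 x : ce x != 0.
Proof. by apply: contra_eq_neq (elN x) => ->; rewrite mulr0 eq_sym oner_eq0. Qed.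

Variable V : vectType F.
Local Notation dual := 'Hom(V, F^o).
Implicit Types (s t : seq (F * dual)%type) (nu : dual) (H K : V).

(** An exponential sum is coded by the list of its pairs (coefficient, exponent), where exponents
    may repeat; [coef] collects repetitions and [dev K] is the directional derivative along K. *)
Definition ev s H : F := \sum_(p <- s) p.1 * ce (p.2 H).
Definition coef s nu : F := \sum_(p <- s | p.2 == nu) p.1.
Definition dev K s : seq (F * dual)%type :=
  [seq ((p.2 K : F) * p.1, p.2) | p : (F * dual)%type <- s].

(** Linear independence of characters: comparing the relation at H + K with [ce (nu0 K)] times the
    relation at H removes the term of [nu0]. *)
Lemma dedekind (l : seq dual) (c : dual -> F) : uniq l ->
  (forall H, \sum_(nu <- l) c nu * ce (nu H) = 0) -> forall nu, nu \in l -> c nu = 0.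
Proof.
elim: l c => // nu0 l IH c /= /andP[n0 ul] H0.
have cl nu : nu \in l -> c nu = 0.
  move=> nul; apply: contrapT => /eqP c0.
  have E K : ce (nu K) = ce (nu0 K).
    apply/eqP; rewrite -subr_eq0; apply/eqP/(mulfI c0); rewrite mulr0.
    apply: (IH (fun m => c m * (ce (m K) - ce (nu0 K))) ul _ nu nul) => H.
    have := H0 (H + K); rewrite big_cons => E1.
    have := H0 H; rewrite big_cons => E2.
    have -> : \sum_(m <- l) c m * (ce (m K) - ce (nu0 K)) * ce (m H) =
       (\sum_(m <- l) c m * ce (m (H + K))) - ce (nu0 K) * \sum_(m <- l) c m * ce (m H).
      by rewrite mulr_sumr -sumrB; apply: eq_bigr => m _; rewrite linearD ceD; ring.
    move/eqP: E1; rewrite addrC addr_eq0 => /eqP ->.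
    move/eqP: E2; rewrite addrC addr_eq0 => /eqP ->.
    by rewrite linearD ceD; ring.
  case/negP: n0; rewrite (_ : nu0 = nu) //; apply/lfunP => K; apply/eqP.
  rewrite eq_sym -subr_eq0; apply/eqP/(el_eq1 el) => t.
  have -> : t * ((nu K : F) - nu0 K) = (nu (t *: K) : F) - nu0 (t *: K).
    by rewrite !dualZ mulrBr.
  by rewrite ceD E mulrC elN.
move=> nu; rewrite inE => /orP[/eqP->|/cl//].
have := H0 0; rewrite big_cons big_seq big1 ?addr0 => [|m /cl->]; last by rewrite mul0r.
by move/eqP; rewrite mulf_eq0 (negPf (el_neq0 _)) orbF => /eqP.
Qed.

Lemma sum_by_exponent s (l : seq dual) (f : F -> dual -> F) :
  uniq l -> {subset map snd s <= l} ->
  \sum_(p <- s) f p.1 p.2 = \sum_(nu <- l) \sum_(p <- s | p.2 == nu) f p.1 p.2.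
Proof.
move=> ul sl; rewrite (exchange_big_dep predT) //= big_seq [RHS]big_seq.
apply: eq_bigr => p ps; have pl : p.2 \in l by apply: sl; apply: map_f.
rewrite big_mkcond (bigD1_seq p.2) //= eqxx big1 ?addr0 // => nu np.
by rewrite eq_sym (negPf np).
Qed.

Lemma ev_coef s (l : seq dual) H : uniq l -> {subset map snd s <= l} ->
  ev s H = \sum_(nu <- l) coef s nu * ce (nu H).
Proof.
move=> ul sl; rewrite /ev (sum_by_exponent (fun c nu => c * ce (nu H)) ul sl).
apply: eq_bigr => nu _; rewrite /coef mulr_suml.
by apply: eq_bigr => p /eqP->.
Qed.

Lemma coef_notin s nu : nu \notin map snd s -> coef s nu = 0.
Proof.
move=> ns; rewrite /coef big_seq_cond big1 // => p /andP[ps /eqP pn].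
by case/negP: ns; rewrite -pn; apply: map_f.
Qed.

Lemma coef_cat s t nu : coef (s ++ t) nu = coef s nu + coef t nu.
Proof. by rewrite /coef big_cat. Qed.

Lemma ev_cat s t H : ev (s ++ t) H = ev s H + ev t H.
Proof. by rewrite /ev big_cat. Qed.

Lemma ev0_coef s : (forall H, ev s H = 0) -> forall nu, coef s nu = 0.
Proof.
move=> s0 nu; have [ns|/coef_notin//] := boolP (nu \in map snd s).
pose l := undup (map snd s).
apply: (@dedekind l (coef s)); rewrite ?undup_uniq ?mem_undup // => H.
rewrite -ev_coef ?undup_uniq // => m; by rewrite mem_undup.
Qed.

Definition negs s := [seq (- p.1, p.2) | p <- s].

Lemma ev_negs s H : ev (negs s) H = - ev s H.
Proof. by rewrite /ev big_map -sumrN; apply: eq_bigr => p _; rewrite mulNr. Qed.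

Lemma coef_negs s nu : coef (negs s) nu = - coef s nu.
Proof. by rewrite /coef big_map -sumrN. Qed.

Lemma ev_eq_coef s t : (forall H, ev s H = ev t H) -> forall nu, coef s nu = coef t nu.
Proof.
move=> E nu; apply/eqP; rewrite -subr_eq0 -coef_negs -coef_cat; apply/eqP/ev0_coef => H.
by rewrite ev_cat ev_negs E subrr.
Qed.

Lemma coef_dev K s nu : coef (dev K s) nu = (nu K : F) * coef s nu.
Proof. by rewrite /coef big_map mulr_sumr; apply: eq_bigr => p /= /eqP->. Qed.

(** The derivative is formal, but it depends on the function only, because the function determines
    the coefficients. *)
Lemma ev_eq_dev s t : (forall H, ev s H = ev t H) ->
  forall K H, ev (dev K s) H = ev (dev K t) H.
Proof.
move=> E K H; pose l := undup (map snd (dev K s ++ dev K t)).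
have sub u : {subset u <= dev K s ++ dev K t} -> {subset map snd u <= l}.
  by move=> su m /seq.mapP[p /su pu ->]; rewrite mem_undup; apply: map_f.
rewrite !(@ev_coef _ l) ?undup_uniq //; first last.
- by apply: sub => m mt; rewrite mem_cat mt.
- by apply: sub => m mt; rewrite mem_cat mt orbT.
by apply: eq_bigr => nu _; rewrite !coef_dev (ev_eq_coef E).
Qed.

End ExpSums.

(** Matrix determinant lemma: a block matrix of size 1 + n conjugates one block triangular form,
    with 1 - v u in the corner, into another one, with 1 - u v. *)
Lemma det_rank1 (F : fieldType) n (u : 'cV[F]_n) (v : 'rV[F]_n) :
  \det (1%:M - u *m v) = 1 - (v *m u) 0 0.
Proof.
pose A := block_mx 1%:M 0 u 1%:M : 'M[F]_(1 + n).
have E : block_mx (1%:M - v *m u) v 0 1%:M *m A = A *m block_mx 1%:M v 0 (1%:M - u *m v).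
  rewrite /A !mulmx_block !(mulmx1, mul1mx, mulmx0, mul0mx, addr0, add0r).
  by rewrite subrK addrC subrK.
have := congr1 determinant E; rewrite !det_mulmx det_lblock det_ublock det_ublock !det1.
rewrite !mul1r !mulr1 => <-.
by rewrite det_mx11 !mxE eqxx.
Qed.

(** * Leading exponents of exponential sums *)

Section LeadingTerm.
Variables (F : numClosedFieldType) (ce : F -> F).
Hypothesis el : exp_like ce.
Let ceD := elD el.
Variables (N : nat) (h : {vspace 'M[F]_N}).
Local Notation V := (subvs_of h).
Local Notation dual := 'Hom(V, F^o).
Variables (r : nat) (a : r.-tuple dual).
Implicit Types (H K : V) (la mu : dual) (f : V -> F) (k : 'I_r -> nat).
Local Notation ev := (ev ce).
Local Notation nat_comb := (nat_comb a).

Definition nz k := exists i, k i != 0%N.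

(** Exponents are strictly below la in the order defined by the simple roots. Coefficients may
    vanish, including the leading one in [lead], so that sums and products preserve these predicates
    unconditionally. *)
Definition lower la f := exists s : seq (F * dual)%type,
  (forall p, p \in s -> exists2 k, nz k & p.2 = la - nat_comb k) /\ forall H, f H = ev s H.

Definition lead la (c : F) f := lower la (fun H => f H - c * ce (la H)).

Lemma lower_ext la f f' : (forall H, f H = f' H) -> lower la f -> lower la f'.
Proof. by move=> E [s [Hs sE]]; exists s; split=> // H; rewrite -E. Qed.

Lemma lead_ext la c f f' : (forall H, f H = f' H) -> lead la c f -> lead la c f'.
Proof. by move=> E; apply: lower_ext => H; rewrite E. Qed.

Lemma lower0 la : lower la (fun=> 0).
Proof. by exists [::]; split=> // H; rewrite /ev big_nil. Qed.

Lemma lowerD la f f' : lower la f -> lower la f' -> lower la (fun H => f H + f' H).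
Proof.
move=> [s [Hs sE]] [t [Ht tE]]; exists (s ++ t); split=> [p|H].
  by rewrite mem_cat => /orP[/Hs|/Ht].
by rewrite ev_cat sE tE.
Qed.

Lemma lower_term la c mu k : nz k -> mu = la - nat_comb k ->
  lower la (fun H => c * ce (mu H)).
Proof.
move=> k0 E; exists [:: (c, mu)]; split=> [p|H]; last by rewrite /ev big_seq1.
by rewrite inE => /eqP->; exists k.
Qed.

Lemma lower_sum la I (l : seq I) (P : pred I) (f : I -> V -> F) :
  (forall i, P i -> lower la (f i)) -> lower la (fun H => \sum_(i <- l | P i) f i H).
Proof.
move=> Hf; elim: l => [|i l IH].
  by apply: lower_ext (lower0 la) => H; rewrite big_nil.
have [Pi|nPi] := boolP (P i).
  by apply: lower_ext (lowerD (Hf i Pi) IH) => H; rewrite big_cons Pi.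
by apply: lower_ext IH => H; rewrite big_cons (negPf nPi).
Qed.

Lemma lower_mul_exp la mu c f : lower la f -> lower (la + mu) (fun H => f H * (c * ce (mu H))).
Proof.
move=> [s [Hs sE]]; exists [seq (p.1 * c, p.2 + mu) | p <- s]; split=> [p|H].
  by case/seq.mapP => q /Hs[k k0 qE] ->; exists k; rewrite //= qE addrAC.
rewrite sE /ev big_map mulr_suml; apply: eq_bigr => p _ /=.
by rewrite add_lfunE ceD; ring.
Qed.

Lemma lowerM la mu f f' : lower la f -> lower mu f' -> lower (la + mu) (fun H => f H * f' H).
Proof.
move=> Hf [s [Hs sE]].
apply: (@lower_ext _ (fun H => \sum_(p <- s | p \in s) f H * (p.1 * ce (p.2 H)))).
  by move=> H; rewrite -big_seq -mulr_sumr sE.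
apply: lower_sum => p /Hs[k _ pE].
have [t [Ht tE]] := lower_mul_exp p.2 p.1 Hf; exists t; split=> // q /Ht[k' [i k'0] ->].
exists (fun j => (k' j + k j)%N); first by exists i; rewrite addn_eq0 (negPf k'0).
have E : nat_comb (fun j => (k' j + k j)%N) = nat_comb k' + nat_comb k by rewrite nat_combD.
by rewrite E pE opprD !addrA [LHS]addrAC.
Qed.

Lemma leadM la mu c d f f' : lead la c f -> lead mu d f' ->
  lead (la + mu) (c * d) (fun H => f H * f' H).
Proof.
move=> Hf Hf'; have H1 := lowerM Hf Hf'.
have H2 := lower_mul_exp mu d Hf; have := lower_mul_exp la c Hf'; rewrite addrC => H3.
apply: lower_ext (lowerD H1 (lowerD H2 H3)) => H.
by rewrite add_lfunE ceD; ring.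
Qed.

Lemma leadD la c d f f' : lead la c f -> lead la d f' ->
  lead la (c + d) (fun H => f H + f' H).
Proof. by move=> Hf Hf'; apply: lower_ext (lowerD Hf Hf') => H; ring. Qed.

Lemma leadZ la b c f : lead la c f -> lead la (b * c) (fun H => b * f H).
Proof.
move=> Hf; have := lower_mul_exp 0 b Hf; rewrite addr0; apply: lower_ext => H.
by rewrite zero_lfunE (el0 el); ring.
Qed.

Lemma lead1 : lead 0 1 (fun=> 1).
Proof. by apply: lower_ext (lower0 0) => H; rewrite zero_lfunE (el0 el) mulr1 subrr. Qed.

Lemma lead0 la : lead la 0 (fun=> 0).
Proof. by apply: lower_ext (lower0 la) => H; rewrite mul0r subrr. Qed.

Lemma lead_prod I (l : seq I) (la : I -> dual) (c : I -> F) (f : I -> V -> F) :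
  (forall i, lead (la i) (c i) (f i)) ->
  lead (\sum_(i <- l) la i) (\prod_(i <- l) c i) (fun H => \prod_(i <- l) f i H).
Proof.
move=> Hf; elim: l => [|i l IH].
  by rewrite !big_nil; apply: lead_ext lead1 => H; rewrite big_nil.
by rewrite !big_cons; apply: lead_ext (leadM (Hf i) IH) => H; rewrite big_cons.
Qed.

Lemma lead_sum la I (l : seq I) (c : I -> F) (f : I -> V -> F) :
  (forall i, lead la (c i) (f i)) ->
  lead la (\sum_(i <- l) c i) (fun H => \sum_(i <- l) f i H).
Proof.
move=> Hf; elim: l => [|i l IH].
  by rewrite big_nil; apply: lead_ext (lead0 la) => H; rewrite big_nil.
by rewrite !big_cons; apply: lead_ext (leadD (Hf i) IH) => H; rewrite big_cons.
Qed.

(** The leading exponent depends on the row only, so all terms of the Leibniz expansion share the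
    leading exponent [\sum_i la i], and their coefficients add up to the determinant of c. *)
Lemma lead_det n (la : 'I_n -> dual) (c : 'M[F]_n) (f : 'I_n -> 'I_n -> V -> F) :
  (forall i j, lead (la i) (c i j) (f i j)) ->
  lead (\sum_i la i) (\det c) (fun H => \det (\matrix_(i, j) f i j H)).
Proof.
move=> Hf; apply: (@lead_ext _ _
  (fun H => \sum_(s : 'S_n) (-1) ^+ s * \prod_i f i (s i) H)).
  by move=> H; apply: eq_bigr => s _; congr (_ * _); apply: eq_bigr => i _; rewrite mxE.
apply: lead_sum => s; apply: leadZ.
by apply: lead_prod => i; exact: Hf.
Qed.

End LeadingTerm.

(** * Simple reflections, the Weyl denominator and the Jacobian of the characters *)

Section Weyl.
Variables (F : numClosedFieldType) (ce : F -> F).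
Hypothesis el : exp_like ce.
Let ceD := elD el.
Let ce0 := el0 el.
Variables (N : nat) (g h : {vspace 'M[F]_N}).
Hypothesis cp : cartan_pair g h.
Local Notation dual := 'Hom(subvs_of h, F^o).
Variables (r : nat) (a : r.-tuple dual).
Local Notation "''a_' i" := (tnth a i) (at level 8, i at level 2, format "''a_' i").
Local Notation isroot := (isroot g).
Local Notation rootv := (rootv g).
Local Notation positive := (positive a).
Local Notation nat_comb := (nat_comb a).
Hypothesis a_basis : basis_of fullv a.
Hypothesis a_root : forall i, isroot 'a_i.
Hypothesis a_pos : forall beta, isroot beta -> positive beta \/ positive (- beta).
Implicit Types (H K : subvs_of h) (alpha beta nu mu : dual).
Implicit Types (i j : 'I_r) (k : 'I_r -> nat).
Local Notation co := (co cp a).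

Definition refl i H : subvs_of h := H - ('a_i H : F) *: co i.
Definition drefl i nu : dual := nu - (nu (co i) : F) *: 'a_i.

Lemma dual_refl i nu H : nu (refl i H) = (drefl i nu H : F) :> F.
Proof.
have -> : (nu (refl i H) : F) = (nu H : F) - (nu (('a_i H : F) *: co i) : F).
  exact: linearB.
rewrite (dualZ nu _ (co i)) /drefl add_lfunE opp_lfunE scale_lfunE.
by congr (_ - _); exact: mulrC.
Qed.

Lemma co2 i : 'a_i (co i) = 2%:R :> F.
Proof. exact: corootE. Qed.

Lemma reflK i H : refl i (refl i H) = H.
Proof.
rewrite {1}/refl dual_refl /drefl co2 add_lfunE opp_lfunE scale_lfunE /refl.
rewrite -addrA -opprD -scalerDl [X in X *: _](_ : _ = 0) ?scale0r ?subr0 //.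
by rewrite -[X in _ + (X - _)]/('a_i H : F) -[2%:R *: _]/(2%:R * ('a_i H : F)); ring.
Qed.

Lemma dreflK i nu : drefl i (drefl i nu) = nu.
Proof. by apply/lfunP => H; rewrite -!dual_refl reflK. Qed.

Lemma simple_coroot_int i j : exists z : int, 'a_i (co j) = z%:~R :> F.
Proof. exact: weight_coroot_int. Qed.

Lemma refl_co i : refl i (co i) = - co i.
Proof. by rewrite /refl co2 -{1}[co i]scale1r -scalerBl (_ : 1 - 2%:R = -1) ?scaleN1r //; ring. Qed.

(** Let rho - k be an exponent with nonzero coefficient and k of least height, and let m = (rho -
    k)(co_i). By antisymmetry the exponent rho - (k + m a_i) occurs too, so m >= 0; and m != 0,
    since the coefficient of a fixed exponent is its own opposite. Thus k (co_i) = 1 - m <= 0 for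
    all i, and [positivity] makes k zero. *)
Lemma refl_lower_zero (rho : dual) (f : subvs_of h -> F) : (forall i, rho (co i) = 1 :> F) -> lower ce a rho f ->
  (forall i H, f (refl i H) = - f H) -> forall H, f H = 0.
Proof.
move=> rho1 [s [Hs sE]] f_anti.
pose s' i : seq (F * dual)%type := [seq (p.1, drefl i p.2) | p : (F * dual)%type <- s].
have ev' i H : ev ce (s' i ++ s) H = 0.
  rewrite ev_cat -sE {1}/ev big_map -[X in _ + X]opprK -(f_anti i) sE.
  apply/eqP; rewrite subr_eq0; apply/eqP; apply: eq_bigr => p _ /=.
  by rewrite dual_refl.
have anti i nu : coef s (drefl i nu) = - coef s nu.
  have /eqP := ev0_coef el (ev' i) (drefl i nu); rewrite coef_cat addrC addr_eq0 => /eqP->.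
  congr (- _); rewrite /coef big_map; apply: eq_bigl => p /=.
  by apply/eqP/eqP => [/(congr1 (drefl i))|->]; rewrite ?dreflK.
have c0 n k : (\sum_i k i < n)%N -> nz k -> coef s (rho - nat_comb k) = 0.
  elim: n k => // n IH k kn k0; apply: contrapT => /eqP cn0; set nu := rho - _ in cn0.
  have neg i : ((nat_comb k) (co i) : F) <= 0.
    set m : F := nu (co i).
    have mE : m = 1 - (nat_comb k (co i) : F) by rewrite /m add_lfunE opp_lfunE rho1.
    have cn0' : coef s (drefl i nu) != 0 by rewrite anti oppr_eq0.
    have [p ps pE] : exists2 p, p \in s & drefl i nu = p.2.
      apply/seq.mapP; apply: contraNT cn0' => /coef_notin ->; exact: eqxx.
    have [k' k'0 k'E] := Hs p ps.
    have E1 : nat_comb k' = nat_comb k + m *: 'a_i.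
      have : drefl i nu = rho - nat_comb k' by rewrite pE k'E.
      rewrite /drefl -/m /nu => /(congr1 (fun x => rho - x)); rewrite subKr => <-.
      by rewrite -[X in rho - X]addrA -opprD subKr.
    have E2 : m = (\sum_j k' j)%N%:R - (\sum_j k j)%N%:R.
      have E3 j : (k' j)%:R = (k j)%:R + m * (j == i)%:R :> F.
        move: j; apply: (simple_inj a_basis); rewrite -nat_combE E1.
        rewrite -[X in m *: X]nat_comb1 !nat_combE scaler_sumr -big_split.
        by apply: eq_bigr => j _; rewrite /= scalerA scalerDl.
      rewrite !natr_sum -sumrB (bigD1 i) //= E3 eqxx mulr1 [X in _ + X]big1 ?addr0.
        by rewrite addrC addKr.
      by move=> j /negPf ji; rewrite E3 ji mulr0 addr0 subrr.
    have le : (\sum_j k j <= \sum_j k' j)%N.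
      rewrite leqNgt; apply/negP => lt; case/eqP: cn0'; rewrite pE k'E.
      by apply: IH => //; apply: leq_trans lt _; rewrite -ltnS.
    have m0 : m != 0.
      apply: contra_neq cn0 => m0; have : coef s nu = - coef s nu.
        by rewrite -(anti i) /drefl -/m m0 scale0r subr0.
      move/eqP; rewrite -addr_eq0 -mulr2n -mulr_natr mulf_eq0 pnatr_eq0 orbF.
      by move/eqP.
    have m1 : 1 <= m.
      rewrite E2 -natrB // ler1n lt0n subn_eq0 -ltnNge ltn_neqAle le andbT.
      by apply: contra_neq m0 => E; rewrite E2 E subrr.
    by rewrite -[X in X <= _]opprK -[X in - X](addKr 1) -mE oppr_le0 addrC subr_ge0.
  have z : nat_comb k = 0.
    by apply: (positivity a_root (nat_combE a k)) => // i; rewrite ler0n.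
  have [i /eqP ki] := k0; apply: ki; apply/eqP; rewrite -(eqr_nat F); apply/eqP.
  apply: (@simple_free _ _ _ _ a a_basis (fun i => (k i)%:R)).
  by rewrite -nat_combE.
move=> H; rewrite sE (@ev_coef _ ce _ s (undup (map snd s))) ?undup_uniq //; last first.
  by move=> m; rewrite mem_undup.
rewrite big_seq big1 // => nu; rewrite mem_undup => /seq.mapP[p /Hs[k k0 ->] ->].
by rewrite (c0 (\sum_i k i).+1) ?mul0r.
Qed.

(** Being a root is only a predicate; the finite list is read off from a basis of g made of root
    vectors and of the simple coroots. Root spaces are lines, so the basis contains no two vectors
    for the same root. *)
Lemma root_basis : exists (rts : seq dual) (xs : dual -> 'M[F]_N),
  [/\ uniq rts, forall alpha, alpha \in rts <-> isroot alpha,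
      forall alpha, alpha \in rts -> rootv alpha (xs alpha) /\ xs alpha != 0
    & basis_of g ([seq xs alpha | alpha <- rts] ++ [seq vsval (co i) | i : 'I_r])].
Proof.
pose e0 := [seq vsval (co i) | i : 'I_r].
pose P X := (exists alpha, [/\ isroot alpha, rootv alpha X & X != 0]) \/ X \in e0.
have vg H : vsval H \in g by exact: (subvP (cp_sub cp) _ (subvsP _)).
have fe0 : free e0.
  rewrite -[e0]/(tval [tuple vsval (co i) | i < r]).
  apply/freeP => c E; apply: (co_free a_basis a_root (c := c)); apply: val_inj.
  rewrite -[LHS]/(vsval _) linear_sum -[RHS]E; apply: eq_bigr => i _.
  by rewrite linearZ -tnth_nth tnth_mktuple.
have Pe0 X : X \in e0 -> X \in g /\ P X.
  by move=> Xe; split; [case/seq.mapP: Xe => i _ ->; exact: vg|right].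
have [|es [bes Pes]] := @basis_pred _ _ g P e0 fe0 Pe0.
  move=> W HW; apply: (weight_span cp) => alpha X HX.
  have [->|X0] := eqVneq X 0; first exact: mem0v.
  have [a0|a0] := eqVneq alpha 0; last first.
    have [Xg _] := HX; apply: HW => //; left; exists alpha; split=> //.
    by split=> //; exists X.
  have Xh : X \in h by apply: (rootv0 cp); rewrite -a0.
  rewrite -(vsprojK Xh); have [c ->] := co_span cp a_basis a_root (vsproj h X).
  rewrite linear_sum; apply: memv_suml => i _; rewrite linearZ memvZ //.
  apply: (HW (vsval (co i))); first exact: vg.
  by right; apply: map_f; rewrite mem_enum.
have fre := basis_free bes.
have notin X : X \in es -> X \notin e0.
  move=> Xe; have := free_uniq fre; rewrite cat_uniq => /and3P[_ /hasPn H _].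
  by apply/negP => /H; rewrite Xe.
have /choice[al Hal] X : exists alpha, X \in es -> [/\ isroot alpha, rootv alpha X & X != 0].
  have [Xe|] := boolP (X \in es); last by exists 0.
  have [[alpha Ha]|] := Pes X Xe; first by exists alpha.
  by rewrite (negPf (notin X Xe)).
have alinj : {in es &, injective al}.
  move=> X Y Xe Ye E; apply/eqP; apply: contraT => XY.
  have [rX HX X0] := Hal X Xe; have [rY HY Y0] := Hal Y Ye.
  rewrite -E in HY; have [c cE] := root_one_dim cp rX HX X0 HY.
  have := catl_free fre; rewrite (perm_free (perm_to_rem Ye)) free_cons => /andP[+ _].
  rewrite {1}cE memvZ // memv_span // mem_rem_uniq ?inE ?XY //.
  exact: free_uniq (catl_free fre).
pose rts := [seq al X | X <- es].
have urts : uniq rts by rewrite map_inj_in_uniq // (free_uniq (catl_free fre)).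
pose xs alpha := nth 0 es (index alpha rts).
have mxs : [seq xs alpha | alpha <- rts] = es.
  apply: (@eq_from_nth _ 0); rewrite !size_map // => i ie.
  rewrite (nth_map 0) ?size_map // /xs (nth_map 0) // -(nth_map 0 0 al) //.
  by rewrite index_uniq ?size_map.
have inxs alpha : alpha \in rts -> xs alpha \in es /\ al (xs alpha) = alpha.
  move=> ar; have ie : (index alpha rts < size es)%N by rewrite -(size_map al) index_mem.
  split; first by rewrite mem_nth.
  by rewrite /xs -(nth_map 0 0 al) // nth_index.
exists rts, xs; split=> //.
- move=> alpha; split=> [/seq.mapP[X /Hal[rX _ _] ->//]|ra].
  (* If alpha were missing from the list, the functional tr (. Z) would vanish on the whole basis
     although its value at X is 1. *)
  have [_ [X X0 HX]] := ra; have [Z HZ XZ] := rootv_dual cp HX X0.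
  apply: contraT => nar.
  pose f := (linfun (mxtrace : 'M[F]_N -> F^o) \o linfun (mulmxr Z))%VF.
  have fE Y : f Y = \tr (Y *m Z) by rewrite comp_lfunE !lfunE.
  suff /subvP s : (g <= lker f)%VS.
    have [Xg _] := HX; have := s X Xg; rewrite memv_ker fE XZ oner_eq0 //.
  apply: (span_basis_ind bes) => Y; rewrite mem_cat memv_ker fE => /orP[Ye|].
    have [rY HY _] := Hal Y Ye; apply/eqP; apply: (rootv_tr HY HZ).
    rewrite subr_eq0; apply: contraNneq nar => <-; exact: map_f.
  case/seq.mapP => i _ ->; apply/eqP; apply: (rootv_tr (rootv_h cp (subvsP (co i))) HZ).
  by rewrite add0r oppr_eq0; case: ra.
- by move=> alpha /inxs[xe ale]; have [_ H1 H2] := Hal _ xe; rewrite ale in H1.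
- by rewrite mxs.
Qed.

Variable rts : seq dual.
Hypothesis rts_uniq : uniq rts.
Hypothesis rtsP : forall alpha, alpha \in rts <-> isroot alpha.

Definition pos_roots : seq dual := [seq alpha <- rts | `[< positive alpha >] ].

Lemma pos_rootsP alpha : alpha \in pos_roots <-> isroot alpha /\ positive alpha.
Proof.
rewrite mem_filter; split=> [/andP[/asboolP ? /rtsP ?]|[? ?]]; first by [].
by apply/andP; split; [exact/asboolP|exact/rtsP].
Qed.

Lemma pos_roots_uniq : uniq pos_roots. Proof. exact: filter_uniq. Qed.

Lemma not_pos_neg alpha : isroot alpha -> positive alpha -> ~ positive (- alpha).
Proof.
move=> [a0 _] [k kE] [k' k'E]; case/eqP: a0; rewrite kE; apply: nat_comb0 => i.
have E : nat_comb (fun j => (k j + k' j)%N) = nat_comb (fun=> 0%N).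
  by rewrite -nat_combD -kE -k'E subrr nat_comb0.
by have /eqP := nat_comb_inj a_basis E i; rewrite addn_eq0 => /andP[/eqP].
Qed.

Lemma perm_roots : perm_eq rts (pos_roots ++ [seq - alpha | alpha <- pos_roots]).
Proof.
apply: uniq_perm => //.
  rewrite cat_uniq pos_roots_uniq (map_inj_uniq oppr_inj) pos_roots_uniq andbT /=.
  apply/hasPn => alpha /seq.mapP[beta /pos_rootsP[rb pb] ->]; apply/negP.
  by move/pos_rootsP => [_]; exact: not_pos_neg.
move=> alpha; rewrite mem_cat; apply/idP/orP => [/rtsP ra|].
  have [pa|na] := a_pos ra; [left|right]; first exact/pos_rootsP.
  by rewrite -[alpha]opprK; apply: map_f; apply/pos_rootsP; split=> //; exact: isrootN.
move=> [/pos_rootsP[ra _]|/seq.mapP[beta /pos_rootsP[rb _] ->]]; apply/rtsP => //.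
exact: isrootN.
Qed.

Let phi (x : F) := ce (2%:R^-1 * x) - ce (- (2%:R^-1 * x)).

(** Each factor is exp (x / 2) - exp (- x / 2), odd in x, so that a simple reflection, which
    permutes the positive roots other than a_i and negates a_i, changes the sign of the product. *)
Definition weyl_denom H : F := \prod_(alpha <- pos_roots) phi (alpha H).

Let half2 (x : F) : x = 2%:R^-1 * x + 2%:R^-1 * x.
Proof. by field. Qed.

(** For alpha and -alpha together, (exp x - 1) (exp (-x) - 1) = - (exp (x/2) - exp (-x/2))^2. *)
Lemma prod_roots H : \prod_(alpha <- rts) (ce (alpha H) - 1) =
  (-1) ^+ size pos_roots * weyl_denom H ^+ 2.
Proof.
rewrite (perm_big _ perm_roots) big_cat big_map -[LHS]/(_ * _) /weyl_denom.
elim: pos_roots => [|alpha l IH] /=; first by rewrite !big_nil expr0 expr1n mulr1.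
rewrite !big_cons mulrACA IH (exprS _ (size l)) opp_lfunE {1}/phi.
set u := ce (2%:R^-1 * alpha H); set v := ce (- (2%:R^-1 * alpha H)).
have uv : u * v = 1 by rewrite mulrC; exact: elN.
have x2 : (alpha H : F) = 2%:R^-1 * alpha H + 2%:R^-1 * alpha H.
  exact: half2.
have -> : ce (alpha H) = u * u by rewrite {1}x2 ceD.
have -> : ce (- alpha H) = v * v by rewrite {1}x2 opprD ceD.
have -> : (u * u - 1) * (v * v - 1) = (u * v - 1) ^+ 2 - (u - v) ^+ 2 by ring.
have -> : phi (alpha H) = u - v by [].
rewrite uv subrr expr0n sub0r; move: (\prod_(_ <- l) _) ((-1) ^+ size l) (u - v) => P s w.
by ring.
Qed.

Definition half_sum : dual := \sum_(alpha <- pos_roots) 2%:R^-1 *: alpha.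

Lemma weyl_denom_lead : lead ce a half_sum 1 weyl_denom.
Proof.
have pr alpha : alpha \in pos_roots ->
    lead ce a (2%:R^-1 *: alpha) 1 (fun H => phi (alpha H)).
  move=> /pos_rootsP[[a0 _] [k kE]].
  have k0 : nz k.
    apply: contrapT => H; case/eqP: a0; rewrite kE; apply: nat_comb0 => i.
    by apply/eqP/negP => ki; apply: H; exists i; exact/negP.
  apply: (lower_ext _ (@lower_term _ ce _ _ _ a (2%:R^-1 *: alpha) (-1) (- (2%:R^-1 *: alpha)) k k0 _)).
    by move=> H; rewrite /phi opp_lfunE scale_lfunE mul1r -[_ *: _]/(2%:R^-1 * (alpha H : F)); ring.
  rewrite -kE -[X in _ - X]scale1r -scalerBl -scaleNr; congr (_ *: _).
  by field.
rewrite /weyl_denom /half_sum; elim: pos_roots pr => [|alpha l IH] pr.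
  by rewrite big_nil; apply: lead_ext (lead1 el a) => H; rewrite big_nil.
have IH' := IH (fun beta bl => pr beta (mem_behead (s := alpha :: l) bl)).
have := leadM el (pr alpha (mem_head _ _)) IH'; rewrite mulr1 big_cons.
by apply: lead_ext => H; rewrite big_cons.
Qed.

Let phiN x : phi (- x) = - phi x.
Proof. by rewrite /phi mulrN opprK opprB. Qed.

Lemma perm_refl i : perm_eq [seq drefl i alpha | alpha <- rem 'a_i pos_roots]
  (rem 'a_i pos_roots).
Proof.
have u := pos_roots_uniq.
have inj : injective (drefl i) by apply: can_inj (dreflK i).
have sub : {subset [seq drefl i alpha | alpha <- rem 'a_i pos_roots] <= rem 'a_i pos_roots}.
  move=> beta /seq.mapP[alpha]; rewrite mem_rem_uniq // inE => /andP[ai /pos_rootsP[ra pa] ->].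
  rewrite mem_rem_uniq // inE; apply/andP; split.
    apply/eqP => E; have aE : alpha = - 'a_i.
      by rewrite -(dreflK i alpha) E /drefl co2 -{1}['a_i]scale1r -scalerBl (_ : 1 - 2%:R = -1) ?scaleN1r //; ring.
    apply: (not_pos_neg (a_root i)); last by rewrite -aE.
    by exists (fun j => (j == i : nat)); rewrite nat_comb1.
  apply/pos_rootsP; split; first exact: root_reflection.
  exact: reflection_pos.
have us : uniq [seq drefl i alpha | alpha <- rem 'a_i pos_roots].
  by rewrite map_inj_uniq // rem_uniq.
apply: uniq_perm => //; first exact: rem_uniq.
by apply: (uniq_min_size us sub _).2; rewrite size_map.
Qed.

Let a_in i : 'a_i \in pos_roots.
Proof.
apply/pos_rootsP; split=> //.
by exists (fun j => (j == i : nat)); rewrite nat_comb1.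
Qed.

Lemma weyl_denom_anti i H : weyl_denom (refl i H) = - weyl_denom H.
Proof.
rewrite /weyl_denom !(perm_big _ (perm_to_rem (a_in i))) !big_cons /=.
have -> : phi ('a_i (refl i H)) = - phi ('a_i H).
  rewrite -phiN; congr phi; rewrite dual_refl /drefl co2 add_lfunE opp_lfunE scale_lfunE.
  by rewrite -[_ *: _]/(2%:R * ('a_i H : F)); ring.
rewrite mulNr; congr (- (_ * _)).
rewrite -(perm_big _ (perm_refl i)) big_map; apply: eq_bigr => alpha _.
by rewrite -dual_refl reflK.
Qed.

(** The reflection permutes the positive roots other than a_i and negates co_i, so their sum S takes
    at co_i a value equal to its opposite; a_i alone contributes 2 / 2. *)
Lemma half_sum_co i : half_sum (co i) = 1 :> F.
Proof.
have two0 : (2%:R : F) != 0 by rewrite pnatr_eq0.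
set S : F := \sum_(alpha <- rem 'a_i pos_roots) (alpha (co i) : F).
have S0 : S = 0.
  apply: (mulIf two0); rewrite mul0r; apply/eqP; rewrite -[2%:R]/(1 + 1) mulrDr mulr1.
  rewrite {1}/S -(perm_big _ (perm_refl i)) big_map.
  rewrite (eq_bigr (fun alpha : dual => - (alpha (co i) : F))) => [|alpha _]; last first.
    by rewrite -dual_refl refl_co; exact: linearN.
  by rewrite sumrN addNr.
have -> : (half_sum (co i) : F) = 2%:R^-1 * \sum_(alpha <- pos_roots) (alpha (co i) : F).
  by rewrite /half_sum sum_lfunE mulr_sumr; apply: eq_bigr => alpha _; rewrite scale_lfunE.
rewrite (perm_big _ (perm_to_rem (a_in i))) big_cons /= -/S S0 addr0 co2.
by rewrite mulVf.
Qed.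

Variables (om : 'I_r -> dual) (L : 'I_r -> seq dual).
Hypothesis om_co : forall i j, om i (co j) = (i == j)%:R :> F.
Hypothesis L_low : forall i mu, mu \in L i -> exists k, nz k /\ mu = om i - nat_comb k.
Hypothesis L_refl : forall i j H, \sum_(mu <- om i :: L i) ce (mu (refl j H)) =
  \sum_(mu <- om i :: L i) ce (mu H).

Definition dchi i K H : F := \sum_(mu <- om i :: L i) (mu K : F) * ce (mu H).

(** The reflection invariance of the character, differentiated formally by [ev_eq_dev]. *)
Lemma dchi_refl i j K H : dchi i K (refl j H) = dchi i (refl j K) H.
Proof.
pose t : seq (F * dual)%type := [seq (1, mu) | mu : dual <- om i :: L i].
pose t' : seq (F * dual)%type := [seq (1, drefl j mu) | mu : dual <- om i :: L i].
have E H' : ev ce t' H' = ev ce t H'.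
  rewrite /ev /t /t' !big_map; under eq_bigr do rewrite /= mul1r -dual_refl.
  by under [RHS]eq_bigr do rewrite /= mul1r; exact: L_refl.
have := ev_eq_dev el E (refl j K) H; rewrite /ev /dev /t /t' -!map_comp !big_map.
under eq_bigr do rewrite /= mulr1 -!dual_refl reflK.
by under [RHS]eq_bigr do rewrite /= mulr1.
Qed.

Definition jac H : F := \det (\matrix_(i < r, j < r) dchi i (co j) H).

(** By [dchi_refl] the reflection of H becomes the matrix 1 - u v of the reflection acting on the
    coroots, whose determinant is 1 - a_l (co_l) = -1. *)
Lemma jac_anti l H : jac (refl l H) = - jac H.
Proof.
pose u : 'cV[F]_r := delta_mx l 0; pose v : 'rV[F]_r := \row_j ('a_l (co j) : F).
pose A := \matrix_(i < r, j < r) dchi i (co j) H.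
have -> : jac (refl l H) = \det (A *m (1%:M - u *m v)).
  congr (\det _); apply/matrixP => i j; rewrite mulmxBr mulmx1 mulmxA.
  have E : (A *m u *m v) i j = A i l * ('a_l (co j) : F).
    by rewrite -colE mxE big_ord1 [col _ _ _ _]mxE [v _ _]mxE.
  rewrite [LHS]mxE [RHS]mxE [X in _ + X]mxE E ![A _ _]mxE.
  rewrite dchi_refl /dchi mulr_suml -sumrB; apply: eq_bigr => mu _.
  rewrite dual_refl /drefl add_lfunE opp_lfunE scale_lfunE.
  rewrite -[_ *: _]/((mu (co l) : F) * ('a_l (co j) : F)); ring.
rewrite det_mulmx det_rank1 -colE !mxE -[X in X * _]/(jac H) co2; ring.
Qed.

Lemma jac_lead : lead ce a (\sum_i om i) 1 jac.
Proof.
rewrite -(det1 F r); apply: (lead_det el) => i j.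
apply: (lower_ext _ (@lower_sum _ ce _ _ _ a (om i) _ (L i) (fun mu => mu \in L i)
  (fun mu H => (mu (co j) : F) * ce (mu H)) _)).
  move=> H; rewrite -big_seq /dchi big_cons om_co mxE; ring.
move=> mu /L_low[k [k0 kE]]; exact: lower_term k0 kE.
Qed.

Lemma sum_om : \sum_i om i = half_sum.
Proof.
apply/lfunP => H; have [c ->] := co_span cp a_basis a_root H.
rewrite !dual_sumZ; apply: eq_bigr => j _; rewrite half_sum_co sum_lfunE.
rewrite (bigD1 j) //= om_co eqxx big1 ?addr0 // => i ij.
by rewrite om_co (negPf ij).
Qed.

(* The difference is antisymmetric under the simple reflections and has only
   exponents lower than rho. *)
Lemma jac_weyl_denom H : jac H = weyl_denom H.
Proof.
apply/eqP; rewrite -subr_eq0; apply/eqP; move: H.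
apply: (@refl_lower_zero half_sum (fun H => jac H - weyl_denom H)).
- exact: half_sum_co.
- have := jac_lead; rewrite sum_om => J.
  apply: (lower_ext _ (leadD J (leadZ el (-1) weyl_denom_lead))) => H; ring.
- by move=> i H; rewrite jac_anti weyl_denom_anti; ring.
Qed.

End Weyl.

(** * The matrix exponential *)

Section MatrixNorm.
Variable R : realType.
Local Notation C := R[i].
Local Open Scope classical_set_scope.
Local Open Scope complex_scope.
Import ComplexField.Normc.

Lemma normc_ge0 (z : C) : 0 <= normc z.
Proof. by case: z => a b; exact: sqrtr_ge0. Qed.

Lemma normcR (a : R) : normc a%:C = `|a|.
Proof. by rewrite /= expr0n addr0 sqrtr_sqr. Qed.

Lemma normcE_norm (z : C) : `|z| = (normc z)%:C :> C.
Proof. by case: z => a b; rewrite normc_def. Qed.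

Lemma normc_nat k : normc (k%:R : C) = k%:R.
Proof. by rewrite -[k%:R](rmorph_nat (real_complex R)) normcR normr_nat. Qed.

Lemma normcB (x y : C) : normc (x - y) = normc (y - x).
Proof. by rewrite -opprB normcN. Qed.

Lemma normc_Re (z : C) : `|complex.Re z| <= normc z.
Proof.
case: z => a b /=; rewrite -[X in X <= _]sqrtr_sqr sqrtr_sqr -sqrtr_sqr.
by rewrite ler_wsqrtr // lerDl sqr_ge0.
Qed.

Lemma normc_Im (z : C) : `|complex.Im z| <= normc z.
Proof.
case: z => a b /=; rewrite -sqrtr_sqr.
by rewrite ler_wsqrtr // lerDr sqr_ge0.
Qed.

Lemma normc_le (z : C) : normc z <= `|complex.Re z| + `|complex.Im z|.
Proof.
rewrite {1}[z]complexE; apply: le_trans (le_normcD _ _) _.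
by rewrite normcM normcR mulrC normcR /= expr0n expr1n add0r sqrtr1 mulr1.
Qed.

Lemma normc_sum I (r : seq I) (P : pred I) (F : I -> C) :
  normc (\sum_(i <- r | P i) F i) <= \sum_(i <- r | P i) normc (F i).
Proof.
elim/big_ind2: _ => [|x a y b xa yb|//]; first by rewrite normc0.
exact: le_trans (le_normcD _ _) (lerD xa yb).
Qed.

(** The entrywise l^1 norm, with values in R. It is submultiplicative but the identity of size m has
    norm m, hence the constant [nrm1], which is at least 1 even for m = 0. *)
Definition nrm m n (A : 'M[C]_(m, n)) : R := \sum_i \sum_j normc (A i j).

Lemma nrm_ge0 m n (A : 'M[C]_(m, n)) : 0 <= nrm A.
Proof. by apply: sumr_ge0 => i _; apply: sumr_ge0 => j _; exact: normc_ge0. Qed.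
Hint Resolve nrm_ge0 normc_ge0 : core.

Lemma nrm0 m n : nrm (0 : 'M[C]_(m, n)) = 0.
Proof. by rewrite /nrm big1 // => i _; rewrite big1 // => j _; rewrite mxE normc0. Qed.

Lemma normc_le_nrm m n (A : 'M[C]_(m, n)) i j : normc (A i j) <= nrm A.
Proof.
rewrite /nrm (bigD1 i) //= (bigD1 j) //= -addrA lerDl addr_ge0 //.
  by apply: sumr_ge0.
by apply: sumr_ge0 => k _; apply: sumr_ge0.
Qed.

Lemma nrm_eq0 m n (A : 'M[C]_(m, n)) : nrm A = 0 -> A = 0.
Proof.
move=> A0; apply/matrixP => i j; rewrite mxE; apply: eq0_normc; apply/le_anti.
by rewrite normc_ge0 -A0 normc_le_nrm.
Qed.

Lemma nrmD m n (A B : 'M[C]_(m, n)) : nrm (A + B) <= nrm A + nrm B.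
Proof.
rewrite /nrm -big_split ler_sum // => i _; rewrite -big_split ler_sum // => j _.
by rewrite mxE le_normcD.
Qed.

Lemma nrmN m n (A : 'M[C]_(m, n)) : nrm (- A) = nrm A.
Proof. by apply: eq_bigr => i _; apply: eq_bigr => j _; rewrite mxE normcN. Qed.

Lemma nrmBC m n (A B : 'M[C]_(m, n)) : nrm (A - B) = nrm (B - A).
Proof. by rewrite -opprB nrmN. Qed.

Lemma nrm_sum m n I (r : seq I) (P : pred I) (F : I -> 'M[C]_(m, n)) :
  nrm (\sum_(i <- r | P i) F i) <= \sum_(i <- r | P i) nrm (F i).
Proof.
elim/big_ind2: _ => [|x a y b xa yb|//]; first by rewrite nrm0.
exact: le_trans (nrmD _ _) (lerD xa yb).
Qed.

Lemma nrmZ m n (a : C) (A : 'M[C]_(m, n)) : nrm (a *: A) = normc a * nrm A.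
Proof.
rewrite /nrm mulr_sumr; apply: eq_bigr => i _; rewrite mulr_sumr.
by apply: eq_bigr => j _; rewrite mxE normcM.
Qed.

Lemma nrmM m n p (A : 'M[C]_(m, n)) (B : 'M[C]_(n, p)) :
  nrm (A *m B) <= nrm A * nrm B.
Proof.
rewrite {1}/nrm.
apply: (@le_trans _ _ (\sum_i \sum_j \sum_k normc (A i k) * normc (B k j))).
  apply: ler_sum => i _; apply: ler_sum => j _; rewrite mxE.
  apply: le_trans (normc_sum _ _ _) _; apply: ler_sum => k _.
  by rewrite normcM.
rewrite /nrm mulr_suml; apply: ler_sum => i _.
rewrite exchange_big mulr_suml; apply: ler_sum => k _ /=.
rewrite -mulr_sumr ler_wpM2l // (bigD1 k) //= lerDl.
by apply: sumr_ge0 => l _; apply: sumr_ge0.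
Qed.

Definition nrm1 m : R := 1 + nrm (1%:M : 'M[C]_m).

Lemma nrm1_ge1 m : 1 <= nrm1 m. Proof. by rewrite lerDl. Qed.
Lemma nrm1_ge0 m : 0 <= nrm1 m. Proof. exact: le_trans ler01 (nrm1_ge1 m). Qed.
Hint Resolve nrm1_ge0 nrm1_ge1 : core.

Lemma nrm1M m (a : R) : 0 <= a -> a <= nrm1 m * a.
Proof. by move=> a0; rewrite ler_peMl. Qed.

Lemma nrmX m (A : 'M[C]_m) k : nrm (A ^+ k) <= nrm1 m * nrm A ^+ k.
Proof.
case: k => [|k]; first by rewrite !expr0 mulr1 lerDr.
apply: le_trans (nrm1M m (exprn_ge0 _ (nrm_ge0 A))).
elim: k => [|k IH]; first by rewrite !expr1.
rewrite exprS [in leRHS]exprS; apply: le_trans (nrmM _ _) _.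
by rewrite ler_wpM2l.
Qed.

(** Convergence in terms of [nrm], for all sizes, so that estimates take place in R; [cvg_tends]
    relates it to convergence of filters. *)
Definition tends m n (u : nat -> 'M[C]_(m, n)) (l : 'M[C]_(m, n)) : Prop :=
  (nrm (u k - l)) @[k --> \oo] --> (0 : R).

Lemma squeeze0 (u v : nat -> R) : (forall k, 0 <= u k <= v k) ->
  v k @[k --> \oo] --> (0 : R) -> u k @[k --> \oo] --> (0 : R).
Proof.
move=> uv v0; apply: (@squeeze_cvgr _ _ _ _ (fun=> 0) v u) => //.
  by near=> k; exact: uv.
exact: cvg_cst.
Unshelve. all: by end_near. Qed.

Lemma tends_le m n (u : nat -> 'M[C]_(m, n)) l (v : nat -> R) :
  (forall k, nrm (u k - l) <= v k) -> v k @[k --> \oo] --> (0 : R) -> tends u l.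
Proof. by move=> uv; apply: squeeze0 => k; rewrite nrm_ge0 uv. Qed.

Lemma tends_unique m n (u : nat -> 'M[C]_(m, n)) a b :
  tends u a -> tends u b -> a = b.
Proof.
move=> ua ub; apply/eqP; rewrite -subr_eq0; apply/eqP/nrm_eq0.
have /(cvg_unique _) : (nrm (u k - a) + nrm (u k - b)) @[k --> \oo] --> (0 + 0 : R).
  exact: cvgD.
have H : (fun=> nrm (a - b)) @ \oo --> (0 : R).
  apply: (@squeeze0 _ (fun k => nrm (u k - a) + nrm (u k - b))).
    move=> k; rewrite nrm_ge0 /= [nrm (u k - a)]nrmBC.
    by apply: le_trans (nrmD _ _); rewrite addrA subrK.
  by rewrite -[X in _ --> X](addr0 (0 : R)); exact: cvgD.
by have := cvg_unique _ H (cvg_cst _) => /(_ _)<-.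
Qed.

Lemma tends_cst m n (a : 'M[C]_(m, n)) : tends (fun=> a) a.
Proof. by rewrite /tends subrr nrm0; exact: cvg_cst. Qed.

Lemma tendsD m n (u v : nat -> 'M[C]_(m, n)) a b :
  tends u a -> tends v b -> tends (fun k => u k + v k) (a + b).
Proof.
move=> ua vb; apply: (@tends_le _ _ _ _ (fun k => nrm (u k - a) + nrm (v k - b))).
  by move=> k; rewrite opprD addrACA nrmD.
by rewrite -[X in _ --> X](addr0 (0 : R)); exact: cvgD.
Qed.

Lemma tendsMl m n p (B : 'M[C]_(p, m)) (u : nat -> 'M[C]_(m, n)) a :
  tends u a -> tends (fun k => B *m u k) (B *m a).
Proof.
move=> ua; apply: (@tends_le _ _ _ _ (fun k => nrm B * nrm (u k - a))).
  by move=> k; rewrite -mulmxBr nrmM.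
by rewrite -[X in _ --> X](mulr0 (nrm B)); apply: cvgM => //; exact: cvg_cst.
Qed.

Lemma tendsMr m n p (B : 'M[C]_(n, p)) (u : nat -> 'M[C]_(m, n)) a :
  tends u a -> tends (fun k => u k *m B) (a *m B).
Proof.
move=> ua; apply: (@tends_le _ _ _ _ (fun k => nrm (u k - a) * nrm B)).
  by move=> k; rewrite -mulmxBl nrmM.
by rewrite -[X in _ --> X](mul0r (nrm B)); apply: cvgM => //; exact: cvg_cst.
Qed.

Lemma tends_bounded m n (u : nat -> 'M[C]_(m, n)) a : tends u a ->
  \forall k \near \oo, nrm (u k) <= nrm a + 1.
Proof.
move=> ua; have /cvgrPdist_lt /(_ 1 ltr01) := ua; apply: filterS => k /=.
rewrite sub0r normrN ger0_norm // => H; rewrite -[u k](subrK a) addrC.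
by apply: le_trans (nrmD _ _) _; rewrite lerD2l ltW.
Qed.

Lemma tendsM m n p (u : nat -> 'M[C]_(m, n)) (v : nat -> 'M[C]_(n, p)) a b :
  tends u a -> tends v b -> tends (fun k => u k *m v k) (a *m b).
Proof.
move=> ua vb.
pose w k := nrm (u k - a) * nrm (v k - b) + nrm a * nrm (v k - b)
            + nrm (u k - a) * nrm b.
apply: (@tends_le _ _ _ _ w).
  move=> k; rewrite /w; set x := u k; set y := v k.
  have -> : x *m y - a *m b = (x - a) *m (y - b) + a *m (y - b) + (x - a) *m b.
    by rewrite !mulmxBl !mulmxBr; apply/matrixP => i j; rewrite !mxE; ring.
  apply: le_trans (nrmD _ _) _; apply: lerD; last exact: nrmM.
  by apply: le_trans (nrmD _ _) _; apply: lerD; exact: nrmM.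
have -> : (0 : R) = 0 * 0 + nrm a * 0 + 0 * nrm b by rewrite !(mulr0, mul0r, addr0).
apply: cvgD; [apply: cvgD; apply: cvgM => //; exact: cvg_cst|].
by apply: cvgM => //; exact: cvg_cst.
Qed.

Lemma tendsZ m n (c : C) (u : nat -> 'M[C]_(m, n)) a :
  tends u a -> tends (fun k => c *: u k) (c *: a).
Proof.
move=> ua; apply: (@tends_le _ _ _ _ (fun k => normc c * nrm (u k - a))).
  by move=> k; rewrite -scalerBr nrmZ.
by rewrite -[X in _ --> X](mulr0 (normc c)); apply: cvgM => //; exact: cvg_cst.
Qed.

Lemma tends_le_nrm m n (u : nat -> 'M[C]_(m, n)) a (c : R) :
  tends u a -> (\forall k \near \oo, nrm (u k) <= c) -> nrm a <= c.
Proof.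
move=> ua uc; apply/ler_addgt0Pl => e e0.
have /cvgrPdist_lt /(_ e e0) := ua => H.
have [k [/= Hk1 Hk2]] : exists k, nrm (u k) <= c /\ `|0 - nrm (u k - a)| < e.
  by apply: (@filter_ex _ \oo); apply: filterI.
rewrite sub0r normrN ger0_norm // in Hk2.
rewrite -[a](subrK (u k)); apply: le_trans (nrmD _ _) _.
by rewrite nrmBC lerD // ltW.
Qed.

Lemma nbhsC_normc (z : C) (P : set C) :
  nbhs z P <-> exists2 e : R, 0 < e & forall w, normc (w - z) < e -> P w.
Proof.
split=> [/nbhs_ballP [e /= e0 eP]|[e e0 eP]].
  have eE : e = (complex.Re e)%:C by rewrite RRe_real // gtr0_real.
  have e0' : 0 < complex.Re e by move: e0; rewrite eE ltcR.
  exists (complex.Re e) => // w wz; apply: eP; rewrite /ball /= eE.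
  by rewrite normcE_norm ltcR normcB.
apply/nbhs_ballP; exists e%:C => /=; first by rewrite ltcR.
move=> w; rewrite /ball /= normcE_norm ltcR normcB; exact: eP.
Qed.

Lemma nbhs_nrm m n (A : 'M[C]_(m, n)) (P : set 'M[C]_(m, n)) :
  nbhs A P <-> exists2 e : R, 0 < e & forall B, nrm (B - A) < e -> P B.
Proof.
split=> [/nbhs_ballP [e /= e0 eP]|[e e0 eP]].
  have eE : e = (complex.Re e)%:C by rewrite RRe_real // gtr0_real.
  have e0' : 0 < complex.Re e by move: e0; rewrite eE ltcR.
  exists (complex.Re e) => // B BA; apply: eP; split => // i j.
  rewrite /ball /= eE normcE_norm ltcR normcB; apply: le_lt_trans BA.
  by have := normc_le_nrm (B - A) i j; rewrite !mxE.
(* The successor avoids a division by 0 for empty matrices and makes the final inequality strict. *)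
apply/nbhs_ballP; pose d : R := e / ((m * n).+1%:R).
have d0 : 0 < d by rewrite divr_gt0 // ltr0n.
exists d%:C => /=; first by rewrite ltcR.
move=> B [_ AB]; apply: eP.
have le1 : nrm (B - A) <= \sum_(i < m) \sum_(j < n) d.
  apply: ler_sum => i _; apply: ler_sum => j _; rewrite !mxE normcB.
  by have := AB i j; rewrite /ball /= normcE_norm ltcR => /ltW.
apply: le_lt_trans le1 _; rewrite !sumr_const !card_ord -mulrnA.
rewrite -[_ *+ _]mulr_natr /d mulrAC ltr_pdivrMr ?ltr0n //.
by rewrite ltr_pM2l // ltr_nat mulnC.
Qed.

Lemma cvg_tends m n (u : nat -> 'M[C]_(m, n)) a : tends u a <-> u @ \oo --> a.
Proof.
split=> [ua P /nbhs_nrm [e e0 eP]|ua].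
  have /cvgrPdist_lt /(_ e e0) := ua; apply: filterS => k /=.
  by rewrite sub0r normrN ger0_norm //; exact: eP.
apply/cvgrPdist_lt => e e0.
have : nbhs a [set B | nrm (B - a) < e] by apply/nbhs_nrm; exists e.
move=> /ua H; near=> k; rewrite sub0r normrN ger0_norm //; near: k; exact: H.
Unshelve. all: by end_near. Qed.

End MatrixNorm.
#[global] Hint Extern 0 (is_true (@Order.le _ _ _ _)) =>
  solve [exact: nrm_ge0 | exact: normc_ge0 | exact: nrm1_ge0] : core.

Lemma subX_sum (S : pzRingType) (a b : S) k :
  a ^+ k.+1 - b ^+ k.+1 = \sum_(i < k.+1) a ^+ (k - i) * (a - b) * b ^+ i.
Proof.
elim: k => [|k IH]; first by rewrite big_ord1 /= expr0 mul1r mulr1.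
rewrite big_ord_recr /= subnn expr0 mul1r.
have -> : \sum_(i < k.+1) a ^+ (k.+1 - i) * (a - b) * b ^+ i =
  a * \sum_(i < k.+1) a ^+ (k - i) * (a - b) * b ^+ i.
  rewrite mulr_sumr; apply: eq_bigr => i _.
  by rewrite subSn -1?ltnS // exprS !mulrA.
by rewrite -IH mulrBr mulrBl -!exprS addrA subrK.
Qed.

(** * The exponential series and its estimates *)

Section MatrixExp.
Variable R : realType.
Local Notation C := R[i].
Local Open Scope classical_set_scope.
Local Open Scope complex_scope.
Import ComplexField.Normc.

(** Completeness is used on the real and imaginary parts of each entry, all dominated by the
    norm. *)
Lemma tends_series_dom m n (t : nat -> 'M[C]_(m, n)) (v : nat -> R) :
  (forall k, nrm (t k) <= v k) -> cvgn (series v) -> exists l, tends (series t) l.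
Proof.
move=> tv cv.
have v0 k : 0 <= v k by exact: le_trans (nrm_ge0 _) (tv k).
have cvF (f : C -> R) : (forall z, `|f z| <= normc z) ->
    forall i j, cvgn (series (fun k => f (t k i j))).
  move=> fn i j; apply: normed_cvg; apply: (series_le_cvg _ v0 _ cv) => k /=.
    exact: normr_ge0.
  exact: le_trans (fn _) (le_trans (normc_le_nrm _ _ _) (tv k)).
have [cR cI] := (cvF _ (@normc_Re R), cvF _ (@normc_Im R)).
pose l := \matrix_(i, j) ((limn (series (fun k => complex.Re (t k i j))))
                        +i* (limn (series (fun k => complex.Im (t k i j)))) : C).
exists l.
pose w N := \sum_i \sum_j (`|series (fun k => complex.Re (t k i j)) N - complex.Re (l i j)|
   + `|series (fun k => complex.Im (t k i j)) N - complex.Im (l i j)|).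
apply: (@tends_le _ _ _ _ _ w).
  move=> N; apply: ler_sum => i _; apply: ler_sum => j _.
  rewrite !mxE; apply: le_trans (normc_le _) _.
  by rewrite !raddfB /= /series /= summxE !raddf_sum.
have cvgsum p (F : 'I_p -> nat -> R) : (forall i, F i k @[k --> \oo] --> (0 : R)) ->
    (\sum_(i < p) F i k) @[k --> \oo] --> (0 : R).
  move=> H; elim: p F H => [|p IH] F H.
    by under eq_fun do rewrite big_ord0; exact: cvg_cst.
  under eq_fun do rewrite big_ord_recr.
  have := cvgD (IH (fun i => F (widen_ord (leqnSn p) i)) _) (H ord_max).
  by rewrite addr0; apply => i; exact: H.
apply: (cvgsum _ _) => i; apply: (cvgsum _ _) => j.
rewrite -[X in (_ --> X)%classic](addr0 (0 : R)); apply: cvgD.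
  have : (series (fun k => complex.Re (t k i j)) N - complex.Re (l i j))
      @[N --> \oo] --> (0 : R).
    by apply/subr_cvg0; rewrite mxE; exact: cR.
  by move/cvg_norm; rewrite normr0.
have : (series (fun k => complex.Im (t k i j)) N - complex.Im (l i j))
    @[N --> \oo] --> (0 : R).
  by apply/subr_cvg0; rewrite mxE; exact: cI.
by move/cvg_norm; rewrite normr0.
Qed.

Section Def.
Variable m : nat.
Implicit Types A B : 'M[C]_m.

Definition psum A : nat -> 'M[C]_m := series (fun k => (k`!%:R)^-1 *: A ^+ k).
Fact mexp_key : unit. Proof. exact: tt. Qed.
(* Sealed: unification must not unfold the limit. *)
Definition mexp A : 'M[C]_m := locked_with mexp_key (lim (psum A @ \oo)).

Lemma normc_factV k : normc ((k`!%:R)^-1 : C) = (k`!%:R)^-1.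
Proof. by rewrite normcV normc_nat. Qed.

Lemma nrm_term A k :
  nrm ((k`!%:R)^-1 *: A ^+ k) <= nrm1 R m * exp_coeff (nrm A) k.
Proof.
by rewrite nrmZ normc_factV exp_coeffE mulrCA ler_wpM2l ?nrmX // invr_ge0 ler0n.
Qed.

Lemma mexp_tends A : tends (psum A) (mexp A).
Proof.
have [l ul] : exists l, tends (psum A) l.
  apply: (tends_series_dom (nrm_term A)).
  have -> : series (fun k => nrm1 R m * exp_coeff (nrm A) k) =
            (fun n => nrm1 R m * series (exp_coeff (nrm A)) n).
    by apply/funext => n; rewrite /series /= mulr_sumr.
  by apply: is_cvgMr; exact: is_cvg_series_exp_coeff.
by rewrite /mexp unlock; apply/cvg_tends/cvg_ex; exists l; exact/cvg_tends.
Qed.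

Lemma expE_le (a : R) n : 0 <= a -> series (exp_coeff a) n <= expR a.
Proof.
move=> a0; apply: nondecreasing_cvgn_le; last exact: is_cvg_series_exp_coeff.
by apply: nondecreasing_series => k _ _; exact: exp_coeff_ge0.
Qed.

Lemma nrm_mexp A : nrm (mexp A) <= nrm1 R m * expR (nrm A).
Proof.
apply: (tends_le_nrm (mexp_tends A)); near=> n.
apply: (@le_trans _ _ (nrm1 R m * series (exp_coeff (nrm A)) n)).
  rewrite /series /= mulr_sumr; apply: le_trans (nrm_sum _ _ _) _.
  by apply: ler_sum => k _; exact: nrm_term.
by apply: ler_wpM2l; [exact: nrm1_ge0|exact/expE_le/nrm_ge0].
Unshelve. all: by end_near. Qed.

Lemma psumS2 A n : psum A n.+2 = 1 + A + \sum_(0 <= k < n) (k.+2`!%:R)^-1 *: A ^+ k.+2.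
Proof.
rewrite /psum /series /= big_nat_recl // big_nat_recl //= addrA.
by rewrite expr0 expr1 !invr1 !scale1r.
Qed.

Lemma mexp_est A :
  nrm (mexp A - 1 - A) <= nrm1 R m * (nrm A ^+ 2 * expR (nrm A)).
Proof.
have T : tends (fun n => psum A n + (- 1 - A)) (mexp A - 1 - A).
  rewrite -addrA; apply: tendsD (mexp_tends A) (tends_cst _).
apply: (tends_le_nrm T).
exists 2 => // -[//|[//|n]] _ /=.
have -> : psum A n.+2 + (- 1 - A) = \sum_(0 <= k < n) (k.+2`!%:R)^-1 *: A ^+ k.+2.
  by rewrite psumS2 addrAC -opprD subrr add0r.
move=> {T}.
apply: le_trans (nrm_sum _ _ _) _.
apply: (@le_trans _ _ (nrm1 R m * (nrm A ^+ 2 * series (exp_coeff (nrm A)) n))).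
  rewrite /series /= !mulr_sumr; apply: ler_sum => k _.
  apply: le_trans (nrm_term A k.+2) _; rewrite !exp_coeffE /=; apply: ler_wpM2l => //.
  rewrite [leRHS]mulrCA -exprD add2n ler_wpM2r ?exprn_ge0 //.
  rewrite lef_pV2 ?posrE ?ltr0n ?fact_gt0 // ler_nat !factS.
  by rewrite mulnA leq_pmull // muln_gt0.
by apply: ler_wpM2l => //; apply: ler_wpM2l; rewrite ?exprn_ge0 //; exact: expE_le.
Qed.

Lemma nrm_subX A B (K c : R) k : 0 <= c -> 0 <= K ->
  (forall i, nrm (A ^+ i) <= K * c ^+ i) -> (forall i, nrm (B ^+ i) <= K * c ^+ i) ->
  nrm (A ^+ k.+1 - B ^+ k.+1) <= K ^+ 2 * (k.+1%:R * c ^+ k) * nrm (A - B).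
Proof.
move=> c0 K0 HA HB.
have -> : A ^+ k.+1 - B ^+ k.+1 = \sum_(i < k.+1) A ^+ (k - i) * (A - B) * B ^+ i.
  exact: subX_sum.
apply: le_trans (nrm_sum _ _ _) _.
apply: (@le_trans _ _ (\sum_(i < k.+1) K ^+ 2 * c ^+ k * nrm (A - B))).
  apply: ler_sum => i _; have ik : (i <= k)%N by rewrite -ltnS.
  apply: le_trans (nrmM _ _) _.
  apply: (@le_trans _ _ ((K * c ^+ (k - i)) * nrm (A - B) * (K * c ^+ i))).
    by apply: ler_pM => //; apply: le_trans (nrmM _ _) _; rewrite ler_wpM2r.
  have -> : c ^+ k = c ^+ (k - i) * c ^+ i by rewrite -exprD subnK.
  by rewrite le_eqVlt; apply/orP; left; apply/eqP; ring.
rewrite sumr_const card_ord -mulr_natr.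
by rewrite le_eqVlt; apply/orP; left; apply/eqP; ring.
Qed.

Lemma nrm_mexpB A B c : nrm A <= c -> nrm B <= c ->
  nrm (mexp A - mexp B) <= nrm1 R m ^+ 2 * expR c * nrm (A - B).
Proof.
move=> Ac Bc; have c0 : 0 <= c := le_trans (nrm_ge0 A) Ac.
have T : tends (fun n => psum A n + - psum B n) (mexp A - mexp B).
  apply: tendsD (mexp_tends A) _.
  by have := tendsZ (-1) (mexp_tends B); under eq_fun do rewrite scaleN1r; rewrite scaleN1r.
apply: (tends_le_nrm T); exists 1 => // -[//|n] _ /=.
have -> : psum A n.+1 - psum B n.+1 =
    \sum_(0 <= k < n) (k.+1`!%:R)^-1 *: (A ^+ k.+1 - B ^+ k.+1).
  have S D : psum D n.+1 = ((0`!%:R)^-1 *: D ^+ 0 : 'M[C]_m) +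
      (\sum_(0 <= k < n) (k.+1`!%:R)^-1 *: D ^+ k.+1 : 'M[C]_m).
    exact: (@big_nat_recl _ _ _ n 0).
  rewrite (S A) (S B) !expr0 opprD addrACA subrr add0r -sumrB.
  by apply: eq_bigr => k _; rewrite scalerBr.
apply: le_trans (nrm_sum _ _ _) _.
apply: (@le_trans _ _ (nrm1 R m ^+ 2 * series (exp_coeff c) n * nrm (A - B))).
  rewrite /series /= [X in _ <= X * _]mulr_sumr [X in _ <= X]mulr_suml; apply: ler_sum => k _.
  rewrite nrmZ normc_factV.
  have H D : nrm D <= c -> forall i, nrm ((D : 'M[C]_m) ^+ i) <= nrm1 R m * c ^+ i.
    move=> Dc i; apply: le_trans (nrmX _ _) _; by rewrite ler_wpM2l // lerXn2r ?nnegrE.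
  have := nrm_subX k c0 (nrm1_ge0 R m) (H _ Ac) (H _ Bc).
  have F0 : 0 <= (k.+1`!%:R)^-1 :> R by rewrite invr_ge0.
  move=> /(ler_wpM2l F0) /le_trans; apply.
  rewrite exp_coeffE /= factS natrM invfM.
  rewrite le_eqVlt; apply/orP; left; apply/eqP.
  have f0 : (k`!%:R : R) != 0 by rewrite pnatr_eq0 -lt0n fact_gt0.
  have k0 : (k.+1%:R : R) != 0 by rewrite pnatr_eq0.
  by move: (k`!%:R) (k.+1%:R) f0 k0 => x y x0 y0; field; rewrite x0 y0.
by apply: ler_wpM2r => //; apply: ler_wpM2l; rewrite ?exprn_ge0 //; exact: expE_le.
Qed.

Lemma mexp_cont (u : nat -> 'M[C]_m) L : tends u L ->
  tends (fun k => mexp (u k)) (mexp L).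
Proof.
move=> uL; have H0 := tends_bounded uL.
have H : (nrm1 R m ^+ 2 * expR (nrm L + 1) * nrm (u k - L)) @[k --> \oo] --> (0 : R).
  by rewrite -[X in _ --> X](mulr0 (nrm1 R m ^+ 2 * expR (nrm L + 1))); apply: cvgM => //; exact: cvg_cst.
apply: (@squeeze_cvgr _ _ _ _ (fun=> 0) _ _ _ _ _ H); last exact: cvg_cst.
near=> k; rewrite nrm_ge0 /=; apply: nrm_mexpB; last by rewrite lerDl.
by near: k.
Unshelve. all: by end_near. Qed.

Lemma mexp0 : mexp 0 = 1.
Proof.
apply: (tends_unique (mexp_tends 0)); apply/cvg_tends.
apply: (@cvg_near_cst _ _ _ _ _); exists 1 => // -[//|n] _ /=.
rewrite /psum /series /= big_nat_recl // big1 ?addr0 => [|k _].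
  by rewrite expr0 invr1 scale1r.
by rewrite exprS mul0r scaler0.
Qed.

End Def.

(** P may be rectangular: eigenvectors, conjugations and inclusions of blocks are all instances. *)
Lemma mexp_inter m p (A : 'M[C]_m) (B : 'M[C]_p) (P : 'M[C]_(m, p)) :
  A *m P = P *m B -> mexp A *m P = P *m mexp B.
Proof.
move=> AP; apply: tends_unique (tendsMr P (mexp_tends A)) _.
have -> : (fun k => psum A k *m P) = (fun k => P *m psum B k).
  apply/funext => n; rewrite /psum /series /= mulmx_suml mulmx_sumr.
  apply: eq_bigr => k _; rewrite -scalemxAl -scalemxAr; congr (_ *: _).
  elim: k => [|k IH]; first by rewrite !expr0 mul1mx mulmx1.
  by rewrite [A ^+ _]exprSr [B ^+ _]exprSr -mulmxA AP !mulmxA IH.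
exact: tendsMl (mexp_tends B).
Qed.

Lemma big_triangle (V : zmodType) (F : nat -> nat -> V) n :
  \sum_(0 <= k < n) \sum_(0 <= i < k.+1) F i (k - i)%N =
  \sum_(0 <= i < n) \sum_(0 <= j < n - i) F i j.
Proof.
elim: n => [|n IH]; first by rewrite !big_geq.
rewrite big_nat_recr //= IH.
have -> : \sum_(0 <= i < n) \sum_(0 <= j < n - i) F i j =
          \sum_(0 <= i < n.+1) \sum_(0 <= j < n - i) F i j.
  by rewrite [RHS]big_nat_recr //= subnn [X in _ + X]big_geq // addr0.
rewrite -big_split /= !big_nat; apply: eq_bigr => i /andP[_ i_n].
by rewrite subSn // [RHS]big_nat_recr.
Qed.

Lemma prod_sub_triangle (V : zmodType) (F : nat -> nat -> V) n :
  \sum_(0 <= i < n) \sum_(0 <= j < n) F i j -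
  \sum_(0 <= k < n) \sum_(0 <= i < k.+1) F i (k - i)%N =
  \sum_(0 <= i < n) \sum_(n - i <= j < n) F i j.
Proof.
rewrite big_triangle -sumrB; apply: eq_bigr => i _.
by rewrite (@big_cat_nat _ _ _ (n - i)%N) ?leq_subr //= addrAC subrr add0r.
Qed.

Lemma fact_binV (S : numFieldType) k i : (i <= k)%N ->
  ((k`!%:R)^-1 * 'C(k, i)%:R : S) = (i`!%:R)^-1 * ((k - i)`!%:R)^-1.
Proof.
move=> ik; rewrite -(bin_fact ik) !natrM.
have H j : (j`!%:R : S) != 0 by rewrite pnatr_eq0 -lt0n fact_gt0.
by field; rewrite !H pnatr_eq0 -lt0n bin_gt0.
Qed.

Lemma mx_expD_term m (A B : 'M[C]_m) k : GRing.comm A B ->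
  (k`!%:R)^-1 *: (A + B) ^+ k = \sum_(0 <= i < k.+1)
     ((i`!%:R)^-1 *: A ^+ i) * (((k - i)`!%:R)^-1 *: B ^+ (k - i)).
Proof.
move=> AB; rewrite big_mkord addrC exprDn_comm; last exact: commr_sym.
rewrite scaler_sumr; apply: eq_bigr => i _.
have -> : i`!%:R^-1 *: A ^+ i * ((k - i)`!%:R^-1 *: B ^+ (k - i)) =
    (i`!%:R^-1 * (k - i)`!%:R^-1) *: (A ^+ i * B ^+ (k - i)).
  by rewrite -[LHS]scalemxAl -[X in _ *: X]scalemxAr scalerA.
have gen (a : C) (X : 'M[C]_m) q : a *: (X *+ q) = (a * q%:R) *: X.
  by rewrite -[X *+ q]scaler_nat scalerA.
have ik : (i <= k)%N by rewrite -ltnS.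
rewrite gen (fact_binV _ ik); congr (_ *: _).
exact/commrX/commr_sym/commrX.
Qed.

Lemma expR_term (a b : R) k :
  exp_coeff (a + b) k = \sum_(0 <= i < k.+1) exp_coeff a i * exp_coeff b (k - i)%N.
Proof.
rewrite big_mkord !exp_coeffE addrC exprDn /= mulr_sumr; apply: eq_bigr => i _.
have ik : (i <= k)%N by rewrite -ltnS.
rewrite -[X in _ * X]mulr_natr; apply: (@etrans _ _ (k`!%:R^-1 * 'C(k, i)%:R * (a ^+ i * b ^+ (k - i)))).
  by ring.
by rewrite fact_binV // mulrACA.
Qed.

(** The product of the partial sums and the partial sum of the Cauchy product differ by the terms
    off the triangle. These are bounded by the same terms for the real exponential at nrm A and nrm
    B, where they tend to 0 by the addition formula for [expR]. *)
Lemma mexpD m (A B : 'M[C]_m) : GRing.comm A B -> mexp (A + B) = mexp A *m mexp B.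
Proof.
move=> AB; apply: tends_unique (mexp_tends _) _.
pose a := nrm A; pose b := nrm B.
pose v n := nrm1 R m ^+ 2 *
  (series (exp_coeff a) n * series (exp_coeff b) n - series (exp_coeff (a + b)) n).
have v0 : v n @[n --> \oo] --> (0 : R).
  rewrite -[X in _ --> X](mulr0 (nrm1 R m ^+ 2)); apply: cvgM; first exact: cvg_cst.
  rewrite -[X in _ --> X](subrr (expR (a + b))).
  apply: cvgB; last exact: is_cvg_series_exp_coeff.
  by rewrite expRD; apply: cvgM; exact: is_cvg_series_exp_coeff.
have H n : nrm (psum A n *m psum B n - psum (A + B) n) <= v n.
  rewrite /psum /series /=.
  under [X in _ - X]eq_bigr do rewrite mx_expD_term //.
  rewrite mulmx_suml; under [X in X - _]eq_bigr do rewrite mulmx_sumr.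
  rewrite (prod_sub_triangle
    (fun i j => ((i`!%:R)^-1 *: A ^+ i) * ((j`!%:R)^-1 *: B ^+ j))).
  rewrite /v /series /=.
  under [X in _ - X]eq_bigr do rewrite expR_term.
  have -> : (\sum_(0 <= k < n) exp_coeff a k) * (\sum_(0 <= k < n) exp_coeff b k) =
      \sum_(0 <= i < n) \sum_(0 <= j < n) exp_coeff a i * exp_coeff b j.
    by rewrite mulr_suml; apply: eq_bigr => i _; rewrite mulr_sumr.
  rewrite (prod_sub_triangle (fun i j => exp_coeff a i * exp_coeff b j)).
  rewrite [in leRHS]mulr_sumr; apply: le_trans (nrm_sum _ _ _) _.
  apply: ler_sum => i _; rewrite [in leRHS]mulr_sumr.
  apply: le_trans (nrm_sum _ _ _) _; apply: ler_sum => j _.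
  apply: le_trans (nrmM _ _) _.
  apply: le_trans (ler_pM (nrm_ge0 _) (nrm_ge0 _) (nrm_term A i) (nrm_term B j)) _.
  by rewrite expr2 mulrACA.
have := tendsM (mexp_tends A) (mexp_tends B) => T.
have T0 : tends (fun n => psum A n *m psum B n - psum (A + B) n) 0.
  by apply: (@tends_le _ _ _ _ _ v) => // n; rewrite subr0.
have := tendsD T (tendsZ (-1) T0).
rewrite scaler0 addr0; congr tends; apply/funext => n.
by rewrite scaleN1r opprB addrC subrK.
Qed.

Lemma mexpM m (A : 'M[C]_m) k : mexp (A *+ k) = mexp A ^+ k.
Proof.
elim: k => [|k IH]; first by rewrite mulr0n mexp0.
by rewrite mulrS mexpD ?IH ?exprS //; apply: commrMn.
Qed.

Lemma mexpN m (A : 'M[C]_m) : mexp A *m mexp (- A) = 1%:M.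
Proof. by rewrite -mexpD ?subrr ?mexp0 //; apply: commrN. Qed.

Lemma mexpNl m (A : 'M[C]_m) : mexp (- A) *m mexp A = 1%:M.
Proof. by rewrite -{2}[A]opprK mexpN. Qed.

(** Compare 1 + E_k with exp E_k: they differ by O(nrm (E_k)^2), and their p_k-th powers by p_k
    times as much up to a constant, since p_k nrm (E_k) stays bounded; this tends to 0. *)
Lemma pow_tends m (E : nat -> 'M[C]_m) (p : nat -> nat) L :
  tends (fun k => E k *+ p k) L -> tends E 0 ->
  tends (fun k => (1 + E k) ^+ p k) (mexp L).
Proof.
move=> EL E0.
have cE : tends (fun k => mexp (E k *+ p k)) (mexp L) by exact: mexp_cont.
pose K := nrm1 R m.
have K1 : 1 <= K by exact: nrm1_ge1.
have K0 : 0 <= K by exact: nrm1_ge0.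
have [M M0 HM] : exists2 M, 0 <= M & \forall k \near \oo, (p k)%:R * nrm (E k) <= M.
  exists (nrm L + 1); first by rewrite addr_ge0.
  have := tends_bounded EL; apply: filterS => k.
  by rewrite -scaler_nat nrmZ normc_nat.
have est k : (p k)%:R * nrm (E k) <= M ->
    nrm ((1 + E k) ^+ p k - mexp (E k *+ p k)) <=
    K ^+ 3 * (M * expR M) * (nrm (E k) * expR (nrm (E k))).
  rewrite mexpM; move: (p k) => [|q] HM'.
    by rewrite !expr0 subrr nrm0 !mulr_ge0 ?expR_ge0 ?exprn_ge0.
  set e := nrm (E k); have e0 : 0 <= e by exact: nrm_ge0.
  have qe : q%:R * e <= M.
    by apply: le_trans HM'; rewrite ler_wpM2r // ler_nat.
  have H1 i : nrm ((1 + E k) ^+ i) <= K * expR e ^+ i.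
    elim: i => [|i IH]; first by rewrite !expr0 mulr1 /K lerDr.
    rewrite exprS mulrDl mul1r; apply: le_trans (nrmD _ _) _.
    apply: (@le_trans _ _ ((1 + e) * nrm ((1 + E k) ^+ i))).
      by rewrite mulrDl mul1r lerD2l nrmM.
    rewrite exprS mulrCA; apply: ler_pM => //; first by rewrite addr_ge0.
    exact: expR_ge1Dx.
  have H2 i : nrm (mexp (E k) ^+ i) <= K * expR e ^+ i.
    rewrite -mexpM; apply: le_trans (nrm_mexp _) _; rewrite ler_wpM2l //.
    by rewrite -expRM_natl ler_expR -scaler_nat nrmZ normc_nat.
  apply: le_trans (nrm_subX q (expR_ge0 _) K0 H1 H2) _.
  have H3 : nrm (1 + E k - mexp (E k)) <= K * (e ^+ 2 * expR e).
    by rewrite nrmBC opprD addrA; exact: mexp_est.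
  apply: (@le_trans _ _ (K ^+ 2 * (q.+1%:R * expR e ^+ q) * (K * (e ^+ 2 * expR e)))).
    by apply: ler_wpM2l H3; rewrite !mulr_ge0 ?exprn_ge0 ?expR_ge0.
  have H4 : expR e ^+ q <= expR M by rewrite -expRM_natl ler_expR.
  have -> : K ^+ 2 * (q.+1%:R * expR e ^+ q) * (K * (e ^+ 2 * expR e)) =
     (q.+1%:R * e) * expR e ^+ q * (K ^+ 3 * (e * expR e)) by ring.
  have -> : K ^+ 3 * (M * expR M) * (e * expR e) =
     M * expR M * (K ^+ 3 * (e * expR e)) by ring.
  apply: ler_wpM2r; first by rewrite !mulr_ge0 ?exprn_ge0 ?expR_ge0.
  by apply: ler_pM => //; rewrite ?exprn_ge0 ?expR_ge0 ?mulr_ge0.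
have n0 : nrm (E k) @[k --> \oo] --> (0 : R).
  by move: E0; rewrite /tends; under eq_fun do rewrite subr0.
have d0 : (K ^+ 3 * (M * expR M) * (nrm (E k) * expR (nrm (E k)))) @[k --> \oo] --> (0 : R).
  rewrite -[X in _ --> X](mulr0 (K ^+ 3 * (M * expR M))); apply: cvgM; first exact: cvg_cst.
  rewrite -[X in _ --> X](mul0r (expR 0)); apply: cvgM => //.
  by apply: continuous_cvg => //; exact: continuous_expR.
have T0 : tends (fun k => (1 + E k) ^+ p k - mexp (E k *+ p k)) 0.
  apply: (@squeeze_cvgr _ _ _ _ (fun=> 0) _ _ _ _ _ d0); last exact: cvg_cst.
  near=> k; rewrite subr0 nrm_ge0 /=; apply: est.
  by near: k.
have := tendsD T0 cE; rewrite add0r; congr tends; apply/funext => n.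
by rewrite subrK.
Unshelve. all: by end_near. Qed.

End MatrixExp.

(** * Closed linear groups *)

Section Groups.
Variable R : realType.
Local Notation C := R[i].
Local Open Scope classical_set_scope.
Local Open Scope complex_scope.
Import ComplexField.Normc.

Lemma expmE n (A : 'M[C]_n.+1) : expm A = mexp A.
Proof. by rewrite /mexp unlock. Qed.

Lemma mx_mulrn m n (X : 'M[C]_(m, n)) k : X *+ k = k%:R *: X.
Proof. by rewrite scaler_nat. Qed.

Lemma tends_ext m n (u v : nat -> 'M[C]_(m, n)) l : (forall k, u k = v k) ->
  tends u l -> tends v l.
Proof. by move=> /funext ->. Qed.

(* The ring structures on 'M_m and on 'M_n.+1 are convertible but not
   syntactically equal, and comparing them is slow, hence this fixed form. *)
Definition mxpow m (A : 'M[C]_m) k : 'M[C]_m := A ^+ k.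
Lemma mxpow0 m (A : 'M[C]_m) : mxpow A 0 = 1%:M. Proof. exact: expr0. Qed.
Lemma mxpowS m (A : 'M[C]_m) k : mxpow A k.+1 = A *m mxpow A k.
Proof. exact: exprS. Qed.

Lemma invS_cvg0 : (k.+1%:R^-1 : R) @[k --> \oo] --> (0 : R).
Proof. exact: cvg_harmonic. Qed.

Lemma nrm_mexp_est m (A : 'M[C]_m) (h : C) : normc h <= 1 ->
  nrm (mexp (h *: A) - 1%:M - h *: A) <=
    nrm1 R m * (nrm A ^+ 2 * expR (nrm A)) * normc h ^+ 2.
Proof.
move=> h1; apply: le_trans (mexp_est _) _; rewrite nrmZ exprMn.
have -> : nrm1 R m * (nrm A ^+ 2 * expR (nrm A)) * normc h ^+ 2 =
  nrm1 R m * (normc h ^+ 2 * nrm A ^+ 2 * expR (nrm A)) by ring.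
apply: ler_wpM2l => //; apply: ler_wpM2l; first by rewrite mulr_ge0 ?exprn_ge0.
by rewrite ler_expR ler_piMl.
Qed.

Lemma derive1_est (f : C -> C) (L : C) (K : R) :
  (forall h, normc h <= 1 -> normc (f h - f 0 - h * L) <= K * normc h ^+ 2) ->
  derive1 f 0 = L.
Proof.
move=> H; rewrite derive1E; apply: cvg_lim => //.
move=> P /nbhsC_normc [e e0 eP]; apply/nbhsC_normc.
pose d := Num.min 1 (e / (`|K| + 1)).
have K1 : 0 < `|K| + 1 by rewrite ltr_wpDl.
exists d; first by rewrite lt_min ltr01 divr_gt0.
move=> h; rewrite subr0 lt_min => /andP[h1 he] h0; apply: eP.
rewrite /= addr0 [_%:A]mulr1 [_ *: _]/(_ * _).
have nh0 : 0 < normc h.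
  rewrite lt_def normc_ge0 andbT; apply: contra h0 => /eqP/eq0_normc ->.
  by [].
have -> : h^-1 * (f h - f 0) - L = h^-1 * (f h - f 0 - h * L).
  by rewrite [RHS]mulrBr mulKf.
rewrite normcM normcV mulrC ltr_pdivrMr //.
apply: le_lt_trans (H _ (ltW h1)) _.
rewrite expr2 mulrA ltr_pM2r //.
apply: le_lt_trans (_ : (`|K| + 1) * normc h < _).
  by rewrite ler_wpM2r // (le_trans (ler_norm _)) // lerDl.
by rewrite mulrC -ltr_pdivlMr.
Qed.

Lemma derive1_mexp m (a : 'rV[C]_m) (A : 'M[C]_m) (b : 'cV[C]_m) (f : C -> C) :
  (forall t, f t = (a *m mexp (t *: A) *m b) 0 0) ->
  derive1 f 0 = (a *m A *m b) 0 0.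
Proof.
move=> fE; apply: (@derive1_est _ _ (nrm a * (nrm1 R m * (nrm A ^+ 2 * expR (nrm A))) * nrm b)).
move=> h h1; rewrite !fE scale0r mexp0 mulmx1.
have -> : (a *m mexp (h *: A) *m b) 0 0 - (a *m b) 0 0 - h * (a *m A *m b) 0 0 =
   (a *m (mexp (h *: A) - 1%:M - h *: A) *m b) 0 0.
  rewrite !(mulmxBr, mulmxBl) mulmx1 -scalemxAr -scalemxAl.
  by rewrite [in RHS]mxE [in RHS]mxE [X in _ = _ + X]mxE [X in _ = _ + - X]mxE [X in _ = _ + X + _]mxE.
apply: le_trans (normc_le_nrm _ _ _) _; apply: le_trans (nrmM _ _) _.
rewrite mulrAC ler_wpM2r // -!mulrA mulrA; apply: le_trans (nrmM _ _) _.
rewrite -[leRHS]mulrA; apply: ler_wpM2l => //; apply: le_trans (nrm_mexp_est _ h1) _.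
by rewrite !mulrA.
Qed.

Lemma tends_deriv m (A : 'M[C]_m) :
  tends (fun k => k.+1%:R *: (mexp (k.+1%:R^-1 *: A) - 1%:M)) A.
Proof.
pose K := nrm1 R m * (nrm A ^+ 2 * expR (nrm A)).
apply: (@tends_le _ _ _ _ _ (fun k => K * k.+1%:R^-1)); last first.
  by rewrite -[X in _ --> X](mulr0 K); apply: cvgM invS_cvg0; exact: cvg_cst.
move=> k; set h : C := k.+1%:R^-1.
have hk : normc h = k.+1%:R^-1 by rewrite normcV normc_nat.
have h1 : normc h <= 1 by rewrite hk invf_le1 ?ltr0n // ler1n.
have hh : k.+1%:R * h = 1 by rewrite mulfV // pnatr_eq0.
have -> : k.+1%:R *: (mexp (h *: A) - 1%:M) - A =
   k.+1%:R *: (mexp (h *: A) - 1%:M - h *: A).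
  by rewrite [RHS]scalerBr scalerA hh scale1r.
rewrite nrmZ normc_nat.
apply: le_trans (ler_wpM2l (ler0n _ _) (nrm_mexp_est A h1)) _.
rewrite -/K hk expr2 mulrCA [X in _ * X]mulrA mulfV ?pnatr_eq0 // mul1r.
by [].
Qed.

Lemma mexp_inj m (A B : 'M[C]_m) :
  (forall t : C, mexp (t *: A) = mexp (t *: B)) -> A = B.
Proof.
move=> AB; apply: tends_unique (tends_deriv A) _.
by under eq_fun do rewrite AB; exact: tends_deriv.
Qed.

Lemma mexp_small m (X : 'M[C]_m) : tends (fun k => mexp (k.+1%:R^-1 *: X)) 1%:M.
Proof.
have <- : mexp 0 = 1%:M :> 'M[C]_m := mexp0 R m; apply: mexp_cont.
apply: (@tends_le _ _ _ _ _ (fun k => k.+1%:R^-1 * nrm X)).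
  by move=> k; rewrite subr0 nrmZ normcV normc_nat.
by rewrite -[X in _ --> X](mul0r (nrm X)); apply: cvgM invS_cvg0 _; exact: cvg_cst.
Qed.

Lemma mexp_nat m (X : 'M[C]_m) k : mxpow (mexp (k.+1%:R^-1 *: X)) k.+1 = mexp X.
Proof.
rewrite /mxpow -mexpM.
have -> : (k.+1%:R^-1 *: X) *+ k.+1 = k.+1%:R *: (k.+1%:R^-1 *: X) by rewrite mx_mulrn.
by rewrite scalerA mulfV ?scale1r // pnatr_eq0.
Qed.

Lemma pow_tendsZ m (E : nat -> 'M[C]_m) (p : nat -> nat) L :
  tends (fun k => (p k)%:R *: E k) L -> tends E 0 ->
  tends (fun k => mxpow (1%:M + E k) (p k)) (mexp L).
Proof.
move=> EL; apply: pow_tends; apply: tends_ext EL => k.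
by rewrite mx_mulrn.
Qed.

(** Trotter product formula. It yields the additivity of the differential of a morphism known to be
    differentiable along one-parameter subgroups. *)
Lemma trotter m (X Y : 'M[C]_m) :
  tends (fun k => mxpow (mexp (k.+1%:R^-1 *: X) *m mexp (k.+1%:R^-1 *: Y)) k.+1)
        (mexp (X + Y)).
Proof.
pose u k := mexp (k.+1%:R^-1 *: X); pose v k := mexp (k.+1%:R^-1 *: Y).
have H := @pow_tendsZ m (fun k => u k *m v k - 1%:M) (fun k => k.+1) (X + Y).
have E k : 1%:M + (u k *m v k - 1%:M) = u k *m v k by rewrite addrC subrK.
apply: (@tends_ext _ _ (fun k => mxpow (1%:M + (u k *m v k - 1%:M)) k.+1)) => [k|].
  by rewrite E.
have uv1 : tends (fun k => u k *m v k - 1%:M) 0.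
  have := tendsD (tendsM (mexp_small X) (mexp_small Y)) (tends_cst (- 1%:M)).
  by rewrite mulmx1 subrr.
apply: H => //.
have := tendsD (tendsM (tends_deriv X) (mexp_small Y)) (tends_deriv Y).
rewrite mulmx1; apply: tends_ext => k.
rewrite -/(u k) -/(v k) -scalemxAl -scalerDr mulmxBl mul1mx; congr (_ *: _).
by rewrite addrA subrK.
Qed.

Lemma tends_lin m n p q (f : 'M[C]_(m, n) -> 'M[C]_(p, q)) u l : linear f ->
  tends u l -> tends (fun k => f (u k)) (f l).
Proof.
move=> lf ul.
pose f' : {linear 'M[C]_(m, n) -> 'M[C]_(p, q)} :=
  HB.pack f (GRing.isLinear.Build _ _ _ _ f lf).
have f0 : f 0 = 0 by have := lf (-1) 0 0; rewrite scaler0 addr0 scaleN1r addNr.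
have fZ a X : f (a *: X) = a *: f X by have := lf a X 0; rewrite f0 !addr0.
pose K := \sum_i \sum_j nrm (f (delta_mx i j)).
have K0 : 0 <= K by apply: sumr_ge0 => i _; apply: sumr_ge0 => j _.
apply: (@tends_le _ _ _ _ _ (fun k => K * nrm (u k - l))); last first.
  by rewrite -[X in _ --> X](mulr0 K); apply: cvgM => //; exact: cvg_cst.
move=> k; rewrite -[f _ - f _](raddfB f') [u k - l]matrix_sum_delta.
rewrite raddf_sum /K mulr_suml; apply: le_trans (nrm_sum _ _ _) _.
apply: ler_sum => i _; rewrite mulr_suml raddf_sum.
apply: le_trans (nrm_sum _ _ _) _.
apply: ler_sum => j _; rewrite -matrix_sum_delta.
change (nrm (f ((u k - l) i j *: delta_mx i j)) <= nrm (f (delta_mx i j)) * nrm (u k - l)).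
rewrite fZ nrmZ mulrC.
by rewrite ler_wpM2l // normc_le_nrm.
Qed.

Lemma tends_vs m n (g : {vspace 'M[C]_(m, n)}) u l :
  (forall k, u k \in g) -> tends u l -> l \in g.
Proof.
move=> ug ul.
suff -> : l = projv g l by exact: memv_proj.
apply: (tends_unique ul).
have -> : u = (fun k => projv g (u k)) by apply/funext => k; rewrite projv_id.
by apply: tends_lin ul; exact: linearP.
Qed.

Lemma compact_square : compact [set z : C | `|complex.Re z| <= 1 /\ `|complex.Im z| <= 1].
Proof.
pose f (p : R * R) : C := p.1 +i* p.2.
have cf : continuous f.
  move=> [a b] P /nbhsC_normc [e e0 eP].
  exists (ball a (e / 2), ball b (e / 2)) => /=.
    by split; apply: nbhsx_ballx; rewrite divr_gt0.
  move=> [c d] [/= ac bd]; apply: eP; apply: le_lt_trans (normc_le _) _ => /=.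
  by rewrite (splitr e) ltrD // distrC.
have -> : [set z : C | `|complex.Re z| <= 1 /\ `|complex.Im z| <= 1] =
    f @` (`[(-1 : R), 1] `*` `[(-1 : R), 1]).
  apply/seteqP; split=> [[a b] /= [ha hb]|_ [[a b] /= [+ +] <-] /=].
    by exists (a, b) => //=; rewrite !in_itv /= -!ler_norml.
  by rewrite !in_itv /= -!ler_norml.
apply: continuous_compact; first exact: continuous_subspaceT.
by apply: compact_setX; exact: segment_compact.
Qed.

Lemma bolzano_weierstrass m n (D : nat -> 'M[C]_(m, n)) : (forall k, nrm (D k) <= 1) ->
  exists B, forall (e : R) N, 0 < e -> exists2 j, (N <= j)%N & nrm (D j - B) < e.
Proof.
move=> D1.
have nrm_vec p q (A : 'M[C]_(p, q)) : nrm (mxvec A) = nrm A.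
  rewrite /nrm big_ord1 pair_big (reindex _ (curry_mxvec_bij p q)) /=.
  by apply: eq_bigr => -[i j] _ /=; rewrite mxvecE.
pose K := [set v : 'rV[C]_(m * n) | forall i,
   [set z : C | `|complex.Re z| <= 1 /\ `|complex.Im z| <= 1] (v ord0 i)].
have cK : compact K.
  apply: (@rV_compact C _ (fun=> [set z : C | `|complex.Re z| <= 1 /\ `|complex.Im z| <= 1])).
  by move=> i; exact: compact_square.
have FK : ((fun k => mxvec (D k)) @ \oo) K.
  exists 0 => // k _ /= i; split; [apply: le_trans (normc_Re _) _|apply: le_trans (normc_Im _) _];
    by apply: le_trans (normc_le_nrm _ _ _) _; rewrite nrm_vec.
have [v [_ cv]] := cK _ _ FK.
exists (vec_mx v) => e N e0.
have [w [[j Nj <-]]] : ([set mxvec (D k) | k in [set k | (N <= k)%N]] `&`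
    [set w | nrm (w - v) < e]) !=set0.
  apply: cv; last by apply/nbhs_nrm; exists e.
  by exists N => // k Nk; exists k.
by exists j => //; rewrite -nrm_vec linearB /= vec_mxK.
Qed.

Lemma conj_comm m (P A B : 'M[C]_m) : P \in unitmx -> A *m P = P *m B ->
  A = P *m B *m invmx P.
Proof. by move=> u H; rewrite -H -mulmxA mulmxV ?mulmx1. Qed.

Lemma conj_mexp m (x X : 'M[C]_m) : x \in unitmx ->
  mexp (x *m X *m invmx x) = x *m mexp X *m invmx x.
Proof.
move=> xu; apply: conj_comm => //; apply: mexp_inter.
by rewrite -!mulmxA mulVmx ?mulmx1.
Qed.

Lemma mexp_unit m (X : 'M[C]_m) : mexp X \in unitmx.
Proof. exact: (mulmx1_unit (mexpN X)).1. Qed.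

Lemma invmx_mexp m (X : 'M[C]_m) : invmx (mexp X) = mexp (- X).
Proof.
by rewrite -[RHS]mul1mx -(mulVmx (mexp_unit X)) -mulmxA mexpN mulmx1.
Qed.

Lemma tends_Ad m (X Y : 'M[C]_m) :
  tends (fun k => k.+1%:R *: (mexp (k.+1%:R^-1 *: X) *m Y *m mexp (- (k.+1%:R^-1 *: X)) - Y))
        (X *m Y - Y *m X).
Proof.
have T1 := tendsM (tendsMr Y (tends_deriv X)) (mexp_small (- X)).
have T2 := tendsMl Y (tends_deriv (- X)).
have := tendsD T1 T2; rewrite mulmx1 mulmxN; apply: tends_ext => k.
rewrite scalerN; set u := mexp (_ *: X); set v := mexp (- _).
rewrite -!scalemxAl -scalemxAr -scalerDr; congr (_ *: _).
rewrite !mulmxBl mul1mx !mulmxBr mulmx1.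
by rewrite addrA subrK.
Qed.

Section OneGroup.
Variable N : nat.
Local Notation M := 'M[C]_N.
Variables (G : set M) (g : {vspace M}).

(** The relation between the group and its Lie algebra in terms of [*m] and [mexp]. As g is a
    complex subspace, [Gexp] covers exp (t X) for complex t, while [Glie] tests real t. *)
Record group_with_lie : Prop := GroupWithLie {
  G1 : G 1%:M;
  GM : forall x y, G x -> G y -> G (x *m y);
  Gunit : forall x, G x -> x \in unitmx;
  GV : forall x, G x -> G (invmx x);
  Gexp : forall X, X \in g -> G (mexp X);
  Glie : forall X, (forall t : R, G (mexp (t%:C *: X))) -> X \in g }.

Hypothesis GG : group_with_lie.
Let G1 := G1 GG. Let GM := GM GG. Let Gunit := Gunit GG. Let GV := GV GG.
Let Gexp := Gexp GG. Let Glie := Glie GG.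

Lemma GX x k : G x -> G (mxpow x k).
Proof.
move=> Gx; elim: k => [|k IH]; first by rewrite mxpow0; exact: G1.
by rewrite mxpowS; exact: GM.
Qed.

Lemma Ad_g x X : G x -> X \in g -> x *m X *m invmx x \in g.
Proof.
move=> Gx Xg; apply: Glie => t.
rewrite scalemxAl scalemxAr conj_mexp ?Gunit //.
by apply: GM; [apply: GM => //; apply: Gexp; rewrite memvZ|exact: GV].
Qed.

(** The bracket is the derivative at 0 of Ad (exp (t X)) Y, hence a limit of elements of the closed
    set g. *)
Lemma bracket_g X Y : X \in g -> Y \in g -> X *m Y - Y *m X \in g.
Proof.
move=> Xg Yg; apply: tends_vs (tends_Ad X Y) => k.
rewrite memvZ // memvB // -invmx_mexp; apply: Ad_g => //.
by apply: Gexp; rewrite memvZ.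
Qed.

(** * The differential of a representation *)

Section Rep.
Variables (m : nat) (rho D : M -> 'M[C]_m).

(** The complex factor s in [rep_deriv] records that the derivative is a complex one, taken along
    the sequence s / (k + 1). *)
Record rep_with_diff : Prop := RepWithDiff {
  rep1 : rho 1%:M = 1%:M;
  repM : forall x y, G x -> G y -> rho (x *m y) = rho x *m rho y;
  rep_cont : forall (u : nat -> M) x, (forall k, G (u k)) -> G x ->
    tends u x -> tends (fun k => rho (u k)) (rho x);
  rep_deriv : forall X (s : C), X \in g ->
    tends (fun k => k.+1%:R *: (rho (mexp ((k.+1%:R^-1 * s) *: X)) - 1%:M)) (s *: D X) }.

Hypothesis RR : rep_with_diff.
Let rep1 := rep1 RR. Let repM := repM RR. Let rep_cont := rep_cont RR.
Let rep_deriv := rep_deriv RR.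

Lemma repX x k : G x -> rho (mxpow x k) = mxpow (rho x) k.
Proof.
move=> Gx; elim: k => [|k IH]; first by rewrite !mxpow0; exact: rep1.
by rewrite !mxpowS (repM Gx) ?IH //; exact: GX.
Qed.

(** rho (exp (s X)) is the (k+1)-th power of rho (exp (s X / (k + 1))) = 1 + E_k, where (k + 1) E_k
    tends to s D X; [pow_tendsZ] gives the limit. *)
Lemma rep_exp X (s : C) : X \in g -> rho (mexp (s *: X)) = mexp (s *: D X).
Proof.
move=> Xg; have T := rep_deriv s Xg.
pose E (k : nat) : 'M[C]_m := rho (mexp ((k.+1%:R^-1 * s) *: X)) - 1%:M.
have E0 : tends E 0.
  have GE k : G (mexp ((k.+1%:R^-1 * s) *: X)) by apply: Gexp; rewrite memvZ.
  have T1 : tends (fun k => mexp ((k.+1%:R^-1 * s) *: X)) 1%:M.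
    have := mexp_small (s *: X); apply: tends_ext => k.
    by rewrite scalerA.
  have := tendsD (rep_cont GE G1 T1) (tends_cst (- 1%:M)).
  by rewrite rep1 subrr.
have := @pow_tendsZ _ E (fun k => k.+1) _ T E0.
apply: tends_unique.
apply: (@tends_ext _ _ (fun=> rho (mexp (s *: X)))) => [k|].
  rewrite /E addrC subrK -repX.
    by rewrite -scalerA mexp_nat.
  by apply: Gexp; rewrite memvZ.
exact: tends_cst.
Qed.

Lemma rep_exp1 X : X \in g -> rho (mexp X) = mexp (D X).
Proof. by move=> /(rep_exp 1); rewrite !scale1r. Qed.

Lemma drepZ a X : X \in g -> D (a *: X) = a *: D X.
Proof.
move=> Xg; apply: mexp_inj => t.
by rewrite -rep_exp ?memvZ ?scalerA ?rep_exp ?scalerA.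
Qed.

Lemma drepD X Y : X \in g -> Y \in g -> D (X + Y) = D X + D Y.
Proof.
move=> Xg Yg; apply: mexp_inj => t.
rewrite -rep_exp ?memvD // !scalerDr.
have T := rep_cont _ _ (trotter (t *: X) (t *: Y)).
have GP k : G (mxpow (mexp (k.+1%:R^-1 *: (t *: X)) *m mexp (k.+1%:R^-1 *: (t *: Y))) k.+1).
  by apply: GX; apply: GM; apply: Gexp; rewrite !memvZ.
have := T GP (Gexp _); rewrite -scalerDr => /(_ _) T'.
have {}T' := T' (memvZ t (memvD Xg Yg)).
apply: (tends_unique T').
have := trotter (t *: D X) (t *: D Y); apply: tends_ext => k.
rewrite repX; last by apply: GM; apply: Gexp; rewrite !memvZ.
rewrite repM; try by apply: Gexp; rewrite !memvZ.
have r Z : Z \in g -> mexp (k.+1%:R^-1 *: (t *: D Z)) = rho (mexp (k.+1%:R^-1 *: (t *: Z))).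
  by move=> Zg; rewrite !scalerA rep_exp.
by rewrite (r X Xg) (r Y Yg).
Qed.

Lemma drepP a X Y : X \in g -> Y \in g -> D (a *: X + Y) = a *: D X + D Y.
Proof. by move=> Xg Yg; rewrite drepD ?memvZ // drepZ. Qed.

Lemma drep_linear : linear (fun X => D (projv g X)).
Proof.
by move=> a X Y; rewrite linearP drepP ?memv_proj.
Qed.

Lemma drep_Ad x X : G x -> X \in g ->
  D (x *m X *m invmx x) = rho x *m D X *m invmx (rho x).
Proof.
move=> Gx Xg; have xu := Gunit Gx.
have ru : rho x *m rho (invmx x) = 1%:M by rewrite -repM ?mulmxV ?rep1 //; exact: GV.
have rxu : rho x \in unitmx := (mulmx1_unit ru).1.
have rV : rho (invmx x) = invmx (rho x).
  by rewrite -[LHS]mul1mx -(mulVmx rxu) -mulmxA ru mulmx1.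
apply: mexp_inj => t; rewrite -rep_exp ?Ad_g //.
have e1 (k : nat) (P X' Q : 'M[C]_k) : t *: (P *m X' *m Q) = P *m (t *: X') *m Q.
  by rewrite -scalemxAr -scalemxAl.
rewrite !e1 !conj_mexp //.
have Gt : G (mexp (t *: X)) by apply: Gexp; rewrite memvZ.
have GxV := GV Gx.
rewrite repM; [|exact: GM|by []].
by rewrite (repM Gx Gt) rV rep_exp.
Qed.

Lemma drep_bracket X Y : X \in g -> Y \in g ->
  D (X *m Y - Y *m X) = D X *m D Y - D Y *m D X.
Proof.
move=> Xg Yg; have T := tends_lin drep_linear (tends_Ad X Y).
have bg := bracket_g Xg Yg.
rewrite /= projv_id // in T; apply: tends_unique T _.
have := tends_Ad (D X) (D Y); apply: tends_ext => k.
have kX : k.+1%:R^-1 *: X \in g by rewrite memvZ.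
have Ag : mexp (k.+1%:R^-1 *: X) *m Y *m mexp (- (k.+1%:R^-1 *: X)) \in g.
  by rewrite -invmx_mexp; apply: Ad_g => //; exact: Gexp.
rewrite projv_id; last by rewrite memvZ // memvB.
have DB A A' : A \in g -> A' \in g -> D (A - A') = D A - D A'.
  move=> Hg Hg'; have -> : A - A' = (-1) *: A' + A by rewrite scaleN1r addrC.
  by rewrite (drepP _ Hg' Hg) scaleN1r addrC.
rewrite (drepZ _ (memvB Ag Yg)) (DB _ _ Ag Yg); congr (_ *: (_ - _)).
rewrite -[in RHS]invmx_mexp drep_Ad ?Gexp //.
by rewrite rep_exp // invmx_mexp.
exact: Gexp.
Qed.

End Rep.
End OneGroup.

End Groups.

(** * Density of the products of exponentials in a connected closed group *)

Section Density.
Variable R : realType.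
Local Notation C := R[i].
Local Open Scope classical_set_scope.
Local Open Scope complex_scope.
Import ComplexField.Normc.
Variable N : nat.
Local Notation M := 'M[C]_N.
Variables (G : set M) (g : {vspace M}).

Inductive expgen : M -> Prop :=
| expgen1 : expgen 1%:M
| expgenM X x : X \in g -> expgen x -> expgen (mexp X *m x).

Definition exp_dense := forall x, G x -> forall e : R, 0 < e ->
  exists2 y, expgen y & nrm (x - y) < e.

Lemma expgen_mul x y : expgen x -> expgen y -> expgen (x *m y).
Proof.
elim=> [|X z Xg _ IH] ey; first by rewrite mul1mx.
by rewrite -mulmxA; apply: expgenM => //; exact: IH.
Qed.

Hypothesis GG : group_with_lie G g.

Lemma expgen_G x : expgen x -> G x.
Proof.
elim=> [|X z Xg _ IH]; first exact: (G1 GG).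
by apply: (GM GG) => //; exact: (Gexp GG).
Qed.

Hypothesis Gclosed : forall (u : nat -> M) x, (forall k, G (u k)) -> tends u x ->
  x \in unitmx -> G x.

Lemma tendsZr m n (c : nat -> C) (u : nat -> 'M[C]_(m, n)) a l :
  (normc (c k - a)) @[k --> \oo] --> (0 : R) -> tends u l ->
  tends (fun k => c k *: u k) (a *: l).
Proof.
move=> ca ul.
pose w k := normc (c k - a) * nrm (u k - l) + normc a * nrm (u k - l)
   + normc (c k - a) * nrm l.
apply: (@tends_le _ _ _ _ _ w) => [k|].
  have -> : c k *: u k - a *: l = (c k - a) *: (u k - l) + a *: (u k - l) + (c k - a) *: l.
    by rewrite !scalerBr !scalerBl; apply/matrixP => i j; rewrite !mxE; ring.
  apply: le_trans (nrmD _ _) _; rewrite /w nrmZ lerD2r.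
  by apply: le_trans (nrmD _ _) _; rewrite !nrmZ.
have -> : (0 : R) = 0 * 0 + normc a * 0 + 0 * nrm l by rewrite !(mulr0, mul0r, addr0).
apply: cvgD; [apply: cvgD; apply: cvgM => //; exact: cvg_cst|].
by apply: cvgM => //; exact: cvg_cst.
Qed.

(* A limit direction at 1 of elements of G is tangent to G: if z_k = 1 + n_k D_k
   with n_k -> 0 and D_k -> B, then z_k ^ floor (t / n_k) -> exp (t B). *)
Lemma limit_direction (n : nat -> R) (D : nat -> M) B :
  (forall k, 0 < n k) -> n k @[k --> \oo] --> (0 : R) ->
  (forall k, G (1%:M + (n k)%:C *: D k)) -> tends D B -> B \in g.
Proof.
move=> n0 nl Gz DB.
have pos (t : R) : 0 <= t -> G (mexp (t%:C *: B)).
  move=> t0; pose p k := Num.trunc (t / n k).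
  have pn k : `|(p k)%:R * n k - t| <= n k.
    have tn : 0 <= t / n k by rewrite divr_ge0 // ltW.
    have /andP[h1 h2] := Num.Theory.trunc_itv tn.
    rewrite -/(p k) in h1 h2.
    have h1' : (p k)%:R * n k <= t by rewrite -ler_pdivlMr.
    have h2' : t < (p k).+1%:R * n k by rewrite -ltr_pdivrMr.
    rewrite ler_norml; apply/andP; split; last first.
      by rewrite lerBlDr (le_trans h1') // lerDr ltW.
    rewrite lerBrDr; move: h2'; rewrite -natr1 mulrDl mul1r => /ltW h2'.
    by rewrite addrC lerBlDr.
  have pn0 : normc (((p k)%:R * n k)%:C - t%:C) @[k --> \oo] --> (0 : R).
    apply: squeeze0 nl => k; rewrite normc_ge0 -rmorphB normcR.
    exact: pn.
  have T1 : tends (fun k => (p k)%:R *: ((n k)%:C *: D k)) (t%:C *: B).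
    apply: tends_ext (tendsZr pn0 DB) => k.
    by rewrite scalerA rmorphM rmorph_nat.
  have T0 : tends (fun k => (n k)%:C *: D k) 0.
    rewrite -(scale0r B); apply: tendsZr DB.
    apply: squeeze0 nl => k; rewrite normc_ge0 subr0 normcR ger0_norm ?lexx //.
    exact: ltW (n0 k).
  apply: (Gclosed _ (pow_tendsZ T1 T0)); last exact: mexp_unit.
  by move=> k; apply: (GX GG); exact: Gz.
apply: (Glie GG) => t; have [t0|t0] := leP 0 t; first exact: pos.
rewrite -[t]opprK rmorphN scaleNr -invmx_mexp; apply: (GV GG); apply: pos.
by rewrite oppr_ge0 ltW.
Qed.

(** Suppose that z_k tends to 1 in G and violates the bound. The normalized directions D_k of z_k -
    1 accumulate, by compactness, at some B, which is in g by [limit_direction]; then X = nrm (z_k -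
    1) B contradicts the violation for large k. *)
Lemma near_half : exists2 d : R, 0 < d & forall z, G z -> nrm (z - 1%:M) < d ->
  exists2 X, X \in g & nrm (mexp (- X) *m z - 1%:M) <= 2^-1 * nrm (z - 1%:M).
Proof.
apply: contrapT => H.
have {}H (k : nat) : exists z, [/\ G z, nrm (z - 1%:M) < k.+1%:R^-1 &
    forall X, X \in g -> 2^-1 * nrm (z - 1%:M) < nrm (mexp (- X) *m z - 1%:M)].
  apply: contrapT => Hk; apply: H; exists (k.+1%:R^-1); first by rewrite invr_gt0.
  move=> z Gz zk; apply: contrapT => HX; apply: Hk; exists z; split => // X Xg.
  by rewrite ltNge; apply/negP => h; apply: HX; exists X.
have [z Hz] := choice H.
pose n k := nrm (z k - 1%:M); pose D k := (n k)^-1%:C *: (z k - 1%:M).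
have n0 k : 0 < n k.
  rewrite lt_def nrm_ge0 andbT; apply/negP => /eqP nk.
  have [_ _ /(_ 0 (mem0v _))] := Hz k.
  by rewrite oppr0 mexp0 mul1mx -/(n k) nk mulr0 ltxx.
have D1 k : nrm (D k) = 1.
  by rewrite /D nrmZ normcR ger0_norm ?invr_ge0 ?mulVf ?gt_eqF // ltW.
have zD k : z k = 1%:M + (n k)%:C *: D k.
  rewrite /D scalerA -rmorphM mulfV ?gt_eqF // scale1r addrC subrK //.
have D1' k : nrm (D k) <= 1 by rewrite D1.
have [B HB] := bolzano_weierstrass D1'.
have H2 k : exists j, (k <= j)%N /\ nrm (D j - B) < k.+1%:R^-1.
  by have [|j kj jB] := HB k.+1%:R^-1 k; [rewrite invr_gt0|exists j].
have [phi Hphi] := choice H2.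
have DB : tends (fun k => D (phi k)) B.
  apply: (@tends_le _ _ _ _ _ (fun k => k.+1%:R^-1)); last exact: invS_cvg0.
  by move=> k; apply: ltW; exact: (Hphi k).2.
have nphi : n (phi k) @[k --> \oo] --> (0 : R).
  apply: squeeze0 (@invS_cvg0 R) => k; rewrite ltW //=.
  have [_ /ltW h _] := Hz (phi k); apply: le_trans h _.
  by rewrite lef_pV2 ?posrE // ler_nat ltnS (Hphi k).1.
have Bg : B \in g.
  apply: (@limit_direction (fun k => n (phi k)) (fun k => D (phi k))) nphi _ DB => k.
    exact: n0.
  by have [+ _ _] := Hz (phi k); rewrite {1}zD.
pose K := nrm1 R N * (nrm (- B) ^+ 2 * expR (nrm (- B))).
have K0 : 0 <= K by rewrite !mulr_ge0 ?exprn_ge0 ?expR_ge0.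
pose L := nrm B + K * (nrm1 R N + 1).
have v0 : (nrm (D (phi k) - B) + n (phi k) * L) @[k --> \oo] --> (0 : R).
  rewrite -[X in _ --> X](addr0 (0 : R)); apply: cvgD => //.
  by rewrite -[X in _ --> X](mul0r L); apply: cvgM => //; exact: cvg_cst.
(* With s = nrm (z - 1), the matrix exp (- s B) z - 1 is s (D - B) up to O(s^2); dividing the
   violated bound by s gives this inequality, whose right-hand side tends to 0. *)
have v2 k : 2^-1 < nrm (D (phi k) - B) + n (phi k) * L.
  set j := phi k; set s := n j; have s0 : 0 < s by exact: n0.
  have s1 : s <= 1.
    have [_ /ltW h _] := Hz j; apply: le_trans h _.
    by rewrite invf_le1 ?ltr0n // ler1n.
  rewrite -(ltr_pM2l s0) mulrC.
  have [_ _ /(_ (s%:C *: B))] := Hz j.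
  rewrite memvZ // => /(_ isT) /lt_le_trans; apply.
  rewrite -scalerN.
  have ns : normc s%:C = s by rewrite normcR gtr0_norm.
  have ns1 : normc s%:C <= 1 by rewrite ns.
  have := nrm_mexp_est (- B) ns1; rewrite ns -/K.
  set P := mexp _; set rho := P - 1%:M - _ => rK.
  have PE : P = 1%:M + s%:C *: (- B) + rho.
    by rewrite /rho -[P - 1%:M - _]addrA -opprD [RHS]addrC subrK.
  have -> : P *m z j - 1%:M =
    s%:C *: (D j - B) - (s * s)%:C *: (B *m D j) + rho *m z j.
    rewrite {1}PE mulmxDl addrAC; congr (_ + _).
    rewrite zD -/s mulmxDl mul1mx -scalemxAl mulNmx mulmxDr mulmx1 -scalemxAr.
    rewrite rmorphM -scalerA scalerBr; apply/matrixP => a b; rewrite !mxE; ring.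
  have nz : nrm (z j) <= nrm1 R N + 1.
    rewrite zD; apply: le_trans (nrmD _ _) _; rewrite nrmZ D1 mulr1 ns.
    by rewrite lerD // lerDr.
  apply: le_trans (nrmD _ _) _.
  have e1 : nrm (rho *m z j) <= s * (s * (K * (nrm1 R N + 1))).
    apply: le_trans (nrmM _ _) _; rewrite mulrA -expr2 mulrA [_ * K]mulrC.
    by apply: ler_pM.
  have e2 : nrm (s%:C *: (D j - B) - (s * s)%:C *: (B *m D j)) <=
     s * nrm (D j - B) + s * (s * nrm B).
    apply: le_trans (nrmD _ _) _; rewrite nrmN !nrmZ ns lerD2l normcR.
    rewrite ger0_norm; last by rewrite mulr_ge0 // ltW.
    rewrite mulrA; apply: ler_wpM2l; first by rewrite mulr_ge0 // ltW.
    by apply: le_trans (nrmM _ _) _; rewrite D1 mulr1.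
  apply: le_trans (lerD e2 e1) _.
  by rewrite /L -addrA -!mulrDr.
have /cvgrPdist_lt /(_ 2^-1) := v0; rewrite invr_gt0 ltr0n => /(_ isT) [k _ /(_ k)] /=.
rewrite leqnn sub0r normrN => /(_ isT); rewrite ger0_norm.
  by move/lt_trans/(_ (v2 k)); rewrite ltxx.
exact: le_trans (_ : 0 <= 2^-1) (ltW (v2 k)).
Qed.

(** Iterating [near_half] writes z = y z' with y a product of exponentials and z' - 1 at least
    halved at each stage. Since nrm y <= nrm z + nrm y / 2, the factors y are bounded and z - y = y
    (z' - 1) tends to 0. *)
Lemma near_gen : exists2 d : R, 0 < d & forall z, G z -> nrm (z - 1%:M) < d ->
  forall e : R, 0 < e -> exists2 y, expgen y & nrm (z - y) < e.
Proof.
have [d d0 Hd] := near_half.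
exists (Num.min d 2^-1); first by rewrite lt_min d0 invr_gt0 ltr0n.
move=> z Gz; rewrite lt_min => /andP[zd z2] e e0.
have step k : exists y z', [/\ expgen y, G z', z = y *m z' &
    nrm (z' - 1%:M) <= 2^-1 ^+ k * nrm (z - 1%:M)].
  elim: k => [|k [y [z' [ey Gz' zE z'k]]]].
    by exists 1%:M, z; split; rewrite ?mul1mx ?expr0 ?mul1r //; exact: expgen1.
  have z'd : nrm (z' - 1%:M) < d.
    apply: le_lt_trans z'k (le_lt_trans _ zd).
    by rewrite ler_piMl // exprn_ile1 // ?invr_ge0 // invf_le1 // ler1n.
  have [X Xg HX] := Hd z' Gz' z'd.
  exists (y *m mexp X), (mexp (- X) *m z'); split.
  - by apply: expgen_mul => //; rewrite -[mexp X]mulmx1; apply: expgenM => //; exact: expgen1.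
  - by apply: (GM GG) => //; apply: (Gexp GG); rewrite memvN.
  - by rewrite -mulmxA (mulmxA (mexp X)) mexpN mul1mx; exact: zE.
  - apply: le_trans HX _; rewrite exprS -mulrA ler_wpM2l // invr_ge0 //.
have geo : (2^-1 ^+ k * (2 * nrm z)) @[k --> \oo] --> (0 : R).
  rewrite -[X in _ --> X](mul0r (2 * nrm z)); apply: cvgM; last exact: cvg_cst.
  by apply: cvg_expr; rewrite ger0_norm ?invr_ge0 // invf_lt1 // ltr1n.
have /cvgrPdist_lt /(_ e e0) [k _ /(_ k)] /= := geo.
rewrite leqnn sub0r normrN => /(_ isT); rewrite ger0_norm; last first.
  by rewrite !mulr_ge0 // exprn_ge0 // invr_ge0.
move=> ke; have [y [z' [ey Gz' zE z'k]]] := step k.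
exists y => //.
have zy : z - y = y *m (z' - 1%:M) by rewrite mulmxBr mulmx1 -zE.
have half : nrm (z' - 1%:M) <= 2^-1.
  apply: le_trans z'k _; apply: le_trans (ltW z2).
  by rewrite ler_piMl // exprn_ile1 // ?invr_ge0 // invf_le1 // ler1n.
have ny : nrm y <= 2 * nrm z.
  have h : nrm y <= nrm z + nrm y * 2^-1.
    have {1}-> : y = z - (z - y) by rewrite opprB addrC subrK.
    apply: le_trans (nrmD _ _) _; rewrite nrmN zy lerD2l.
    by apply: le_trans (nrmM _ _) _; rewrite ler_wpM2l.
  by lra.
rewrite zy; apply: le_lt_trans ke; apply: le_trans (nrmM _ _) _.
rewrite mulrC; apply: ler_pM => //.
apply: le_trans z'k _; rewrite ler_piMr ?exprn_ge0 ?invr_ge0 //.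
by apply: le_trans (ltW z2) _; rewrite invf_le1 // ler1n.
Qed.

Hypothesis Gconn : connected G.

(** The closure of the products of exponentials is closed and also open in G: if x is in it and y is
    near x, then x^-1 y is near 1, where [near_gen] applies. Connectedness makes it all of G. *)
Lemma exp_dense_connected : exp_dense.
Proof.
pose H := G `&` closure [set y | expgen y].
have HP x : closure [set y | expgen y] x <->
    forall e : R, 0 < e -> exists2 y, expgen y & nrm (x - y) < e.
  split=> [cx e e0|cx P /nbhs_nrm [e e0 eP]].
    have : nbhs x [set y | nrm (y - x) < e] by apply/nbhs_nrm; exists e.
    by move=> /cx [y [/= ey yx]]; exists y => //; rewrite nrmBC.
  have [y ey xy] := cx e e0; exists y; split => //.
  by apply: eP; rewrite nrmBC.
have [d d0 Hd] := near_gen.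
suff E : H = G.
  move=> x Gx; have : H x by rewrite E.
  by case=> _ /HP.
 apply: Gconn.
- exists 1%:M; split; first exact: (G1 GG).
  by apply/HP => e e0; exists 1%:M; rewrite ?subrr ?nrm0 //; exact: expgen1.
- exists [set y | exists2 x, H x & nrm (invmx x *m y - 1%:M) < d].
    rewrite openE => y [x Hx xy]; apply/nbhs_nrm.
    pose e := (d - nrm (invmx x *m y - 1%:M)) / (nrm (invmx x) + 1).
    have p1 : 0 < nrm (invmx x) + 1 by rewrite ltr_wpDl.
    exists e; first by rewrite divr_gt0 // subr_gt0.
    move=> w wy; exists x => //.
    have -> : invmx x *m w - 1%:M = invmx x *m (w - y) + (invmx x *m y - 1%:M).
      by rewrite mulmxBr addrA subrK.
    apply: le_lt_trans (nrmD _ _) _; rewrite -ltrBrDr.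
    apply: le_lt_trans (nrmM _ _) _.
    apply: le_lt_trans (_ : (nrm (invmx x) + 1) * nrm (w - y) < _).
      by rewrite ler_wpM2r // lerDl.
    by rewrite mulrC -ltr_pdivlMr.
  apply/seteqP; split=> [y Hy|y [Gy [x [Gx /HP cx] xy]]].
    split; first by case: Hy.
    exists y => //; rewrite mulVmx ?subrr ?nrm0 //; exact: (Gunit GG Hy.1).
  split => //; apply/HP => e e0.
  pose z := invmx x *m y.
  have Gz : G z by apply: (GM GG) => //; exact: (GV GG).
  have yE : y = x *m z by rewrite /z mulmxA mulmxV ?mul1mx //; exact: (Gunit GG).
  have zp : 0 < nrm z + 1 by rewrite ltr_wpDl.
  have [|y1 e1 h1] := cx (Num.min 1 (e / 2 / (nrm z + 1))).
    by rewrite lt_min ltr01 !divr_gt0.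
  have yp : 0 < nrm y1 + 1 by rewrite ltr_wpDl.
  have [|y2 e2 h2] := Hd z Gz xy (e / 2 / (nrm y1 + 1)); first by rewrite !divr_gt0.
  exists (y1 *m y2); first exact: expgen_mul.
  have -> : y - y1 *m y2 = (x - y1) *m z + y1 *m (z - y2).
    by rewrite mulmxBl mulmxBr -yE addrA subrK.
  move: h1; rewrite lt_min => /andP[_ h1].
  apply: le_lt_trans (nrmD _ _) _; rewrite [e]splitr ltrD //.
    apply: le_lt_trans (nrmM _ _) _.
    apply: le_lt_trans (_ : nrm (x - y1) * (nrm z + 1) < _).
      by rewrite ler_wpM2l // lerDl.
    by rewrite -ltr_pdivlMr.
  apply: le_lt_trans (nrmM _ _) _.
  apply: le_lt_trans (_ : (nrm y1 + 1) * nrm (z - y2) < _).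
    by rewrite ler_wpM2r // lerDl.
  by rewrite mulrC -ltr_pdivlMr.
- by exists (closure [set y | expgen y]) => //; exact: closed_closure.
Qed.

End Density.

(** * Exponentials of left and right multiplication operators *)

Section ExpLin.
Variable R : realType.
Local Notation C := R[i].
Local Open Scope classical_set_scope.
Local Open Scope complex_scope.
Import ComplexField.Normc.

Lemma mxvec_linear m n : linear (@mxvec C m n).
Proof. exact: linearP. Qed.

Lemma cmxXS m (A : 'M[C]_m) i : A ^+ i.+1 = A *m A ^+ i.
Proof. exact: exprS. Qed.

Lemma cmxXSr m (A : 'M[C]_m) i : A ^+ i.+1 = A ^+ i *m A.
Proof. exact: exprSr. Qed.

Lemma mxvec_ext m n p (A B : 'M[C]_(m * n, p)) :
  (forall Z : 'M[C]_(m, n), mxvec Z *m A = mxvec Z *m B) -> A = B.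
Proof. by move=> H; apply/row_matrixP => i; rewrite !rowE -[delta_mx _ _]vec_mxK. Qed.

Lemma lin_mulmxP m n a (X Y : 'M[C]_m) :
  lin_mulmx (a *: X + Y) = a *: lin_mulmx X + lin_mulmx Y :> 'M[C]_(m * n).
Proof.
apply: mxvec_ext => Z; rewrite mulmxDr -scalemxAr !mul_vec_lin /=.
by rewrite mulmxDl -scalemxAl linearD linearZ.
Qed.

Lemma lin_mulmxrP m n a (X Y : 'M[C]_n) :
  lin_mulmxr (a *: X + Y) = a *: lin_mulmxr X + lin_mulmxr Y :> 'M[C]_(m * n).
Proof.
apply: mxvec_ext => Z; rewrite mulmxDr -scalemxAr !mul_vec_lin /=.
by rewrite mulmxDr -scalemxAr linearD linearZ.
Qed.

(** [lin_mulmx P] is the matrix of Z -> P Z on vectorised matrices. This makes the entries of exp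
    (X) x coordinates on which an exponential acts, as regular functions require. *)
Lemma mexp_lin_mulmx m n (P : 'M[C]_m) (Z : 'M[C]_(m, n)) :
  mxvec Z *m mexp (lin_mulmx P) = mxvec (mexp P *m Z).
Proof.
apply: tends_unique (tendsMl _ (mexp_tends _)) _.
apply: tends_ext (tends_lin (@mxvec_linear _ _) (tendsMr Z (mexp_tends P))) => k.
rewrite /psum /series /= mulmx_suml mulmx_sumr linear_sum /=.
apply: eq_bigr => i _; rewrite -scalemxAl linearZ /= -scalemxAr; congr (_ *: _).
elim: i Z => [|i IH] Z; first by rewrite !expr0 mulmx1 mul1mx.
rewrite (cmxXS (lin_mulmx P)) cmxXSr -mulmxA IH.
by rewrite -[X in X *m _](mul_vec_lin (mulmx P)) mulmxA.
Qed.

Lemma mexp_lin_mulmxr m n (Q : 'M[C]_n) (Z : 'M[C]_(m, n)) :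
  mxvec Z *m mexp (lin_mulmxr Q) = mxvec (Z *m mexp Q).
Proof.
apply: tends_unique (tendsMl _ (mexp_tends _)) _.
apply: tends_ext (tends_lin (@mxvec_linear _ _) (tendsMl Z (mexp_tends Q))) => k.
rewrite /psum /series /= !mulmx_sumr linear_sum /=.
apply: eq_bigr => i _; rewrite -!scalemxAr linearZ /=; congr (_ *: _).
elim: i Z => [|i IH] Z; first by rewrite !expr0 !mulmx1.
rewrite (cmxXS (lin_mulmxr Q)) cmxXS mulmxA IH.
by rewrite -[X in X *m _](mul_vec_lin (mulmxr Q)) mulmxA.
Qed.

Lemma comm_lin_mulmx m n (P : 'M[C]_m) (Q : 'M[C]_n) :
  GRing.comm (lin_mulmx P : 'M[C]_(m * n)) (lin_mulmxr Q).
Proof.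
have H : lin_mulmx P *m lin_mulmxr Q = lin_mulmxr Q *m lin_mulmx P :> 'M[C]_(m * n).
  by apply: mxvec_ext => Z; rewrite !mulmxA !mul_vec_lin /= mulmxA.
exact: H.
Qed.

Lemma mexp_lin_mulmx2 m n (P : 'M[C]_m) (Q : 'M[C]_n) (Z : 'M[C]_(m, n)) :
  mxvec Z *m mexp (lin_mulmx P + lin_mulmxr Q) = mxvec (mexp P *m Z *m mexp Q).
Proof.
by rewrite (mexpD (comm_lin_mulmx P Q)) mulmxA mexp_lin_mulmx mexp_lin_mulmxr.
Qed.

Lemma mexp_tr m (A : 'M[C]_m) : mexp A^T = (mexp A)^T.
Proof.
have lt : linear (@trmx C m m) by exact: linearP.
apply: tends_unique (mexp_tends _) _.
apply: tends_ext (tends_lin lt (mexp_tends A)) => k.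
rewrite /psum /series /= linear_sum /=; apply: eq_bigr => i _.
rewrite linearZ /=; congr (_ *: _); elim: i => [|i IH]; first by rewrite !expr0 trmx1.
by rewrite cmxXS cmxXSr trmx_mul IH.
Qed.

Lemma mexp_row m1 m2 (A : 'M[C]_m1) (B : 'M[C]_m2) (u : 'rV[C]_m1) (v : 'rV[C]_m2) :
  row_mx u v *m mexp (block_mx A 0 0 B) = row_mx (u *m mexp A) (v *m mexp B).
Proof.
have HA := @mexp_inter R _ _ A (block_mx A 0 0 B) (row_mx 1%:M 0).
have HB := @mexp_inter R _ _ B (block_mx A 0 0 B) (row_mx 0 1%:M).
have -> : row_mx u v = u *m row_mx 1%:M 0 + v *m row_mx 0 1%:M.
  by rewrite !mul_mx_row !mulmx1 !mulmx0 add_row_mx addr0 add0r.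
rewrite mulmxDl -!mulmxA -HA -?HB; last 2 first.
- by rewrite mul_mx_row mul_row_block !mulmx0 !mulmx1 !mul0mx mul1mx !add0r.
- by rewrite mul_mx_row mul_row_block !mulmx0 !mulmx1 !mul0mx mul1mx !addr0.
rewrite !mulmxA !mul_mx_row !mulmx1 !mulmx0 add_row_mx addr0 add0r //.
Qed.

Lemma tends_deriv2 m (X Y : 'M[C]_m) :
  tends (fun k => k.+1%:R *: (mexp (k.+1%:R^-1 *: X) *m mexp (k.+1%:R^-1 *: Y) - 1%:M)) (X + Y).
Proof.
have := tendsD (tendsM (tends_deriv X) (mexp_small Y)) (tends_deriv Y).
rewrite mulmx1; apply: tends_ext => k.
rewrite -scalemxAl -scalerDr mulmxBl mul1mx; congr (_ *: _).
by rewrite addrA subrK.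
Qed.

Lemma tends_tr m n (u : nat -> 'M[C]_(m, n)) l : tends u l ->
  tends (fun k => (u k)^T) l^T.
Proof. by apply: tends_lin; exact: linearP. Qed.

Lemma tends_mxvec m n (u : nat -> 'M[C]_(m, n)) l : tends u l ->
  tends (fun k => mxvec (u k)) (mxvec l).
Proof. by apply: tends_lin; exact: linearP. Qed.

Lemma tends_near0 m n (u : nat -> 'M[C]_(m, n)) l : tends u l ->
  (\forall k \near \oo, u k = 0) -> l = 0.
Proof.
move=> ul u0; apply: tends_unique ul _; apply/cvg_tends.
by apply: cvg_near_cst.
Qed.

End ExpLin.

(** * Regular functions and the identity principle *)

Section RegFun.
Variable R : realType.
Local Notation C := R[i].
Local Open Scope classical_set_scope.
Local Open Scope complex_scope.
Import ComplexField.Normc.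
Variable N : nat.
Local Notation M := 'M[C]_N.
Variables (G : set M) (g : {vspace M}).

(* The coordinates of y span a space of functions stable under left
   translation by exp g; the entries of x, x^-1 and of any representation are
   of this kind, and no algebraic geometry on G is needed. *)
Record reg_data m (y : M -> 'rV[C]_m) (A : M -> 'M[C]_m) : Prop := RegData {
  reg_exp : forall X x, X \in g -> G x -> y (mexp X *m x) = y x *m mexp (A X);
  reg_lin : forall a X Y, X \in g -> Y \in g -> A (a *: X + Y) = a *: A X + A Y;
  reg_cont : forall u x, (forall k, G (u k)) -> G x -> tends u x ->
    tends (fun k => y (u k)) (y x) }.

Definition regfun (f : M -> C) : Prop := exists m y A (l : 'cV[C]_m),
  @reg_data m y A /\ forall x, G x -> f x = (y x *m l) 0 0.

Lemma regfun_ext f h : (forall x, G x -> f x = h x) -> regfun f -> regfun h.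
Proof.
move=> fh [m [y [A [l [yA fE]]]]]; exists m, y, A, l; split=> // x Gx.
by rewrite -fh ?fE.
Qed.

Lemma regfun_cst c : regfun (fun=> c).
Proof.
exists 1%N, (fun=> 1%:M), (fun=> 0), (c%:M); split; last first.
  by move=> x _; rewrite mul1mx mxE.
split=> [X x _ _|a X Y _ _|u x _ _ _]; first by rewrite mexp0 mulmx1.
  by rewrite scaler0 addr0.
exact: tends_cst.
Qed.

Lemma reg_data_row m1 m2 y1 A1 y2 A2 : @reg_data m1 y1 A1 -> @reg_data m2 y2 A2 ->
  reg_data (fun x => row_mx (y1 x) (y2 x)) (fun X => block_mx (A1 X) 0 0 (A2 X)).
Proof.
move=> d1 d2; split=> [X x Xg Gx|a X Y Xg Yg|u x Gu Gx ux].
- by rewrite mexp_row (reg_exp d1) ?(reg_exp d2).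
- rewrite (reg_lin d1) ?(reg_lin d2) // scale_block_mx !scaler0 add_block_mx.
  by rewrite !addr0.
- have -> : (fun k => row_mx (y1 (u k)) (y2 (u k))) =
     (fun k => y1 (u k) *m row_mx 1%:M 0 + y2 (u k) *m row_mx 0 1%:M).
    apply/funext => k.
    by rewrite !mul_mx_row !mulmx1 !mulmx0 add_row_mx addr0 add0r.
  have := tendsD (tendsMr (row_mx 1%:M 0) (reg_cont d1 Gu Gx ux))
                 (tendsMr (row_mx 0 1%:M) (reg_cont d2 Gu Gx ux)).
  by rewrite !mul_mx_row !mulmx1 !mulmx0 add_row_mx addr0 add0r.
Qed.

(** Tensor product: a product of two coefficients is a coefficient of the outer product of the
    coordinate vectors, on which the sum of two commuting multiplication operators acts. *)
Lemma reg_data_tensor m1 m2 y1 A1 y2 A2 : @reg_data m1 y1 A1 -> @reg_data m2 y2 A2 ->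
  reg_data (fun x => mxvec ((y1 x)^T *m y2 x))
           (fun X => lin_mulmx (A1 X)^T + lin_mulmxr (A2 X)).
Proof.
move=> d1 d2; split=> [X x Xg Gx|a X Y Xg Yg|u x Gu Gx ux].
- rewrite mexp_lin_mulmx2 mexp_tr (reg_exp d1) ?(reg_exp d2) //.
  by rewrite trmx_mul !mulmxA.
- rewrite (reg_lin d1 _ Xg Yg) (reg_lin d2 _ Xg Yg) linearP lin_mulmxP lin_mulmxrP.
  by rewrite scalerDr !addrA; congr (_ + _); rewrite -!addrA; congr (_ + _); rewrite addrC.
- apply: tends_mxvec; apply: tendsM; last exact: (reg_cont d2).
  by apply: tends_tr; exact: (reg_cont d1).
Qed.

Lemma regfunD f h : regfun f -> regfun h -> regfun (fun x => f x + h x).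
Proof.
move=> [m1 [y1 [A1 [l1 [d1 f1]]]]] [m2 [y2 [A2 [l2 [d2 f2]]]]].
exists (m1 + m2)%N, (fun x => row_mx (y1 x) (y2 x)), (fun X => block_mx (A1 X) 0 0 (A2 X)), (col_mx l1 l2); split; first exact: reg_data_row d1 d2.
by move=> x Gx; rewrite f1 // f2 // mul_row_col [RHS]mxE.
Qed.

Lemma regfunM f h : regfun f -> regfun h -> regfun (fun x => f x * h x).
Proof.
move=> [m1 [y1 [A1 [l1 [d1 f1]]]]] [m2 [y2 [A2 [l2 [d2 f2]]]]].
exists (m1 * m2)%N, (fun x => mxvec ((y1 x)^T *m y2 x)), (fun X => lin_mulmx (A1 X)^T + lin_mulmxr (A2 X)), (mxvec (l1 *m l2^T))^T; split; first exact: reg_data_tensor d1 d2.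
move=> x Gx; rewrite f1 // f2 //.
rewrite mxvec_dotmul mulmxA -mulmxA -trmx_mul.
by rewrite [RHS]mxE big_ord1 [X in _ = _ * X]mxE.
Qed.

Lemma regfunN f : regfun f -> regfun (fun x => - f x).
Proof.
move=> rf; apply: regfun_ext (regfunM (regfun_cst (-1)) rf) => x _.
by rewrite mulN1r.
Qed.

Lemma regfun_sum I (r : seq I) (P : pred I) (F : I -> M -> C) :
  (forall i, P i -> regfun (F i)) -> regfun (fun x => \sum_(i <- r | P i) F i x).
Proof.
move=> HF; elim: r => [|i r IH].
  by apply: regfun_ext (regfun_cst 0) => x _; rewrite big_nil.
case Pi: (P i).
  by apply: regfun_ext (regfunD (HF i Pi) IH) => x _; rewrite big_cons Pi.
by apply: regfun_ext IH => x _; rewrite big_cons Pi.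
Qed.

Lemma regfun_prod I (r : seq I) (P : pred I) (F : I -> M -> C) :
  (forall i, P i -> regfun (F i)) -> regfun (fun x => \prod_(i <- r | P i) F i x).
Proof.
move=> HF; elim: r => [|i r IH].
  by apply: regfun_ext (regfun_cst 1) => x _; rewrite big_nil.
case Pi: (P i).
  by apply: regfun_ext (regfunM (HF i Pi) IH) => x _; rewrite big_cons Pi.
by apply: regfun_ext IH => x _; rewrite big_cons Pi.
Qed.

Lemma regfun_det m (F : M -> 'M[C]_m) : (forall i j, regfun (fun x => F x i j)) ->
  regfun (fun x => \det (F x)).
Proof.
move=> HF; apply: regfun_sum => s _; apply: regfunM; first exact: regfun_cst.
by apply: regfun_prod => i _; exact: HF.
Qed.

Hypothesis GG : group_with_lie G g.

Lemma regfun_entry i j : regfun (fun x => x i j).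
Proof.
exists (N * N)%N, (fun x => mxvec x), (fun X => lin_mulmx X), (delta_mx (mxvec_index i j) 0).
split; last by move=> x _; rewrite -colE mxE mxvecE.
split=> [X x Xg Gx|a X Y Xg Yg|u x Gu Gx ux]; last exact: tends_mxvec.
  by rewrite mexp_lin_mulmx.
exact: lin_mulmxP.
Qed.

Lemma tends_invmx (u : nat -> M) x : (forall k, u k \in unitmx) -> x \in unitmx ->
  tends u x -> tends (fun k => invmx (u k)) (invmx x).
Proof.
move=> uu xu ux; pose c := nrm (invmx x).
have B : \forall k \near \oo, nrm (invmx (u k)) <= 2 * c.
  have c1 : 0 < 2 * (c + 1) by rewrite mulr_gt0 // ltr_wpDl // nrm_ge0.
  have /cvgrPdist_lt /(_ (2 * (c + 1))^-1) := ux.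
  rewrite invr_gt0 c1 => /(_ isT); apply: filterS => k /=.
  rewrite sub0r normrN ger0_norm ?nrm_ge0 // => h.
  set v := invmx (u k).
  (* Resolvent identity: for u_k close to x its last term is at most nrm v / 2, whence nrm v <= 2
     c. *)
  have vE : v = invmx x - v *m (u k - x) *m invmx x.
    rewrite mulmxBr mulVmx // mulmxBl mul1mx -mulmxA mulmxV // mulmx1.
    by rewrite opprB addrC subrK.
  have h1 : nrm v <= c + nrm v * (2 * (c + 1))^-1 * c.
    rewrite {1}vE; apply: le_trans (nrmD _ _) _; rewrite nrmN lerD2l.
    apply: le_trans (nrmM _ _) _; rewrite ler_wpM2r ?nrm_ge0 //.
    apply: le_trans (nrmM _ _) _; rewrite ler_wpM2l ?nrm_ge0 //; exact: ltW.
  have h2 : (2 * (c + 1))^-1 * c <= 2^-1.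
    rewrite invfM -mulrA ler_piMr ?invr_ge0 // mulrC ler_pdivrMr ?ltr_wpDl ?nrm_ge0 //.
    by rewrite mul1r lerDl.
  have := ler_wpM2l (nrm_ge0 v) h2; rewrite mulrA => h3.
  by lra.
have d0 : (2 * c * c * nrm (u k - x)) @[k --> \oo] --> (0 : R).
  by rewrite -[X in _ --> X](mulr0 (2 * c * c)); apply: cvgM => //; exact: cvg_cst.
apply: (@squeeze_cvgr _ _ _ _ (fun=> 0) _ _ _ _ _ d0); last exact: cvg_cst.
near=> k; rewrite nrm_ge0 /=.
have -> : invmx (u k) - invmx x = - (invmx (u k) *m (u k - x) *m invmx x).
  by rewrite mulmxBr mulVmx // mulmxBl mul1mx -mulmxA mulmxV // mulmx1 opprB.
rewrite nrmN; apply: le_trans (nrmM _ _) _.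
rewrite mulrAC ler_wpM2r ?nrm_ge0 //; apply: le_trans (nrmM _ _) _.
by rewrite ler_wpM2r ?nrm_ge0 //; near: k.
Unshelve. all: by end_near. Qed.

Lemma regfun_inv_entry i j : regfun (fun x => invmx x i j).
Proof.
exists (N * N)%N, (fun x => mxvec (invmx x)), (fun X => lin_mulmxr (- X)),
  (delta_mx (mxvec_index i j) 0).
split; last by move=> x _; rewrite -colE mxE mxvecE.
split=> [X x Xg Gx|a X Y Xg Yg|u x Gu Gx ux].
- rewrite mexp_lin_mulmxr -invmx_mexp; congr mxvec.
  have xu := Gunit GG Gx; have eu := mexp_unit X.
  have H : (invmx x *m invmx (mexp X)) *m (mexp X *m x) = 1%:M.
    by rewrite -mulmxA (mulmxA (invmx (mexp X))) mulVmx // mul1mx mulVmx.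
  have U : mexp X *m x \in unitmx by rewrite unitmx_mul eu.
  by rewrite -[RHS]mulmx1 -(mulmxV U) mulmxA H mul1mx.
- by rewrite opprD -scalerN lin_mulmxrP.
- apply: tends_mxvec; apply: tends_invmx => //; first by move=> k; exact: (Gunit GG).
  exact: (Gunit GG).
Qed.

Lemma regfun_rep m (rho D : M -> 'M[C]_m) i j : rep_with_diff G g rho D ->
  regfun (fun x => rho x i j).
Proof.
move=> RR; exists (m * m)%N, (fun x => mxvec (rho x)), (fun X => lin_mulmx (D X)),
  (delta_mx (mxvec_index i j) 0).
split; last by move=> x _; rewrite -colE mxE mxvecE.
split=> [X x Xg Gx|a X Y Xg Yg|u x Gu Gx ux].
- rewrite mexp_lin_mulmx (repM RR) ?(rep_exp1 GG RR) //; exact: (Gexp GG).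
- by rewrite (drepP GG RR) // lin_mulmxP.
- by apply: tends_mxvec; exact: (rep_cont RR).
Qed.

(* The two families of curves through z in Z have tangent vectors K and
   z Y z^-1 - Y, which together span g. *)
Definition spreading (Z : set M) := forall z X, Z z -> X \in g ->
  exists K Y, [/\ K \in g, Y \in g, X = K + (z *m Y *m invmx z - Y),
    \forall k \near \oo, Z (mexp ((k.+1%:R^-1 : C) *: K) *m z)
  & forall s : C, Z (mexp (s *: - Y) *m (z *m mexp (s *: Y)))].

Hypothesis Gdense : exp_dense G g.

Lemma reg_data0 m y A : @reg_data m y A -> A 0 = 0.
Proof.
move=> d; have := reg_lin d (-1) (mem0v g) (mem0v g).
by rewrite scaler0 addr0 scaleN1r addNr.
Qed.

Lemma reg_dataZ m y A X (a : C) : @reg_data m y A -> X \in g -> A (a *: X) = a *: A X.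
Proof.
move=> d Xg; have := reg_lin d a Xg (mem0v g).
by rewrite (reg_data0 d) !addr0.
Qed.

(** As z exp (s Y) = exp (s z Y z^-1) z, the conjugate of z is a left translate of z by two
    exponentials, to which [reg_exp] applies twice. *)
Lemma reg_conj m y A z Y (s : C) : @reg_data m y A -> G z -> Y \in g ->
  y (mexp (s *: - Y) *m (z *m mexp (s *: Y))) =
  y z *m (mexp (s *: A (z *m Y *m invmx z)) *m mexp (s *: - A Y)).
Proof.
move=> d Gz Yg; have zu := Gunit GG Gz.
have Ag := Ad_g GG Gz Yg.
have -> : z *m mexp (s *: Y) = mexp (s *: (z *m Y *m invmx z)) *m z.
  by rewrite scalemxAl scalemxAr conj_mexp // -mulmxA mulVmx // mulmx1.
have G1 : G (mexp (s *: (z *m Y *m invmx z)) *m z).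
  by apply: (GM GG) => //; apply: (Gexp GG); rewrite memvZ.
rewrite (reg_exp d) //; last by rewrite memvZ // memvN.
rewrite (reg_exp d) //; last by rewrite memvZ.
rewrite (reg_dataZ _ d Ag) -mulmxA; congr (_ *m (_ *m mexp _)).
by rewrite (reg_dataZ _ d) ?memvN // -[- Y]scaleN1r (reg_dataZ _ d) // scaleN1r.
Qed.

(** Let L be the space of vectors v with y (z) v = 0 on Z. Differentiating along the two families of
    curves of [spreading] shows that A X maps L into L for every X in g, so exp (A X) does too.
    Since l is in L, the function vanishes at w z0 for every product w of exponentials, and by
    density on G. *)
Lemma regfun_identity (Z : set M) z0 f : regfun f -> Z `<=` G -> Z z0 -> spreading Z ->
  (forall z, Z z -> f z = 0) -> forall x, G x -> f x = 0.
Proof.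
move=> [m [y [A [l [d fE]]]]] ZG Zz0 spr f0.
pose L (v : 'cV[C]_m) := forall z, Z z -> y z *m v = 0.
have Ll : L l.
  move=> z Zz; have Gz := ZG _ Zz; apply/matrixP => i j.
  by rewrite !ord1 -fE // f0 // mxE.
have LA X v : X \in g -> L v -> L (A X *m v).
  move=> Xg Lv z Zz; have Gz := ZG _ Zz.
  have [K [Y [Kg Yg -> ZK ZY]]] := spr z X Zz Xg.
  have Ag := Ad_g GG Gz Yg.
  have AE : A (K + (z *m Y *m invmx z - Y)) = A K + (A (z *m Y *m invmx z) - A Y).
    have := reg_lin d 1 Kg (memvB Ag Yg); rewrite !scale1r => ->; congr (_ + _).
    have := reg_lin d (-1) Yg Ag; rewrite !scaleN1r addrC => ->.
    by rewrite addrC.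
  rewrite AE mulmxDl mulmxDr.
  have -> : y z *m (A K *m v) = 0.
    apply: (tends_near0 (tendsMl (y z) (tendsMr v (tends_deriv (A K))))).
    move: ZK; apply: filterS => k Zk.
    rewrite -scalemxAl -scalemxAr mulmxBl mul1mx mulmxBr (Lv z Zz) subr0.
    rewrite -(reg_dataZ _ d Kg) mulmxA -(reg_exp d) ?memvZ //.
    by rewrite (Lv _ Zk) scaler0.
  rewrite add0r.
  apply: (tends_near0 (tendsMl (y z) (tendsMr v (tends_deriv2 (A (z *m Y *m invmx z)) (- A Y))))).
  exists 0 => // k _ /=.
  rewrite -scalemxAl -scalemxAr mulmxBl mul1mx mulmxBr (Lv z Zz) subr0.
  rewrite mulmxA -(reg_conj _ d Gz Yg) (Lv _ (ZY _)) scaler0 //.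
have Lexp X v : X \in g -> L v -> L (mexp (A X) *m v).
  move=> Xg Lv z Zz.
  have Lpow i : L ((A X) ^+ i *m v).
    elim: i => [|i IH]; first by rewrite expr0 mul1mx.
    by rewrite cmxXS -mulmxA; exact: LA.
  apply: (tends_near0 (tendsMl (y z) (tendsMr v (mexp_tends (A X))))).
  exists 0 => // k _ /=; rewrite /psum /series /= mulmx_suml mulmx_sumr big1 // => i _.
  by rewrite -scalemxAl -scalemxAr (Lpow i z Zz) scaler0.
have Lgen w : expgen g w -> forall v, L v -> y (w *m z0) *m v = 0.
  elim=> [|X w' Xg ew' IH] v Lv; first by rewrite mul1mx Lv.
  rewrite -mulmxA (reg_exp d) //; last first.
    by apply: (GM GG); [exact: (expgen_G GG)|exact: ZG].
  by rewrite -mulmxA; apply: IH; exact: Lexp.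
move=> x Gx; have Gz0 := ZG _ Zz0; have zu := Gunit GG Gz0.
have H k : exists w, expgen g w /\ nrm (x *m invmx z0 - w) < k.+1%:R^-1.
  have [||w ew hw] := Gdense (x := x *m invmx z0) _ (e := k.+1%:R^-1); last by exists w.
    by apply: (GM GG) => //; exact: (GV GG).
  by rewrite invr_gt0.
have [w Hw] := choice H.
have T : tends (fun k => w k *m z0) x.
  have T0 : tends w (x *m invmx z0).
    apply: (@tends_le _ _ _ _ _ (fun k => k.+1%:R^-1)); last exact: invS_cvg0.
    by move=> k; rewrite nrmBC; apply: ltW; case: (Hw k).
  by have := tendsMr z0 T0; rewrite -mulmxA mulVmx // mulmx1.
have Gw k : G (w k *m z0).
  by apply: (GM GG) => //; apply: (expgen_G GG); case: (Hw k).
have := tendsMr l (reg_cont d Gw Gx T) => T2.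
rewrite fE //; have -> : y x *m l = 0; last by rewrite mxE.
apply: (tends_near0 T2); exists 0 => // k _ /=.
by apply: Lgen => //; case: (Hw k).
Qed.

(** The derivative along X is the coefficient with A X l in place of l. For the last item, a class
    function is constant along exp (- s Y) x exp (s Y), whose velocity at s = 0 is Ad x Y - Y. *)
Lemma regfun_diff f : regfun f -> exists df : M -> M -> C,
  [/\ forall X, X \in g -> regfun (df X),
     forall X x, X \in g -> G x ->
       derive1 (fun t : C => f (mexp (t *: X) *m x)) 0 = df X x,
     forall a X Y x, X \in g -> Y \in g -> G x ->
       df (a *: X + Y) x = a * df X x + df Y x
   & (forall x y, G x -> G y -> f (y *m x *m invmx y) = f x) ->
     forall Y x, Y \in g -> G x -> df (x *m Y *m invmx x) x = df Y x].
Proof.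
move=> [m [y [A [l [d fE]]]]]; exists (fun X x => (y x *m A X *m l) 0 0); split.
- move=> X Xg; exists m, y, A, (A X *m l); split=> // x Gx.
  by rewrite mulmxA.
- move=> X x Xg Gx; apply: derive1_mexp => t.
  rewrite fE; last by apply: (GM GG) => //; apply: (Gexp GG); rewrite memvZ.
  by rewrite (reg_exp d (memvZ t Xg) Gx) (reg_dataZ _ d Xg).
- move=> a X Y x Xg Yg Gx; rewrite (reg_lin d) //.
  by rewrite mulmxDr mulmxDl -scalemxAr -scalemxAl mxE [X in X + _]mxE.
- move=> fc Y x Yg Gx; have Ag := Ad_g GG Gx Yg.
  apply/eqP; rewrite -subr_eq0.
  have -> : (y x *m A (x *m Y *m invmx x) *m l) 0 0 - (y x *m A Y *m l) 0 0 =
     (y x *m ((A (x *m Y *m invmx x) - A Y) *m l)) 0 0.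
    by rewrite mulmxA mulmxBr mulmxBl [RHS]mxE [X in _ = _ + X]mxE.
  have -> : y x *m ((A (x *m Y *m invmx x) - A Y) *m l) = 0; last by rewrite mxE.
  apply: (tends_near0 (tendsMl (y x) (tendsMr l (tends_deriv2 (A (x *m Y *m invmx x)) (- A Y))))).
  exists 0 => // k _ /=.
  rewrite -scalemxAl -scalemxAr mulmxBl mul1mx mulmxBr mulmxA -(reg_conj _ d Gx Yg).
  have Gs (s : C) : G (mexp (s *: Y)) by apply: (Gexp GG); rewrite memvZ.
  have GsN (s : C) : G (mexp (s *: - Y)) by apply: (Gexp GG); rewrite memvZ // memvN.
  have e1 : forall u v : 'rV[C]_m, (u *m l) 0 0 = (v *m l) 0 0 -> u *m l - v *m l = 0.
    move=> u v uv; apply/matrixP => i j; rewrite !ord1 mxE [X in _ + X]mxE uv subrr.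
    by rewrite mxE.
  rewrite e1 ?scaler0 // -!fE //; last by apply: (GM GG) => //; exact: (GM GG).
  have iE (s : C) : invmx (mexp (s *: - Y)) = mexp (s *: Y).
    by rewrite invmx_mexp -scalerN opprK.
  by rewrite -[RHS](fc x (mexp (k.+1%:R^-1 *: - Y)) Gx (GsN _)) iE mulmxA.
Qed.

End RegFun.

Lemma mulmx_cancel (S : pzRingType) m n (A : 'M[S]_(m, n)) (B B' : 'M[S]_n) :
  B' *m B = 1%:M -> A *m B' *m B = A.
Proof. by move=> E; rewrite -mulmxA E mulmx1. Qed.

(** * The scalar exponential and terminating adjoint actions *)

Section ScalarExp.
Variable R : realType.
Local Notation C := R[i].
Import ComplexField.Normc.
Local Open Scope classical_set_scope.

(** The complex exponential, as the 1 x 1 case of [mexp], whose properties it inherits. *)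
Definition ce (x : C) : C := mexp (x%:M : 'M[C]_1) 0 0.

Lemma mexp_scalar1 (x : C) : mexp (x%:M : 'M[C]_1) = (ce x)%:M.
Proof. exact: mx11_scalar. Qed.

Lemma scalar11 (x : C) : (x%:M : 'M[C]_1) 0 0 = x.
Proof. by rewrite mxE eqxx mulr1n. Qed.

Lemma mexp_eigen m (D : 'M[C]_m) (v : 'cV[C]_m) (l : C) :
  D *m v = l *: v -> mexp D *m v = ce l *: v.
Proof.
move=> Dv; have E : D *m v = v *m (l%:M : 'M[C]_1) by rewrite mul_mx_scalar.
by rewrite (mexp_inter E) mexp_scalar1 mul_mx_scalar.
Qed.

Lemma ce_exp_like : exp_like ce.
Proof.
split=> [|x y|x H].
- have := mexp_scalar1 0; rewrite (_ : (0 : C)%:M = 0) ?mexp0; last by rewrite raddf0.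
  by move/(congr1 (fun A : 'M[C]_1 => A 0 0)); rewrite scalar11 => <-; exact: scalar11.
- have E : mexp ((x + y)%:M : 'M[C]_1) = mexp (x%:M : 'M[C]_1) *m mexp (y%:M : 'M[C]_1).
    rewrite (raddfD (@scalar_mx C 1)) /= mexpD //; exact: scalar_mxC.
  by rewrite {1}/ce E !mexp_scalar1 -scalar_mxM scalar11.
have E : (x%:M : 'M[C]_1) = 0.
  apply: mexp_inj => t; rewrite scaler0 mexp0 scale_scalar_mx mexp_scalar1 H //.
by rewrite -(scalar11 x) E mxE.
Qed.

Lemma mexp_diag m (d : 'rV[C]_m) : mexp (diag_mx d) = diag_mx (map_mx ce d).
Proof.
apply/matrixP => i j.
have E : diag_mx d *m delta_mx j 0 = d 0 j *: (delta_mx j 0 : 'cV[C]_m).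
  by apply/colP => k; rewrite mul_diag_mx !mxE; case: eqP => [->|]; rewrite ?mulr1 ?mulr0.
have := mexp_eigen E; rewrite -colE => /colP/(_ i); rewrite [LHS]mxE => ->.
rewrite [LHS]mxE [delta_mx _ _ _ _]mxE [RHS]mxE [map_mx _ _ _ _]mxE eqxx andbT.
by case: eqP => [->|_]; [exact: mulr1|exact: mulr0].
Qed.

Lemma derive1_ce_sum (I : finType) (x y : I -> C) :
  derive1 (fun t : C => \sum_i ce (t * x i + y i)) 0 = \sum_i x i * ce (y i).
Proof.
pose n := #|I|; pose d := \row_(k < n) x (enum_val k).
pose b := \col_(k < n) ce (y (enum_val k)).
have E (f : I -> C) : \sum_(k < n) f (enum_val k) = \sum_i f i.
  by rewrite [RHS](reindex _ (onW_bij _ (enum_val_bij I))).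
rewrite (@derive1_mexp R n (const_mx 1) (diag_mx d) b) => [|t].
  rewrite mxE -E; apply: eq_bigr => k _; rewrite mul_mx_diag !mxE mul1r //.
have -> : t *: diag_mx d = diag_mx (\row_k (t * x (enum_val k))).
  by apply/matrixP => i j; rewrite !mxE mulrnAr.
rewrite mexp_diag mxE -E; apply: eq_bigr => k _.
by rewrite mul_mx_diag !mxE mul1r (elD ce_exp_like).
Qed.

Lemma ce_tends (u : nat -> C) l : (normc (u k - l)) @[k --> \oo] --> (0 : R) ->
  (normc (ce (u k) - ce l)) @[k --> \oo] --> (0 : R).
Proof.
move=> ul; have E (z : C) (i j : 'I_1) : (z%:M : 'M[C]_1) i j = z by rewrite !ord1 scalar11.
have tl : tends (fun k => (u k)%:M : 'M[C]_1) l%:M.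
  apply: tends_le ul => k; rewrite -(raddfB (@scalar_mx C 1)) /nrm !big_ord1 E //.
apply: squeeze0 (mexp_cont tl) => k; rewrite normc_ge0 /=.
by have := normc_le_nrm (mexp (u k)%:M - mexp (l%:M : 'M[C]_1)) 0 0; rewrite !mexp_scalar1 -raddfB E.
Qed.

(* Here exp(ad X) terminates after the quadratic term. *)
Lemma mexp_ad_quad m (X Z : 'M[C]_m) : br X (br X (br X Z)) = 0 ->
  mexp X *m Z = (Z + br X Z + 2%:R^-1 *: br X (br X Z)) *m mexp X.
Proof.
move=> H3; pose T : 'M[C]_(m * m) := lin_mulmx X + lin_mulmxr (- X).
have TE Y : mxvec Y *m T = mxvec (br X Y).
  rewrite /T mulmxDr !mul_vec_lin /= -(raddfD mxvec) /=; congr mxvec.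
  by rewrite mulmxN.
have Tk k : mxvec Z *m (T ^+ k.+3) = 0.
  rewrite !(exprS T) -[T * (T * (T * _))]/(T *m (T *m (T *m _))) !mulmxA !TE H3.
  by rewrite linear0 mul0mx.
have S c k : mxvec Z *m (c *: T ^+ k) = c *: (mxvec Z *m T ^+ k) by rewrite -scalemxAr.
have T0 : mxvec Z *m T ^+ 0 = mxvec Z by rewrite expr0 mulmx1.
have T1 : mxvec Z *m T ^+ 1 = mxvec (br X Z) by rewrite expr1 TE.
have T2 : mxvec Z *m T ^+ 2 = mxvec (br X (br X Z)).
  have E2 : T ^+ 2 = T *m T := expr2 T.
  rewrite E2 (mulmxA (mxvec Z) T T) (TE Z).
  exact: (TE (br X Z)).
have f1 : (1%:R^-1 : C) = 1 by rewrite invr1.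
have f2 : ((2`!)%:R^-1 : C) = 2%:R^-1 by [].
have L (A B D : 'M[C]_m) c : mxvec (A + B + c *: D) = mxvec A + (mxvec B + c *: mxvec D).
  by rewrite !linearD linearZ addrA.
have lim : mxvec Z *m mexp T = mxvec (Z + br X Z + 2%:R^-1 *: br X (br X Z)).
  apply: (@tends_unique R _ _ (fun n => mxvec Z *m psum T n)).
    by apply: tendsMl; exact: mexp_tends.
  apply: (@tends_le R _ _ _ _ (fun n => if (n < 3)%N then nrm (mxvec Z *m psum T n - mxvec (Z + br X Z + 2%:R^-1 *: br X (br X Z))) else 0)).
    case=> [|[|[|n]]]; rewrite ?lexx //=.
    suff -> : mxvec Z *m psum T n.+3 = mxvec (Z + br X Z + 2%:R^-1 *: br X (br X Z)).
      by rewrite subrr nrm0.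
    rewrite /psum seriesEnat /= big_nat_recl // big_nat_recl // big_nat_recl //.
    rewrite !mulmxDr mulmx_sumr big1 => [|k _]; last by rewrite S Tk scaler0.
    by rewrite !S T0 T1 T2 -[0`!]/1%N -[1`!]/1%N f1 f2 !scale1r addr0 L.
  apply/cvgrPdist_lt => e e0; near=> n.
  rewrite ifF ?subr0 ?normr0 //; apply/negbTE; rewrite -leqNgt; near: n; exact: nbhs_infty_ge.
have := mexp_lin_mulmx2 X (- X) Z; rewrite -/T lim => /(can_inj mxvecK) ->.
exact/esym/mulmx_cancel/mexpNl.
Unshelve. all: by end_near.
Qed.

End ScalarExp.

(** * The regular torus *)

Section AbstractTorus.
Variable F : numClosedFieldType.

Lemma lead_neq0 (ce : F -> F) (el : exp_like ce) N (h : {vspace 'M[F]_N}) r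
    (a : r.-tuple 'Hom(subvs_of h, F^o)) la f : basis_of fullv a ->
  lead ce a la 1 f -> exists H, f H != 0.
Proof.
move=> ab [s [Hs sE]]; apply: contrapT => H0.
have f0 H : f H = 0 by apply/eqP/negP => /negP fH; apply: H0; exists H.
have := @ev0_coef _ ce el _ ((1, la) :: s) _ la.
rewrite /coef big_cons /= eqxx => /(_ _)/eqP; rewrite big_seq_cond big1 ?addr0 ?oner_eq0.
  move=> E; apply: (notF (E _)) => H.
  by rewrite /ev big_cons /= -[X in _ + X]/(ev ce s H) -sE f0 sub0r mul1r subrr.
move=> p /andP[/Hs[k [i /eqP ki] ->]]; rewrite -subr_eq0 addrAC subrr sub0r oppr_eq0 => /eqP k0.
case: ki; apply/eqP; rewrite -(eqr_nat F); apply/eqP.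
by apply: (@simple_free _ _ _ _ a ab (fun i => (k i)%:R)); rewrite -nat_combE.
Qed.

(** Here e = exp E and f = exp (- Y) for an sl_2 triple, and e f e is the usual representative in
    SL_2 of the reflection; the hypotheses say how each factor moves past v, E and H. *)
Lemma reflection_conj N (e f E Y v H : 'M[F]_N) (c : F) :
  e *m v = (v - c *: E) *m e -> f *m v = (v - c *: Y) *m f ->
  f *m E = (E + H - Y) *m f -> e *m E = E *m e -> e *m H = (H - 2%:R *: E) *m e ->
  (e *m f *m e) *m v = (v - c *: H) *m (e *m f *m e).
Proof.
move=> ev fv fE eE eH; rewrite -mulmxA ev -!mulmxA (mulmxA f) mulmxBr fv -scalemxAr fE.
rewrite scalemxAl -mulmxBl -!mulmxA (mulmxA e (_ - _)).
have -> : v - c *: Y - c *: (E + H - Y) = v - c *: E - c *: H.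
  by apply/matrixP => i j; rewrite !mxE; ring.
rewrite !mulmxBr ev -!scalemxAr eE eH !scalemxAl -!mulmxBl -!mulmxA; congr (_ *m _).
by apply/matrixP => i j; rewrite !mxE; ring.
Qed.

Lemma tr_eigenbasis m n (A : 'M[F]_m) (b : n.-tuple 'cV[F]_m) (l : 'I_n -> F) :
  basis_of fullv b -> (forall j : 'I_n, A *m b`_j = l j *: b`_j) -> \tr A = \sum_j l j.
Proof.
move=> bb Ab; have nm : n = m.
  have := size_basis bb; rewrite dimvf => <-.
  by have -> : dim 'cV[F]_m = (m * 1)%N by []; rewrite muln1.
subst n; pose P := \matrix_(i < m, j < m) (b`_j i 0 : F).
have Pj j : col j P = b`_j by apply/colP => i; rewrite !mxE.
have Pu : P \in unitmx.
  rewrite -unitmx_tr -row_free_unit; apply/inj_row_free => v vP.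
  apply/rowP => j; rewrite mxE; have /freeP fr := basis_free bb.
  apply: (fr (v 0)); apply/colP => i; rewrite summxE [RHS]mxE.
  transitivity ((v *m P^T) 0 i); last by rewrite vP mxE.
  by rewrite [RHS]mxE; apply: eq_bigr => k _; rewrite !mxE.
have AP : A *m P = P *m diag_mx (\row_j l j).
  apply/matrixP => i j; transitivity ((A *m b`_j) i 0).
    by rewrite !mxE; apply: eq_bigr => k _; rewrite mxE.
  by rewrite Ab mul_mx_diag !mxE [RHS]mulrC.
have -> : A = P *m diag_mx (\row_j l j) *m invmx P by rewrite -AP mulmxK.
by rewrite tr_conj // mxtrace_diag; apply: eq_bigr => j _; rewrite mxE.
Qed.

End AbstractTorus.

Section Torus.
Variable R : realType.
Local Notation C := R[i].
Local Open Scope classical_set_scope.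
Local Open Scope complex_scope.
Import ComplexField.Normc.
Variable N : nat.
Local Notation M := 'M[C]_N.
Variables (G : set M) (g h : {vspace M}).
Hypothesis GG : group_with_lie G g.
Hypothesis Gdense : exp_dense G g.
Hypothesis cp : cartan_pair g h.
Local Notation dual := 'Hom(subvs_of h, C^o).
Variables (r : nat) (a : r.-tuple dual).
Local Notation "''a_' i" := (tnth a i) (at level 8, i at level 2, format "''a_' i").
Hypothesis a_basis : basis_of fullv a.
Hypothesis a_root : forall i, isroot g 'a_i.
Hypothesis a_pos : forall beta, isroot g beta -> positive a beta \/ positive a (- beta).
Implicit Types (H K : subvs_of h) (alpha mu : dual).
Local Notation co := (co cp a).
Local Notation el := (@ce_exp_like R).

Lemma mexp_rootv alpha X H : rootv g alpha X ->
  mexp (vsval H) *m X = (ce (alpha H) *: X) *m mexp (vsval H).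
Proof.
move=> [_ /(_ H) HX]; pose T : 'M[C]_(N * N) := lin_mulmx (vsval H) + lin_mulmxr (- vsval H).
have E : ((alpha H : C)%:M : 'M[C]_1) *m mxvec X = mxvec X *m T.
  have -> : mxvec X *m T = mxvec (br (vsval H) X).
    by rewrite /T mulmxDr !mul_vec_lin /= -(raddfD mxvec) /= mulmxN.
  by rewrite HX mul_scalar_mx linearZ.
have := mexp_inter E; rewrite mexp_scalar1 mul_scalar_mx -linearZ /=.
rewrite (mexp_lin_mulmx2 (vsval H) (- vsval H) X) => /(can_inj mxvecK) ->.
exact/esym/mulmx_cancel/mexpNl.
Qed.

Lemma mexp_lin1 (X Z : M) c : br X Z = c *: X -> mexp X *m Z = (Z + c *: X) *m mexp X.
Proof.
move=> E; have E2 : br X (br X Z) = 0 by rewrite E brZr brXX scaler0.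
have E3 : br X (br X (br X Z)) = 0 := etrans (congr1 (br X) E2) (br0r X).
by rewrite (mexp_ad_quad E3) E2 scaler0 addr0 E.
Qed.

Lemma refl_element i : exists2 n, G n & forall H, n *m vsval H = vsval (refl cp a i H) *m n.
Proof.
have ri := a_root i; have [_ [E E0 HE]] := ri; have [Y HY EY] := sl2_triple cp ri HE E0.
have [[Eg _] [Yg _]] := (HE, HY).
exists (mexp E *m mexp (- Y) *m mexp E).
  by apply: (GM GG); [apply: (GM GG)|]; apply: (Gexp GG); rewrite ?memvN.
move=> H; have -> : vsval (refl cp a i H) = vsval H - ('a_i H : C) *: vsval (co i).
  by rewrite /refl linearB linearZ.
have brE K : br E (vsval K) = - ('a_i K : C) *: E by rewrite brC; have [_ ->] := HE; rewrite scaleNr.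
have brY K : br (- Y) (vsval K) = ('a_i K : C) *: (- Y).
  by rewrite brNl brC opprK; have [_ ->] := HY; rewrite opp_lfunE scaleNr scalerN.
apply: (reflection_conj (Y := Y)).
- by rewrite (mexp_lin1 (brE H)) scaleNr.
- by rewrite (mexp_lin1 (brY H)) scalerN.
- have E1 : br (- Y) E = vsval (co i) by rewrite brNl brC opprK.
  have E2 : br (- Y) (vsval (co i)) = 2%:R *: (- Y) by rewrite brY corootE.
  have E3 : br (- Y) (br (- Y) (br (- Y) E)) = 0 by rewrite E1 E2 brZr brXX scaler0.
  have two : (2%:R^-1 * 2%:R : C) = 1 by apply: mulVf; rewrite pnatr_eq0.
  by rewrite (mexp_ad_quad E3) E1 E2 scalerA two scale1r.
- have /mexp_lin1 -> : br E E = 0 *: E by rewrite brXX scale0r.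
  by rewrite scale0r addr0.
- by have := mexp_lin1 (brE (co i)); rewrite (corootE cp ri) scaleNr => ->.
Qed.

Lemma class_refl (f : M -> C) i H : (forall x y, G x -> G y -> f (x *m y *m invmx x) = f y) ->
  f (mexp (vsval (refl cp a i H))) = f (mexp (vsval H)).
Proof.
move=> fc; have [n Gn /(_ H) nH] := refl_element i.
have Hg : vsval H \in g by exact: (subvP (cp_sub cp) _ (subvsP _)).
transitivity (f (n *m mexp (vsval H) *m invmx n)); last exact: (fc n _ Gn (Gexp GG Hg)).
congr f.
by rewrite (conj_comm (Gunit GG Gn) (esym nH)) (conj_mexp _ (Gunit GG Gn)).
Qed.

Section OneRep.
Variables (m : nat) (rho D : M -> 'M[C]_m) (i0 : 'I_r) (w : 'cV[C]_m).
Hypothesis RR : rep_with_diff G g rho D.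
Hypothesis irr : forall U : {vspace 'cV[C]_m},
  (forall x u, G x -> u \in U -> rho x *m u \in U) -> U = 0%VS \/ U = fullv.
Hypothesis w0 : w != 0.
Hypothesis w_kill : forall i E, rootv g 'a_i E -> D E *m w = 0.
Hypothesis w_co : forall i, D (vsval (co i)) *m w = (i0 == i)%:R *: w.

Lemma mexp_stable (A : 'M[C]_m) (U : {vspace 'cV[C]_m}) u :
  (forall v, v \in U -> A *m v \in U) -> u \in U -> mexp A *m u \in U.
Proof.
move=> AU uU; apply: (tends_vs (u := fun n => psum A n *m u)); last first.
  by apply: tendsMr; exact: mexp_tends.
move=> n; rewrite /psum seriesEnat /= mulmx_suml; apply: memv_suml => k _.
rewrite -scalemxAl memvZ //; elim: k => [|k IH]; first by rewrite expr0 mul1mx.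
by rewrite cmxXS -mulmxA; exact: AU.
Qed.

(** A subspace stable under the differential is stable under exponentials, hence under G by density
    and continuity; so irreducibility passes from G to g. *)
Lemma rep_irr_diff (U : {vspace 'cV[C]_m}) :
  (forall X u, X \in g -> u \in U -> D X *m u \in U) -> U = 0%VS \/ U = fullv.
Proof.
move=> DU; apply: irr => x u Gx uU.
have step y : expgen g y -> forall v, v \in U -> rho y *m v \in U.
  elim=> [v vU|X y' Xg Ey' IH v vU]; first by rewrite (rep1 RR) mul1mx.
  rewrite (repM RR (Gexp GG Xg) (expgen_G GG Ey')) (rep_exp1 GG RR Xg) -mulmxA.
  by apply: mexp_stable; [move=> v' v'U; exact: DU|exact: IH].
have /choice[y Hy] (k : nat) : exists y, expgen g y /\ nrm (x - y) < (k.+1%:R^-1 : R).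
  have k0 : 0 < (k.+1%:R^-1 : R) by rewrite invr_gt0.
  by have [y Ey yx] := Gdense Gx k0; exists y.
have yx : tends y x.
  apply: (@tends_le _ _ _ _ _ (fun k => k.+1%:R^-1)); last exact: invS_cvg0.
  by move=> k; rewrite nrmBC ltW //; have [] := Hy k.
have Gy k : G (y k) by apply: (expgen_G GG); have [] := Hy k.
apply: (tends_vs (u := fun k => rho (y k) *m u)).
  by move=> k; apply: step => //; have [] := Hy k.
exact: tendsMr (rep_cont RR Gy Gx yx).
Qed.

Lemma rep_weights : exists (om : dual) (L : seq dual),
  [/\ forall j, om (co j) = (i0 == j)%:R :> C,
      forall mu, mu \in L -> exists k, nz k /\ mu = om - nat_comb a k
    & forall H, \tr (rho (mexp (vsval H))) = \sum_(mu <- om :: L) ce (mu H)].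
Proof.
have Dl c X Y : X \in g -> Y \in g -> D (c *: X + Y) = c *: D X + D Y.
  exact: (drepP GG RR).
have Db X Y : X \in g -> Y \in g -> D (br X Y) = br (D X) (D Y).
  exact: (drep_bracket GG RR).
have [om [omco omw]] := highest_weight a_basis a_root Dl w0 w_co.
have [es [bes Hes]] := rep_weight_basis cp a_basis a_root a_pos Dl Db w0 w_kill omw rep_irr_diff.
have /choice[k Hk] u : exists k, u \in es -> nz k /\
    forall H, D (vsval H) *m u = ((om - nat_comb a k) H : C) *: u.
  have [/Hes[k Pk]|] := boolP (u \in es); first by exists k.
  by exists (fun=> 0%N).
exists om, [seq om - nat_comb a (k u) | u <- es]; split=> //.
  by move=> mu /seq.mapP[u /Hk[k0 _] ->]; exists (k u).
move=> H; have Hg : vsval H \in g by exact: (subvP (cp_sub cp) _ (subvsP _)).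
rewrite (rep_exp1 GG RR Hg).
pose b := es ++ [:: w]; pose l := [seq om - nat_comb a (k u) | u <- es] ++ [:: om].
have slb : size l = size b by rewrite !size_cat size_map.
have sb : size b = (size es).+1 by rewrite size_cat addn1.
transitivity (\sum_(j < size b) ce (l`_j H)); last first.
  rewrite -(big_mkord xpredT (fun j => ce (l`_j H))) -slb -(big_nth 0 xpredT (fun mu : dual => ce (mu H))).
  by rewrite big_cat big_seq1 /= big_cons addrC.
apply: (@tr_eigenbasis _ _ _ _ (in_tuple b)) => //= j; apply: mexp_eigen.
rewrite /b /l !nth_cat size_map; case: ltnP => jes.
  by rewrite (nth_map 0) //; apply: (Hk _ _).2; rewrite mem_nth.
have -> : (j - size es)%N = 0%N.
  by apply/eqP; rewrite subn_eq0 -ltnS -sb ltn_ord.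
exact: omw.
Qed.

End OneRep.

End Torus.

Section AbstractConj.
Variables (F : fieldType) (N : nat).
Implicit Types (k m X Y K : 'M[F]_N).

Lemma invmx_mul k m : k \in unitmx -> m \in unitmx -> invmx (k *m m) = invmx m *m invmx k.
Proof.
move=> ku mu; have kmu : k *m m \in unitmx by rewrite unitmx_mul ku.
rewrite -[RHS](mulKmx kmu) !mulmxA -(mulmxA (_ *m k) m) mulmxV // mulmx1.
by rewrite -(mulmxA (invmx _) k) mulmxV // mulmx1.
Qed.

Lemma conj_mul k m X : k \in unitmx ->
  (k *m X *m invmx k) *m (k *m m *m invmx k) = k *m (X *m m) *m invmx k.
Proof. by move=> ku; rewrite !mulmxA -(mulmxA (k *m X)) mulVmx // mulmx1. Qed.

Lemma conj_inv k m : k \in unitmx -> m \in unitmx ->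
  invmx (k *m m *m invmx k) = k *m invmx m *m invmx k.
Proof.
move=> ku mu; rewrite !invmx_mul ?unitmx_mul ?ku ?mu ?unitmx_inv //.
by rewrite invmxK mulmxA.
Qed.

Lemma conj_split k m X Y K : k \in unitmx -> m \in unitmx ->
  invmx k *m X *m k = K + (m *m Y *m invmx m - Y) ->
  X = k *m K *m invmx k + ((k *m m *m invmx k) *m (k *m Y *m invmx k) *m
     invmx (k *m m *m invmx k) - k *m Y *m invmx k).
Proof.
move=> ku mu E; rewrite conj_inv // !conj_mul //.
rewrite -mulmxBl -mulmxBr -mulmxDl -mulmxDr -E !mulmxA mulmxV // mul1mx.
by rewrite -mulmxA mulmxV // mulmx1.
Qed.

Lemma scale_sub1 (c : F) X : c - 1 != 0 -> X = (c - 1)^-1 *: (c *: X - X).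
Proof.
move=> c1; have -> : c *: X - X = (c - 1) *: X by rewrite scalerBl scale1r.
by rewrite scalerA mulVf // scale1r.
Qed.

Lemma dualP (V : vectType F) (alpha : 'Hom(V, F^o)) c (H H' : V) :
  (alpha (c *: H + H') : F) = c * (alpha H : F) + (alpha H' : F).
Proof. by rewrite linearP. Qed.

End AbstractConj.

Section Torus.
Variable R : realType.
Local Notation C := R[i].
Local Open Scope classical_set_scope.
Local Open Scope complex_scope.
Import ComplexField.Normc.
Variable N : nat.
Local Notation M := 'M[C]_N.
Variables (G : set M) (g h : {vspace M}).
Hypothesis GG : group_with_lie G g.
Hypothesis Gdense : exp_dense G g.
Hypothesis cp : cartan_pair g h.
Local Notation dual := 'Hom(subvs_of h, C^o).
Variables (r : nat) (a : r.-tuple dual).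
Local Notation "''a_' i" := (tnth a i) (at level 8, i at level 2, format "''a_' i").
Hypothesis a_basis : basis_of fullv a.
Hypothesis a_root : forall i, isroot g 'a_i.
Hypothesis a_pos : forall beta, isroot g beta -> positive a beta \/ positive a (- beta).
Implicit Types (H K : subvs_of h) (alpha mu : dual).
Local Notation co := (co cp a).
Local Notation el := (@ce_exp_like R).

Definition torus_regular (rts : seq dual) H : Prop :=
  forall alpha, alpha \in rts -> ce (alpha H) != 1.

Variable rts : seq dual.
Hypothesis rts_uniq : uniq rts.
Hypothesis rtsP : forall alpha, alpha \in rts <-> isroot g alpha.

(** The Weyl denominator has leading coefficient 1, so it is nonzero at some H; its square is up to
    sign the product of the exp (alpha H) - 1. *)
Lemma torus_regular_exists : exists H, torus_regular rts H.
Proof.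
have [H nz] := lead_neq0 el a_basis (weyl_denom_lead el a rtsP).
exists H => alpha ar; apply: contraNneq nz => ca.
have := prod_roots el cp a_basis a_pos rts_uniq rtsP H.
rewrite (bigD1_seq alpha) //= ca subrr mul0r => /esym/eqP.
by rewrite mulf_eq0 signr_eq0 /= expf_eq0 => /andP[_].
Qed.

Definition regular_torus : set M :=
  [set z | exists k H, [/\ G k, torus_regular rts H & z = k *m mexp (vsval H) *m invmx k]].

Lemma conj_rootv alpha X H : rootv g alpha X ->
  mexp (vsval H) *m X *m invmx (mexp (vsval H)) = ce (alpha H) *: X.
Proof. by move=> HX; rewrite (mexp_rootv H HX) mulmxK //; exact: mexp_unit. Qed.

(** On the root space of alpha the operator Ad (exp H) - 1 is multiplication by exp (alpha H) - 1,
    nonzero by regularity; the weight space 0 is h. *)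
Lemma torus_complement H X : torus_regular rts H -> X \in g -> exists K Y : M,
  [/\ K \in h, Y \in g & X = K + (mexp (vsval H) *m Y *m invmx (mexp (vsval H)) - Y)].
Proof.
move=> rH Xg; pose m := mexp (vsval H).
pose f := ((linfun (mulmx m : M -> M) \o linfun (mulmxr (invmx m) : M -> M))%VF - \1%VF)%R.
have fE Y : f Y = m *m Y *m invmx m - Y.
  by rewrite add_lfunE opp_lfunE comp_lfunE !lfunE /= mulmxA.
suff /subvP/(_ X Xg)/memv_addP[K Kh [Z /memv_imgP[Y Yg ->] ->]] : (g <= h + f @: g)%VS.
  by exists K, Y; rewrite fE.
apply: (weight_span cp) => alpha Y HY.
have [->|Y0] := eqVneq Y 0; first exact: mem0v.
have [a0|a0] := eqVneq alpha 0.
  have Yh : Y \in h by apply: (rootv0 cp); rewrite -a0.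
  by apply: (subvP (addvSl _ _)).
have ar : alpha \in rts by apply/rtsP; split=> //; exists Y.
apply: (subvP (addvSr _ _)); have [Yg _] := HY.
have c0 : ce (alpha H) - 1 != 0 by rewrite subr_eq0 rH.
have -> : Y = f ((ce (alpha H) - 1)^-1 *: Y).
  rewrite fE -scalemxAr -scalemxAl /m (conj_rootv H HY) -scalerBr.
  exact: scale_sub1.
by apply: memv_img; rewrite memvZ.
Qed.

Lemma near_regular (l : seq dual) H K : torus_regular l H ->
  exists n0, forall k, (n0 <= k)%N -> torus_regular l ((k.+1%:R^-1 : C) *: K + H).
Proof.
elim: l => [|alpha l IH] rH; first by exists 0%N => k _ beta; rewrite in_nil.
have [|n1 Hn1] := IH; first by move=> beta bl; apply: rH; rewrite inE bl orbT.
have c0 : 0 < normc (ce (alpha H) - 1).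
  have : ce (alpha H) != 1 by apply: rH; rewrite mem_head.
  by rewrite -subr_eq0 lt_def normc_ge0 andbT; apply: contra => /eqP/eq0_normc ->.
pose u (k : nat) : C := alpha ((k.+1%:R^-1 : C) *: K + H).
have u0 : (normc (u k - alpha H)) @[k --> \oo] --> (0 : R).
  apply: (@squeeze0 _ _ (fun k => k.+1%:R^-1 * normc (alpha K))) => [k|].
    have -> : u k - alpha H = (k.+1%:R^-1 : C) * (alpha K : C).
      by rewrite /u dualP; exact: (addrK (alpha H : C)).
    by rewrite normc_ge0 normcM normcV normc_nat lexx.
  by rewrite -(mul0r (normc (alpha K))); apply: cvgM; [exact: invS_cvg0|exact: cvg_cst].
have /cvgrPdist_lt/(_ _ c0)[n2 _ Hn2] := ce_tends u0.
exists (maxn n1 n2) => k; rewrite geq_max => /andP[k1 k2] beta.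
rewrite inE => /orP[/eqP->|bl]; last exact: Hn1.
apply/eqP => E; have := Hn2 k k2; rewrite /= sub0r normrN ger0_norm ?normc_ge0 //.
by rewrite /u E normcB ltxx.
Qed.

(** After conjugating z into the torus, X splits by [torus_complement]. Moving along K stays in the
    torus, and near H it stays regular; moving along Y is a conjugation. *)
Lemma spreading_torus : spreading g regular_torus.
Proof.
move=> z X [k [H [Gk rH ->]]] Xg; have Gm := Gexp GG (subvP (cp_sub cp) _ (subvsP H)).
have ku := Gunit GG Gk; have Gki := GV GG Gk.
have X'g : invmx k *m X *m k \in g.
  by have := Ad_g GG Gki Xg; rewrite invmxK.
have [K [Y [Kh Yg E]]] := torus_complement rH X'g.
have conjE (A : M) (s : C) : mexp (s *: (k *m A *m invmx k)) = k *m mexp (s *: A) *m invmx k.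
  by rewrite -(conj_mexp _ ku) -scalemxAr -scalemxAl.
exists (k *m K *m invmx k), (k *m Y *m invmx k); split.
- by apply: (Ad_g GG Gk); exact: (subvP (cp_sub cp)).
- exact: (Ad_g GG Gk).
- by apply: conj_split => //; exact: mexp_unit.
- have [n0 Hn0] := near_regular (vsproj h K) rH; exists n0 => // j /Hn0 rj.
  exists k, ((j.+1%:R^-1 : C) *: vsproj h K + H); split=> //.
  have -> : vsval ((j.+1%:R^-1 : C) *: vsproj h K + H) = (j.+1%:R^-1 : C) *: K + vsval H.
    by rewrite linearD linearZ /= vsprojK.
  rewrite conjE (conj_mul _ _ ku); congr (_ *m _ *m _); symmetry; apply: mexpD.
  rewrite -[GRing.comm _ _]/(_ *m _ = _ *m _) -scalemxAl -scalemxAr.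
  by congr (_ *: _); exact: (cartan_comm (cp_br cp) (cp_nondeg cp) (cp_sub cp) (cp_nil cp) (cp_self cp) Kh (subvsP H)).
move=> s; set n := mexp (s *: _).
have Gn : G n by apply: (Gexp GG); rewrite memvZ // memvN; exact: (Ad_g GG Gk).
exists (n *m k), H; split=> //; first exact: GM GG _ _ Gn Gk.
have -> : mexp (s *: (k *m Y *m invmx k)) = invmx n.
  by rewrite /n invmx_mexp scalerN opprK.
rewrite invmx_mul ?(Gunit GG Gn) // !mulmxA //.
Qed.

Lemma torus_identity f : regfun G g f ->
  (forall H, torus_regular rts H -> forall k, G k -> f (k *m mexp (vsval H) *m invmx k) = 0) ->
  forall x, G x -> f x = 0.
Proof.
move=> rf f0; have [H rH] := torus_regular_exists.
have Gm K := Gexp GG (subvP (cp_sub cp) _ (subvsP K)).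
apply: (regfun_identity GG Gdense rf (z0 := mexp (vsval H)) _ _ spreading_torus) => [z||].
- by move=> [k [K [Gk _ ->]]]; apply: (GM GG); [exact: (GM GG)|exact: (GV GG)].
- exists 1%:M, H; split=> //; first exact: G1 GG.
  by rewrite mul1mx invmx1 mulmx1.
- by move=> z [k [K [Gk rK ->]]]; exact: f0.
Qed.

End Torus.

(** * Changes of bases and determinants of maps that are linear on a subspace *)

Section Coordinates.
Variables (F : fieldType) (V : vectType F).
Implicit Types (W U : {vspace V}).

Definition cmx n (a b : n.-tuple V) : 'M[F]_n := \matrix_(i < n, j < n) coord b j a`_i.

Lemma base_change_cmx n (a b : seq V) (sa : size a == n) (sb : size b == n) :
  base_change a b = \det (cmx (Tuple sa) (Tuple sb)).
Proof.
have E := eqP sb; subst n; rewrite /base_change /cmx; congr (\det _).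
apply/matrixP => i j; rewrite !mxE; congr (coord _ j _); exact: val_inj.
Qed.

Lemma tuple_mem n (a : n.-tuple V) W : {subset a <= W} -> forall i : 'I_n, a`_i \in W.
Proof. by move=> aW i; apply: aW; rewrite mem_nth ?size_tuple. Qed.

Lemma cmx_mul n W (a b c : n.-tuple V) : {subset a <= W} -> basis_of W b ->
  cmx a c = cmx a b *m cmx b c.
Proof.
move=> aW bW; apply/matrixP => i k; rewrite !mxE.
rewrite {1}(coord_basis bW (tuple_mem aW i)) linear_sum /=.
by apply: eq_bigr => j _; rewrite linearZ /= !mxE.
Qed.

Lemma cmx_id n (a : n.-tuple V) : free a -> cmx a a = 1%:M.
Proof. by move=> fa; apply/matrixP => i j; rewrite !mxE coord_free. Qed.

Lemma cmx_inv n W (a b : n.-tuple V) : basis_of W a -> basis_of W b ->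
  cmx a b *m cmx b a = 1%:M.
Proof.
move=> aW bW; rewrite -(@cmx_mul _ W) ?cmx_id ?(basis_free aW) //.
by move=> v; exact: basis_mem.
Qed.

Lemma cmx_comm n W (a b : n.-tuple V) : basis_of W a -> basis_of W b ->
  \det (cmx a b) * \det (cmx b a) = 1.
Proof. by move=> aW bW; rewrite -det_mulmx (cmx_inv aW bW) det1. Qed.

(** The map is only assumed linear on W in what follows, since the form B is bilinear on g only;
    hence a function instead of an endomorphism of V. *)
Definition map_det W (f : V -> V) : F :=
  \det (\matrix_(i < \dim W, j < \dim W) coord (vbasis W) j (f (vbasis W)`_i)).

Lemma map_det_bases n W (f : V -> V) (p q : n.-tuple V) : 
  (forall a X Y, X \in W -> Y \in W -> f (a *: X + Y) = a *: f X + f Y) ->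
  (forall X, X \in W -> f X \in W) -> basis_of W p -> basis_of W q ->
  map_det W f = \det (\matrix_(i < n, j < n) coord q j (f p`_i)) * \det (cmx q p).
Proof.
move=> fl fW pW qW; have nd : n = \dim W by rewrite (size_basis pW).
subst n; set e := vbasis W; have eW : basis_of W e := vbasisP W.
have f0 : f 0 = 0 by have := fl (-1) 0 0 (mem0v W) (mem0v W); rewrite scaler0 addr0 scaleN1r addNr.
have fsum (c : 'I_(\dim W) -> F) (x : (\dim W).-tuple V) : {subset x <= W} ->
    f (\sum_i c i *: x`_i) = \sum_i c i *: f x`_i.
  move=> xW; have xW' := tuple_mem xW.
  suff : \sum_i c i *: x`_i \in W /\ f (\sum_i c i *: x`_i) = \sum_i c i *: f x`_i by case.
  elim/big_ind2: _ => [|y1 y2 z1 z2 [? E1] [? E2]|t _]; first by rewrite mem0v.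
    by split; [rewrite memvD|rewrite -[y2]scale1r fl // scale1r E1 E2].
  by split; [rewrite memvZ|rewrite -[_ *: _]addr0 fl ?mem0v // f0 addr0].
have sub b : basis_of W b -> {subset b <= W} by move=> bW v; exact: basis_mem.
pose Mf (a b : (\dim W).-tuple V) := \matrix_(i < \dim W, j < \dim W) coord b j (f a`_i).
have M1 (a b b' : (\dim W).-tuple V) : {subset a <= W} -> basis_of W b -> Mf a b' = Mf a b *m cmx b b'.
  move=> aW bW; apply/matrixP => i k; rewrite !mxE.
  rewrite {1}(coord_basis bW (fW _ (tuple_mem aW i))) linear_sum /=.
  by apply: eq_bigr => j _; rewrite linearZ /= !mxE.
have M2 (a a' b : (\dim W).-tuple V) : {subset a <= W} -> basis_of W a' -> Mf a b = cmx a a' *m Mf a' b.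
  move=> aW a'W; apply/matrixP => i k; rewrite !mxE.
  rewrite {1}(coord_basis a'W (tuple_mem aW i)) fsum ?linear_sum /=; last exact: sub.
  by apply: eq_bigr => j _; rewrite linearZ /= !mxE.
rewrite -[LHS]/(\det (Mf e e)) -[X in X * _]/(\det (Mf p q)).
rewrite (M2 p e q (sub _ pW) eW) (M1 e e q (sub _ eW) eW) !det_mulmx.
have -> : \det (cmx p e) * (\det (Mf e e) * \det (cmx e q)) * \det (cmx q p) =
   \det (Mf e e) * (\det (cmx p e) * (\det (cmx e q *m cmx q p))).
  by rewrite det_mulmx; ring.
by rewrite -(cmx_mul _ (sub _ eW) qW) (cmx_comm pW eW) mulr1.
Qed.

(* Both sides are expanded along the row of x. *)
Lemma det_move_row n (phi : 'I_n.+1 -> V -> F) (x : V) (s : seq V) : size s = n ->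
  \det (\matrix_(i < n.+1, j < n.+1) phi j (x :: s)`_i) =
  (-1) ^+ n * \det (\matrix_(i < n.+1, j < n.+1) phi j (rcons s x)`_i).
Proof.
move=> sn; rewrite (expand_det_row _ ord0) (expand_det_row _ ord_max) mulr_sumr.
apply: eq_bigr => j _; rewrite !mxE /= nth_rcons sn ltnn eqxx /cofactor /= add0n.
rewrite [RHS]mulrCA; congr (_ * _); rewrite exprD !mulrA -expr2 sqrr_sign mul1r.
congr (_ * \det _); apply/matrixP => i k; rewrite !mxE /=; congr (phi _ _).
by rewrite /bump leqNgt ltn_ord add0n nth_rcons sn ltn_ord.
Qed.

Lemma det_swap_rows n (phi : 'I_n -> V -> F) (v b : seq V) : (size v + size b)%N = n ->
  \det (\matrix_(i < n, j < n) phi j (v ++ b)`_i) =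
  (-1) ^+ (size v * size b) * \det (\matrix_(i < n, j < n) phi j (b ++ v)`_i).
Proof.
elim: v b => [|x v IH] b nE /=; first by rewrite mul0n expr0 mul1r cats0.
case: n phi IH nE => [//|n] phi IH nE.
have sn : size (v ++ b) = n by rewrite size_cat; case: nE.
rewrite (det_move_row phi x sn) -cats1 -catA IH; last by rewrite size_cat addn1 addnS.
rewrite -catA /= size_cat addn1 mulrA -exprD; congr (_ * _).
rewrite -signr_odd -[RHS]signr_odd; congr ((-1) ^+ (nat_of_bool _)).
have -> : n = (size v + size b)%N by case: nE.
by rewrite !(oddD, oddM) /=; case: (odd (size v)); case: (odd (size b)).
Qed.

End Coordinates.

(** * The torsion as a determinant *)

Section TorsionDeterminant.
Variables (F : fieldType) (V : vectType F) (W : {vspace V}) (A : 'End(V)).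
Local Notation f := (coboundary A).
Hypothesis fW : (f @: W <= W)%VS.
Variables (r : nat) (B : V -> V -> F) (v u : r.-tuple V).
Hypothesis B_lin : forall a X Y Z, X \in W -> Y \in W -> Z \in W ->
  B Z (a *: X + Y) = a * B Z X + B Z Y.
Hypothesis vH : basisH1 W A v.
Hypothesis uH : basis_of (H0 W A) u.

Let phi Y := f Y + \sum_(k < r) B (tnth v k) Y *: tnth v k.

Let rdim : r = \dim (H0 W A). Proof. by rewrite (size_basis uH). Qed.

Let dimW : (\dim (B1 W A) + r)%N = \dim W.
Proof. by rewrite addnC rdim /H0 /B1 limg_ker_dim. Qed.

Let vW : {subset v <= W}.
Proof.
by case: vH => _ _ <- x xv; apply: (subvP (addvSl _ _)); exact: memv_span.
Qed.

(** Since [f] sends b' to b and u to 0, the map [phi] has matrix [1, *; 0, B(v, u)] from the basis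
    [b' ++ u] to the basis [b ++ v]. Passing to the bases used by the torsion, the only new sign, of
    exponent r * dim B1, comes from reordering [b ++ v] into [v ++ b]. *)
Lemma torsion_det T : is_Tor W A u v T ->
  T * \det (\matrix_(i < r, j < r) B (tnth v i) (tnth u j)) =
  (-1) ^+ (torsion_sign_exponent W A + r * \dim (B1 W A)) * map_det W phi.
Proof.
move=> [c [b [b' [cW bB [b'W b'b] ->]]]].
set s := \dim (B1 W A).
have sb : size b = s by rewrite -(size_basis (X := in_tuple b) bB).
have sb' : size b' = s by rewrite -sb -b'b size_map.
have sc : size c == (s + r)%N by rewrite dimW (size_basis (X := in_tuple c) cW).
have sp : size (b' ++ u) == (s + r)%N by rewrite size_cat sb' size_tuple.
have sq : size (b ++ v) == (s + r)%N by rewrite size_cat sb size_tuple.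
have sq' : size (v ++ b) == (s + r)%N by rewrite size_cat sb size_tuple addnC.
have fE X : X \in W -> f X \in B1 W A by exact: memv_img.
have BW : (B1 W A <= W)%VS := fW.
have uW : {subset u <= W}.
  by move=> x xu; have := basis_mem uH xu; rewrite memv_cap => /andP[].
(* A vector of W has the same image under [f] as some combination of the lifts b', and the
   difference is in H0. *)
have pW : basis_of W (Tuple sp).
  rewrite basisEdim; apply/andP; split; last by rewrite size_tuple dimW.
  apply/subvP => x xW /=; rewrite span_cat (span_basis uH).
  have : f x \in <<b>>%VS by rewrite (span_basis bB) fE.
  have -> : <<b>>%VS = (f @: <<b'>>)%VS by rewrite limg_span b'b.
  case/memv_imgP => y yb' E; rewrite -(subrK y x) addrC memv_add //.
  have yW : y \in W by apply: (subvP _ _ yb'); exact/span_subvP.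
  by rewrite memv_cap memvB //= memv_ker linearB /= E subrr.
have qW : basis_of W (Tuple sq).
  rewrite basisEdim; apply/andP; split; last by rewrite size_tuple dimW.
  by rewrite /= span_cat (span_basis bB) addvC; case: vH => _ _ ->.
have cW' : basis_of W (Tuple sc) by [].
have philin a X Y : X \in W -> Y \in W -> phi (a *: X + Y) = a *: phi X + phi Y.
  move=> XW YW; rewrite /phi linearP scalerDr addrACA; congr (_ + _).
  rewrite scaler_sumr -big_split; apply: eq_bigr => k _ /=.
  by rewrite (B_lin _ XW YW (vW (mem_tnth k v))) scalerDl scalerA.
have phiW X : X \in W -> phi X \in W.
  move=> XW; apply: memvD; first exact: (subvP BW) (fE _ XW).
  by apply: memv_suml => k _; rewrite memvZ // vW ?mem_tnth.
rewrite (map_det_bases philin phiW pW qW).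
rewrite (base_change_cmx sq' sc) (base_change_cmx sp sc).
set D := \det (\matrix_(i < r, j < r) B _ _).
have -> : \det (\matrix_(i < s + r, j < s + r) coord (Tuple sq) j (phi (Tuple sp)`_i)) = D.
  pose P := \matrix_(i < s, k < r) B (tnth v k) b'`_i.
  pose Q := \matrix_(j < r, k < r) B (tnth v k) u`_j.
  have vE k : tnth v k = (Tuple sq)`_(s + k).
    by rewrite /= nth_cat sb ltnNge leq_addr /= addKn -tnth_nth.
  have cv j k : coord (Tuple sq) j (tnth v k) = (j == rshift s k)%:R.
    by rewrite vE -[(s + k)%N]/(nat_of_ord (rshift s k)) coord_free ?(basis_free qW) // eq_sym.
  have -> : \matrix_(i < s + r, j < s + r) coord (Tuple sq) j (phi (Tuple sp)`_i) =
     block_mx 1%:M P 0 Q.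
    have cphi j X : coord (Tuple sq) j (phi X) = coord (Tuple sq) j (f X) +
        \sum_k B (tnth v k) X * (j == rshift s k)%:R.
      rewrite /phi linearD linear_sum; congr (_ + _); apply: eq_bigr => k _.
      by rewrite linearZ /= cv.
    have suml (c' : 'I_r -> F) j : \sum_k c' k * (lshift r j == rshift s k)%:R = 0.
      by rewrite big1 // => k _; rewrite eq_lrshift mulr0.
    have sumr (c' : 'I_r -> F) j : \sum_k c' k * (rshift s j == rshift s k)%:R = c' j.
      rewrite (bigD1 j) //= eqxx mulr1 big1 ?addr0 // => k kj.
      by rewrite eq_rshift eq_sym (negPf kj) mulr0.
    have pl (i : 'I_s) : (Tuple sp)`_(lshift r i) = b'`_i.
      by rewrite /= nth_cat sb' ltn_ord.
    have pr (i : 'I_r) : (Tuple sp)`_(rshift s i) = u`_i.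
      by rewrite /= nth_cat sb' ltnNge leq_addr /= addKn.
    have fl (i : 'I_s) j : coord (Tuple sq) j (f b'`_i) = (lshift r i == j)%:R.
      have -> : f b'`_i = (Tuple sq)`_(lshift r i).
        by rewrite /= nth_cat sb ltn_ord -b'b (nth_map 0) ?sb'.
      by rewrite coord_free ?(basis_free qW).
    have fr (i : 'I_r) : f u`_i = 0.
      have := basis_mem uH (mem_nth 0 (_ : i < size u)%N); rewrite size_tuple ltn_ord.
      by move=> /(_ isT); rewrite memv_cap memv_ker => /andP[_ /eqP].
    apply/matrixP => i j; rewrite mxE cphi.
    case: (split_ordP i) => i' ->; case: (split_ordP j) => j' ->; rewrite ?pl ?pr ?fl ?fr ?linear0.
    - by rewrite suml addr0 block_mxEul mxE eq_lshift.
    - by rewrite sumr eq_lrshift add0r block_mxEur mxE.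
    - by rewrite suml addr0 block_mxEdl mxE.
    - by rewrite sumr add0r block_mxEdr mxE.
  rewrite det_ublock det1 mul1r -det_tr; congr (\det _); apply/matrixP => i j.
  by rewrite !mxE -tnth_nth.
have qc : \det (cmx (Tuple sq') (Tuple sc)) = (-1) ^+ (r * s) * \det (cmx (Tuple sq) (Tuple sc)).
  have := @det_swap_rows _ _ (s + r) (fun j X => coord (Tuple sc) j X) v b _.
  by rewrite size_tuple sb addnC => /(_ erefl).
have qp : \det (cmx (Tuple sq) (Tuple sp)) =
    \det (cmx (Tuple sq) (Tuple sc)) / \det (cmx (Tuple sp) (Tuple sc)).
  have qsub : {subset Tuple sq <= W} by move=> x; exact: basis_mem.
  rewrite (cmx_mul (Tuple sp) qsub cW') det_mulmx; congr (_ * _).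
  have E := cmx_comm cW' pW; have nz : \det (cmx (Tuple sp) (Tuple sc)) != 0.
    by apply/eqP => z; move/eqP: E; rewrite z mulr0 eq_sym oner_eq0.
  by apply: (mulIf nz); rewrite E mulVf.
rewrite qc qp exprD; move: (\det (cmx (Tuple sq) _)) (\det (cmx _ _))^-1 (_ ^+ _) (_ ^+ _) D => a1 a2 a3 a4 a5.
by ring.
Qed.

End TorsionDeterminant.

Section TorsionExistence.
Variables (F : fieldType) (V : vectType F) (W : {vspace V}) (A : 'End(V)).
Local Notation f := (coboundary A).
Hypothesis fW : (f @: W <= W)%VS.

Lemma dimH1E : dimH1 W A = dimH0 W A.
Proof. by rewrite /dimH1 /dimH0 /H0 /B1 -[X in (X - _)%N](limg_ker_dim f W) addnK. Qed.

(** The condition defining nu quantifies over bases and torsions; this provides an instance at which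
    a given form can be evaluated. *)
Lemma torsion_bases r : \dim (H0 W A) = r -> exists v u : r.-tuple V,
  [/\ basisH1 W A v, basis_of (H0 W A) u & exists T, is_Tor W A u v T].
Proof.
move=> dr; pose U := (W :\: B1 W A)%VS.
have UB : (U + B1 W A)%VS = W by rewrite /U addv_diff; exact/addv_idPl.
have UcB : (U :&: B1 W A)%VS = 0%VS by exact: capv_diff.
have dU : \dim U = r.
  apply/eqP; rewrite -(eqn_add2r (\dim (B1 W A))) -dimv_disjoint_sum // UB.
  by rewrite -dr -(limg_ker_dim f W).
have sv : size (vbasis U) == r by rewrite size_tuple dU.
have su : size (vbasis (H0 W A)) == r by rewrite size_tuple dr.
exists (Tuple sv), (Tuple su); split; last first.
- have /choice[lift Hl] (x : V) : exists y, x \in B1 W A -> y \in W /\ f y = x.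
    have [/memv_imgP[y yW ->]|_] := boolP (x \in B1 W A); first by exists y.
    by exists 0.
  pose b := vbasis (B1 W A); exists ((-1) ^+ torsion_sign_exponent W A *
    (base_change (vbasis U ++ b) (vbasis W) /
     base_change (map lift b ++ vbasis (H0 W A)) (vbasis W))).
  exists (vbasis W), b, (map lift b); split=> //; try exact: vbasisP.
  split=> [x|]; first by case/seq.mapP => y /vbasis_mem/Hl[yW _] ->.
  rewrite -map_comp -[RHS]map_id; apply/eq_in_map => y /vbasis_mem/Hl[_ yE].
  by rewrite /= yE.
- exact: vbasisP.
split.
- exact: basis_free (vbasisP U).
- by rewrite (span_basis (vbasisP U)).
- by rewrite (span_basis (vbasisP U)).
Qed.

End TorsionExistence.

(** Here B1 = 0 and all dimensions are 1, so the sign exponent is 1 * 1 + 2 * 2, which is odd, while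
    the orientation makes the ratio of the coordinates of h1 and h0 positive. *)
Lemma real_Tor_neg (R : realType) (T : R) : is_real_Tor T -> T < 0.
Proof.
move=> [h0 [h1 [hp [c [b [b' [cB bB [_ b'b] ->]]]]]]].
have cob : coboundary \1%VF = 0 :> 'End(R^o) by rewrite /coboundary subrr.
have B10 : B1 fullv \1%VF = 0%VS :> {vspace R^o}.
  by apply/eqP; rewrite -subv0 /B1 cob; apply/subvP => x /memv_imgP[y _ ->]; rewrite zero_lfunE mem0v.
have d1 : \dim (fullv : {vspace R^o}) = 1%N by rewrite dimvf.
have H01 : dimH0 (fullv : {vspace R^o}) \1%VF = 1%N.
  have := limg_ker_dim (coboundary \1%VF : 'End(R^o)) fullv.
  by rewrite -/(B1 _ _) B10 dimv0 addn0 d1.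
have b0 : b = [::] by apply/nilP; rewrite /nilp -(size_basis (X := in_tuple b) bB) B10 dimv0.
have b'0 : b' = [::] by apply/nilP; rewrite /nilp -(size_map (coboundary \1%VF) b') b'b b0.
rewrite b0 b'0 /torsion_sign_exponent dimH1E H01 d1 /=.
have sc : size c = 1%N by rewrite -(size_basis (X := in_tuple c) cB) d1.
case: c sc cB => [//|c0 [|//]] _ cB.
have bc (x : R^o) : base_change [:: x] [:: c0] = coord (in_tuple [:: c0]) 0 x.
  by rewrite /base_change det_mx11 mxE.
have cE (x : R^o) : x = (coord (in_tuple [:: c0]) 0 x : R) * c0.
  have := coord_basis (X := in_tuple [:: c0]) cB (memvf x); rewrite big_ord1 /=.
  by move=> {1}->.
rewrite /= !bc; set x1 := coord _ 0 h1; set x0 := coord _ 0 h0.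
have e1 : h1 = (x1 : R) * c0 := cE h1; have e0 : h0 = (x0 : R) * c0 := cE h0.
have : 0 < (x0 : R) * x1.
  have h2 : 0 < h0 * h1 := hp; rewrite e0 e1 in h2.
  have h3 : 0 < (c0 : R) * c0.
    rewrite -expr2 lt_def sqr_ge0 andbT expf_neq0 //.
    by apply/eqP => z; move: h2; rewrite z !mulr0 ltxx.
  have h4 : (x0 : R) * c0 * (x1 * c0) = (x0 * x1) * (c0 * c0) :> R by ring.
  by move: h2; rewrite h4 (pmulr_lgt0 _ h3).
rewrite -[(1 + 1)%N]/2%N -signr_odd /= => h; rewrite expr1 mulN1r oppr_lt0.
have x00 : x0 != 0 by apply/eqP => z; move: h; rewrite z mul0r ltxx.
have -> : (x1 / x0 : R) = (x0 * x1) / (x0 ^+ 2) by field.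
by rewrite divr_gt0 // lt_def sqr_ge0 expf_neq0.
Qed.

Lemma real_Tor_exists (R : realType) : exists T : R, is_real_Tor T.
Proof.
exists ((-1) ^+ torsion_sign_exponent (fullv : {vspace R^o}) \1%VF *
  (base_change [:: (1 : R^o)] [:: (1 : R^o)] / base_change [:: (1 : R^o)] [:: (1 : R^o)])).
exists 1, 1; split; first by rewrite /positively_oriented mulr1.
exists [:: (1 : R^o)], [::], [::]; split=> //.
- rewrite basisEdim /= dimvf andbT; apply/subvP => x _.
  by rewrite span_seq1 -[x]mulr1 -[x * 1]/(x *: (1 : R^o)) memvZ // memv_line.
- rewrite /basis_of span_nil nil_free andbT eq_sym -subv0.
  apply/subvP => x /memv_imgP[y _ ->].
  by rewrite /coboundary subrr zero_lfunE mem0v.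
Qed.

(** * Forms of top degree on H^1 *)

Section Forms.
Variable R : realType.
Local Notation C := R[i].
Variable n : nat.
Local Notation M := 'M[C]_n.+1.
Variables (g : {vspace M}) (x : M) (r : nat).
Implicit Types (w : r.-tuple M -> C) (v : r.-tuple M).

Lemma tnth_update v i X j : tnth (update v i X) j = if j == i then X else tnth v j.
Proof. by rewrite tnth_mktuple. Qed.

Lemma update_sub v i X : {subset v <= g} -> X \in g -> {subset update v i X <= g}.
Proof.
move=> vg Xg Y /tnthP[j ->]; rewrite tnth_update; case: eqP => // _.
by apply: vg; exact: mem_tnth.
Qed.

Lemma update_comm v i j X Y : i != j ->
  update (update v i X) j Y = update (update v j Y) i X.
Proof.
move=> ij; apply: eq_from_tnth => k; rewrite !tnth_update.
by case: (eqVneq k j) => [->|//]; rewrite eq_sym (negPf ij).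
Qed.

Lemma update_id v i : update v i (tnth v i) = v.
Proof. by apply: eq_from_tnth => k; rewrite tnth_update; case: eqP => [->|]. Qed.

Lemma formH1_lin (a b : C) w w' : formH1 g x w -> formH1 g x w' ->
  formH1 g x (fun v => a * w v + b * w' v).
Proof.
move=> [l1 a1 z1] [l2 a2 z2]; split=> [v i c X Y vg Xg Yg|v i j vg ij E|v i X vg XB].
- by rewrite l1 // l2 //; ring.
- by rewrite (a1 v i j) // (a2 v i j) // !mulr0 addr0.
- by rewrite z1 // z2 // !mulr0 addr0.
Qed.

Definition reindex_tuple v (f : 'I_r -> 'I_r) : r.-tuple M := [tuple tnth v (f k) | k < r].

Lemma reindex_sub v f : {subset v <= g} -> {subset reindex_tuple v f <= g}.
Proof. by move=> vg Y /tnthP[j ->]; rewrite tnth_mktuple; apply: vg; exact: mem_tnth. Qed.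

(** The form is 0 when the entries i and j are both X + Y; expanding leaves the values at v and at
    the swapped tuple. *)
Lemma form_tperm w v i j : formH1 g x w -> {subset v <= g} -> w v = 0 ->
  w (reindex_tuple v (tperm i j)) = 0.
Proof.
move=> [lin alt _] vg wv; have [->|ij] := eqVneq i j.
  rewrite tperm1 (_ : reindex_tuple _ _ = v) //; apply: eq_from_tnth => k.
  by rewrite tnth_mktuple perm1.
set X := tnth v i; set Y := tnth v j.
have Xg : X \in g by apply: vg; exact: mem_tnth.
have Yg : Y \in g by apply: vg; exact: mem_tnth.
pose P Z Z' := update (update v i Z) j Z'.
have Pg Z Z' : Z \in g -> Z' \in g -> {subset P Z Z' <= g}.
  by move=> Zg Z'g; apply: update_sub => //; exact: update_sub.
have PZZ Z : Z \in g -> w (P Z Z) = 0.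
  move=> Zg; apply: (alt _ i j) => //; first exact: Pg.
  by rewrite !tnth_update eqxx (negPf ij) eqxx.
have XYg : 1 *: X + Y \in g by rewrite scale1r memvD.
have r2 Z : Z \in g -> w (P Z (1 *: X + Y)) = w (P Z X) + w (P Z Y).
  by move=> Zg; rewrite /P lin ?mul1r //; exact: update_sub.
have r1 Z : Z \in g -> w (P (1 *: X + Y) Z) = w (P X Z) + w (P Y Z).
  move=> Zg; rewrite /P !(update_comm v _ _ ij) lin ?mul1r //; exact: update_sub.
have := PZZ _ XYg; rewrite r2 // !r1 // !PZZ // add0r addr0.
have -> : P X Y = v by rewrite /P /X update_id /Y update_id.
rewrite wv addr0 => <-; congr w; apply: eq_from_tnth => k.
rewrite tnth_mktuple !tnth_update permE /=.
case: (eqVneq k i) => [->|ki]; first by rewrite (negPf ij).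
by case: (eqVneq k j).
Qed.

Lemma form_perm w v (s : 'S_r) : formH1 g x w -> {subset v <= g} -> w v = 0 ->
  w (reindex_tuple v s) = 0.
Proof.
move=> fw vg wv; have [ts -> _] := prod_tpermP s.
elim: ts => [|t ts IH].
  rewrite big_nil (_ : reindex_tuple _ _ = v) //; apply: eq_from_tnth => k.
  by rewrite tnth_mktuple perm1.
rewrite big_cons; move: (\prod_(_ <- ts) _)%g IH => s' IH.
have -> : reindex_tuple v (tperm t.1 t.2 * s')%g = reindex_tuple (reindex_tuple v s') (tperm t.1 t.2).
  by apply: eq_from_tnth => k; rewrite !tnth_mktuple permM.
by apply: form_tperm => //; exact: reindex_sub.
Qed.

Lemma form_reindex w v (f : 'I_r -> 'I_r) : formH1 g x w -> {subset v <= g} -> w v = 0 ->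
  w (reindex_tuple v f) = 0.
Proof.
move=> fw vg wv; have [/injectiveP inj|/injectivePn[i [j ij E]]] := boolP (injectiveb f).
  have := form_perm (perm inj) fw vg wv; rewrite (_ : reindex_tuple v (perm inj) = reindex_tuple v f) //.
  by apply: eq_from_tnth => k; rewrite !tnth_mktuple permE.
have [_ alt _] := fw; apply: (alt _ i j) => //; first exact: reindex_sub.
by rewrite !tnth_mktuple E.
Qed.

Lemma basisH1_sub v : basisH1 g (Ad x) v -> {subset v <= g}.
Proof.
by move=> [_ _ <-] X Xv; apply: (subvP (addvSl _ _)); exact: memv_span.
Qed.

(** Multilinear expansion one entry at a time, where k bounds the positions not yet filled by
    vectors of [v0]. The component in B1 contributes 0, and a tuple of vectors of [v0] is a
    reindexing of [v0]. *)
Lemma form_zero w v0 : formH1 g x w -> basisH1 g (Ad x) v0 -> w v0 = 0 ->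
  forall v, {subset v <= g} -> w v = 0.
Proof.
move=> fw bv0 wv0; have v0g := basisH1_sub bv0; have [lin alt B10] := fw.
have [_ _ span] := bv0.
suff K k v : (k <= r)%N -> {subset v <= g} ->
    (forall i : 'I_r, (k <= i)%N -> exists j, tnth v i = tnth v0 j) -> w v = 0.
  by move=> v vg; apply: (K r) => // i; rewrite leqNgt ltn_ord.
elim: k v => [|k IH] v kr vg Hv.
  have /choice[f Hf] i : exists j, tnth v i = tnth v0 j by exact: Hv.
  have -> : v = reindex_tuple v0 f by apply: eq_from_tnth => i; rewrite tnth_mktuple.
  exact: form_reindex.
pose i0 := Ordinal kr; pose phi X := w (update v i0 X).
have phi0 : phi 0 = 0.
  have := lin v i0 (-1) 0 0 vg (mem0v g) (mem0v g); rewrite scaler0 addr0 -/(phi 0).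
  by rewrite mulN1r addNr.
have : tnth v i0 \in (<<v0>> + B1 g (Ad x))%VS by rewrite span; apply: vg; exact: mem_tnth.
move=> /memv_addP[y yv [z zB vE]].
rewrite -(update_id v i0) vE -[y]scale1r lin //; last 2 first.
- by rewrite -span; apply: (subvP (addvSl _ _)).
- by rewrite -span; apply: (subvP (addvSr _ _)).
rewrite (B10 v i0 z) // addr0 mul1r; rewrite (coord_span yv).
suff : \sum_(i < r) coord v0 i y *: v0`_i \in g /\ phi (\sum_(i < r) coord v0 i y *: v0`_i) = 0.
  by case.
have v0i (i : 'I_r) : v0`_i \in g by apply: v0g; rewrite mem_nth ?size_tuple.
elim/big_ind: _ => [|X Y [Xg X0] [Yg Y0]|i _]; first by rewrite mem0v.
- by split; [rewrite memvD|rewrite -[X]scale1r /phi lin // -!/(phi _) X0 Y0 mulr0 addr0].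
split; first by rewrite memvZ.
rewrite -[_ *: _]addr0 /phi lin ?mem0v // -!/(phi _) phi0 addr0.
suff -> : phi v0`_i = 0 by rewrite mulr0.
apply: IH; [exact: ltnW|exact: update_sub|] => j kj; rewrite tnth_update.
case: eqP => [_|ji]; first by exists i; rewrite -tnth_nth.
by apply: Hv; rewrite ltn_neqAle kj andbT; apply/eqP => E; apply: ji; apply: val_inj.
Qed.

Lemma form_eq w w' v0 : formH1 g x w -> formH1 g x w' -> basisH1 g (Ad x) v0 ->
  w v0 = w' v0 -> forall v, {subset v <= g} -> w v = w' v.
Proof.
move=> fw fw' bv0 E v vg; apply/eqP; rewrite -subr_eq0; apply/eqP.
have := form_zero (formH1_lin 1 (-1) fw fw') bv0 _ vg; rewrite !mul1r !mulN1r; apply.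
by rewrite E subrr.
Qed.

Lemma det_form (L : 'I_r -> M -> C) :
  (forall i a X Y, X \in g -> Y \in g -> L i (a *: X + Y) = a * L i X + L i Y) ->
  (forall i X, X \in B1 g (Ad x) -> L i X = 0) ->
  formH1 g x (fun v => \det (\matrix_(i < r, j < r) L i (tnth v j))).
Proof.
move=> lin zB; pose D v := \det (\matrix_(j < r, i < r) L i (tnth v j)).
have DE v : \det (\matrix_(i < r, j < r) L i (tnth v j)) = D v.
  by rewrite -det_tr; congr (\det _); apply/matrixP => i j; rewrite !mxE.
split=> [v i a X Y vg Xg Yg|v i j vg ij E|v i X vg XB]; rewrite !DE /D.
- rewrite (@determinant_multilinear _ _ _ (\matrix_(j < r, l < r) L l (tnth (update v i X) j))
    (\matrix_(j < r, l < r) L l (tnth (update v i Y) j)) i a 1) ?mul1r //.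
  + apply/rowP => l; rewrite !mxE !tnth_mktuple eqxx lin // mul1r //.
  + by apply/matrixP => k l; rewrite !mxE !tnth_mktuple eq_sym (negPf (neq_lift _ _)).
  + by apply/matrixP => k l; rewrite !mxE !tnth_mktuple eq_sym (negPf (neq_lift _ _)).
- by rewrite (determinant_alternate ij) // => l; rewrite !mxE E.
- rewrite (expand_det_row _ i) big1 // => l _.
  by rewrite mxE tnth_mktuple eqxx zB ?mul0r.
Qed.

(** The defining condition leaves a choice of sign at each basis separately. Both w and c wd are
    forms of top degree on H^1, so a sign found at one basis v0 is the same at all tuples. *)
Lemma nu_char (B : M -> M -> C) (c : C) (wd : r.-tuple M -> C) :
  (coboundary (Ad x) @: g <= g)%VS -> \dim (H0 g (Ad x)) = r -> formH1 g x wd ->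
  (forall (v u : r.-tuple M) T, basisH1 g (Ad x) v -> basis_of (H0 g (Ad x)) u ->
     is_TOR g x u v T -> T * pairing B v u = c ^+ 2 * wd v ^+ 2) ->
  forall w, is_nu g B x w <->
    (forall v, {subset v <= g} -> w v = c * wd v) \/
    (forall v, {subset v <= g} -> w v = - c * wd v).
Proof.
move=> fg dH fwd key w.
have sq (y z : C) : y ^+ 2 = z ^+ 2 -> y = z \/ y = - z.
  by move/eqP; rewrite eqf_sqr => /orP[/eqP|/eqP]; [left|right].
have fc b : formH1 g x (fun v => b * wd v).
  by have [l1 a1 z1] := fwd; split=> [v i a X Y ? ? ?|v i j ? ? ?|v i X ? ?];
    [rewrite l1 //; ring|rewrite (a1 v i j) ?mulr0|rewrite z1 ?mulr0].
have [v0 [u0 [bv bu [T1 HT1]]]] := torsion_bases fg dH.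
have [T0 HT0] := real_Tor_exists R.
split=> [[fw Hw]|Hw].
  pose T := T1 * (Num.sg T0)%:C%C ^+ \dim g.
  have HT : is_TOR g x u0 v0 T by exists T1, T0.
  have E := key v0 u0 T bv bu HT.
  have : w v0 = c * wd v0 \/ w v0 = - (c * wd v0).
    apply: sq; rewrite exprMn -E.
    by case: (Hw v0 u0 T bv bu HT) => ->; rewrite ?sqrrN sqrtCK.
  by case=> E0; [left|right] => v vg; apply: (form_eq fw (fc _) bv) => //; rewrite E0 ?mulNr.
have {Hw} [b [b2 Hw]] : exists b, b ^+ 2 = c ^+ 2 /\ forall v, {subset v <= g} -> w v = b * wd v.
  by case: Hw => Hw; [exists c|exists (- c); rewrite sqrrN].
have [l1 a1 z1] := fc b.
split; last first.
  move=> v u T bv' bu' HT; rewrite (Hw _ (basisH1_sub bv')); apply: sq.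
  by rewrite sqrtCK exprMn b2 (key v u).
split=> [v i a X Y vg Xg Yg|v i j vg ij E|v i X vg XB].
- by rewrite !Hw ?l1 //; apply: update_sub; rewrite ?memvD ?memvZ.
- by rewrite Hw // (a1 v i j).
- by rewrite Hw ?z1 //; apply: update_sub => //; exact: (subvP fg).
Qed.

End Forms.

(** * Determinants at a diagonalizable coboundary *)

Section DiagonalMap.
Variables (F : fieldType) (V : vectType F) (W : {vspace V}).
Variables (s r : nat) (p : (s + r).-tuple V) (f : 'End(V)) (d : 'I_s -> F).
Hypothesis pW : basis_of W p.
Local Notation b i := (p`_(lshift r i)).
Local Notation u j := (p`_(rshift s j)).
Hypothesis fb : forall i : 'I_s, f (b i) = d i *: b i.
Hypothesis fu : forall j : 'I_r, f (u j) = 0.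

Let cv (v : r.-tuple V) := \matrix_(k < r, j < r) coord p (rshift s j) (tnth v k).

Let pmem i : p`_(nat_of_ord (i : 'I_(s + r))) \in W.
Proof. by apply: (basis_mem pW); rewrite mem_nth ?size_tuple. Qed.

Let vE (v : r.-tuple V) k : {subset v <= W} ->
  tnth v k = \sum_i coord p (lshift r i) (tnth v k) *: b i +
             \sum_j cv v k j *: u j.
Proof.
move=> vW; rewrite {1}(coord_basis pW (vW _ (mem_tnth k v))) big_split_ord /=.
by congr (_ + _); apply: eq_bigr => j _; rewrite mxE.
Qed.

Lemma lin_on_sum (L : V -> F) (I : finType) (c : I -> F) (x : I -> V) :
  (forall a X Y, X \in W -> Y \in W -> L (a *: X + Y) = a * L X + L Y) ->
  (forall i, x i \in W) -> L (\sum_i c i *: x i) = \sum_i c i * L (x i).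
Proof.
move=> Ll xW; have L0 : L 0 = 0.
  by have := Ll (-1) 0 0 (mem0v W) (mem0v W); rewrite scaler0 addr0 mulN1r addNr.
suff : \sum_i c i *: x i \in W /\ L (\sum_i c i *: x i) = \sum_i c i * L (x i) by case.
elim/big_ind2: _ => [|y1 y2 z1 z2 [? E1] [? E2]|t _]; first by rewrite mem0v.
  by split; [rewrite memvD|rewrite -[y2]scale1r Ll // mul1r E1 E2].
by split; [rewrite memvZ|rewrite -[_ *: _]addr0 Ll ?mem0v // L0 addr0].
Qed.

(** The L_i vanish on the eigenvectors b, so only the components of v along u matter; their
    determinant [cv v] is the factor that also appears, squared, in [map_det_diag]. *)
Lemma det_functionals (L : 'I_r -> V -> F) (v : r.-tuple V) : {subset v <= W} ->
  (forall i a X Y, X \in W -> Y \in W -> L i (a *: X + Y) = a * L i X + L i Y) ->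
  (forall i (j : 'I_s), L i (b j) = 0) ->
  \det (\matrix_(i < r, j < r) L i (tnth v j)) =
  \det (\matrix_(i < r, j < r) L i (u j)) * \det (cv v).
Proof.
move=> vW Ll L0; rewrite -[\det (cv v)]det_tr -det_mulmx; congr (\det _).
apply/matrixP => i j; rewrite !mxE {1}(vE j vW) -[X in L i X]addrC.
have sW : \sum_j0 cv v j j0 *: u j0 \in W by apply: memv_suml => k _; rewrite memvZ.
have tW : \sum_k coord p (lshift r k) (tnth v j) *: b k \in W.
  by apply: memv_suml => k _; rewrite memvZ.
rewrite -[X in L i (X + _)]scale1r Ll // mul1r !lin_on_sum //; try exact: Ll.
rewrite [X in _ + X]big1 ?addr0; last by move=> k _; rewrite L0 mulr0.
by apply: eq_bigr => k _; rewrite !mxE mulrC.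
Qed.

Variable B : V -> V -> F.
Hypothesis B_linl : forall a X Y Z, X \in W -> Y \in W -> Z \in W ->
  B (a *: X + Y) Z = a * B X Z + B Y Z.
Hypothesis B_linr : forall a X Y Z, X \in W -> Y \in W -> Z \in W ->
  B Z (a *: X + Y) = a * B Z X + B Z Y.
Hypothesis B_bu : forall (i : 'I_s) (j : 'I_r), B (b i) (u j) = 0.

(* In the basis p the map is the product of the block matrices
   [D, *; 0, B(v, u)] and [1, 0; *, cv v]. *)
Lemma map_det_diag (v : r.-tuple V) : {subset v <= W} ->
  map_det W (fun X => f X + \sum_k B (tnth v k) X *: tnth v k) =
  (\prod_i d i) * \det (\matrix_(i < r, j < r) B (u i) (u j)) * \det (cv v) ^+ 2.
Proof.
move=> vW; set phi := fun X => _.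
have fW X : X \in W -> f X \in W.
  move=> XW; rewrite (coord_basis pW XW) linear_sum memv_suml // => i _.
  rewrite linearZ memvZ //=; case: (split_ordP i) => j ->; first by rewrite [f _]fb memvZ.
  by rewrite [f _]fu mem0v.
have phiW X : X \in W -> phi X \in W.
  move=> XW; apply: memvD; first exact: fW.
  by apply: memv_suml => k _; rewrite memvZ // vW ?mem_tnth.
have philin a X Y : X \in W -> Y \in W -> phi (a *: X + Y) = a *: phi X + phi Y.
  move=> XW YW; rewrite /phi linearP scalerDr addrACA; congr (_ + _).
  rewrite scaler_sumr -big_split; apply: eq_bigr => k _ /=.
  by rewrite (B_linr _ XW YW (vW _ (mem_tnth k v))) scalerDl scalerA.
rewrite (map_det_bases philin phiW pW pW) cmx_id ?(basis_free pW) // det1 mulr1.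
pose Pl := \matrix_(i < s, k < r) B (tnth v k) (b i).
pose Q := \matrix_(j < r, k < r) B (tnth v k) (u j).
pose cl := \matrix_(k < r, i < s) coord p (lshift r i) (tnth v k).
pose D := diag_mx (\row_i d i).
have cphi i j : coord p j (phi p`_i) = coord p j (f p`_i) +
    \sum_k B (tnth v k) p`_i * coord p j (tnth v k).
  by rewrite /phi linearD linear_sum; congr (_ + _); apply: eq_bigr => k _; rewrite linearZ.
have cp i j : coord p j p`_(nat_of_ord (i : 'I_(s + r))) = (i == j)%:R.
  by rewrite coord_free ?(basis_free pW).
have -> : \matrix_(i < s + r, j < s + r) coord p j (phi p`_i) =
   block_mx D Pl 0 Q *m block_mx 1%:M 0 cl (cv v).
  have cf i j : coord p j (f (b i)) = d i * (lshift r i == j)%:R.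
    by rewrite fb [LHS]linearZ; congr (_ * _); exact: cp.
  rewrite mulmx_block mulmx1 mulmx0 add0r mul0mx !add0r.
  apply/matrixP => i j; rewrite mxE cphi.
  case: (split_ordP i) => i' ->; case: (split_ordP j) => j' ->; rewrite ?cf ?fu ?linear0.
  - rewrite block_mxEul mxE; congr (_ + _); first by rewrite !mxE eq_lshift mulr_natr.
    by rewrite mxE; apply: eq_bigr => k _; rewrite !mxE.
  - by rewrite eq_lrshift mulr0 add0r block_mxEur mxE; apply: eq_bigr => k _; rewrite !mxE.
  - by rewrite add0r block_mxEdl mxE; apply: eq_bigr => k _; rewrite !mxE.
  - by rewrite !add0r block_mxEdr mxE; apply: eq_bigr => k _; rewrite !mxE.
rewrite det_mulmx det_ublock det_lblock det1 mul1r det_diag.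
have -> : \det Q = \det (\matrix_(i < r, j < r) B (u i) (u j)) * \det (cv v).
  rewrite -[LHS]det_tr mulrC -det_mulmx; congr (\det _); apply/matrixP => i j.
  rewrite !mxE {1}(vE i vW).
  have sW : \sum_j0 cv v i j0 *: u j0 \in W by apply: memv_suml => k _; rewrite memvZ.
  have tW : \sum_k coord p (lshift r k) (tnth v i) *: b k \in W.
    by apply: memv_suml => k _; rewrite memvZ.
  have Bl a X Y : X \in W -> Y \in W -> B (a *: X + Y) (u j) = a * B X (u j) + B Y (u j).
    by move=> XW YW; exact: B_linl.
  rewrite -[X in B (X + _)]scale1r Bl // mul1r.
  rewrite (@lin_on_sum (fun X => B X (u j)) _ _ _ Bl) // (@lin_on_sum (fun X => B X (u j)) _ _ _ Bl) //.
  rewrite big1 ?add0r; last by move=> k _; rewrite B_bu mulr0.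
  by apply: eq_bigr => k _; rewrite [X in _ = _ * X]mxE.
have -> : \prod_i (\row_i d i) 0 i = \prod_i d i by apply: eq_bigr => i _; rewrite mxE.
by rewrite expr2 !mulrA.
Qed.

Lemma diag_kernel_dim (A : 'End(V)) : coboundary A = f -> (forall i, d i != 0) ->
  \dim (H0 W A) = r.
Proof.
move=> cE d0.
rewrite /H0 cE; suff -> : (W :&: lker f)%VS = <<[tuple u j | j < r]>>%VS.
  have fr : free [tuple u j | j < r].
    apply/freeP => c; under eq_bigr do rewrite nth_mktuple.
    move=> E j; have := congr1 (coord p (rshift s j)) E; rewrite linear_sum linear0.
    rewrite (eq_bigr (fun k => c k * (k == j)%:R)) => [|k _].
      by rewrite (bigD1 j) //= eqxx mulr1 big1 ?addr0 // => k /negPf ->; rewrite mulr0.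
    rewrite [LHS]linearZ; congr (_ * _).
    by rewrite -(eq_rshift s k j) -(coord_free _ _ (basis_free pW)).
  by move: fr; rewrite /free size_tuple => /eqP.
apply/eqP; rewrite eqEsubv; apply/andP; split; apply/subvP => x.
  rewrite memv_cap memv_ker => /andP[xW /eqP fx].
  rewrite (coord_basis pW xW) big_split_ord /= big1 ?add0r => [|i _].
    by apply: memv_suml => j _; rewrite memvZ // memv_span //; apply/mapP; exists j; rewrite ?mem_enum.
  have : coord p (lshift r i) (f x) = d i * coord p (lshift r i) x.
    rewrite {1}(coord_basis pW xW) linear_sum linear_sum.
    rewrite (eq_bigr (fun j => (j == lshift r i)%:R * (d i * coord p (lshift r i) x))) => [|j _].
      by rewrite (bigD1 (lshift r i)) //= eqxx mul1r big1 ?addr0 // => j /negPf ->; rewrite mul0r.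
    transitivity (coord p j x * coord p (lshift r i) (f p`_j)).
      by rewrite -[RHS]linearZ; congr (coord _ _ _); exact: linearZ.
    case: (split_ordP j) => j' ->; last by rewrite fu linear0 mulr0 eq_rlshift mul0r.
    have -> : coord p (lshift r i) (f (b j')) = d j' * (lshift r j' == lshift r i)%:R.
      by rewrite fb [LHS]linearZ; congr (_ * _); rewrite -(coord_free _ _ (basis_free pW)).
    by rewrite eq_lshift; have [->|_] := eqVneq j' i; rewrite ?mulr1 ?mul1r ?mulr0 ?mul0r // mulrC.
  rewrite fx linear0 => /esym/eqP; rewrite mulf_eq0 (negPf (d0 i)) => /eqP ->.
  by rewrite scale0r.
move=> xs; suff : (<<[tuple u j | j < r]>> <= W :&: lker f)%VS by move/subvP; apply.
apply/span_subvP => y /mapP[j _ ->]; rewrite memv_cap pmem memv_ker fu; exact: eqxx.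
Qed.

End DiagonalMap.

(** More than dim U vectors of U are linearly dependent; in this way minors bound the rank of Ad x -
    1. *)
Lemma det_dependent (F : fieldType) (V : vectType F) k (y : k.-tuple V) (U : {vspace V})
    (phi : 'I_k -> {linear V -> F^o}) : {subset y <= U} -> (\dim U < k)%N ->
  \det (\matrix_(i < k, j < k) (phi j y`_i : F)) = 0.
Proof.
move=> yU dU; set A := \matrix_(i, j) _; apply/eqP; apply: contraTT dU => A0.
rewrite -leqNgt -[X in (X <= _)%N](size_tuple y).
have /eqP <- : free y.
  apply/freeP => c E; have : (\row_i c i) *m A = 0.
    apply/rowP => j; rewrite [LHS]mxE [RHS]mxE.
    transitivity (phi j (\sum_i c i *: y`_i) : F); last by rewrite E linear0.
    by rewrite linear_sum; apply: eq_bigr => i _; rewrite linearZ !mxE.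
  move=> /(congr1 (mulmx^~ (invmx A))); rewrite mulmxK ?unitmxE ?unitfE // mul0mx.
  by move=> /rowP H i; have := H i; rewrite !mxE.
by apply: dimvS; apply/span_subvP.
Qed.

Lemma functional_delta (F : fieldType) N (l : {linear 'M[F]_N -> F^o}) (Y : 'M[F]_N) :
  (l Y : F) = \sum_i \sum_j Y i j * (l (delta_mx i j) : F).
Proof.
rewrite {1}(matrix_sum_delta Y) linear_sum; apply: eq_bigr => i _.
by rewrite linear_sum; apply: eq_bigr => j _; rewrite linearZ.
Qed.

Lemma bigD_ord (F : fieldType) (I : Type) (x0 : I) (s : seq I) (f : I -> F) :
  \prod_(x <- s) f x = \prod_(i < size s) f (nth x0 s i).
Proof. by rewrite (big_nth x0) big_mkord. Qed.

Lemma nth_cat_enum (T : Type) (x0 : T) (p : seq T) r (f : 'I_r -> T) (j : 'I_r) :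
  nth x0 (p ++ [seq f i | i : 'I_r]) (size p + j) = f j.
Proof.
rewrite nth_cat ltnNge leq_addr /= addKn (nth_map j) ?size_enum_ord //.
by rewrite nth_ord_enum.
Qed.

Section ConjBasis.
Variables (F : fieldType) (N : nat) (g : {vspace 'M[F]_N}) (k : 'M[F]_N).
Hypothesis ku : k \in unitmx.
Hypothesis kg : forall X, X \in g -> k *m X *m invmx k \in g.

Lemma conj_basis (p : seq 'M[F]_N) : basis_of g p ->
  basis_of g [seq k *m X *m invmx k | X <- p].
Proof.
have lf c X Y : k *m (c *: X + Y) *m invmx k = c *: (k *m X *m invmx k) + k *m Y *m invmx k.
  by rewrite mulmxDr mulmxDl -scalemxAr -scalemxAl.
move=> pg; have [phi phiE] := linfun_of lf.
have -> : [seq k *m X *m invmx k | X <- p] = map phi p by apply: eq_map => X; rewrite phiE.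
have k0 : lker phi = 0%VS.
  apply/eqP; rewrite -subv0; apply/subvP => X; rewrite memv_ker phiE memv0 => /eqP E.
  have : invmx k *m (k *m X *m invmx k) *m k = 0 by rewrite E mulmx0 mul0mx.
  by rewrite -mulmxA mulmxKV // mulKmx // => ->.
have gE : (phi @: g)%VS = g.
  apply/eqP; rewrite eqEdim limg_dim_eq ?k0 ?capv0 // leqnn andbT.
  by apply/subvP => _ /memv_imgP[X Xg ->]; rewrite phiE kg.
by rewrite -[X in basis_of X]gE; apply: limg_basis_of => //; rewrite k0 capv0.
Qed.

End ConjBasis.

(** * The square of the form nu *)

Section Identity.
Variable R : realType.
Local Notation C := R[i].
Local Open Scope classical_set_scope.
Local Open Scope complex_scope.
Import ComplexField.Normc.
Variable n : nat.
Local Notation M := 'M[C]_n.+1.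

Lemma AdE (x X : M) : Ad x X = x *m X *m invmx x.
Proof.
have lf c (Y Z : M) : x * (c *: Y + Z) * x^-1 = c *: (x * Y * x^-1) + x * Z * x^-1.
  by rewrite mulrDr mulrDl -scalerAr -scalerAl.
pose fL : {linear M -> M} := HB.pack (fun X : M => x * X * x^-1) (GRing.isLinear.Build _ _ _ _ _ lf).
by rewrite /Ad -[LHS]/(linfun fL X) lfunE.
Qed.

Lemma cobE (x X : M) : coboundary (Ad x) X = x *m X *m invmx x - X.
Proof. by rewrite /coboundary add_lfunE opp_lfunE id_lfunE AdE. Qed.

Lemma dcharE (f : M -> C) (x X : M) :
  dchar f x X = derive1 (fun t : C => f (mexp (t *: X) *m x)) 0.
Proof.
have E : (fun t : C => f (expm (t *: X) * x)) = (fun t : C => f (mexp (t *: X) *m x)).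
  by apply/funext => t; rewrite expmE.
by rewrite /dchar E.
Qed.

Variables (G : set M) (g h : {vspace M}).
Hypothesis GG : group_with_lie G g.

Lemma cob_sub x : G x -> (coboundary (Ad x) @: g <= g)%VS.
Proof.
by move=> Gx; apply/subvP => _ /memv_imgP[X Xg ->]; rewrite cobE memvB // (Ad_g GG).
Qed.

Section OneFunction.
Variable f : M -> C.
Hypothesis freg : regfun G g f.
Hypothesis fclass : forall x y, G x -> G y -> f (x *m y *m invmx x) = f y.

Let dchar_diff : exists df : M -> M -> C,
  [/\ forall X, X \in g -> regfun G g (df X),
     forall X x, X \in g -> G x -> dchar f x X = df X x,
     forall c X Y x, X \in g -> Y \in g -> G x ->
       df (c *: X + Y) x = c * df X x + df Y x
   & forall Y x, Y \in g -> G x -> df (x *m Y *m invmx x) x = df Y x].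
Proof.
have [df [dfr dfE dfl dfc]] := regfun_diff GG freg; exists df; split; [exact: dfr| |exact: dfl|].
  by move=> X x Xg Gx; exact: etrans (dcharE f x X) (dfE X x Xg Gx).
by apply: dfc => x y Gx Gy; exact: fclass.
Qed.

Lemma dchar_regfun X : X \in g -> regfun G g (fun x => dchar f x X).
Proof.
move=> Xg; have [df [dfr dfE _ _]] := dchar_diff.
by apply: regfun_ext (dfr X Xg) => x Gx; exact: esym (dfE X x Xg Gx).
Qed.

Lemma dchar_lin x c X Y : G x -> X \in g -> Y \in g ->
  dchar f x (c *: X + Y) = c * dchar f x X + dchar f x Y.
Proof.
move=> Gx Xg Yg; have [df [_ dfE dfl _]] := dchar_diff.
have sg : c *: X + Y \in g by apply: memvD => //; exact: memvZ.
by rewrite (dfE _ x sg Gx) (dfE X x Xg Gx) (dfE Y x Yg Gx) (dfl c X Y x Xg Yg Gx).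
Qed.

Lemma dchar_cob x X : G x -> X \in B1 g (Ad x) -> dchar f x X = 0.
Proof.
move=> Gx /memv_imgP[Y Yg ->]; rewrite cobE -scaleN1r addrC.
have Ag := Ad_g GG Gx Yg; rewrite (dchar_lin _ Gx Yg Ag) mulN1r.
have [df [_ dfE _ dfc]] := dchar_diff.
by rewrite (dfE _ x Ag Gx) (dfE Y x Yg Gx) (dfc Y x Yg Gx) addNr.
Qed.

Lemma dchar_conj k x X : G k -> G x -> X \in g ->
  dchar f (k *m x *m invmx k) (k *m X *m invmx k) = dchar f x X.
Proof.
move=> Gk Gx Xg; have ku := Gunit GG Gk.
have E : (fun t : C => f (mexp (t *: (k *m X *m invmx k)) *m (k *m x *m invmx k))) =
         (fun t : C => f (mexp (t *: X) *m x)).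
  apply/funext => t; have Gt : G (mexp (t *: X)) by apply: (Gexp GG); exact: memvZ.
  rewrite -(fclass Gk (GM GG Gt Gx)); congr f.
  by rewrite -(conj_mul _ _ ku) -(conj_mexp _ ku) -scalemxAr -scalemxAl.
by rewrite (dcharE f x X) (dcharE f (k *m x *m invmx k)) E.
Qed.

End OneFunction.

Hypothesis Gdense : exp_dense G g.
Hypothesis cp : cartan_pair g h.
Local Notation dual := 'Hom(subvs_of h, C^o).
Variables (r : nat) (a : r.-tuple dual).
Local Notation "''a_' i" := (tnth a i) (at level 8, i at level 2, format "''a_' i").
Hypothesis a_basis : basis_of fullv a.
Hypothesis a_root : forall i, isroot g 'a_i.
Hypothesis a_pos : forall beta, isroot g beta -> positive a beta \/ positive a (- beta).
Implicit Types (H K : subvs_of h) (alpha mu : dual) (v : r.-tuple M).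
Local Notation co := (co cp a).
Local Notation el := (@ce_exp_like R).

Variables (rts : seq dual) (xs : dual -> M).
Hypothesis rts_uniq : uniq rts.
Hypothesis rtsP : forall alpha, alpha \in rts <-> isroot g alpha.
Hypothesis xsP : forall alpha, alpha \in rts -> rootv g alpha (xs alpha) /\ xs alpha != 0.
Hypothesis xs_basis :
  basis_of g ([seq xs alpha | alpha <- rts] ++ [seq vsval (co i) | i : 'I_r]).

Let hg H : vsval H \in g. Proof. exact: (subvP (cp_sub cp) _ (subvsP _)). Qed.
Let Gm H : G (mexp (vsval H)). Proof. exact: (Gexp GG (hg H)). Qed.

Local Notation s := (size rts).

Let conj_size k : size [seq k *m X *m invmx k |
  X <- [seq xs alpha | alpha <- rts] ++ [seq vsval (co i) | i : 'I_r]] == (s + r)%N.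
Proof. by rewrite size_map size_cat size_map size_image card_ord. Qed.

Let pk k : (s + r).-tuple M := Tuple (conj_size k).

Let pk_basis k : G k -> basis_of g (pk k).
Proof.
by move=> Gk; apply: conj_basis xs_basis; [exact: Gunit GG _ Gk|move=> X; exact: (Ad_g GG Gk)].
Qed.

Let pkl k (i : 'I_s) : (pk k)`_(lshift r i) = k *m xs rts`_i *m invmx k.
Proof.
have ir : (i < size (map xs rts))%N by rewrite size_map.
by rewrite /pk [LHS](nth_map 0) ?size_cat ?ltn_addr //= nth_cat ir (nth_map 0).
Qed.

Let pkr k (j : 'I_r) : (pk k)`_(rshift s j) = k *m vsval (co j) *m invmx k.
Proof.
have E := nth_cat_enum 0 (map xs rts) (fun i => vsval (co i)) j; rewrite size_map in E.
rewrite /pk [LHS](nth_map 0); first by congr (_ *m _ *m _).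
by rewrite size_cat size_map size_image card_ord ltn_add2l.
Qed.

Let cob_conj k H alpha X : G k -> rootv g alpha X ->
  coboundary (Ad (k *m mexp (vsval H) *m invmx k)) (k *m X *m invmx k) =
  (ce (alpha H) - 1) *: (k *m X *m invmx k).
Proof.
move=> Gk HX; have ku := Gunit GG Gk.
rewrite cobE conj_inv ?mexp_unit // !conj_mul // (conj_rootv H HX).
by rewrite scalerBl scale1r -scalemxAr -scalemxAl.
Qed.

Let cob_l k H (i : 'I_s) : G k ->
  coboundary (Ad (k *m mexp (vsval H) *m invmx k)) (pk k)`_(lshift r i) =
  (ce (rts`_i H) - 1) *: (pk k)`_(lshift r i).
Proof.
by move=> Gk; rewrite pkl; apply: cob_conj => //; apply: (xsP _).1; rewrite mem_nth.
Qed.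

Let cob_r k H (j : 'I_r) : G k ->
  coboundary (Ad (k *m mexp (vsval H) *m invmx k)) (pk k)`_(rshift s j) = 0.
Proof.
move=> Gk; rewrite pkr (@cob_conj k H 0); last first.
- by apply: (rootv_h cp); exact: subvsP.
- by [].
by rewrite zero_lfunE (el0 el) subrr scale0r.
Qed.

Lemma dim_g : \dim g = (s + r)%N.
Proof. by have := size_basis (pk_basis (G1 GG)). Qed.

Lemma torus_dim_H0 k H : G k -> torus_regular rts H ->
  \dim (H0 g (Ad (k *m mexp (vsval H) *m invmx k))) = r.
Proof.
move=> Gk rH; apply: (@diag_kernel_dim _ _ _ _ _ (pk k) (coboundary (Ad (k *m mexp (vsval H) *m invmx k)))
  (fun i : 'I_s => ce (rts`_i H) - 1)) => //.
- exact: pk_basis.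
- by move=> i; exact: cob_l.
- by move=> i; exact: cob_r.
- by move=> i; rewrite subr_eq0 rH // mem_nth.
Qed.

Lemma dchar_exp_sum (f : M -> C) (l : seq dual) K H :
  (forall H', f (mexp (vsval H')) = \sum_(mu <- l) ce (mu H')) ->
  dchar f (mexp (vsval H)) (vsval K) = \sum_(mu <- l) (mu K : C) * ce (mu H).
Proof.
move=> fE; have -> : \sum_(mu <- l) (mu K : C) * ce (mu H) =
    \sum_(j < size l) (l`_j K : C) * ce (l`_j H).
  by rewrite (big_nth 0) big_mkord.
rewrite dcharE -(derive1_ce_sum (fun j : 'I_(size l) => l`_j K) (fun j => l`_j H)).
apply: (congr1 (fun u : C -> C => derive1 u 0)); apply/funext => t.
have -> : mexp (t *: vsval K) *m mexp (vsval H) = mexp (vsval (t *: K + H)).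
  rewrite linearP mexpD // -[GRing.comm _ _]/(_ *m _ = _ *m _) -scalemxAl -scalemxAr.
  by congr (_ *: _); exact: (cartan_comm (cp_br cp) (cp_nondeg cp) (cp_sub cp) (cp_nil cp) (cp_self cp) (subvsP K) (subvsP H)).
rewrite fE (big_nth 0) big_mkord; apply: eq_bigr => j _.
by rewrite dualP.
Qed.

Section Key.
Variable B : M -> M -> C.
Hypothesis B_lin : forall c X Y Z, X \in g -> Y \in g -> Z \in g ->
  B (c *: X + Y) Z = c * B X Z + B Y Z.
Hypothesis B_sym : forall X Y, X \in g -> Y \in g -> B X Y = B Y X.
Hypothesis B_inv : forall x X Y, G x -> X \in g -> Y \in g ->
  B (x *m X *m invmx x) (x *m Y *m invmx x) = B X Y.

Lemma B_linr c X Y Z : X \in g -> Y \in g -> Z \in g ->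
  B Z (c *: X + Y) = c * B Z X + B Z Y.
Proof. by move=> Xg Yg Zg; rewrite !(B_sym Zg) ?memvD ?memvZ // B_lin. Qed.

(** Invariance under exp K for a regular K gives B (X, H) = exp (alpha K) B (X, H) with exp (alpha
    K) != 1. *)
Lemma rootv_orth alpha X H : alpha \in rts -> rootv g alpha X -> B X (vsval H) = 0.
Proof.
move=> ar HX; have [K /(_ _ ar) rK] := torus_regular_exists cp a_basis a_pos rts_uniq rtsP.
have [Xg _] := HX; have := B_inv (Gm K) Xg (hg H).
rewrite (conj_rootv K HX) (conj_rootv K (rootv_h cp (subvsP H))) zero_lfunE (el0 el) scale1r.
have B0 : B 0 (vsval H) = 0.
  have := B_lin (-1) (mem0v g) (mem0v g) (hg H).
  by rewrite scaler0 addr0 mulN1r addNr.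
rewrite -[_ *: X]addr0 B_lin ?mem0v // B0 addr0 => /eqP.
by rewrite -subr_eq0 -[X in _ - X]mul1r -mulrBl mulf_eq0 subr_eq0 (negPf rK) => /eqP.
Qed.

Variable sigma : 'I_r -> M -> C.
Hypothesis sreg : forall i, regfun G g (sigma i).
Hypothesis sclass : forall i x y, G x -> G y -> sigma i (x *m y *m invmx x) = sigma i y.
Variables (om : 'I_r -> dual) (L : 'I_r -> seq dual).
Hypothesis om_co : forall i j, om i (co j) = (i == j)%:R :> C.
Hypothesis L_low : forall i mu, mu \in L i -> exists k, nz k /\ mu = om i - nat_comb a k.
Hypothesis s_torus : forall i H,
  sigma i (mexp (vsval H)) = \sum_(mu <- om i :: L i) ce (mu H).

Definition nu_square : C :=
  (-1) ^+ size (pos_roots a rts) * \det (\matrix_(i < r, j < r) B (vsval (co i)) (vsval (co j))).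

Definition pairing_map v x X : M :=
  coboundary (Ad x) X + \sum_k B (tnth v k) X *: tnth v k.

Lemma dchar_torus i K H :
  dchar (sigma i) (mexp (vsval H)) (vsval K) = dchi (@ce R) om L i K H.
Proof. exact: (dchar_exp_sum K H (s_torus i)). Qed.

Lemma det_dchar_torus H :
  \det (\matrix_(i < r, j < r) dchar (sigma i) (mexp (vsval H)) (vsval (co j))) =
  weyl_denom (@ce R) a rts H.
Proof.
have L_refl i j K : \sum_(mu <- om i :: L i) ce (mu (refl cp a j K)) =
    \sum_(mu <- om i :: L i) ce (mu K).
  have E := class_refl GG cp a_root j K (@sclass i).
  exact: etrans (esym (s_torus i _)) (etrans E (s_torus i K)).
rewrite -(jac_weyl_denom el a_basis a_root a_pos rts_uniq rtsP om_co L_low L_refl).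
apply: (congr1 (fun A : 'M[C]_r => \det A)); apply/matrixP => i j.
by rewrite [LHS]mxE [RHS]mxE; exact: dchar_torus.
Qed.

(** In the conjugated basis of root vectors and coroots Ad z - 1 is diagonal, and v enters both
    sides only through the squared determinant of its coordinates along the coroots. What remains is
    the product over the roots on one side and the squared Jacobian on the other. *)
Lemma key_torus k H v : G k -> torus_regular rts H -> {subset v <= g} ->
  map_det g (pairing_map v (k *m mexp (vsval H) *m invmx k)) =
  nu_square * wedge_dchar sigma (k *m mexp (vsval H) *m invmx k) v ^+ 2.
Proof.
move=> Gk rH vg; set z := _ *m _ *m _.
have Gz : G z by apply: (GM GG); [apply: (GM GG)|exact: (GV GG)].
have kg X : X \in g -> k *m X *m invmx k \in g by exact: (Ad_g GG Gk).
have Bbu (i : 'I_s) (j : 'I_r) : B (pk k)`_(lshift r i) (pk k)`_(rshift s j) = 0.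
  have [HX _] := xsP (mem_nth 0 (ltn_ord i)); have [Xg _] := HX.
  by rewrite pkl pkr B_inv // (rootv_orth _ _ HX) // mem_nth.
rewrite (@map_det_diag _ _ _ _ _ _ (coboundary (Ad z)) _ (pk_basis Gk) (fun i => cob_l H i Gk)
  (fun j => cob_r H j Gk) B B_lin B_linr Bbu v vg).
rewrite /wedge_dchar (@det_functionals _ _ _ _ _ _ (pk_basis Gk) (fun i X => dchar (sigma i) z X) v vg); last 2 first.
- by move=> i c X Y Xg Yg; exact: (dchar_lin (sreg i) (@sclass i)).
- move=> i j; apply: (dchar_cob (sreg i) (@sclass i) Gz).
  have c0 : ce (rts`_j H) - 1 != 0 by rewrite subr_eq0 rH // mem_nth.
  rewrite -[_`_ _]scale1r -(mulVf c0) -scalerA -cob_l // memvZ // memv_img //.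
  by rewrite pkl; apply: kg; have [[]] := xsP (mem_nth 0 (ltn_ord j)).
have -> : \det (\matrix_(i < r, j < r) dchar (sigma i) z (pk k)`_(rshift s j)) =
    weyl_denom (@ce R) a rts H.
  rewrite -det_dchar_torus; apply: (congr1 (fun A : 'M[C]_r => \det A)); apply/matrixP => i j.
  by rewrite [LHS]mxE [RHS]mxE pkr; exact: (dchar_conj (@sclass i) Gk (Gm H) (hg (co j))).
have -> : \prod_(i < s) (ce (rts`_i H) - 1) =
    (-1) ^+ size (pos_roots a rts) * weyl_denom (@ce R) a rts H ^+ 2.
  by rewrite -(prod_roots el cp a_basis a_pos rts_uniq rtsP) (bigD_ord 0).
have -> : \det (\matrix_(i < r, j < r) B (pk k)`_(rshift s i) (pk k)`_(rshift s j)) =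
    \det (\matrix_(i < r, j < r) B (vsval (co i)) (vsval (co j))).
  by congr (\det _); apply/matrixP => i j; rewrite !mxE !pkr B_inv.
have key (w1 w2 w3 w4 : C) : w4 * w1 ^+ 2 * w2 * w3 ^+ 2 = w4 * w2 * (w1 * w3) ^+ 2 by ring.
exact: key.
Qed.

Lemma regfun_functional (l : {linear M -> C^o}) (F : M -> M) :
  (forall i j, regfun G g (fun x => F x i j)) -> regfun G g (fun x => (l (F x) : C)).
Proof.
move=> HF; apply: regfun_ext (_ : regfun G g (fun x =>
  \sum_i \sum_j F x i j * (l (delta_mx i j) : C))) => [x _|].
  by rewrite -functional_delta.
by do 2 apply: regfun_sum => ? _; apply: regfunM => //; exact: regfun_cst.
Qed.

Lemma regfun_cob X (Y : M) i j : regfun G g (fun x => (coboundary (Ad x) X + Y) i j).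
Proof.
apply: regfun_ext (_ : regfun G g (fun x =>
  \sum_k (\sum_l x i l * X l k) * invmx x k j + (- X i j + Y i j))) => [x _|].
  rewrite cobE [RHS]mxE [X in _ = X + _]mxE [X in _ = _ + X + _]mxE -addrA; congr (_ + _).
  by rewrite mxE; apply: eq_bigr => k _; rewrite [in RHS]mxE.
apply: regfunD; last exact: regfun_cst.
apply: regfun_sum => k _; apply: regfunM; last exact: regfun_inv_entry GG _ _.
apply: regfun_sum => l _; apply: regfunM; last exact: regfun_cst.
exact: regfun_entry.
Qed.

(* Both sides are regular in x and they agree on the regular torus. *)
Lemma key_identity x v : G x -> {subset v <= g} ->
  map_det g (pairing_map v x) = nu_square * wedge_dchar sigma x v ^+ 2.
Proof.
move=> Gx vg; apply/eqP; rewrite -subr_eq0; apply/eqP.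
apply: (torus_identity GG Gdense cp a_basis a_pos rts_uniq rtsP
  (f := fun x => map_det g (pairing_map v x) - nu_square * wedge_dchar sigma x v ^+ 2)) Gx.
  apply: regfunD; last apply: regfunN.
    apply: regfun_det => i j; apply: regfun_ext (_ : regfun G g (fun x => (coord (vbasis g) j
      (coboundary (Ad x) (vbasis g)`_i + \sum_k B (tnth v k) (vbasis g)`_i *: tnth v k) : C))).
      by move=> y _; rewrite mxE.
    by apply: regfun_functional => i' j'; exact: regfun_cob.
  apply: regfunM; first exact: regfun_cst.
  have rw : regfun G g (fun x => wedge_dchar sigma x v).
    apply: regfun_det => i j; apply: regfun_ext (_ : regfun G g (fun x => dchar (sigma i) x (tnth v j))).
      by move=> y _; rewrite mxE.
    exact: (dchar_regfun (sreg i) (@sclass i) (vg _ (mem_tnth j v))).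
  by apply: regfun_ext (regfunM rw rw) => y _; rewrite expr2.
by move=> H rH k Gk; rewrite key_torus // subrr.
Qed.

(* A minor of Ad x - 1 of size larger than d - r vanishes at the regular points
   of the torus, hence everywhere. *)
Lemma dim_H0_ge x : G x -> (r <= \dim (H0 g (Ad x)))%N.
Proof.
move=> Gx; pose k := \dim (B1 g (Ad x)).
have dk y : (\dim (H0 g (Ad y)) + \dim (B1 g (Ad y)))%N = (s + r)%N.
  by rewrite -dim_g -(limg_ker_dim (coboundary (Ad y)) g).
rewrite leqNgt; apply/negP => lt; have ks : (s < k)%N.
  by move: (dk x) lt; rewrite -/k; lia.
pose b := vbasis (B1 g (Ad x)).
have /choice[X HX] (i : 'I_k) : exists X, X \in g /\ coboundary (Ad x) X = b`_i.
  have : b`_i \in B1 g (Ad x) by apply: vbasis_mem; rewrite mem_nth ?size_tuple.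
  by case/memv_imgP => X Xg ->; exists X.
pose D y := \det (\matrix_(i < k, j < k) coord b j (coboundary (Ad y) (X i))).
have D1 : D x = 1.
  rewrite /D (_ : \matrix_(i, j) _ = 1%:M) ?det1 //; apply/matrixP => i j.
  by rewrite !mxE (HX i).2 coord_free // (basis_free (vbasisP _)).
suff D0 : D x = 0 by move/eqP: D1; rewrite D0 eq_sym oner_eq0.
apply: (torus_identity GG Gdense cp a_basis a_pos rts_uniq rtsP (f := D)) Gx.
  apply: regfun_det => i j; apply: regfun_ext (_ : regfun G g (fun y => (coord b j
      (coboundary (Ad y) (X i) + 0) : C))) => [y _|]; first by rewrite mxE addr0.
  by apply: regfun_functional => i' j'; exact: regfun_cob.
move=> H rH c Gc; rewrite /D; set z := _ *m _ *m _.
pose y := [tuple coboundary (Ad z) (X i) | i < k].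
rewrite (_ : \matrix_(i, j) _ = \matrix_(i < k, j < k) (coord b j y`_i : C)).
  apply: (@det_dependent _ _ _ y (B1 g (Ad z)) (fun j => coord b j)).
    by move=> _ /mapP[i _ ->]; rewrite memv_img // (HX i).1.
  have := dk z; rewrite (torus_dim_H0 Gc rH : \dim (H0 g (Ad z)) = r) addnC => /eqP.
  by rewrite eqn_add2r => /eqP ->.
by apply/matrixP => i j; rewrite !mxE nth_mktuple.
Qed.

(** For the inclusion of the Lie algebra in the kernel, exp (t X) = exp (t x X x^-1) for t = 1 / (k
    + 1) is differentiated at t = 0. *)
Lemma lie_centralizer x : G x -> lie_algebra (centralizer G x) (H0 g (Ad x)).
Proof.
move=> Gx X; have xu := Gunit GG Gx; split=> [|HX].
  rewrite memv_cap memv_ker cobE subr_eq0 => /andP[Xg /eqP xX] t.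
  rewrite expmE; have Xt : t%:C *: X \in g by exact: memvZ.
  split; first exact: (Gexp GG).
  suff : mexp (t%:C *: X) *m x = x *m mexp (t%:C *: X) by [].
  have E : x *m mexp (t%:C *: X) *m invmx x = mexp (t%:C *: X).
    by rewrite -(conj_mexp _ xu) -scalemxAr -scalemxAl xX.
  by rewrite -{1}E mulmxKV.
have Xg : X \in g by apply: (Glie GG) => t; have [] := HX t; rewrite expmE.
rewrite memv_cap Xg memv_ker cobE subr_eq0; apply/eqP.
have E (k : nat) : mexp (k.+1%:R^-1 *: (x *m X *m invmx x)) = mexp (k.+1%:R^-1 *: X).
  have -> : (k.+1%:R^-1 : C) = (k.+1%:R^-1 : R)%:C by rewrite rmorphV ?unitfE // rmorph_nat.
  have [_] := HX k.+1%:R^-1; rewrite expmE => E.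
  have {}E : mexp ((k.+1%:R^-1 : R)%:C *: X) *m x = x *m mexp ((k.+1%:R^-1 : R)%:C *: X) by exact: E.
  have -> : (k.+1%:R^-1 : R)%:C *: (x *m X *m invmx x) = x *m ((k.+1%:R^-1 : R)%:C *: X) *m invmx x.
    by rewrite -scalemxAr -scalemxAl.
  by rewrite (conj_mexp _ xu) -E mulmxK.
apply: (tends_unique (tends_deriv _)); apply: (tends_ext _ (tends_deriv X)) => k.
by rewrite E.
Qed.

(** A regular point of the torus attains the lower bound r of [dim_H0_ge], so the minimality that
    defines regular elements forces equality. *)
Lemma regular_dim x : regular G x -> \dim (H0 g (Ad x)) = r.
Proof.
move=> [Gx [z Hz z_min]]; apply/eqP; rewrite eqn_leq dim_H0_ge // andbT.
have -> : H0 g (Ad x) = z by apply/vspaceP => X; apply/idP/idP => [/(proj1 (lie_centralizer Gx X))/Hz|/Hz/(proj2 (lie_centralizer Gx X))].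
have [H rH] := torus_regular_exists cp a_basis a_pos rts_uniq rtsP.
have G1' := G1 GG; have Gy : G (1%:M *m mexp (vsval H) *m invmx 1%:M).
  by apply: (GM GG); [apply: (GM GG)|exact: (GV GG)].
by rewrite -(torus_dim_H0 G1' rH); apply: z_min (lie_centralizer Gy).
Qed.

Lemma torus_value H : map_det g (pairing_map [tuple vsval (co j) | j < r] (mexp (vsval H))) =
  nu_square * weyl_denom (@ce R) a rts H ^+ 2.
Proof.
rewrite (key_identity (Gm H)) => [|X /mapP[j _ ->]//].
congr (_ * _ ^+ 2); rewrite -det_dchar_torus.
apply: (congr1 (fun A : 'M[C]_r => \det A)); apply/matrixP => i j.
by rewrite [LHS]mxE [RHS]mxE tnth_mktuple.
Qed.

Lemma nu_constant_square c : c ^+ 2 = nu_square -> nu_constant G g B sigma c.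
Proof.
move=> c2 x rx; have [Gx _] := rx; have dH := regular_dim rx; have fg := cob_sub Gx.
apply: (nu_char fg dH).
  apply: (@det_form _ _ _ _ _ (fun i X => dchar (sigma i) x X)).
    by move=> i b X Y Xg Yg; exact: (dchar_lin (sreg i) (@sclass i)).
  by move=> i X XB; exact: (dchar_cob (sreg i) (@sclass i) Gx).
move=> v u T bv bu [T1 [T0 [HT1 HT0 ->]]].
have Br c' X Y Z : X \in g -> Y \in g -> Z \in g -> B Z (c' *: X + Y) = c' * B Z X + B Z Y.
  exact: B_linr.
have := torsion_det fg Br bv bu HT1; rewrite -/(pairing B v u) => E.
have -> : T1 * (Num.sg T0)%:C ^+ \dim g * pairing B v u =
    (Num.sg T0)%:C ^+ \dim g * (T1 * pairing B v u).
  by rewrite [T1 * _]mulrC -mulrA.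
rewrite E (_ : map_det g _ = map_det g (pairing_map v x)) // key_identity //; last exact: basisH1_sub bv.
rewrite c2 (ltr0_sg (real_Tor_neg HT0)) rmorphN1 mulrA -exprD.
(* The sign of the real torsion contributes the summand dim g. The number s of roots is even, so dim
   g and r have the same parity and the exponent is congruent to r + r^2. *)
suff -> : (-1 : C) ^+ (\dim g + (torsion_sign_exponent g (Ad x) + r * \dim (B1 g (Ad x)))) = 1.
  by rewrite mul1r.
have se : odd s = false.
  by rewrite (perm_size (perm_roots cp a_basis a_pos rts_uniq rtsP)) size_cat size_map addnn odd_double.
have dB : \dim (B1 g (Ad x)) = s.
  apply/eqP; rewrite -(eqn_add2l r) -dH (limg_ker_dim (coboundary (Ad x)) g).
  by rewrite dH addnC dim_g.
rewrite -signr_odd /torsion_sign_exponent dimH1E // /dimH0 dH dB dim_g.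
by rewrite !(oddD, oddM) se /=; case: (odd r).
Qed.

End Key.

End Identity.

(** * Independence of the torus *)

Section IntegralComparison.
Variables (F : numClosedFieldType) (ce : F -> F).
Hypothesis el : exp_like ce.

Lemma ce_nat t k : ce (t * k%:R) = ce t ^+ k.
Proof.
elim: k => [|k IH]; first by rewrite mulr0 (el0 el) expr0.
by rewrite -natr1 mulrDr mulr1 (elD el) IH exprSr.
Qed.

(** Otherwise two of the values ce (t k) with k < N = size p coincide, for every t, so that ce t is
    a root of unity of order dividing N!. Then ce (t N!) = 1 for all t, which forces N! = 0. *)
Lemma exp_poly_eq0 (p : {poly F}) : (forall t, p.[ce t] = 0) -> p = 0.
Proof.
move=> p0; apply/eqP; apply: contraT => pn0; pose N := size p.
suff E : (N`!%:R : F) = 0 by move/eqP: E; rewrite pnatr_eq0 -leqn0 leqNgt fact_gt0.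
apply: (el_eq1 el) => t; rewrite ce_nat.
pose rs := [seq ce (t * k%:R) | k <- iota 0 N].
have nu : ~~ uniq rs.
  apply/negP => urs; have := max_poly_roots pn0 _ urs; rewrite size_map size_iota ltnn.
  suff -> : all (root p) rs by move=> /(_ isT).
  by apply/allP => _ /seq.mapP[k _ ->]; rewrite /root p0.
have [i [j [ij jN E]]] : exists i j, [/\ (i < j)%N, (j < N)%N & ce (t * i%:R) = ce (t * j%:R)].
  have /(uniqPn 0)[i [j [ij js E]]] := nu; rewrite size_map size_iota in js.
  exists i, j; split=> //; have iN := ltn_trans ij js; move: E.
  by rewrite !(nth_map 0%N) ?size_iota // !nth_iota.
have c1 : ce t ^+ (j - i) = 1.
  have c0 : ce t ^+ i != 0 by rewrite expf_neq0 // (el_neq0 el).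
  by apply: (mulIf c0); rewrite mul1r -exprD subnK ?(ltnW ij) // -!ce_nat E.
have /dvdnP[q ->] : (j - i %| N`!)%N by apply: dvdn_fact; rewrite subn_gt0 ij; lia.
by rewrite mulnC exprM c1 expr1n.
Qed.

Variables (N : nat) (g h : {vspace 'M[F]_N}).
Hypothesis cp : cartan_pair g h.
Local Notation dual := 'Hom(subvs_of h, F^o).
Variables (r : nat) (a : r.-tuple dual).
Local Notation "''a_' i" := (tnth a i) (at level 8, i at level 2, format "''a_' i").
Hypothesis a_basis : basis_of fullv a.
Hypothesis a_root : forall i, isroot g 'a_i.
Local Notation co := (co cp a).
Local Notation positive := (positive a).

(** The Cartan matrix A is integral, and invertible because the simple roots separate points of h.
    Taking z = det A * adj A * (1, ..., 1) gives A z = (det A)^2 (1, ..., 1), where the square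
    ensures that D > 0. *)
Lemma integral_cocharacter : exists (z : 'I_r -> int) (D : nat), (0 < D)%N /\
  forall i, 'a_i (\sum_j (z j)%:~R *: co j) = D%:R :> F.
Proof.
have /choice[A0 HA] (ij : 'I_r * 'I_r) : exists z : int, 'a_ij.1 (co ij.2) = z%:~R :> F.
  exact: (simple_coroot_int cp a_root).
pose A := \matrix_(i, j) A0 (i, j); pose AF := map_mx (intr : int -> F) A.
have HAF i j : AF i j = 'a_i (co j) by rewrite !mxE -HA.
have d0 : \det AF != 0.
  apply/negP => /eqP E; have /det0P[v v0 vA] : \det AF^T == 0 by rewrite det_tr E.
  case/eqP: v0; apply/rowP => j; rewrite mxE.
  apply: (co_free a_basis a_root (cp := cp) (c := fun j => v 0 j)).
  set H := \sum_i _; have aH i : 'a_i H = 0 :> F.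
    rewrite dual_sumZ; have /rowP/(_ i) := vA; rewrite !mxE => E1; rewrite -[RHS]E1.
    by apply: eq_bigr => k _; rewrite mxE HAF.
  apply/eqP; apply: contraT => H0; pose f (K : subvs_of h) : F^o := 0.
  have [al al1] : exists al : dual, al H != 0 :> F.
    pose b := vbasis (fullv : {vspace subvs_of h}).
    have [i ci] : exists i, coord b i H != 0.
      apply/existsP; apply: contraNT H0; rewrite negb_exists => /forallP c0.
      rewrite (coord_vbasis (memvf H)) big1 // => i _.
      by have := c0 i; rewrite negbK => /eqP ->; rewrite scale0r.
    have [al alE] := linfun_of (W := F^o) (f := coord b i) (fun c x y => linearP _ c x y).
    by exists al; rewrite alE.
  have := coord_basis a_basis (memvf al) => alE; case/eqP: al1.
  rewrite alE sum_lfunE big1 // => i _.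
  by rewrite scale_lfunE -tnth_nth aH scaler0.
pose z := (\det A) *: (\adj A *m const_mx 1 : 'cV[int]_r).
exists (fun j => z j 0), (absz (\det A ^+ 2)); split.
  rewrite absz_gt0 expf_neq0 //; apply: contraNneq d0 => E.
  by rewrite /AF det_map_mx E.
move=> i; rewrite dual_sumZ.
have : A *m z = (\det A ^+ 2) *: const_mx 1 :> 'cV[int]_r.
  by rewrite /z -scalemxAr mulmxA mul_mx_adj mul_scalar_mx scalerA -expr2.
move=> /matrixP/(_ i 0); rewrite [LHS]mxE [RHS]mxE [const_mx _ _ _]mxE mulr1 => E.
rewrite natr_absz ger0_norm ?sqr_ge0 // -E rmorph_sum.
by apply: eq_bigr => j _; rewrite rmorphM mulrC !mxE /= -HA.
Qed.

Variable rts : seq dual.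
Hypothesis rtsP : forall alpha, alpha \in rts <-> isroot g alpha.
Local Notation wd := (weyl_denom ce a rts).

(* On a rational one-parameter subgroup both sides are polynomials in ce t; the
   product over the roots is monic and the Jacobian has integer coefficients,
   hence the lead coefficients give q = q' m^2. *)
Lemma integral_comparison (q q' : F) (L' : 'I_r -> seq dual) :
  (forall i nu j, nu \in L' i -> exists z : int, nu (co j) = z%:~R :> F) ->
  (forall H, q * wd H ^+ 2 = q' * \det (\matrix_(i < r, j < r)
     \sum_(nu <- L' i) (nu (co j) : F) * ce (nu H)) ^+ 2) ->
  exists m : int, q = q' * m%:~R ^+ 2.
Proof.
move=> L'int E; have [z [D [D0 aD]]] := integral_cocharacter.
set H0 := \sum_j _ in aD.
have /choice[zc Hzc] (inj : 'I_r * dual * 'I_r) : exists c : int,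
    inj.1.2 \in L' inj.1.1 -> inj.1.2 (co inj.2) = c%:~R :> F.
  have [nuL|_] := boolP (inj.1.2 \in L' inj.1.1); last by exists 0.
  by have [c Hc] := L'int _ _ inj.2 nuL; exists c.
pose e i nu : int := \sum_j z j * zc (i, nu, j).
have He i nu : nu \in L' i -> nu H0 = (e i nu)%:~R :> F.
  move=> nuL; rewrite dual_sumZ rmorph_sum; apply: eq_bigr => j _.
  by rewrite rmorphM /= (Hzc (i, nu, j)).
pose K := (\max_i \max_(nu <- L' i) absz (e i nu))%N.
have eK i nu : nu \in L' i -> 0 <= e i nu + K%:Z.
  move=> nuL; have : (absz (e i nu) <= K)%N.
    apply: (@leq_trans (\max_(nu <- L' i) absz (e i nu))); first exact: leq_bigmax_seq.
    exact: (leq_bigmax (F := fun i => \max_(nu <- L' i) absz (e i nu)) i).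
  by lia.
have /choice[ze Hze] (inu : 'I_r * dual) : exists k : nat, inu.2 \in L' inu.1 ->
    (inu.2 H0 : F) + K%:R = k%:R.
  have [nuL|_] := boolP (inu.2 \in L' inu.1); last by exists 0%N.
  have [k Hk] : exists k : nat, e inu.1 inu.2 + K%:Z = k.
    by exists (absz (e inu.1 inu.2 + K%:Z)); rewrite gez0_abs // eK.
  by exists k => _; rewrite (He inu.1) // -[K%:R]/((K%:Z)%:~R) -rmorphD /= Hk.
pose Qz : {poly int} := \det (\matrix_(i < r, j < r)
  \sum_(nu <- L' i) (zc (i, nu, j))%:P * 'X^(ze (i, nu))).
pose Q := map_poly (intr : int -> F) Qz.
have QE t : Q.[ce t] = ce t ^+ (r * K) * \det (\matrix_(i < r, j < r)
     \sum_(nu <- L' i) (nu (co j) : F) * ce (nu (t *: H0))).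
  rewrite /Q /Qz -det_map_mx -horner_evalE -det_map_mx.
  rewrite mulnC exprM -detZ; congr (\det _); apply/matrixP => i j; rewrite !mxE.
  rewrite rmorph_sum /= horner_evalE horner_sum mulr_sumr big_seq [RHS]big_seq.
  apply: eq_bigr => nu nuL; rewrite rmorphM /= map_polyC map_polyXn /= !hornerE.
  have -> : ce t ^+ ze (i, nu) = ce t ^+ K * ce (nu (t *: H0)).
    by rewrite -ce_nat -(Hze (i, nu)) //= mulrDr (elD el) ce_nat dualZ mulrC.
  by rewrite -(Hzc (i, nu, j)) //; exact: etrans (mulrCA _ _ _) (mulrA _ _ _).
have /choice[m Hm] al : exists k : nat, al \in pos_roots a rts -> al H0 = (k * D)%:R :> F /\ (0 < k)%N.
  have [|_] := boolP (al \in pos_roots a rts); last by exists 0%N.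
  move=> /(pos_rootsP a rtsP)[[a0 _] [k kE]]; exists (\sum_i k i)%N => _; split.
    rewrite kE nat_combE sum_lfunE big_distrl natr_sum; apply: eq_bigr => i _.
    by rewrite natrM -(aD i); exact: scale_lfunE.
  rewrite lt0n; apply: contraNneq a0 => k0; rewrite kE nat_comb0 // => i.
  by apply/eqP; rewrite -leqn0 -k0 (bigD1 i) //= leq_addr.
pose P := \prod_(al <- pos_roots a rts) ('X^(m al * D) - 1 : {poly F}).
pose E0 := (\sum_(al <- pos_roots a rts) m al * D)%N.
have PE t : P.[ce t] ^+ 2 = ce t ^+ E0 * wd (t *: H0) ^+ 2.
  rewrite /P horner_prod /weyl_denom /E0 -!prodrXl expr_sum -big_split.
  apply: eq_big_seq => al alP; rewrite hornerD hornerN hornerXn hornerC /=.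
  rewrite dualZ (Hm al alP).1 -ce_nat; move: (t * _) => u.
  have E1 := elN el (2%:R^-1 * u).
  have -> : ce u = ce (2%:R^-1 * u) ^+ 2 by rewrite expr2 -(elD el); congr ce; field.
  move: (ce (2%:R^-1 * u)) (ce (- _)) E1 => y y' E1.
  rewrite -exprMn; congr (_ ^+ 2); rewrite mulrBr -expr2 (mulrC y) E1.
  by [].
have Pm : P \is monic.
  rewrite /P big_seq; apply: monic_prod => al alP.
  by apply: monicXnsubC; rewrite muln_gt0 (Hm al alP).2.
have PQ : q *: (P ^+ 2 * 'X^(r * K * 2)) = q' *: (Q ^+ 2 * 'X^E0).
  apply/eqP; rewrite -subr_eq0; apply/eqP; apply: exp_poly_eq0 => t.
  have hE (S : {poly F}) k (x : F) : (S ^+ 2 * 'X^k).[x] = S.[x] ^+ 2 * x ^+ k.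
    by rewrite hornerM horner_exp hornerXn.
  rewrite hornerD hornerN !hornerZ !hE PE QE.
  have := E (t *: H0); move: (\det _) (wd _) (ce t) => d w x Ed.
  rewrite [x ^+ _ * w ^+ 2]mulrC -[q * _]/(q * _) exprMn -exprM.
  have -> : q * (w ^+ 2 * x ^+ E0 * x ^+ (r * K * 2)) = (q * w ^+ 2) * (x ^+ E0 * x ^+ (r * K * 2)).
    by rewrite !mulrA.
  rewrite Ed; move: (x ^+ E0) (x ^+ (r * K * 2)) => y1 y2.
  by ring.
exists (lead_coef Qz).
have := congr1 lead_coef PQ; rewrite !lead_coefZ !lead_coefM !lead_coefXn !mulr1.
rewrite (monicP Pm) !mulr1 => ->; rewrite -expr2.
by rewrite /Q lead_coef_map_inj //; exact: intr_inj.
Qed.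

End IntegralComparison.

Section TrigExp.
Variable R : realType.
Local Notation C := R[i].

Lemma entry_mul m (B : 'M[C]_m) i j :
  (delta_mx 0 i : 'rV_m) *m B *m (delta_mx j 0 : 'cV_m) = (B i j)%:M.
Proof.
by rewrite -rowE -colE [LHS]mx11_scalar !mxE.
Qed.

Lemma trig_mexp m (A : 'M[C]_m) : is_trig_mx A ->
  is_trig_mx (mexp A) /\ forall i, mexp A i i = ce (A i i).
Proof.
move=> tA; have T i j := tendsMr (delta_mx j 0 : 'cV[C]_m)
  (tendsMl (delta_mx 0 i : 'rV[C]_m) (mexp_tends A)).
have E (X Y : 'M[C]_1) i j : X = (mexp A i j)%:M -> X = Y -> mexp A i j = Y 0 0.
  by move=> -> <-; rewrite mxE eqxx mulr1n.
split=> [|i].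
  apply/is_trig_mxP => i j ij; rewrite (E _ 0 i j (entry_mul _ i j)) ?mxE //.
  apply: tends_unique (T i j) _; apply: tends_ext (tends_cst 0) => k.
  rewrite entry_mul /psum /series /= summxE big1 ?raddf0 // => l _.
  by rewrite mxE (is_trig_mxP (trigX l tA).1) ?mulr0.
rewrite (E _ (mexp (A i i)%:M) i i (entry_mul _ i i)) //.
apply: tends_unique (T i i) _; apply: tends_ext (mexp_tends _) => k.
rewrite entry_mul /psum /series /= summxE raddf_sum; apply: eq_bigr => l _.
have -> : (A i i)%:M ^+ l = (A i i ^+ l)%:M :> 'M[C]_1.
  by elim: l => [|l IH]; rewrite ?expr0 // cmxXS IH -scalar_mxM -exprS.
have -> : (l`!%:R^-1 *: A ^+ l) i i = l`!%:R^-1 * A i i ^+ l by rewrite mxE (trigX l tA).2.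
exact: scale_scalar_mx.
Qed.

End TrigExp.

Section IntegralWeights.
Variable R : realType.
Local Notation C := R[i].
Variable N : nat.
Local Notation M := 'M[C]_N.
Variables (g h : {vspace M}).
Hypothesis cp : cartan_pair g h.
Local Notation dual := 'Hom(subvs_of h, C^o).

Let hg H : vsval (H : subvs_of h) \in g. Proof. exact: (subvP (cp_sub cp) _ (subvsP _)). Qed.

Lemma integral_weights m (D : M -> 'M[C]_m) :
  (forall c X Y, X \in g -> Y \in g -> D (c *: X + Y) = c *: D X + D Y) ->
  (forall X Y, X \in g -> Y \in g -> D (br X Y) = br (D X) (D Y)) ->
  exists P (mu : 'I_m -> dual), [/\ P \in unitmx,
    forall H, is_trig_mx (P *m mexp (D (vsval H)) *m invmx P) /\
      forall p, (P *m mexp (D (vsval H)) *m invmx P) p p = ce (mu p H)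
  & forall p alpha, isroot g alpha -> exists z : int, mu p (coroot cp alpha) = z%:~R :> C].
Proof.
move=> Dl Db; have D0 : D 0 = 0.
  by have := Dl (-1) 0 0 (mem0v g) (mem0v g); rewrite scaler0 addr0 scaleN1r addNr.
have [|H K|P [mu [Pu HP]]] := @cartan_rep_weights _ _ h m (fun H => D (vsval H)).
- move=> c H K; have -> : vsval (c *: H + K) = c *: vsval H + vsval K by rewrite linearP.
  exact: Dl.
- have := Db _ _ (hg H) (hg K).
  have -> : br (vsval H) (vsval K) = 0.
    apply/eqP; rewrite subr_eq0; apply/eqP.
    exact: (cartan_comm (cp_br cp) (cp_nondeg cp) (cp_sub cp) (cp_nil cp) (cp_self cp) (subvsP H) (subvsP K)).
  by rewrite D0 => /esym/eqP; rewrite subr_eq0 => /eqP.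
exists P, mu; split=> // [H|p alpha ra].
  have [tr dg] := HP H; rewrite -(conj_mexp _ Pu); have [t1 t2] := trig_mexp tr.
  by split; [exact: t1|move=> p; rewrite (t2 p) (dg p)].
have [_ [X X0 HX]] := ra; have [Y HY XY] := sl2_triple cp ra HX X0.
have [Xg _] := HX; have [Yg _] := HY.
have DZ c Z : Z \in g -> D (c *: Z) = c *: D Z.
  by move=> Zg; rewrite -[c *: Z]addr0 Dl ?mem0v // D0 addr0.
rewrite -(HP _).2; apply: (@matrix_sl2_integral _ _ (D X) (D Y) (D (vsval (coroot cp alpha)))).
- by rewrite -Db // XY.
- by rewrite -Db // (coroot_br cp ra HX) DZ.
- by rewrite -Db // (coroot_brN cp ra HY) DZ.
- by apply: char_poly_trig_root => //; exact: (HP _).1.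
Qed.

Variable G : set M.
Hypothesis GG : group_with_lie G g.

(** Applies to every Cartan subalgebra, including those for which nothing is known about leading
    weights; integrality on coroots is what [integral_comparison] asks for. *)
Lemma rep_integral_weights m (rho D : M -> 'M[C]_m) : rep_with_diff G g rho D ->
  exists L : seq dual, (forall H, \tr (rho (mexp (vsval H))) = \sum_(nu <- L) ce (nu H)) /\
    forall nu alpha, nu \in L -> isroot g alpha -> exists z : int, nu (coroot cp alpha) = z%:~R :> C.
Proof.
move=> RR; have Dl c X Y : X \in g -> Y \in g -> D (c *: X + Y) = c *: D X + D Y.
  exact: (drepP GG RR).
have Db X Y : X \in g -> Y \in g -> D (br X Y) = br (D X) (D Y).
  exact: (drep_bracket GG RR).
have [P [mu [Pu HP Hmu]]] := integral_weights Dl Db.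
exists [seq mu p | p : 'I_m]; split=> [H|nu alpha /mapP[p _ ->]]; last exact: Hmu.
rewrite (rep_exp1 GG RR (hg H)) -(tr_conj _ Pu) big_image.
by apply: eq_bigr => p _; rewrite (HP H).2.
Qed.

End IntegralWeights.

(** * Groups with a compact real form *)

Section Exponential.
Variable R : realType.
Local Notation C := R[i].
Local Open Scope classical_set_scope.
Local Open Scope complex_scope.
Import ComplexField.Normc.

Lemma mexp_sq0_mul m p (A : 'M[C]_m) (v : 'M[C]_(m, p)) : A *m (A *m v) = 0 ->
  mexp A *m v = v + A *m v.
Proof.
move=> Av; apply: (tends_unique (tendsMr v (mexp_tends A))); apply/cvg_tends.
apply: (@cvg_near_cst _ _ _ _ _); exists 2%N => // -[//|[//|k]] _ /=.
rewrite /psum /series /= mulmx_suml !big_nat_recl // big1 => [|j _].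
  rewrite expr0 expr1 !fact0 invr1 !scale1r mul1mx addr0 //.
by rewrite cmxXSr cmxXSr -scalemxAl -!mulmxA Av mulmx0 scaler0.
Qed.

Lemma mexp_sq0 m (A : 'M[C]_m) : A *m A = 0 -> mexp A = 1%:M + A.
Proof.
by move=> A2; rewrite -[LHS]mulmx1 mexp_sq0_mul ?mulmx1.
Qed.

Lemma tends_ge_nrm m n (u : nat -> 'M[C]_(m, n)) a (c : R) :
  tends u a -> (exists k0, forall k, (k0 <= k)%N -> c <= nrm (u k)) -> c <= nrm a.
Proof.
move=> ua [k0 Hk]; apply/ler_addgt0Pl => e e0.
have /cvgrPdist_lt/(_ _ e0)[k1 _ Hk1] := ua.
have := Hk1 (maxn k0 k1) (leq_maxr _ _); rewrite /= sub0r normrN ger0_norm // => lt.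
apply: le_trans (Hk _ (leq_maxl k0 k1)) _.
rewrite -[u _](subrK a); apply: le_trans (nrmD _ _) _.
by apply: lerD => //; exact: ltW.
Qed.

Lemma bernoulli (y : R) k : -1 <= y -> 1 + k%:R * y <= (1 + y) ^+ k.
Proof.
move=> y1; have y0 : 0 <= 1 + y by rewrite -lerBlDl sub0r.
elim: k => [|k IH]; first by rewrite mul0r addr0 expr0.
rewrite exprS; apply: le_trans (_ : (1 + y) * (1 + k%:R * y) <= _); last exact: ler_wpM2l.
have -> : (1 + y) * (1 + k%:R * y) = 1 + k.+1%:R * y + k%:R * y ^+ 2 by rewrite -natr1; ring.
by rewrite lerDl mulr_ge0 ?ler0n // sqr_ge0.
Qed.

(* Since exp l is the limit of (1 + l/k)^k. *)
Lemma ce_growth (l : C) : 1 + complex.Re l <= normc (ce l).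
Proof.
pose E (k : nat) : 'M[C]_1 := (k.+1%:R^-1 * l)%:M.
have nrm11 (x : C) : nrm (x%:M : 'M[C]_1) = normc x.
  by rewrite /nrm !big_ord1 mxE eqxx mulr1n.
have T : tends (fun k => mxpow (1%:M + E k) k.+1) (mexp l%:M).
  apply: (@pow_tendsZ _ _ E succn).
    apply: tends_ext (tends_cst _) => k.
    by rewrite /E scale_scalar_mx mulrA mulfV ?mul1r // pnatr_eq0.
  apply: (@tends_le _ _ _ _ _ (fun k => k.+1%:R^-1 * normc l)) => [k|].
    by rewrite subr0 /E nrm11 normcM normcV normc_nat.
  by rewrite -(mul0r (normc l)); apply: cvgM; [exact: invS_cvg0|exact: cvg_cst].
rewrite -nrm11 -mexp_scalar1; apply: tends_ge_nrm T _.
have [k0 Hk0] : exists k0 : nat, `|complex.Re l| <= k0%:R.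
  by exists (Num.bound `|complex.Re l|); apply: ltW; exact: archi_boundP.
exists k0 => k k0k.
have pE (x : C) j : mxpow (x%:M : 'M[C]_1) j = (x ^+ j)%:M.
  by elim: j => [|j IH]; rewrite ?mxpow0 ?expr0 // mxpowS IH -scalar_mxM exprS.
have normcX (x : C) j : normc (x ^+ j) = normc x ^+ j.
  by elim: j => [|j IH]; rewrite ?expr0 ?normc1 // !exprS normcM IH.
rewrite /E -raddfD pE nrm11 normcX; set x := _ * l.
have xE : complex.Re x = k.+1%:R^-1 * complex.Re l.
  rewrite /x (_ : (k.+1%:R^-1 : C) = (k.+1%:R^-1 : R)%:C); last by rewrite rmorphV ?unitfE // rmorph_nat.
  by case: (l) => lr li /=; rewrite mul0r subr0.
have ReD : complex.Re (1 + x) = 1 + complex.Re x by case: (x).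
have kp : 0 < k.+1%:R :> R by rewrite ltr0n.
have -> : complex.Re l = k.+1%:R * complex.Re x.
  by rewrite xE mulrA mulfV ?mul1r // pnatr_eq0.
have x1 : -1 <= complex.Re x.
  rewrite xE lerNl -mulrN ler_pdivrMl // mulr1; apply: le_trans (ler_norm _) _.
  by rewrite normrN; apply: le_trans Hk0 _; rewrite ler_nat ltnW.
apply: le_trans (bernoulli _ x1) _.
apply: lerXn2r; rewrite ?nnegrE ?normc_ge0 //; first by rewrite -lerBlDl sub0r.
by rewrite -ReD; apply: le_trans (ler_norm _) (normc_Re _).
Qed.

Lemma compact_nrm_bound m n (K : set 'M[C]_(m, n)) : compact K ->
  exists c : R, forall x, K x -> nrm x <= c.
Proof.
move=> cK; apply: contrapT => H.
have /choice[u Hu] (k : nat) : exists x, K x /\ k%:R < nrm x.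
  apply: contrapT => Hk; apply: H; exists k%:R => x Kx.
  by rewrite leNgt; apply/negP => lt; apply: Hk; exists x.
have uK : (u @ \oo) K by exists 0%N => // k _; case: (Hu k).
have [p [Kp clp]] := cK _ _ uK.
pose k0 := Num.bound (nrm p + 1).
have k0P : nrm p + 1 < k0%:R by apply: archi_boundP; rewrite addr_ge0.
have [||x [[k k0k <-] /= xp]] := clp (u @` [set k | (k0 <= k)%N]) [set x | nrm (x - p) < 1].
- by exists k0 => // k k0k; exists k.
- by apply/nbhs_nrm; exists 1.
have [_] := Hu k; apply/negP; rewrite -leNgt -[u k](subrK p).
apply: le_trans (nrmD _ _) _; apply: ltW; apply: lt_le_trans (_ : 1 + nrm p <= _); first by rewrite ltrD2r.
by rewrite addrC ltW // (lt_le_trans k0P) // ler_nat.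
Qed.

Section Bounded.
Variables (m : nat) (Y : 'M[C]_m) (c : R).
Hypothesis Yc : forall t : R, nrm (mexp (t%:C *: Y)) <= c.

Lemma linear_bounded0 (y a : R) : (forall t : R, a + t * y <= c) -> y = 0.
Proof.
move=> H; apply/eqP; apply: contraT => y0.
have := H ((c - a + 1) / y); rewrite divfK // addrC addrAC subrK.
by rewrite gerDl ler10.
Qed.

(** By [ce_growth], 1 + t Re l <= |exp (t l)|, and on an eigenvector this is at most c for all real
    t of either sign. *)
Lemma bounded_eigenvalue (l : C) : eigenvalue Y l -> complex.Re l = 0.
Proof.
move=> /eigenvalueP[v vY v0]; apply: (@linear_bounded0 _ 1) => t.
have tl : complex.Re (t%:C * l) = t * complex.Re l.
  by case: (l) => lr li /=; rewrite mul0r subr0.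
rewrite -tl; apply: le_trans (ce_growth _) _.
have vp : 0 < nrm v by rewrite lt_def nrm_ge0 andbT; apply: contraNneq v0 => /nrm_eq0 ->.
have E : ce (t%:C * l) *: v = v *m mexp (t%:C *: Y).
  rewrite -mul_scalar_mx -mexp_scalar1; apply: mexp_inter.
  by rewrite mul_scalar_mx -scalemxAr vY scalerA.
rewrite -(ler_pM2r vp) -nrmZ E; apply: le_trans (nrmM _ _) _.
by rewrite mulrC ler_pM2r.
Qed.

(** If Y (Y v) = 0 then exp (t Y) v = v + t Y v, which is bounded in t only if Y v = 0; so Y has no
    Jordan block at 0. *)
Lemma bounded_sq0 (v : 'cV[C]_m) : Y *m (Y *m v) = 0 -> Y *m v = 0.
Proof.
move=> Yv; apply: nrm_eq0; apply: (@mulfI _ 1) => //; rewrite mulr0 mul1r.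
suff H (t : R) : t * nrm (Y *m v) <= (c + 1) * nrm v.
  apply/eqP; apply: contraT => y0.
  have := H (((c + 1) * nrm v + 1) / nrm (Y *m v)).
  by rewrite divfK // gerDl ler10.
have E : (t%:C *: Y) *m v = mexp (t%:C *: Y) *m v - v.
  rewrite mexp_sq0_mul; first by rewrite addrC addKr.
  by rewrite -!scalemxAl -scalemxAr Yv !scaler0.
apply: le_trans (_ : nrm ((t%:C *: Y) *m v) <= _).
  by rewrite -scalemxAl nrmZ normcR ler_wpM2r // ler_norm.
rewrite E; apply: le_trans (nrmD _ _) _; rewrite nrmN mulrDl mul1r lerD2r.
by apply: le_trans (nrmM _ _) _; rewrite ler_wpM2r.
Qed.

Lemma bounded_nil0 k : Y ^+ k = 0 -> Y = 0.
Proof.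
have S j : Y ^+ j.+2 = 0 -> Y ^+ j.+1 = 0.
  move=> Y2; have H q : Y *m (Y ^+ j *m delta_mx q 0) = 0 :> 'cV_m.
    apply: bounded_sq0; rewrite (mulmxA Y (Y ^+ j)) -cmxXS (mulmxA Y (Y ^+ j.+1)) -cmxXS.
    by rewrite Y2 mul0mx.
  apply/matrixP => p q; have := H q; rewrite mulmxA -cmxXS -colE => /colP/(_ p).
  by rewrite [LHS]mxE => ->; rewrite !mxE.
elim: k => [|[|k] IH].
- rewrite expr0 => Y1; have e (A : 'M[C]_m) : A = 0 by rewrite -[A]mulmx1 -[1%:M]/(1) Y1 mulmx0.
  exact: e.
- by rewrite expr1.
- by move=> /S/IH.
Qed.

(** The eigenvalues are imaginary, so s is the sum of the squares of their imaginary parts. If s = 0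
    then Y is nilpotent, hence 0 by [bounded_nil0]. *)
Lemma bounded_trace : exists2 s : R, \tr (Y *m Y) = - s%:C & 0 <= s /\ (s = 0 -> Y = 0).
Proof.
have [|P Pu tP] := @cotrig _ m [:: Y].
  by move=> A B; rewrite !inE => /eqP-> /eqP->.
have tB := tP Y (mem_head _ _); set B := P *m Y *m invmx P in tB.
have ReB i : complex.Re (B i i) = 0.
  by apply: bounded_eigenvalue; rewrite eigenvalue_root_char; apply: char_poly_trig_root.
have B2 i : B i i * B i i = - ((complex.Im (B i i)) ^+ 2)%:C.
  have := ReB i; case: (B i i) => br bi /= ->; apply/eqP.
  by rewrite eq_complex /= !mul0r mulr0 sub0r addr0 expr2 oppr0 !eqxx.
exists (\sum_i (complex.Im (B i i)) ^+ 2).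
  rewrite -[Y *m Y]/(mxpow Y 2) -[mxpow Y 2]/(Y ^+ 2) -(tr_conj (Y ^+ 2) Pu) conjX // -/B.
  rewrite rmorph_sum -sumrN /mxtrace.
  by apply: eq_bigr => i _; rewrite (trigX 2 tB).2 expr2 B2.
split; first by apply: sumr_ge0 => i _; exact: sqr_ge0.
move=> s0; have Bi i : B i i = 0.
  have /eqP := s0; rewrite psumr_eq0 => [/allP/(_ i)|j _]; last exact: sqr_ge0.
  rewrite mem_index_enum sqrf_eq0 => /(_ isT)/eqP Im0.
  by apply/eqP; rewrite eq_complex ReB Im0 !eqxx.
apply: (@bounded_nil0 m); apply: trace_pow_nil => k.
rewrite -(tr_conj (Y ^+ k.+1) Pu) conjX // -/B /mxtrace big1 // => i _.
by rewrite (trigX _ tB).2 Bi expr0n.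
Qed.

End Bounded.

End Exponential.

Section Interface.
Variable R : realType.
Local Notation C := R[i].
Local Open Scope classical_set_scope.
Local Open Scope complex_scope.
Import ComplexField.Normc.
Variable n : nat.
Local Notation M := 'M[C]_n.+1.
Implicit Types (G K : set M) (g h : {vspace M}) (X Y : M).

Lemma group_with_lie_of G g : is_subgroup G -> lie_algebra G g -> group_with_lie G g.
Proof.
move=> [G1 GM GV] Hg; split.
- exact: G1.
- exact: GM.
- by move=> x /GV[].
- by move=> x /GV[].
- by move=> X /Hg/(_ 1); rewrite expmE scale1r.
- by move=> X HX; apply/Hg => t; rewrite expmE; exact: HX.
Qed.

Lemma exp_dense_of G g : ssc_linear_group G g -> exp_dense G g.
Proof.
move=> [sG Gc Hg [Gconn _] _]; have GG := group_with_lie_of sG Hg.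
apply: (exp_dense_connected GG _ Gconn) => u x Gu /cvg_tends ux xu.
apply: Gc; split=> // P /ux [n0 _ Hn].
by exists (u n0); split; [exact: Gu|exact: Hn n0 (leqnn _)].
Qed.

(** Write X = X1 + i X2 with X1 and X2 tangent to K, whose one-parameter groups are bounded. Against
    X1 - i X2 the trace is tr (X1^2) + tr (X2^2), a sum of nonpositive terms that vanish only for X1
    = X2 = 0. *)
Lemma compact_form_nondeg G g K X : group_with_lie G g -> compact_real_form G g K ->
  X \in g -> (forall Y, Y \in g -> \tr (X *m Y) = 0) -> X = 0.
Proof.
move=> GG [KG _ cK Kg _] Xg X0; have [c Hc] := compact_nrm_bound cK.
have [X1 [X2 [K1 K2 XE]]] := (Kg X).1 Xg.
have Kb Y : lie_set K Y -> Y \in g /\ forall t : R, nrm (mexp (t%:C *: Y)) <= c.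
  move=> KY; split; last by move=> t; rewrite -expmE; apply: Hc; exact: KY.
  by apply: (Glie GG) => t; rewrite -expmE; apply: KG; exact: KY.
have [g1 /bounded_trace[s1 t1 [s1p s10]]] := Kb _ K1.
have [g2 /bounded_trace[s2 t2 [s2p s20]]] := Kb _ K2.
have Yg : X1 - 'i *: X2 \in g by rewrite memvB // memvZ.
have E : \tr (X *m (X1 - 'i *: X2)) = \tr (X1 *m X1) + \tr (X2 *m X2).
  rewrite XE mulmxDl !mulmxBr -!scalemxAl -!scalemxAr !mxtraceD ![\tr (- _)]raddfN /= !mxtraceZ.
  by rewrite (mxtrace_mulC X2 X1) mulrA -expr2 sqrCi mulN1r opprK; ring.
have : (s1 + s2)%:C = 0.
  have := X0 _ Yg; rewrite E t1 t2 -opprD => /eqP; rewrite oppr_eq0 => /eqP.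
  by rewrite rmorphD.
move=> /(congr1 (@complex.Re R)) /= /eqP; rewrite paddr_eq0 // => /andP[/eqP/s10 Z1 /eqP/s20 Z2].
by rewrite XE Z1 Z2 scaler0 addr0.
Qed.

Lemma cartan_pair_of G g h : group_with_lie G g ->
  (forall X, X \in g -> (forall Y, Y \in g -> \tr (X *m Y) = 0) -> X = 0) ->
  cartan g h -> cartan_pair g h.
Proof.
move=> GG nd [hg hn hs]; split=> //.
- by move=> X Y Xg Yg; exact: (bracket_g GG).
Qed.

Lemma derivable_nrm p q (f : C -> 'M[C]_(p.+1, q.+1)) : derivable f 0 1 ->
  forall e : R, 0 < e -> exists2 d : R, 0 < d & forall t : C, normc t < d -> t != 0 ->
    nrm (t^-1 *: (f t - f 0) - derive1 f 0) < e.
Proof.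
move=> df e e0; pose P : set 'M[C]_(p.+1, q.+1) := [set A | nrm (A - derive1 f 0) < e].
have DP : nbhs (derive1 f 0) P by apply/nbhs_nrm; exists e.
rewrite derive1E in DP; have := df _ DP; rewrite /= /dnbhs /within /= => Q.
have /nbhsC_normc[d d0 Hd] := Q; exists d => // t td t0.
have := Hd t; rewrite subr0 => /(_ td t0); rewrite /P /=.
by rewrite -[_ *: 1]/(_ * 1) mulr1 addr0.
Qed.

Lemma rep_with_diff_of G g m (rho : M -> 'M[C]_m.+1) : group_with_lie G g ->
  holomorphic_rep g G rho -> rep_with_diff G g rho (diff_rep rho).
Proof.
move=> GG [r1 rM rc rd]; split.
- exact: r1.
- exact: rM.
- move=> u x Gu Gx /cvg_tends ux; apply/cvg_tends => P HP.
  have /subspace_continuousP/(_ x Gx P HP) := rc.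
  by move=> /ux [n0 _ Hn]; exists n0 => // k n0k; exact: Hn.
move=> X s Xg; have [->|s0] := eqVneq s 0.
  apply: tends_ext (tends_cst _) => k.
  by rewrite mulr0 !scale0r mexp0 r1 subrr scaler0.
have Hd := derivable_nrm (rd X Xg); rewrite -/(diff_rep rho X) in Hd.
pose f (t : C) := rho (expm (t *: X)); have f0 : f 0 = 1%:M by rewrite /f scale0r expmE mexp0.
have fE t : f t = rho (mexp (t *: X)) by rewrite /f expmE.
have {}Hd : forall e : R, 0 < e -> exists2 d : R, 0 < d & forall t : C, normc t < d -> t != 0 ->
    nrm (t^-1 *: (f t - f 0) - diff_rep rho X) < e by exact: Hd.
move: f0 fE Hd; move: (diff_rep rho X) f => D f f0 fE Hd.
have tE k : s * (k.+1%:R^-1 * s)^-1 = k.+1%:R.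
  by rewrite invfM invrK mulrCA mulfV // mulr1.
apply: (@tends_ext _ _ _ (fun k => s *: ((k.+1%:R^-1 * s)^-1 *: (f (k.+1%:R^-1 * s) - f 0)))) => [k|].
  by rewrite scalerA tE f0 fE.
apply: tendsZ; apply/cvgrPdist_lt => e e0; have [d d0 Hd'] := Hd e e0.
have s_cvg : (k.+1%:R^-1 * normc s) @[k --> \oo] --> (0 : R).
  by rewrite -(mul0r (normc s)); apply: cvgM; [exact: invS_cvg0|exact: cvg_cst].
have /cvgrPdist_lt/(_ _ d0)[k0 _ Hk0] := s_cvg.
exists k0 => // k /Hk0 /=; rewrite !sub0r !normrN => lt.
rewrite ger0_norm ?nrm_ge0 //; apply: Hd'.
  rewrite normcM normcV normc_nat; apply: le_lt_trans lt; exact: ler_norm.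
by rewrite mulf_neq0 // invr_eq0 pnatr_eq0.
Qed.

Record torus_data g h (cp : cartan_pair g h) r (a : r.-tuple 'Hom(subvs_of h, C^o))
    (om : 'I_r -> 'Hom(subvs_of h, C^o)) (L : 'I_r -> seq 'Hom(subvs_of h, C^o))
    (sigma : 'I_r -> M -> C) : Prop := TorusData {
  td_basis : basis_of fullv a;
  td_root : forall i, isroot g (tnth a i);
  td_pos : forall beta, isroot g beta -> positive a beta \/ positive a (- beta);
  td_om : forall i j, om i (co cp a j) = (i == j)%:R :> C;
  td_low : forall i mu, mu \in L i -> exists k, nz k /\ mu = om i - nat_comb a k;
  td_torus : forall i H, sigma i (mexp (vsval H)) = \sum_(mu <- om i :: L i) ce (mu H) }.

(** Common ground of the fundamental characters and of the elementary symmetric functions on SL_N,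
    so that the constants of the two can be compared. Leading weights are asked for one Cartan
    subalgebra, integrality of the weights for all of them. *)
Record char_system G g r (sigma : 'I_r -> M -> C) : Prop := CharSystem {
  cs_reg : forall i, regfun G g (sigma i);
  cs_class : forall i x y, G x -> G y -> sigma i (x *m y *m invmx x) = sigma i y;
  cs_torus : exists h (cp : cartan_pair g h) (a : r.-tuple 'Hom(subvs_of h, C^o)) om L,
    torus_data cp a om L sigma;
  cs_integral : forall h (cp : cartan_pair g h) i, exists L : seq 'Hom(subvs_of h, C^o),
    (forall H, sigma i (mexp (vsval H)) = \sum_(nu <- L) ce (nu H)) /\
    forall nu alpha, nu \in L -> isroot g alpha ->
      exists z : int, nu (coroot cp alpha) = z%:~R :> C }.

Lemma fundamental_torus_rep G g h (cp : cartan_pair g h) r (a : r.-tuple 'Hom(subvs_of h, C^o))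
    m (rho : M -> 'M[C]_m.+1) i : group_with_lie G g -> exp_dense G g ->
  basis_of fullv a -> (forall i, isroot g (tnth a i)) ->
  (forall beta, isroot g beta -> positive a beta \/ positive a (- beta)) ->
  holomorphic_rep g G rho -> irreducible_rep G rho ->
  (exists w, fundamental_highest_weight g a i rho w) ->
  exists om : 'Hom(subvs_of h, C^o), exists L : seq 'Hom(subvs_of h, C^o),
  [/\ forall j, om (co cp a j) = (i == j)%:R :> C,
      forall mu, mu \in L -> exists k, nz k /\ mu = om - nat_comb a k
    & forall H, \tr (rho (mexp (vsval H))) = \sum_(mu <- om :: L) ce (mu H)].
Proof.
move=> GG Gdense a_basis a_root a_pos hr irr [w [w0 wk wc]].
have RR := rep_with_diff_of GG hr.
have wc' j : diff_rep rho (vsval (co cp a j)) *m w = (i == j)%:R *: w.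
  have ra := a_root j; have [_ [X X0 HX]] := ra; have [Y HY XY] := sl2_triple cp ra HX X0.
  apply: wc; split; first exact: corootE.
  by exists X, Y; split.
exact: (rep_weights GG Gdense a_basis a_root a_pos RR irr w0 wk wc').
Qed.

Lemma fundamental_positive g h r (a : r.-tuple 'Hom(subvs_of h, C^o)) : simple_system g a ->
  forall beta, isroot g beta -> positive a beta \/ positive a (- beta).
Proof.
move=> [_ _ a_pos'] beta rb; have [k [E|E]] := a_pos' beta rb; [left|right]; exists k; first exact: E.
by rewrite E opprK.
Qed.

Lemma fundamental_char_system G g r (sigma : 'I_r -> M -> C) :
  group_with_lie G g -> exp_dense G g ->
  (forall X, X \in g -> (forall Y, Y \in g -> \tr (X *m Y) = 0) -> X = 0) ->
  fundamental_characters G g sigma -> char_system G g sigma.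
Proof.
move=> GG Gdense nd [h hC [a as_ Hrep]]; have cp := cartan_pair_of GG nd hC.
have a_pos := fundamental_positive as_; have [a_basis a_root _] := as_.
have Hrep' i : exists m (rho D : M -> 'M[C]_m.+1), rep_with_diff G g rho D /\
    (forall x, G x -> sigma i x = \tr (rho x)).
  have [m [rho [hr _ _ HE]]] := Hrep i; exists m, rho, (diff_rep rho); split=> //.
  exact: rep_with_diff_of.
have fundamental_torus i : exists om : 'Hom(subvs_of h, C^o), exists L : seq 'Hom(subvs_of h, C^o),
  [/\ forall j, om (co cp a j) = (i == j)%:R :> C,
      forall mu, mu \in L -> exists k, nz k /\ mu = om - nat_comb a k
    & forall H, sigma i (mexp (vsval H)) = \sum_(mu <- om :: L) ce (mu H)].
  have [m [rho [hr irr wP HE]]] := Hrep i.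
  have [om [L [H1 H2 H3]]] := fundamental_torus_rep cp GG Gdense a_basis a_root a_pos hr irr wP.
  exists om, L; split; [exact: H1|exact: H2|move=> H; rewrite HE; first exact: H3].
  by apply: (Gexp GG); exact: (subvP (cp_sub cp) _ (subvsP _)).
split.
- move=> i; have [m [rho [D [RR HE]]]] := Hrep' i.
  apply: (regfun_ext (f := fun x => \sum_j rho x j j)) => [x Gx|]; first by rewrite HE.
  by apply: regfun_sum => j _; exact: regfun_rep RR.
- move=> i x y Gx Gy; have [m [rho [D [RR HE]]]] := Hrep' i.
  have GxV := GV GG Gx; have Gxy := GM GG Gx Gy.
  rewrite !HE //; last exact: (GM GG).
  rewrite (repM RR) // (repM RR) // mxtrace_mulC mulmxA -(repM RR) //.
  by rewrite mulVmx ?(Gunit GG Gx) // (rep1 RR) mul1mx.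
- have /choice[om /choice[L HL]] i := fundamental_torus i.
  exists h, cp, a, om, L; split.
  + exact: a_basis.
  + exact: a_root.
  + exact: a_pos.
  + by move=> i j; have [H1 _ _] := HL i; exact: H1.
  + by move=> i; have [_ H1 _] := HL i; exact: H1.
  + by move=> i; have [_ _ H1] := HL i; exact: H1.
- move=> h' cp' i; have [m [rho [D [RR HE]]]] := Hrep' i.
  have [L [H1 H2]] := rep_integral_weights cp' GG RR; exists L; split=> // H.
  by rewrite HE //; apply: (Gexp GG); exact: (subvP (cp_sub cp') _ (subvsP _)).
Qed.

End Interface.

Section Constant.
Variable R : realType.
Local Notation C := R[i].
Variable n : nat.
Local Notation M := 'M[C]_n.+1.
Variables (G : set M) (g : {vspace M}).
Hypothesis GG : group_with_lie G g.
Hypothesis Gdense : exp_dense G g.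
Variable B : M -> M -> C.
Hypothesis B_lin : forall c X Y Z, X \in g -> Y \in g -> Z \in g ->
  B (c *: X + Y) Z = c * B X Z + B Y Z.
Hypothesis B_sym : forall X Y, X \in g -> Y \in g -> B X Y = B Y X.
Hypothesis B_nondeg : forall X, X \in g -> (forall Y, Y \in g -> B X Y = 0) -> X = 0.
Hypothesis B_inv : forall x X Y, G x -> X \in g -> Y \in g ->
  B (x *m X *m invmx x) (x *m Y *m invmx x) = B X Y.
Variable r : nat.
Implicit Types sigma : 'I_r -> M -> C.

(** A relation and not a function: a value q belongs to a choice of Cartan subalgebra, simple roots
    and root vectors, and its independence of these is proved afterwards. *)
Definition torus_constant sigma (q : C) : Prop := exists h (cp : cartan_pair g h)
  (a : r.-tuple 'Hom(subvs_of h, C^o)) om L, torus_data cp a om L sigma /\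
  exists rts xs, [/\ uniq rts, forall alpha, alpha \in rts <-> isroot g alpha,
      forall alpha, alpha \in rts -> rootv g alpha (xs alpha) /\ xs alpha != 0,
      basis_of g ([seq xs alpha | alpha <- rts] ++ [seq vsval (co cp a i) | i : 'I_r])
    & q = nu_square cp a rts B].

Lemma torus_constant_exists sigma : char_system G g sigma -> exists q, torus_constant sigma q.
Proof.
move=> [_ _ [h [cp [a [om [L td]]]]] _]; have [a_basis a_root _ _ _ _] := td.
have [rts [xs [H1 H2 H3 H4]]] := root_basis cp a_basis a_root.
by exists (nu_square cp a rts B), h, cp, a, om, L; split=> //; exists rts, xs.
Qed.

(** A kernel vector of the Gram matrix gives H in h orthogonal to the coroots; H is also orthogonal
    to the root vectors, hence to g. *)
Lemma torus_constant_neq0 sigma q : torus_constant sigma q -> q != 0.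
Proof.
move=> [h [cp [a [om [L [[a_basis a_root a_pos _ _ _]]]]]]].
move=> [rts [xs [rts_uniq rtsP xsP xs_basis ->]]].
rewrite mulf_neq0 ?signr_eq0 //; set A := \matrix_(i, j) _.
have hg H : vsval (H : subvs_of h) \in g by exact: (subvP (cp_sub cp) _ (subvsP _)).
apply/negP => /eqP E; have /det0P[v v0 vA] : \det A == 0 by rewrite E.
case/eqP: v0; apply/rowP => j; rewrite mxE.
apply: (co_free a_basis a_root (cp := cp) (c := fun j => v 0 j)); apply: val_inj.
set H := \sum_i _; have B0l Y : Y \in g -> B 0 Y = 0.
  move=> Yg; have := B_lin (-1) (mem0v g) (mem0v g) Yg.
  by rewrite scaler0 addr0 mulN1r addNr.
have Hco i : B (vsval H) (vsval (co cp a i)) = 0.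
  have HE : vsval H = \sum_k v 0 k *: vsval (co cp a k).
    by rewrite /H linear_sum; apply: eq_bigr => k _; rewrite linearZ.
  have Bl c X Y : X \in g -> Y \in g ->
      B (c *: X + Y) (vsval (co cp a i)) = c * B X (vsval (co cp a i)) + B Y (vsval (co cp a i)).
    by move=> Xg Yg; exact: (B_lin c Xg Yg (hg (co cp a i))).
  rewrite HE (lin_on_sum (W := g) (L := fun X => B X (vsval (co cp a i)))) //.
  have /rowP/(_ i) := vA; rewrite [LHS]mxE [RHS]mxE => E1; rewrite -[RHS]E1.
  by apply: eq_bigr => k _; rewrite [A _ _]mxE.
apply: (B_nondeg (hg H)) => Y Yg; rewrite B_sym //.
have [phi Bphi] : exists phi : 'Hom(M, C^o), forall Z, Z \in g -> phi Z = B Z (vsval H) :> C.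
  have [|phi phiE] := @linfun_of C M C^o (fun Z => B (projv g Z) (vsval H)).
    move=> c X Z; rewrite linearP; exact: (B_lin c (memv_proj g X) (memv_proj g Z) (hg H)).
  by exists phi => Z Zg; rewrite phiE projv_id.
suff /subvP/(_ Y Yg) : (g <= lker phi)%VS by rewrite memv_ker (Bphi Y Yg) => /eqP.
apply: (span_basis_ind xs_basis) => Z; rewrite mem_cat memv_ker => /orP[|].
  move=> /seq.mapP[alpha ar ->]; have [HX _] := xsP alpha ar; have [Xg _] := HX.
  by rewrite (Bphi _ Xg) (rootv_orth GG cp a_basis a_pos rts_uniq rtsP B_lin B_inv H ar HX).
move=> /mapP[i _ ->]; rewrite (Bphi _ (hg (co cp a i))) B_sym //; apply/eqP; exact: Hco.
Qed.

Lemma torus_constant_key sigma q : char_system G g sigma -> torus_constant sigma q ->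
  forall x (v : r.-tuple M), G x -> {subset v <= g} ->
  map_det g (pairing_map B v x) = q * wedge_dchar sigma x v ^+ 2.
Proof.
move=> [sreg sclass _ _] [h [cp [a [om [L [[a_basis a_root a_pos om_co L_low s_torus]]]]]]].
move=> [rts [xs [rts_uniq rtsP xsP xs_basis ->]]] x v Gx vg.
exact: (key_identity GG Gdense a_basis a_root a_pos rts_uniq rtsP xsP xs_basis B_lin B_sym B_inv
  sreg sclass om_co L_low s_torus).
Qed.

Lemma torus_constant_nu sigma q c : char_system G g sigma -> torus_constant sigma q ->
  c ^+ 2 = q -> nu_constant G g B sigma c.
Proof.
move=> [sreg sclass _ _] [h [cp [a [om [L [[a_basis a_root a_pos om_co L_low s_torus]]]]]]].
move=> [rts [xs [rts_uniq rtsP xsP xs_basis ->]]] c2.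
exact: (nu_constant_square GG Gdense a_basis a_root a_pos rts_uniq rtsP xsP xs_basis B_lin B_sym
  B_inv sreg sclass om_co L_low s_torus c2).
Qed.

(** Evaluate at the coroots, on the torus attached to sigma. The determinant is q times the squared
    Weyl denominator, and, by the identity for sigma', also q' times the squared Jacobian of sigma',
    an exponential sum with integral weights there. *)
Lemma torus_constant_compare sigma sigma' q q' : char_system G g sigma ->
  char_system G g sigma' -> torus_constant sigma q -> torus_constant sigma' q' ->
  exists m : int, q = q' * m%:~R ^+ 2.
Proof.
move=> cs cs' tc tc'; have key := torus_constant_key cs' tc'.
have [sreg sclass _ _] := cs.
case: tc => [h [cp [a [om [L [[a_basis a_root a_pos om_co L_low s_torus]]]]]]].
move=> [rts [xs [rts_uniq rtsP xsP xs_basis ->]]].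
have hg H : vsval (H : subvs_of h) \in g by exact: (subvP (cp_sub cp) _ (subvsP _)).
have tv := torus_value GG Gdense a_basis a_root a_pos rts_uniq rtsP xsP xs_basis B_lin B_sym B_inv
  sreg sclass om_co L_low s_torus.
have [_ sclass' _ int'] := cs'; have /choice[L' HL'] := int' h cp.
apply: (integral_comparison (@ce_exp_like R) a_basis a_root rtsP (L' := L')) => [i nu j nuL|H].
  by have [_ H2] := HL' i; exact: H2 nuL (a_root j).
rewrite -tv key; last 2 first.
- exact: (Gexp GG).
- by move=> X /mapP[j _ ->].
congr (_ * _ ^+ 2); congr (\det _); apply/matrixP => i j; rewrite !mxE tnth_mktuple.
have [H1 _] := HL' i; exact: (dchar_exp_sum cp (co cp a j) H H1).
Qed.

(* q = q' m^2 and q' = q m'^2 for integers m and m', so m^2 = 1: conjugacy of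
   Cartan subalgebras is not needed. *)
Lemma torus_constant_unique sigma sigma' q q' : char_system G g sigma ->
  char_system G g sigma' -> torus_constant sigma q -> torus_constant sigma' q' -> q = q'.
Proof.
move=> cs cs' tc tc'; have q0 := torus_constant_neq0 tc.
have [m E] := torus_constant_compare cs cs' tc tc'.
have [m' E'] := torus_constant_compare cs' cs tc' tc.
have /eqP : ((m' * m) ^+ 2)%:~R = 1 :> C.
  by apply: (mulfI q0); rewrite mulr1 {2}E E' exprMn rmorphM !rmorphXn /= mulrA.
rewrite -[1]/(1%:~R) eqr_int => /eqP m2.
have : m ^+ 2 = 1.
  have m0 : 0 <= m ^+ 2 by exact: sqr_ge0.
  have : (absz (m' ^+ 2) * absz (m ^+ 2))%N = 1%N by rewrite -abszM -exprMn m2.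
  by move=> /eqP; rewrite muln_eq1 => /andP[_ /eqP mE]; rewrite -(ger0_norm m0) -abszE mE.
by move=> m1; rewrite E -rmorphXn /= m1 mulr1.
Qed.

End Constant.

(** * The special linear group *)

Section Transvections.
Variables (F : fieldType) (N : nat).
Implicit Types (x y : 'M[F]_N) (u : 'cV[F]_N) (w : 'rV[F]_N).

Lemma transvection_inv u w : w *m u = 0 -> (1%:M - u *m w) *m (1%:M + u *m w) = 1%:M.
Proof.
move=> wu; rewrite mulmxDr mulmx1 mulmxBl mul1mx -mulmxA (mulmxA w) wu mul0mx mulmx0 subr0.
by rewrite subrK.
Qed.

Lemma transvection_invr u w : w *m u = 0 -> (1%:M + u *m w) *m (1%:M - u *m w) = 1%:M.
Proof.
move=> wu; rewrite mulmxBr mulmx1 mulmxDl mul1mx -mulmxA (mulmxA w) wu mul0mx mulmx0 addr0.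
by rewrite addrK.
Qed.

Lemma transvection_l u w x i j : ((1%:M + u *m w) *m x) i j = x i j + u i 0 * (w *m x) 0 j.
Proof. by rewrite mulmxDl mul1mx mxE -mulmxA [X in _ + X]mxE big_ord1. Qed.

Lemma transvection_r u w x i j : (x *m (1%:M + u *m w)) i j = x i j + (x *m u) i 0 * w 0 j.
Proof. by rewrite mulmxDr mulmx1 mxE mulmxA [X in _ + X]mxE big_ord1. Qed.

Variable E : 'M[F]_N -> Prop.
Hypothesis E1 : E 1%:M.
Hypothesis EM : forall x y, E x -> E y -> E (x *m y).
Hypothesis Et : forall u w, w *m u = 0 -> E (1%:M + u *m w).

Let El u w x : w *m u = 0 -> E ((1%:M + u *m w) *m x) -> E x.
Proof.
move=> wu Ex; rewrite -[x]mul1mx -(transvection_inv wu) -mulmxA; apply: EM => //.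
by rewrite -mulNmx; apply: Et; rewrite mulmxN wu oppr0.
Qed.

Let Er u w x : w *m u = 0 -> E (x *m (1%:M + u *m w)) -> E x.
Proof.
move=> wu Ex; rewrite -[x]mulmx1 -(transvection_invr wu) mulmxA; apply: EM => //.
by rewrite -mulNmx; apply: Et; rewrite mulmxN wu oppr0.
Qed.

Let dr (i : 'I_N) p (x : 'M[F]_(N, p)) j : ((delta_mx 0 i : 'rV_N) *m x) 0 j = x i j.
Proof. by rewrite -rowE mxE. Qed.

Let dc (i : 'I_N) p (x : 'M[F]_(p, N)) j : (x *m (delta_mx i 0 : 'cV_N)) j 0 = x j i.
Proof. by rewrite -colE mxE. Qed.

Let det_transv u w : w *m u = 0 -> \det (1%:M + u *m w) = 1.
Proof.
move=> wu; rewrite -[u]opprK mulNmx det_rank1 mulmxN wu oppr0.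
by rewrite mxE subr0.
Qed.

(* Gaussian elimination: row and column k are cleared once the k-th diagonal
   entry is 1. *)
Lemma transvection_ind x : \det x = 1 -> E x.
Proof.
pose red k x := forall i j : 'I_N, (i < k)%N || (j < k)%N -> x i j = (i == j)%:R.
suff H d k y : (N - k = d)%N -> (k <= N)%N -> \det y = 1 -> red k y -> E y.
  by move=> dx; apply: (H N 0%N x) => //; rewrite subn0.
elim: d k y => [|d IH] k y dk kN dy ry.
  have kE : k = N by apply/eqP; rewrite eqn_leq kN -subn_eq0 dk.
  suff -> : y = 1%:M by [].
  by apply/matrixP => i j; rewrite ry ?mxE // kE ltn_ord.
have ltkN : (k < N)%N by rewrite -subn_gt0 dk.
pose ik := Ordinal ltkN.
have gtE (i : 'I_N) : (k < i)%N -> (i == ik) = false.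
  by move=> ki; apply/negbTE; rewrite -val_eqE neq_ltn ki orbT.
have ltE (i : 'I_N) : (i < k)%N -> (i == ik) = false.
  by move=> ki; apply/negbTE; rewrite -val_eqE neq_ltn ki.
have caseA z : \det z = 1 -> red k z -> z ik ik = 1 -> E z.
  move=> dz rz zk; pose u : 'cV[F]_N := \col_i (if (k < i)%N then - z i ik else 0).
  have wu : (delta_mx 0 ik : 'rV_N) *m u = 0.
    by apply/matrixP => i j; rewrite !ord1 [LHS]dr !mxE ltnn.
  apply: (El wu); set z1 := _ *m z.
  have z1E i j : z1 i j = z i j + u i 0 * z ik j by rewrite transvection_l dr.
  pose w : 'rV[F]_N := \row_j (if (k < j)%N then - z1 ik j else 0).
  have wu' : w *m (delta_mx ik 0 : 'cV_N) = 0.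
    by apply/matrixP => i j; rewrite !ord1 [LHS]dc !mxE ltnn.
  have r1 : red k z1.
    move=> i j ij; rewrite z1E rz //; case/orP: ij => [ik'|jk].
      by rewrite mxE ltnNge ltnW // mul0r addr0.
    by rewrite [z ik j]rz ?jk ?orbT // [ik == j]eq_sym ltE // mulr0 addr0.
  have z1k i : z1 i ik = (i == ik)%:R.
    rewrite z1E zk mulr1 mxE; case: (ltngtP k i) => [ki|ki|ki].
    - by rewrite subrr gtE.
    - by rewrite addr0 rz ?ki.
    - by rewrite addr0; have -> : i = ik by [exact: val_inj]; rewrite zk eqxx.
  apply: (Er wu'); apply: (IH k.+1) => //.
  - by rewrite subnS dk.
  - by rewrite det_mulmx (det_transv wu') mulr1 det_mulmx (det_transv wu) mul1r.
  move=> i j; rewrite !ltnS transvection_r dc z1k [w 0 j]mxE => ij.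
  case: (ltngtP k j) => [kj|kj|kj].
  - have ik' : (i <= k)%N by case/orP: ij => // jk; move: kj; rewrite ltnNge jk.
    rewrite leq_eqVlt in ik'; case/orP: ik' => [/eqP ki|ki].
      have -> : i = ik by exact: val_inj.
      by rewrite eqxx mul1r subrr eq_sym gtE.
    by rewrite r1 ?ki // ltE // mul0r addr0.
  - by rewrite mulr0 addr0 r1 // kj orbT.
  - by have -> : j = ik by [exact: val_inj]; rewrite mulr0 addr0 z1k.
have caseB z (i : 'I_N) : \det z = 1 -> red k z -> (k < i)%N -> z i ik != 0 -> E z.
  move=> dz rz ki zi; pose c := (1 - z ik ik) / z i ik.
  have wu : (delta_mx 0 i : 'rV_N) *m (c *: delta_mx ik 0 : 'cV_N) = 0.
    by apply/matrixP => p q; rewrite !ord1 [LHS]dr !mxE gtE // mulr0.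
  apply: (El wu); apply: caseA; first by rewrite det_mulmx det_transv // mul1r.
    move=> p q pq; rewrite transvection_l dr !mxE andbT rz //; case/orP: pq => [pk|qk].
      by rewrite ltE // mulr0 mul0r addr0.
    rewrite [z i q]rz ?qk ?orbT // [i == q]eq_sym -[q == i]val_eqE ltn_eqF ?(ltn_trans qk) //.
    by rewrite mulr0 addr0.
  by rewrite transvection_l dr !mxE eqxx mulr1 /c divfK // addrC subrK.
have [/existsP[i /andP[ki yi]]|] := boolP [exists i : 'I_N, (k < i)%N && (y i ik != 0)].
  exact: (caseB y i).
rewrite negb_exists => /forallP y0.
have {}y0 (i : 'I_N) : (k < i)%N -> y i ik = 0.
  by move=> ki; have := y0 i; rewrite ki negbK => /eqP.
have ykk : y ik ik != 0.
  apply/eqP => z; move/eqP: dy; rewrite (expand_det_col _ ik) big1 ?(eq_sym 0) ?oner_eq0 // => i _.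
  case: (ltngtP k i) => [ki|ki|ki]; first by rewrite y0 ?mul0r.
    by rewrite ry ?ki // ltE // mul0r.
  by have -> : i = ik by [exact: val_inj]; rewrite z mul0r.
have [k1N|] := ltnP k.+1 N; last first.
  move=> Nk; apply: caseA => //.
  have tr : is_trig_mx y.
    apply/is_trig_mxP => i j ij; rewrite ry -?val_eqE ?ltn_eqF //.
    by rewrite (leq_trans ij) // -ltnS (leq_trans (ltn_ord j)).
  rewrite -dy det_trig // (bigD1 ik) //= big1 ?mulr1 // => i ii.
  rewrite ry ?eqxx // ltn_neqAle -ltnS (leq_trans (ltn_ord i)) // andbT orbb.
  by apply: contraNneq ii => iE; apply/eqP/val_inj.
pose i1 := Ordinal k1N.
have wu : (delta_mx 0 ik : 'rV[F]_N) *m (delta_mx i1 0 : 'cV[F]_N) = 0.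
  by apply/matrixP => p q; rewrite !ord1 [LHS]dr !mxE -val_eqE /= ltn_eqF.
apply: (El wu); apply: (caseB _ i1) => //.
- by rewrite det_mulmx det_transv // mul1r.
- move=> p q pq; rewrite transvection_l dr !mxE andbT ry //; case/orP: pq => [pk|qk].
    have -> : (p == i1) = false by apply/negbTE; rewrite -val_eqE /= neq_ltn ltnS (ltnW pk).
    by rewrite mul0r addr0.
  by rewrite [y ik q]ry ?qk ?orbT // [ik == q]eq_sym ltE // mulr0 addr0.
- by rewrite transvection_l dr !mxE eqxx mul1r y0 // add0r.
Qed.

End Transvections.

(** * The determinant of the Cartan matrix of type A *)

Section CartanMatrix.
Variable F : numFieldType.

Lemma sum_delta_nat n m (f : nat -> F) :
  \sum_(j < n) (nat_of_ord j == m)%:R * f j = if (m < n)%N then f m else 0.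
Proof.
case: ltnP => mn.
  rewrite (bigD1 (Ordinal mn)) //= eqxx mul1r big1 ?addr0 // => j jm.
  by rewrite -[m]/(nat_of_ord (Ordinal mn)) val_eqE (negPf jm) mul0r.
rewrite big1 // => j _; rewrite ltn_eqF ?mul0r //.
exact: leq_trans (ltn_ord j) mn.
Qed.

(* C *m U is lower triangular for U i k = (i + 1) / (k + 1), i <= k: the second
   difference of a linear function vanishes. *)
Lemma det_cartan_matrix n : \det (\matrix_(i < n, j < n)
  ((i == j)%:R *+ 2 - (nat_of_ord j == i.+1)%:R - (nat_of_ord i == j.+1)%:R) : 'M[F]_n) =
  n.+1%:R.
Proof.
set A := \matrix_(i, j) _.
pose f (k i : nat) : F := if (i <= k)%N then i.+1%:R / k.+1%:R else 0.
pose U := \matrix_(i < n, k < n) f k i.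
have U1 : \det U = 1.
  rewrite -det_tr det_trig; last first.
    by apply/is_trig_mxP => i j ij; rewrite !mxE /f leqNgt ij.
  by rewrite big1 // => i _; rewrite !mxE /f leqnn mulfV // pnatr_eq0.
have AU (i k : 'I_n) : (i <= k)%N -> (A *m U) i k = (k - i == 0)%N%:R * (k.+2%:R / k.+1%:R).
  move=> ik; rewrite mxE.
  rewrite (eq_bigr (fun j : 'I_n => (nat_of_ord j == i)%:R * f k j *+ 2 -
    (nat_of_ord j == i.+1)%:R * f k j - (nat_of_ord j == i.-1)%:R * ((0 < i)%:R * f k j))) => [|j _].
    rewrite !sumrB sumrMnl (sum_delta_nat n i (f k)) (sum_delta_nat n i.+1 (f k)).
    rewrite (sum_delta_nat n i.-1 (fun j => (0 < i)%:R * f k j)) ltn_ord.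
    rewrite (leq_ltn_trans (leq_pred i) (ltn_ord i)).
    rewrite /f ik; have [ki|ki] := ltnP i k.
      have -> : ((k - i)%N == 0%N) = false by rewrite subn_eq0 leqNgt ki.
      rewrite (leq_ltn_trans ki (ltn_ord k)) (leq_trans (leq_pred i) ik) mul0r.
      move: (k.+1%:R^-1) => K.
      by case: (nat_of_ord i) => [|i'] /=; rewrite ?mul0r ?mul1r -!natr1; ring.
    have E : nat_of_ord i = k by apply/eqP; rewrite eqn_leq ik.
    rewrite E subnn mul1r leq_pred.
    have -> : (if (k.+1 < n)%N then 0 else 0 : F) = 0 by case: ifP.
    move: (k.+1%:R^-1) => K.
    by case: (nat_of_ord k) => [|k'] /=; rewrite ?mul0r ?mul1r -!natr1; ring.
  have -> : A i j = (nat_of_ord j == i)%:R *+ 2 - (nat_of_ord j == i.+1)%:R - (nat_of_ord i == j.+1)%:R.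
    by rewrite mxE -val_eqE eq_sym.
  have -> : U j k = f k j by rewrite mxE.
  have -> : (nat_of_ord i == j.+1)%:R = (nat_of_ord j == i.-1)%:R * (0 < i)%:R :> F.
    rewrite -natrM mulnb; congr (nat_of_bool _)%:R.
    by case: (nat_of_ord i) => [|i'] /=; rewrite ?andbF // andbT eqSS eq_sym.
  by ring.
have -> : \det A = \det (A *m U) by rewrite det_mulmx U1 mulr1.
rewrite det_trig; last first.
  by apply/is_trig_mxP => i j ij; rewrite AU ?(ltnW ij) // subn_eq0 leqNgt ij mul0r.
rewrite (eq_bigr (fun k : 'I_n => k.+2%:R / k.+1%:R)) => [|i _]; last first.
  by rewrite AU // subnn mul1r.
suff H m : \prod_(k < m) (k.+2%:R / k.+1%:R) = m.+1%:R :> F by exact: H.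
elim: m => [|m IH]; first by rewrite big_ord0.
by rewrite big_ord_recr /= IH mulrCA mulfV ?mulr1 // pnatr_eq0.
Qed.

End CartanMatrix.

Section ElementarySymmetric.
Variable R : realType.
Local Notation C := R[i].

Lemma elem_sym_coef n (x : 'M[C]_n.+1) k : (k <= n.+1)%N ->
  elem_sym k (eigenvalues x) = (-1) ^+ k * (char_poly x)`_(n.+1 - k).
Proof.
move=> kn; rewrite /eigenvalues; case: (closed_field_poly_normal _) => s /= E.
rewrite (monicP (char_poly_monic x)) scale1r in E.
have sE : size s = n.+1.
  by apply/eqP; rewrite -eqSS -(size_prod_XsubC s id) -E size_char_poly.
rewrite E coef_prod_XsubC sE ?leq_subr // subKn // mulrA -expr2 sqrr_sign mul1r.
by rewrite /elem_sym sE; apply: eq_bigl => I; rewrite inE.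
Qed.

Lemma elem_sym_prod n (x : 'M[C]_n.+1) (l : 'I_n.+1 -> C) k : (k <= n.+1)%N ->
  char_poly x = \prod_p ('X - (l p)%:P) ->
  elem_sym k (eigenvalues x) = \sum_(I : {set 'I_n.+1} | #|I| == k) \prod_(p in I) l p.
Proof.
move=> kn cx; rewrite elem_sym_coef // cx.
pose ps := [seq l p | p <- enum 'I_n.+1].
have sp : size ps = n.+1 by rewrite size_map size_enum_ord.
have -> : \prod_p ('X - (l p)%:P) = \prod_(c <- ps) ('X - c%:P).
  by rewrite big_map big_enum.
rewrite coef_prod_XsubC sp ?leq_subr // subKn // mulrA -expr2 sqrr_sign mul1r.
have lE (p : 'I_n.+1) : l p = ps`_p.
  by rewrite (nth_map p) ?size_enum_ord // nth_ord_enum.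
apply: eq_big => [I|I _]; first by rewrite inE.
by apply: eq_bigr => p _; rewrite lE.
Qed.

End ElementarySymmetric.

(** * The diagonal Cartan subalgebra of sl_N and its weights *)

Section DiagonalCartan.
Variables (F : numClosedFieldType) (n : nat).
Local Notation M := 'M[F]_n.+1.
Variables (g h : {vspace M}).
Hypothesis gP : forall X, X \in g <-> \tr X = 0.
Hypothesis hP : forall X, X \in h <-> \tr X = 0 /\ forall i j, i != j -> X i j = 0.
Local Notation dual := 'Hom(subvs_of h, F^o).
Implicit Types (X Y : M) (H : subvs_of h) (i j p q : 'I_n.+1).

Lemma diag_br H X i j : br (vsval H) X i j = (vsval H i i - vsval H j j) * X i j.
Proof.
have [_ dH] := (hP (vsval H)).1 (subvsP H).
rewrite /br 2!mxE [X in _ + X]mxE [X in _ - X]mxE mulrBl; congr (_ - _).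
  by rewrite (bigD1 i) //= big1 ?addr0 // => k ki; rewrite dH ?mul0r // eq_sym.
rewrite (bigD1 j) //= big1 ?addr0 1?mulrC // => k kj.
by rewrite dH ?mulr0.
Qed.

Lemma trd_delta i j : i != j -> \tr (delta_mx i j : M) = 0.
Proof.
move=> ij; rewrite /mxtrace big1 // => k _; rewrite mxE.
by case: eqP => [->|//]; rewrite (negPf ij).
Qed.

Lemma diag_mem (d : 'I_n.+1 -> F) : \sum_k d k = 0 -> diag_mx (\row_k d k) \in h.
Proof.
move=> d0; apply/hP; split=> [|p q pq]; last by rewrite !mxE (negPf pq).
by rewrite mxtrace_diag -[RHS]d0; apply: eq_bigr => k _; rewrite mxE.
Qed.

Lemma cartan_pair_diag : cartan_pair g h.
Proof.
have trd i j : i != j -> delta_mx i j \in g by move=> ij; apply/gP; rewrite trd_delta.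
have trM X i j : \tr (X *m delta_mx i j) = X j i.
  rewrite /mxtrace (bigD1 j) //= mxE (bigD1 i) //= mxE !eqxx mulr1 big1 => [|k ki].
    rewrite addr0 big1 ?addr0 // => k kj; rewrite mxE big1 // => l _.
    by rewrite mxE (negPf kj) andbF mulr0.
  by rewrite mxE (negPf ki) mulr0.
split.
- by move=> X Y _ _; apply/gP; rewrite /br raddfB /= mxtrace_mulC subrr.
- move=> X /gP Xg X0; have off i j : i != j -> X i j = 0.
    by move=> ij; rewrite -trM X0 // trd // eq_sym.
  have dg i : X i i = X 0 0.
    have d0 : delta_mx i i - delta_mx 0 0 \in g; last first.
      by have := X0 _ d0; rewrite mulmxBr raddfB /= !trM => /eqP; rewrite subr_eq0 => /eqP.
    apply/gP; rewrite raddfB /=.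
    have trd1 j : \tr (delta_mx j j : M) = 1.
      by rewrite /mxtrace (bigD1 j) //= mxE !eqxx big1 ?addr0 // => k kj; rewrite mxE (negPf kj).
    by rewrite !trd1 subrr.
  apply/matrixP => i j; rewrite [RHS]mxE; have [->|ij] := eqVneq i j; last exact: off.
  move: Xg; rewrite /mxtrace (eq_bigr (fun=> X 0 0)) => [|k _]; last exact: dg.
  rewrite sumr_const card_ord -mulr_natr => /eqP; rewrite mulf_eq0 pnatr_eq0 orbF dg.
  by move/eqP.
- by apply/subvP => X /hP[X0 _]; apply/gP.
- exists 1%N; apply/eqP; rewrite -subv0; apply: brv_sub => X Y Xh Yh.
  rewrite memv0; apply/eqP/matrixP => i j; rewrite -[X](vsprojK Xh) diag_br mxE.
  have [_ dY] := (hP Y).1 Yh; have [->|ij] := eqVneq i j; first by rewrite subrr mul0r.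
  by rewrite dY // mulr0.
- move=> X /gP Xg XH; apply/hP; split=> // i j ij.
  (* The bracket with E_ii - E_jj multiplies the entry (i, j) of X by 2 up to sign. *)
  pose d k : F := (k == i)%:R - (k == j)%:R.
  have Dh : diag_mx (\row_k d k) \in h.
    apply: diag_mem; rewrite sumrB (bigD1 i) //= eqxx big1 => [|k /negPf->//].
    by rewrite (bigD1 j) //= eqxx big1 ?subrr // => k /negPf->.
  have := (hP _).1 (XH _ Dh) => -[_ /(_ _ _ ij)]; rewrite brC -(vsprojK Dh) mxE diag_br vsprojK //.
  rewrite !mxE !eqxx !mulr1n /d !eqxx (negPf ij) [j == i]eq_sym (negPf ij) subr0 sub0r opprK.
  by move=> /eqP; rewrite oppr_eq0 mulf_eq0 -mulr2n pnatr_eq0 => /eqP.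
Qed.

Let cp := cartan_pair_diag.
Variable eps : 'I_n.+1 -> dual.
Hypothesis epsE : forall i H, eps i H = vsval H i i :> F.

Definition diag_elt (d : 'I_n.+1 -> F) : subvs_of h := vsproj h (diag_mx (\row_k d k)).

Lemma eps_diag d i : \sum_k d k = 0 -> eps i (diag_elt d) = d i :> F.
Proof. by move=> d0; rewrite epsE vsprojK ?diag_mem // !mxE eqxx. Qed.

Lemma epsB i j H : (eps i - eps j) H = vsval H i i - vsval H j j :> F.
Proof. by rewrite add_lfunE opp_lfunE -!epsE. Qed.

Lemma rootv_delta i j : i != j -> rootv g (eps i - eps j) (delta_mx i j).
Proof.
move=> ij; split; first by apply/gP; rewrite trd_delta.
move=> H; apply/matrixP => p q; rewrite diag_br [RHS]mxE epsB !mxE.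
by case: (eqVneq p i) => [->|_]; case: (eqVneq q j) => [->|_]; rewrite ?mulr0.
Qed.

Let unit_diff i j k : F := (k == i)%:R - (k == j)%:R.

Let sum_unit_diff i j : \sum_k unit_diff i j k = 0.
Proof.
rewrite sumrB (bigD1 i) //= eqxx big1 => [|k /negPf->//].
by rewrite (bigD1 j) //= eqxx big1 ?subrr // => k /negPf->.
Qed.

Lemma isroot_delta i j : i != j -> isroot g (eps i - eps j).
Proof.
move=> ij; split; last first.
  exists (delta_mx i j); last exact: rootv_delta.
  by apply/eqP => /matrixP/(_ i j)/eqP; rewrite !mxE !eqxx oner_eq0.
apply/eqP => /lfunP/(_ (diag_elt (unit_diff i j)))/eqP.
rewrite zero_lfunE add_lfunE opp_lfunE !(eps_diag _ (sum_unit_diff i j)) /unit_diff.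
rewrite !eqxx (negPf ij) [j == i]eq_sym (negPf ij) subr0 sub0r opprK -[_ + _]/(1 + 1 : F).
by rewrite -mulr2n pnatr_eq0.
Qed.

Lemma isroot_eps alpha : isroot g alpha -> exists i j, i != j /\ alpha = eps i - eps j.
Proof.
move=> [a0 [X X0 [_ HX]]].
have [p [q Xpq]] : exists p q, X p q != 0.
  apply: contrapT => H; case/eqP: X0; apply/matrixP => p q; rewrite mxE.
  by apply/eqP; apply: contraT => Xpq; case: H; exists p, q.
have E : alpha = eps p - eps q.
  apply/lfunP => H; have := congr1 (fun Y : M => Y p q) (HX H).
  rewrite /= diag_br mxE => /(mulIf Xpq) <-; exact: esym (epsB p q H).
exists p, q; split=> //; apply: contraNneq a0 => pq.
by rewrite E pq subrr.
Qed.

Definition eps_nat (m : nat) : dual := eps (inord m).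
Definition simple_sl : n.-tuple dual := [tuple eps_nat j - eps_nat j.+1 | j < n].
Local Notation a := simple_sl.

Lemma eps_natE i : eps_nat i = eps i.
Proof. by rewrite /eps_nat inord_val. Qed.

Lemma telescope_eps (p q : nat) : (p <= q)%N -> (q <= n)%N ->
  eps_nat p - eps_nat q = nat_comb a (fun k => (p <= k < q)%N : nat).
Proof.
move=> pq qn; rewrite /nat_comb.
rewrite (eq_bigr (fun k : 'I_n => (eps_nat k - eps_nat k.+1) *+ (p <= k < q)%N)) => [|k _]; last first.
  by rewrite tnth_mktuple.
rewrite -(big_mkord xpredT (fun k => (eps_nat k - eps_nat k.+1) *+ (p <= k < q)%N)).
rewrite (big_cat_nat (n := q)) //= [X in _ = _ + X]big_nat_cond [X in _ = _ + X]big1 ?addr0; last first.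
  by move=> k /andP[/andP[qk _] _]; rewrite [(k < q)%N]ltnNge qk andbF.
rewrite (big_cat_nat (n := p)) //= [X in _ = X + _]big_nat_cond [X in _ = X + _]big1 ?add0r; last first.
  by move=> k /andP[/andP[_ kp] _]; rewrite leqNgt kp.
rewrite [RHS]big_nat_cond (eq_bigr (fun k => - (eps_nat k.+1 - eps_nat k))) => [|k /andP[-> _]]; last first.
  by rewrite opprB.
by rewrite -big_nat_cond sumrN telescope_sumr // opprB.
Qed.

Lemma card_le m : (m <= n)%N -> #|[set p : 'I_n.+1 | (p <= m)%N]| = m.+1.
Proof.
move=> mn; rewrite -sum1dep_card.
have le : (m.+1 <= n.+1)%N by [].
transitivity (\sum_(p < n.+1 | (p < m.+1)%N) 1)%N; first exact: eq_bigl.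
by rewrite (big_ord_narrow le) sum1_card card_ord.
Qed.

Lemma sum_le m : (m <= n)%N -> \sum_(p < n.+1) (p <= m)%N%:R = m.+1%:R :> F.
Proof.
move=> mn; rewrite -(card_le mn) -sum1dep_card natr_sum [RHS]big_mkcond.
by apply: eq_bigr => p _; case: leqP.
Qed.

(** Fundamental coweight: the projection on the first j + 1 coordinates, made traceless by
    subtracting the scalar (j + 1) / (n + 1). *)
Definition coweight (j : nat) : subvs_of h :=
  diag_elt (fun p => (p <= j)%N%:R - j.+1%:R / n.+1%:R).

Lemma simple_coweight (i j : 'I_n) : tnth a i (coweight j) = (i == j)%:R :> F.
Proof.
have s0 : \sum_(p < n.+1) ((p <= j)%N%:R - j.+1%:R / n.+1%:R) = 0 :> F.
  have c : \sum_(p < n.+1) (j.+1%:R / n.+1%:R) = j.+1%:R :> F.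
    by rewrite sumr_const card_ord -[_ *+ _]mulr_natr divfK // pnatr_eq0.
  by rewrite sumrB (sum_le (ltnW (ltn_ord j))) c subrr.
rewrite tnth_mktuple add_lfunE opp_lfunE -[_ + _]/(_ - _ : F) !(eps_diag _ s0).
rewrite (inordK (leqW (ltn_ord i))) (inordK (ltn_ord i : (i.+1 < n.+1)%N)).
move: (j.+1%:R / n.+1%:R : F) => c.
transitivity ((i <= j)%N%:R - (i < j)%N%:R : F); first by ring.
by rewrite -val_eqE /=; case: ltngtP; rewrite ?subrr ?subr0.
Qed.

Lemma simple_separate H : (forall k : 'I_n, tnth a k H = 0 :> F) -> H = 0.
Proof.
move=> aH; apply: val_inj; have [trH offH] := (hP (vsval H)).1 (subvsP H).
have dH k : (k <= n)%N -> eps_nat k H = eps_nat 0 H :> F.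
  elim: k => [//|k IH] kn; rewrite -(IH (ltnW kn)).
  have := aH (Ordinal kn); rewrite tnth_mktuple add_lfunE opp_lfunE -[_ + _]/(_ - _ : F).
  by move=> /eqP; rewrite subr_eq0 => /eqP.
have dE i : vsval H i i = eps_nat 0 H :> F by rewrite -epsE -eps_natE dH // -ltnS.
have e0 : eps_nat 0 H = 0 :> F.
  move: trH; rewrite /mxtrace (eq_bigr (fun=> eps_nat 0 H : F)) => [|i _]; last exact: dE.
  by rewrite sumr_const card_ord -mulr_natr => /eqP; rewrite mulf_eq0 pnatr_eq0 orbF => /eqP.
apply/matrixP => i j; rewrite [RHS]mxE; have [->|ij] := eqVneq i j; last exact: offH.
by rewrite -[LHS]/(vsval H j j) dE.
Qed.

Lemma simple_basis : basis_of fullv a.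
Proof.
apply/andP; split; last first.
  apply/freeP => c E i; have E' : \sum_k c k *: tnth a k = 0.
    by rewrite -[RHS]E; apply: eq_bigr => k _; rewrite (tnth_nth 0).
  have : \sum_k c k * (k == i)%:R = 0.
    transitivity ((\sum_k c k *: tnth a k) (coweight i) : F); last by rewrite E' zero_lfunE.
    by rewrite sum_lfunE; apply: eq_bigr => k _; rewrite scale_lfunE simple_coweight.
  by rewrite (bigD1 i) //= eqxx mulr1 big1 ?addr0 // => k /negPf->; rewrite mulr0.
rewrite eqEsubv subvf; apply/subvP => phi _.
have -> : phi = \sum_(i < n) ((phi : dual) (coweight i) : F) *: tnth a i.
  apply/lfunP => H; have HE : H = \sum_(i < n) (tnth a i H : F) *: coweight i.
    apply/eqP; rewrite -subr_eq0; apply/eqP; apply: simple_separate => i.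
    rewrite linearB /= -[_ - _]/(_ - _ : F) dual_sumZ (bigD1 i) //= simple_coweight eqxx mulr1.
    rewrite big1 ?addr0 ?subrr // => k ki.
    by rewrite simple_coweight eq_sym (negPf ki) mulr0.
  rewrite {1}HE dual_sumZ sum_lfunE; apply: eq_bigr => i _.
  by rewrite scale_lfunE mulrC.
by apply: memv_suml => i _; rewrite memvZ // memv_span // mem_tnth.
Qed.

Let ij_neq (j : 'I_n) : (inord j : 'I_n.+1) != inord j.+1.
Proof. by rewrite -val_eqE /= !inordK ?ltnS // 1?ltnW // ltn_eqF. Qed.

Lemma simple_isroot (k : 'I_n) : isroot g (tnth a k).
Proof. by rewrite tnth_mktuple; exact: isroot_delta. Qed.

Lemma simple_pos beta : isroot g beta -> positive a beta \/ positive a (- beta).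
Proof.
move=> /isroot_eps[i [j [ij ->]]]; rewrite opprB -!eps_natE.
case: (ltngtP i j) => [lt|lt|/val_inj E]; last by rewrite E eqxx in ij.
- by left; eexists; apply: telescope_eps; rewrite ?(ltnW lt) // -ltnS.
- by right; eexists; apply: telescope_eps; rewrite ?(ltnW lt) // -ltnS.
Qed.

Lemma simple_coroot (j : 'I_n) : co cp a j = diag_elt (unit_diff (inord j) (inord j.+1)).
Proof.
have s0 := sum_unit_diff (inord j) (inord j.+1); have ij := ij_neq j.
apply/esym; apply: (coroot_unique cp (X := delta_mx (inord j) (inord j.+1))
  (Y := delta_mx (inord j.+1) (inord j))).
- rewrite tnth_mktuple add_lfunE opp_lfunE -[_ + _]/(_ - _ : F) !(eps_diag _ s0) /unit_diff.
  by rewrite !eqxx (negPf ij) [inord j.+1 == _]eq_sym (negPf ij) subr0 sub0r opprK.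
- by rewrite tnth_mktuple; exact: rootv_delta.
- by rewrite tnth_mktuple opprB; apply: rootv_delta; rewrite eq_sym.
rewrite vsprojK ?diag_mem // /br !mul_delta_mx; apply/matrixP => p q; rewrite !mxE /unit_diff.
case: (eqVneq p q) => [->|pq]; first by rewrite !andbb.
have Z c : (p == c) && (q == c) = false.
  by apply/negbTE; apply: contraNN pq => /andP[/eqP-> /eqP->].
by rewrite !Z subrr.
Qed.

(** The sets of size k index the weights of the k-th exterior power of the standard representation;
    [fund_set i], of size i + 1, gives the i-th fundamental weight. *)
Definition eps_set (I : {set 'I_n.+1}) : dual := \sum_(p in I) eps p.
Definition fund_set (i : 'I_n) : {set 'I_n.+1} := [set p : 'I_n.+1 | (p <= i)%N].

Lemma fund_coroot (i j : 'I_n) : eps_set (fund_set i) (co cp a j) = (i == j)%:R :> F.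
Proof.
rewrite simple_coroot /eps_set sum_lfunE.
rewrite (eq_bigr (unit_diff (inord j) (inord j.+1))) => [|p _]; last by rewrite eps_diag ?sum_unit_diff.
rewrite /unit_diff sumrB.
have S m : (m <= n)%N -> \sum_(p in fund_set i) (p == inord m :> 'I_n.+1)%:R = (m <= i)%N%:R :> F.
  move=> mn; have [mi|im] := leqP m i.
    rewrite (bigD1 (inord m)) ?inE ?inordK //= eqxx big1 ?addr0 // => p /andP[_ /negPf->//].
  rewrite big1 // => p; rewrite inE => pi; case: eqP => // pE.
  by move: pi; rewrite pE inordK // leqNgt im.
rewrite (S j (ltnW (ltn_ord j))) (S j.+1 (ltn_ord j)) -val_eqE /=.
by case: ltngtP; rewrite ?subrr ?subr0.
Qed.

Definition count_le (I : {set 'I_n.+1}) (j : nat) : nat := #|I :&: [set p : 'I_n.+1 | (p <= j)%N]|.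

(** Abel summation: each eps p is eps n plus the simple roots of index at least p, so a_k is counted
    once for each p <= k in I. *)
Lemma eps_set_nat (I : {set 'I_n.+1}) :
  eps_set I = eps_nat n *+ #|I| + nat_comb a (fun k : 'I_n => count_le I k).
Proof.
rewrite /eps_set (eq_bigr (fun p => eps_nat n + nat_comb a (fun k => (p <= k < n)%N : nat))) => [|p _]; last first.
  have pn : (p <= n)%N by rewrite -ltnS.
  by rewrite -(telescope_eps pn (leqnn n)) eps_natE addrC subrK.
rewrite big_split /= sumr_const; congr (_ + _).
rewrite /nat_comb exchange_big; apply: eq_bigr => j _ /=.
rewrite sumrMnr; congr (_ *+ _).
rewrite /count_le -sum1dep_card big_mkcondr; apply: eq_bigr => p _.
by rewrite ltn_ord andbT inE; case: leqP.
Qed.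

(** By [eps_set_nat] the difference has coefficients [count_le (fund_set i) j - count_le I j]. They
    are nonnegative, since among the sets of a given size the initial segment has the most elements
    up to j, and positive at j = i. *)
Lemma fund_low (i : 'I_n) (I : {set 'I_n.+1}) : #|I| = i.+1 -> I != fund_set i ->
  exists k, nz k /\ eps_set I = eps_set (fund_set i) - nat_comb a k.
Proof.
move=> cI nI; have cF : #|fund_set i| = i.+1 by rewrite card_le // ltnW.
have le (j : 'I_n) : (count_le I j <= count_le (fund_set i) j)%N.
  have [ij|ji] := leqP i j.
    have -> : count_le (fund_set i) j = #|fund_set i|.
      rewrite /count_le (finset.setIidPl _) //; apply/fintype.subsetP => p; rewrite !inE => pi.
      exact: leq_trans pi ij.
    by rewrite cF -cI subset_leq_card // finset.subsetIl.
  apply: subset_leq_card; apply/fintype.subsetP => p; rewrite !inE => /andP[_ pj].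
  by rewrite pj andbT (leq_trans pj) // ltnW.
exists (fun j : 'I_n => (count_le (fund_set i) j - count_le I j)%N); split.
  exists i; rewrite subn_eq0 -ltnNge.
  have -> : count_le (fund_set i) i = #|I| by rewrite cI -cF /count_le finset.setIid.
  apply: proper_card; apply/properP; split; first exact: finset.subsetIl.
  have : ~~ (I \subset fund_set i).
    by apply: contra nI => sI; rewrite eqEcard sI cF cI leqnn.
  case/fintype.subsetPn => p pI pF; exists p => //; rewrite inE pI /=; exact: pF.
rewrite !eps_set_nat cI cF -addrA; congr (_ + _).
have -> : nat_comb a (fun j : 'I_n => count_le (fund_set i) j) =
   nat_comb a (fun j : 'I_n => count_le I j) + nat_comb a (fun j : 'I_n => (count_le (fund_set i) j - count_le I j)%N).
  by rewrite nat_combD /nat_comb; apply: eq_bigr => j _; rewrite subnKC.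
by rewrite addrK.
Qed.

End DiagonalCartan.

Section SpecialLinear.
Variable R : realType.
Local Notation C := R[i].
Local Open Scope classical_set_scope.
Local Open Scope complex_scope.
Variable n : nat.
Local Notation M := 'M[C]_n.+1.
Local Notation G := (SL R n).
Local Notation g := (sl R n).
Local Notation el := (@ce_exp_like R).
Local Notation sgm := (@sl_sigma R n).

Lemma linfunE_of (F : fieldType) (V W : vectType F) (f : V -> W) :
  (forall a x y, f (a *: x + y) = a *: f x + f y) -> linfun f =1 f.
Proof.
by move=> lf; pose fL : {linear V -> W} := HB.pack f (GRing.isLinear.Build _ _ _ _ f lf); exact: (lfunE fL).
Qed.

Lemma mem_capker (F : fieldType) (V : vectType F) (U : {vspace V}) (phi : 'End(V)) v :
  (v \in (U :&: lker phi)%VS) = (v \in U) && (phi v == 0).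
Proof. by rewrite memv_cap memv_ker. Qed.

Lemma sl_mem (X : M) : X \in g <-> \tr X = 0.
Proof.
have lf (c : C) (A B : M) : (\tr (c *: A + B) : C^o) = c *: (\tr A : C^o) + \tr B.
  by rewrite raddfD /= mxtraceZ.
by rewrite /sl memv_ker (linfunE_of lf); split=> [/eqP|->].
Qed.

Lemma ce_sum (I : finType) (P : pred I) (f : I -> C) :
  ce (\sum_(i | P i) f i) = \prod_(i | P i) ce (f i).
Proof. exact: (big_morph (@ce R) (elD el) (el0 el)). Qed.

Lemma mexp_diag_row m (d : 'I_m -> C) :
  mexp (diag_mx (\row_p d p)) = diag_mx (\row_p ce (d p)).
Proof.
rewrite mexp_diag; apply: (congr1 (@diag_mx _ m)); apply/rowP => p.
by rewrite [LHS]mxE [RHS]mxE [X in ce X]mxE.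
Qed.

Lemma det_mexp m (X : 'M[C]_m) : \det (mexp X) = ce (\tr X).
Proof.
have [|P Pu tP] := @cotrig _ m [:: X].
  by move=> A B; rewrite !inE => /eqP-> /eqP->.
have [t1 t2] := trig_mexp (tP X (mem_head _ _)).
have -> : \det (mexp X) = \det (mexp (P *m X *m invmx P)).
  by rewrite conj_mexp // !det_mulmx mulrAC -det_mulmx mulmxV // det1 mul1r.
rewrite det_trig // -(tr_conj X Pu) ce_sum.
by apply: eq_bigr => i _; rewrite t2.
Qed.

Lemma SL_group : group_with_lie G g.
Proof.
split.
- exact: det1.
- by move=> x y dx dy; rewrite /SL /= det_mulmx dx dy mulr1.
- by move=> x dx; rewrite unitmxE dx unitr1.
- by move=> x dx; rewrite /SL /= det_inv dx invr1.
- by move=> X /sl_mem X0; rewrite /SL /= det_mexp X0 (el0 el).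
- move=> X HX; apply/sl_mem; set l := \tr X.
  have ce1 (t : R) : ce (t%:C * l) = 1 by have := HX t; rewrite /SL /= det_mexp mxtraceZ.
  have /matrixP/(_ 0 0) : (l%:M : 'M[C]_1) = 0; last by rewrite !mxE eqxx mulr1n.
  apply: (tends_unique (tends_deriv _)); apply: (tends_ext _ (tends_cst 0)) => k.
  rewrite scale_scalar_mx mexp_scalar1.
  have -> : (k.+1%:R^-1 : C) = (k.+1%:R^-1 : R)%:C by rewrite rmorphV ?unitfE // rmorph_nat.
  by rewrite ce1 subrr scaler0.
Qed.

(** SL_N is generated by transvections 1 + u w with w u = 0, and each of them is the exponential of
    the traceless square-zero matrix u w; so every element is a product of exponentials. *)
Lemma SL_dense : exp_dense G g.
Proof.
suff H x : \det x = 1 -> expgen g x.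
  by move=> x dx e e0; exists x; [exact: H|rewrite subrr nrm0].
apply: transvection_ind => [|y z|u w wu]; first exact: expgen1.
  exact: expgen_mul.
rewrite -mexp_sq0; last by rewrite -mulmxA (mulmxA w) wu mul0mx mulmx0.
rewrite -[mexp _]mulmx1; apply: expgenM; last exact: expgen1.
by apply/sl_mem; rewrite mxtrace_mulC wu raddf0.
Qed.

Lemma diag_exists : exists h : {vspace M}, forall X,
  X \in h <-> \tr X = 0 /\ forall i j, i != j -> X i j = 0.
Proof.
have lf (c : C) (X Y : M) : (c *: X + Y) - diag_mx (\row_i (c *: X + Y) i i) =
    c *: (X - diag_mx (\row_i X i i)) + (Y - diag_mx (\row_i Y i i)).
  apply/matrixP => i j; rewrite !mxE; have [->|_] := eqVneq i j; last by rewrite !mulr0n !subr0.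
  by rewrite !mulr1n !subrr mulr0 addr0.
have [phi phiE] := linfun_of lf.
exists (g :&: lker phi)%VS => X; rewrite (mem_capker g phi X) phiE; split.
  move=> /andP[/sl_mem trX /eqP/matrixP E]; split=> // i j ij.
  by have := E i j; rewrite !mxE (negPf ij) mulr0n subr0.
move=> [/sl_mem -> offX] /=; apply/eqP/matrixP => i j; rewrite !mxE.
by have [->|ij] := eqVneq i j; rewrite ?mulr1n ?subrr // mulr0n subr0 offX.
Qed.

Definition polyreg (F : M -> {poly C}) : Prop := forall k, regfun G g (fun x => (F x)`_k).

Lemma polyreg_cst p : polyreg (fun=> p).
Proof. by move=> k; exact: regfun_cst. Qed.

Lemma polyregD F1 F2 : polyreg F1 -> polyreg F2 -> polyreg (fun x => F1 x + F2 x).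
Proof.
by move=> r1 r2 k; apply: regfun_ext (regfunD (r1 k) (r2 k)) => x _; rewrite coefD.
Qed.

Lemma polyregM F1 F2 : polyreg F1 -> polyreg F2 -> polyreg (fun x => F1 x * F2 x).
Proof.
move=> r1 r2 k; apply: regfun_ext (_ : regfun G g (fun x => \sum_(j < k.+1) (F1 x)`_j * (F2 x)`_(k - j))).
  by move=> x _; rewrite coefM.
by apply: regfun_sum => j _; exact: regfunM.
Qed.

(** Regularity is tracked coefficientwise, so that the characteristic polynomial, a determinant over
    polynomials, has regular coefficients; up to sign these are the sigma_i. *)
Lemma polyreg_det m (F : M -> 'M[{poly C}]_m) : (forall i j, polyreg (fun x => F x i j)) ->
  polyreg (fun x => \det (F x)).
Proof.
move=> HF; rewrite /determinant.
have sumP I (s : seq I) (H : I -> M -> {poly C}) : (forall i, polyreg (H i)) ->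
    polyreg (fun x => \sum_(i <- s) H i x).
  move=> HH; elim: s => [|i s IH] k.
    by apply: regfun_ext (polyreg_cst 0 k) => x _; rewrite big_nil.
  by apply: regfun_ext (polyregD (HH i) IH k) => x _; rewrite big_cons.
have prodP I (s : seq I) (H : I -> M -> {poly C}) : (forall i, polyreg (H i)) ->
    polyreg (fun x => \prod_(i <- s) H i x).
  move=> HH; elim: s => [|i s IH] k.
    by apply: regfun_ext (polyreg_cst 1 k) => x _; rewrite big_nil.
  by apply: regfun_ext (polyregM (HH i) IH k) => x _; rewrite big_cons.
by apply: sumP => t; apply: polyregM; [exact: polyreg_cst|exact: prodP].
Qed.

Lemma polyreg_char_poly : polyreg (fun x => char_poly x).
Proof.
apply: polyreg_det => i j k.
apply: regfun_ext (_ : regfun G g (fun x => ('X *+ (i == j) : {poly C})`_k + - ((k == 0)%N%:R * x i j))).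
  move=> x _; rewrite !mxE coefB coefC; congr (_ - _).
  by case: (k == 0)%N; rewrite ?mul1r ?mul0r.
apply: regfunD; first exact: regfun_cst.
by apply: regfunN; apply: regfunM; [exact: regfun_cst|exact: regfun_entry].
Qed.

Lemma sl_sigma_coef (i : 'I_n) (x : M) :
  sgm i x = (-1) ^+ i.+1 * (char_poly x)`_(n.+1 - i.+1).
Proof. by apply: elem_sym_coef; exact: ltnW (ltn_ord i : (i.+1 < n.+1)%N). Qed.

Lemma sl_sigma_reg i : regfun G g (sgm i).
Proof.
apply: regfun_ext (_ : regfun G g (fun x => (-1) ^+ i.+1 * (char_poly x)`_(n.+1 - i.+1))).
  by move=> x _; rewrite sl_sigma_coef.
by apply: regfunM; [exact: regfun_cst|exact: polyreg_char_poly].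
Qed.

Lemma sl_sigma_conj (i : 'I_n) (k x : M) : k \in unitmx -> sgm i (k *m x *m invmx k) = sgm i x.
Proof. by move=> ku; rewrite !sl_sigma_coef char_poly_conj. Qed.

Lemma sl_sigma_trig (i : 'I_n) (A P : M) (l : 'I_n.+1 -> C) : P \in unitmx ->
  is_trig_mx (P *m A *m invmx P) -> (forall p, (P *m A *m invmx P) p p = l p) ->
  sgm i A = \sum_(I : {set 'I_n.+1} | #|I| == i.+1) \prod_(p in I) l p.
Proof.
move=> Pu tA dA; apply: elem_sym_prod; first exact: ltnW (ltn_ord i : (i.+1 < n.+1)%N).
rewrite -(char_poly_conj A Pu) char_poly_trig //.
by apply: eq_bigr => p _; rewrite dA.
Qed.

Lemma sl_sigma_weights (h : {vspace M}) (i : 'I_n) (A P : M) (mu : 'I_n.+1 -> 'Hom(subvs_of h, C^o)) H : P \in unitmx ->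
  is_trig_mx (P *m A *m invmx P) -> (forall p, (P *m A *m invmx P) p p = ce (mu p H)) ->
  sgm i A = \sum_(I : {set 'I_n.+1} | #|I| == i.+1) ce ((\sum_(p in I) mu p) H).
Proof.
move=> Pu tA dA; rewrite (sl_sigma_trig i Pu tA dA); apply: eq_bigr => I _.
by rewrite sum_lfunE -[X in ce X]/(\sum_(p in I) (mu p H : C)) ce_sum.
Qed.

Section Torus.
Variable h : {vspace M}.
Hypothesis hP : forall X, X \in h <-> \tr X = 0 /\ forall i j, i != j -> X i j = 0.
Variable eps : 'I_n.+1 -> 'Hom(subvs_of h, C^o).
Hypothesis epsE : forall i H, eps i H = vsval H i i :> C.
Local Notation cp := (cartan_pair_diag sl_mem hP).

Lemma sl_torus_data : torus_data cp (simple_sl eps)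
  (fun i => eps_set eps (fund_set i))
  (fun i => map (eps_set eps) (seq.filter (fun I : {set 'I_n.+1} => (#|I| == i.+1) && (I != fund_set i)) (index_enum _)))
  (@sl_sigma R n).
Proof.
split.
- exact: (simple_basis hP epsE).
- exact: (simple_isroot sl_mem hP epsE).
- by move=> beta; exact: (simple_pos hP epsE).
- exact: (fund_coroot sl_mem hP epsE).
- move=> i mu /seq.mapP[I]; rewrite mem_filter => /andP[/andP[/eqP cI nI] _] ->.
  exact: (fund_low eps cI nI).
move=> i H; have [_ offH] := (hP (vsval H)).1 (subvsP H).
have HE : vsval H = diag_mx (\row_p (eps p H : C)).
  apply/matrixP => p q; rewrite !mxE epsE; have [->|pq] := eqVneq p q; first by rewrite mulr1n.
  by rewrite mulr0n offH.
have mE : mexp (vsval H) = diag_mx (\row_p ce (eps p H : C)).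
  by rewrite HE; exact: (mexp_diag_row (fun p => eps p H : C)).
rewrite (@sl_sigma_weights h i _ 1%:M eps H) ?unitmx1 //; last 2 first.
- by rewrite mul1mx invmx1 mulmx1 mE; exact: diag_mx_is_trig.
- by move=> p; rewrite mul1mx invmx1 mulmx1 mE !mxE eqxx mulr1n.
rewrite (bigD1 (fund_set i)) ?card_le //=; last by rewrite ltnW.
by rewrite big_cons big_map big_filter.
Qed.

End Torus.

Lemma sl_nondeg (X : M) : X \in g -> (forall Y, Y \in g -> \tr (X *m Y) = 0) -> X = 0.
Proof. by have [h hP] := diag_exists; exact: (cp_nondeg (cartan_pair_diag sl_mem hP)). Qed.

Lemma eps_exists (h : {vspace M}) : exists eps : 'I_n.+1 -> 'Hom(subvs_of h, C^o),
  forall i H, eps i H = vsval H i i :> C.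
Proof.
suff /choice[f Hf] : forall i, exists e : 'Hom(subvs_of h, C^o), forall H, e H = vsval H i i :> C.
  by exists f.
move=> i; have lf (c : C) (H K : subvs_of h) :
    (vsval (c *: H + K) i i : C^o) = c *: (vsval H i i : C^o) + vsval K i i.
  by rewrite linearP !mxE.
by have [e eE] := linfun_of lf; exists e.
Qed.

Lemma sl_sigma_char_system : char_system G g (@sl_sigma R n).
Proof.
split.
- exact: sl_sigma_reg.
- by move=> i x y dx _; apply: sl_sigma_conj; exact: (Gunit SL_group).
- have [h hP] := diag_exists; have [eps epsE] := eps_exists h.
  by do 5 eexists; exact: (sl_torus_data hP epsE).
move=> h cp i.
(* These are the weights of the standard representation, whose differential is the identity; the
   exponents of sigma_i are the sums of i + 1 of them. *)
have [P [mu [Pu HP Hmu]]] := integral_weights cp (D := fun X => X) (fun _ _ _ _ _ => erefl) (fun _ _ _ _ => erefl).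
exists (map (fun I : {set 'I_n.+1} => \sum_(p in I) mu p) (seq.filter (fun I : {set 'I_n.+1} => #|I| == i.+1) (index_enum _))); split.
  move=> H; by rewrite (sl_sigma_weights i Pu (HP H).1 (HP H).2) big_map big_filter.
move=> nu alpha /seq.mapP[I _ ->] ra.
elim/big_ind: _ => [|x y [z1 E1] [z2 E2]|p _]; last exact: Hmu.
  by exists 0; rewrite zero_lfunE.
by exists (z1 + z2); rewrite add_lfunE E1 E2 rmorphD.
Qed.

End SpecialLinear.

Lemma trace_diag_elt (F : numClosedFieldType) n (h : {vspace 'M[F]_n.+1})
  (hP : forall X, X \in h <-> \tr X = 0 /\ forall i j, i != j -> X i j = 0) (d e : 'I_n.+1 -> F) :
  \sum_k d k = 0 -> \sum_k e k = 0 ->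
  \tr (vsval (diag_elt h d) *m vsval (diag_elt h e)) = \sum_k d k * e k.
Proof.
move=> d0 e0; rewrite !vsprojK ?(diag_mem hP) // mulmx_diag mxtrace_diag.
by apply: eq_bigr => k _; rewrite !mxE.
Qed.

Lemma sum_delta_sub (F : numClosedFieldType) (I : finType) (p q : I) (e : I -> F) :
  \sum_k ((k == p)%:R - (k == q)%:R) * e k = e p - e q.
Proof.
rewrite (eq_bigr (fun k => (k == p)%:R * e k - (k == q)%:R * e k)) => [|k _]; last exact: mulrBl.
have one (m : I) : \sum_k (k == m)%:R * e k = e m.
  by rewrite (bigD1 m) //= eqxx mul1r big1 ?addr0 // => k /negPf->; rewrite mul0r.
by rewrite sumrB !one.
Qed.

(** Here n = N - 1, D is the dimension, s the number of roots and p that of the positive ones, so p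
    = n (n + 1) / 2 and k = n (n - 1) / 2. *)
Lemma sl_count (n D s p k : nat) : D.+1 = (n.+1 * n.+1)%N -> D = (s + n)%N -> s = (p + p)%N ->
  k.*2 = (n * n.-1)%N -> (p + n = k + n.*2)%N.
Proof. by case: n => [|m] /=; nia. Qed.

Section SpecialLinearForm.
Variable R : realType.
Local Notation C := R[i].
Variable n : nat.
Local Notation M := 'M[C]_n.+1.
Local Notation G := (SL R n).
Local Notation g := (sl R n).
Local Notation B := (sl_form R n).
Local Notation slm := (@sl_mem R n).

Lemma sl_form_lin (c : C) (X Y Z : M) : B (c *: X + Y) Z = c * B X Z + B Y Z.
Proof.
rewrite /sl_form -!mulmxE mulmxDl raddfD /= -scalemxAl mxtraceZ.
by rewrite opprD mulrN.
Qed.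

Lemma sl_form_sym (X Y : M) : B X Y = B Y X.
Proof. by rewrite /sl_form -!mulmxE mxtrace_mulC. Qed.

Lemma sl_form_nondeg (X : M) : X \in g -> (forall Y, Y \in g -> B X Y = 0) -> X = 0.
Proof.
move=> Xg X0; apply: sl_nondeg Xg _ => Y Yg.
by apply/eqP; rewrite -oppr_eq0; apply/eqP; exact: (X0 Y Yg).
Qed.

Lemma sl_form_inv (x X Y : M) : G x ->
  B (x *m X *m invmx x) (x *m Y *m invmx x) = B X Y.
Proof.
move=> Gx; have xu : x \in unitmx by exact: (Gunit (SL_group R n)).
rewrite /sl_form -!mulmxE; congr (- _).
have -> : x *m X *m invmx x *m (x *m Y *m invmx x) = x *m (X *m Y) *m invmx x.
  by rewrite !mulmxA (mulmxKV xu).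
by rewrite (tr_conj _ xu).
Qed.

Lemma dim_sl : (\dim g).+1 = (n.+1 * n.+1)%N.
Proof.
set phi := linfun (mxtrace : M -> C^o).
have phiE X : phi X = \tr X.
  by apply: linfunE_of => c A D; rewrite raddfD /= mxtraceZ.
have D : \dim {:M} = (n.+1 * n.+1)%N by rewrite dimvf.
rewrite -D -(limg_ker_dim phi fullv) capfv.
suff -> : \dim (limg phi) = 1%N by rewrite addn1.
apply/eqP; rewrite eqn_leq; apply/andP; split.
  by have := dimvS (subvf (limg phi)); rewrite dimvf.
rewrite lt0n dimv_eq0; apply/eqP => E.
have : phi 1%:M \in limg phi by rewrite memv_img ?memvf.
rewrite E memv0 phiE mxtrace1 => /eqP/eqP; apply/negP; exact: (negbT (pnatr_eq0 C n.+1)).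
Qed.

Section Constant.
Variable h : {vspace M}.
Hypothesis hP : forall X, X \in h <-> \tr X = 0 /\ forall i j, i != j -> X i j = 0.
Variable eps : 'I_n.+1 -> 'Hom(subvs_of h, C^o).
Hypothesis epsE : forall i H, eps i H = vsval H i i :> C.
Local Notation cp := (cartan_pair_diag slm hP).
Local Notation a := (simple_sl eps).

Lemma sl_gram : \matrix_(i, j) B (vsval (co cp a i)) (vsval (co cp a j)) =
  - (\matrix_(i < n, j < n) ((i == j)%:R *+ 2 - (j == i.+1 :> nat)%:R - (i == j.+1 :> nat)%:R) : 'M[C]_n).
Proof.
apply/matrixP => i j; rewrite [LHS]mxE [RHS]mxE [X in - X]mxE /sl_form -mulmxE; congr (- _).
rewrite (simple_coroot slm hP epsE i) (simple_coroot slm hP epsE j).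
have s0 (p q : 'I_n.+1) : \sum_k ((k == p)%:R - (k == q)%:R) = 0 :> C.
  by rewrite -[RHS](subrr 1) -(sum_delta_sub p q (fun=> 1)); apply: eq_bigr => k _; rewrite mulr1.
rewrite (trace_diag_elt hP (s0 _ _) (s0 _ _)).
have inE k m : (k <= n)%N -> (m <= n)%N -> (inord k == inord m :> 'I_n.+1) = (k == m).
  by move=> kn mn; rewrite -val_eqE /= !inordK.
rewrite sum_delta_sub !inE ?(ltnW (ltn_ord _)) ?ltn_ord // eqSS mulr2n -val_eqE /=.
by rewrite [(i.+1 == j)%N]eq_sym; ring.
Qed.

(** The positive roots contribute (-1)^p and the opposite of the Cartan matrix (-1)^n * N. As p + n
    = k + 2 n with k = n (n - 1) / 2, the sign is (-1)^k, the square of the k-th power of the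
    imaginary unit. *)
Lemma sl_nu_square rts xs : uniq rts -> (forall alpha, alpha \in rts <-> isroot g alpha) ->
  basis_of g ([seq xs alpha | alpha <- rts] ++ [seq vsval (co cp a i) | i : 'I_n]) ->
  nu_square cp a rts B = ('i ^+ ((n.+1.-1 * n.+1.-2)./2) * sqrtC n.+1%:R) ^+ 2 :> C.
Proof.
move=> rts_uniq rtsP xs_basis.
have dg := dim_g (SL_group R n) xs_basis.
have a_pos beta : isroot g beta -> positive a beta \/ positive a (- beta).
  exact: (simple_pos hP epsE).
have /perm_size := perm_roots cp (simple_basis hP epsE) a_pos rts_uniq rtsP.
rewrite size_cat size_map /nu_square sl_gram.
move: (size (pos_roots a rts)) => p sz.
have -> : \det (- (\matrix_(i < n, j < n) ((i == j)%:R *+ 2 - (j == i.+1 :> nat)%:R - (i == j.+1 :> nat)%:R) : 'M[C]_n))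
   = (-1) ^+ n * n.+1%:R by rewrite -scaleN1r detZ det_cartan_matrix.
have ds := dim_sl.
rewrite exprMn sqrtCK mulrA -exprD; congr (_ * _).
rewrite exprAC sqrCi /=; set k := (n * n.-1)./2.
have kE : k.*2 = (n * n.-1)%N.
  rewrite -[RHS](odd_double_half (n * n.-1)).
  suff -> : odd (n * n.-1) = false by [].
  by case: (n) => [//|m]; rewrite oddM /=; case: (odd m).
suff -> : (p + n = k + n.*2)%N by rewrite exprD -mul2n exprM sqrrN !expr1n mulr1.
exact: sl_count ds dg sz kE.
Qed.

Lemma sl_torus_constant :
  torus_constant g B (sl_sigma R n) (('i ^+ ((n.+1.-1 * n.+1.-2)./2) * sqrtC n.+1%:R) ^+ 2).
Proof.
have [rts [xs [H1 H2 H3 H4]]] := root_basis cp (simple_basis hP epsE) (simple_isroot slm hP epsE).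
do 5 eexists; split; first exact: (sl_torus_data hP epsE).
by exists rts, xs; split=> //; rewrite (sl_nu_square H1 H2 H4).
Qed.

End Constant.
End SpecialLinearForm.

Lemma sl_nu_constant (R : realType) n (sigma : 'I_n -> 'M[R[i]]_n.+1 -> R[i]) :
  char_system (SL R n) (sl R n) sigma ->
  nu_constant (SL R n) (sl R n) (sl_form R n) sigma ('i ^+ ((n.+1.-1 * n.+1.-2)./2) * sqrtC n.+1%:R).
Proof.
move=> cs; have GG := SL_group R n; have GD := @SL_dense R n.
have Bl c X Y Z : X \in sl R n -> Y \in sl R n -> Z \in sl R n ->
    sl_form R n (c *: X + Y) Z = c * sl_form R n X Z + sl_form R n Y Z.
  by move=> _ _ _; exact: sl_form_lin.
have Bs X Y : X \in sl R n -> Y \in sl R n -> sl_form R n X Y = sl_form R n Y X.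
  by move=> _ _; exact: sl_form_sym.
have Bi x X Y : SL R n x -> X \in sl R n -> Y \in sl R n ->
    sl_form R n (x *m X *m invmx x) (x *m Y *m invmx x) = sl_form R n X Y.
  by move=> Gx _ _; exact: sl_form_inv.
have [h hP] := diag_exists R n; have [eps epsE] := eps_exists h.
have tc' := sl_torus_constant hP epsE.
have [q tc] := torus_constant_exists (sl_form R n) cs.
have E := torus_constant_unique GG GD Bl Bs (@sl_form_nondeg R n) Bi
  cs (sl_sigma_char_system R n) tc tc'.
exact: (torus_constant_nu GG GD Bl Bs Bi cs tc (esym E)).
Qed.

Theorem proposition2 (R : realType) :
  (forall (n : nat) (G : set 'M[R[i]]_n.+1) (g : {vspace 'M[R[i]]_n.+1})
          (r : nat) (B : 'M[R[i]]_n.+1 -> 'M[R[i]]_n.+1 -> R[i]),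
     ssc_linear_group G g -> is_rank g r -> invariant_form G g B ->
     exists2 c : R[i], c != 0 &
       forall sigma : 'I_r -> 'M[R[i]]_n.+1 -> R[i],
         fundamental_characters G g sigma -> nu_constant G g B sigma c)
  /\
  (forall n : nat,
     let c : R[i] := 'i ^+ ((n.+1.-1 * n.+1.-2)./2) * sqrtC n.+1%:R in
     (forall sigma : 'I_n -> 'M[R[i]]_n.+1 -> R[i],
        fundamental_characters (SL R n) (sl R n) sigma ->
        nu_constant (SL R n) (sl R n) (sl_form R n) sigma c) /\
     nu_constant (SL R n) (sl R n) (sl_form R n) (sl_sigma R n) c).
Proof.
split=> [n G g r B sscG _ [B_lin B_sym B_nondeg B_inv [K cK _]]|n c].
  have GD := exp_dense_of sscG; have [sG _ Hg _ _] := sscG.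
  have GG := group_with_lie_of sG Hg.
  have nd X : X \in g -> (forall Y, Y \in g -> \tr (X *m Y) = 0) -> X = 0.
    exact: (compact_form_nondeg GG cK).
  (* The constant must be chosen before sigma: it comes from one system [s0], and uniqueness of q
     carries it over to every other one. If there is no system, the claim about sigma is empty and 1
     is taken as a nonzero value. *)
  have [[s0 f0]|no] := EM (exists sigma : 'I_r -> _, fundamental_characters G g sigma); last first.
    by exists 1; [exact: oner_neq0|move=> sigma fs; case: no; exists sigma].
  have cs0 := fundamental_char_system GG GD nd f0.
  have [q tc0] := torus_constant_exists B cs0.
  have q0 := torus_constant_neq0 GG B_lin B_sym B_nondeg B_inv tc0.
  exists (sqrtC q); first by rewrite sqrtC_eq0.
  move=> sigma fs; have cs := fundamental_char_system GG GD nd fs.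
  have [q' tc] := torus_constant_exists B cs.
  have E := torus_constant_unique GG GD B_lin B_sym B_nondeg B_inv cs0 cs tc0 tc.
  by apply: (torus_constant_nu GG GD B_lin B_sym B_inv cs tc); rewrite sqrtCK.
split=> [sigma fs|]; last exact: (sl_nu_constant (sl_sigma_char_system R n)).
apply: sl_nu_constant; apply: fundamental_char_system fs.
- exact: SL_group.
- exact: SL_dense.
- exact: sl_nondeg.
Qed.
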